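(* Let $B\subset M$ be $\sigma$-finite von Neumann algebras and $\theta\colon B\to M$ a faithful normal $*$-homomorphism. Assume there exist faithful normal conditional expectations $E^M_B\colon M\to B$ and $E^M_{\theta(B)}\colon M\to\theta(B)$. If $M$ is weakly exact, then the HNN extension of $M$ by $\theta$ (with respect to $E^M_B$ and $E^M_{\theta(B)}$) is also weakly exact.
   Context: For C$^*$-algebras, $\odot$ denotes the algebraic tensor product and $\otimes$ the minimal tensor product. Inclusions are unital and $\theta$ is unital. Weak exactness. A von Neumann algebra $M$ is weakly exact (in the sense of Kirchberg) if for every unital C$^*$-algebra $C$ with a closed two-sided ideal $J$ and every representation $\pi\colon M\otimes C\to\mathbb{B}(\mathcal{K})$ with $M\otimes J\subset\ker\pi$ such that $\pi|_{M\otimes\mathbb{C}}$ is ultraweakly continuous on $M$, the induced representation $\widetilde\pi\colon M\odot (C/J)\to\mathbb{B}(\mathcal{K})$ is continuous with respect to the minimal tensor norm. HNN extension. The HNN extension of $M$ by $\theta$ with respect to $E^M_B,E^M_{\theta(B)}$ is the unique (up to canonical isomorphism) triple $(N,E^N_M,u)$ consisting of a von Neumann algebra $N$ containing $M$ (unitally), a faithful normal conditional expectation $E^N_M\colon N\to M$, and a unitary $u=u(\theta)\in N$ such that $N$ is generated by $M$ and $u$, $u\,\theta(b)\,u^*=b$ for every $b\in B$, and $E^N_M(w)=0$ for every reduced word $w$ in $M$ and $u$. Here, with $B_{1}=\theta(B)$ and $B_{-1}=B$, a word $w=x_0u^{\varepsilon_1}x_1\cdots x_{n-1}u^{\varepsilon_n}x_n$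 with $n\geq1$, $x_i\in M$ and $\varepsilon_i\in\{-1,1\}$ is called reduced if $x_i\in M\ominus B_{\varepsilon_i}:=\ker E^M_{B_{\varepsilon_i}}$ whenever $1\leq i\leq n-1$ and $\varepsilon_i\neq\varepsilon_{i+1}$. ''The HNN extension is weakly exact'' means that the von Neumann algebra $N$ is weakly exact. *)

(* Defs.v *)
From HB Require Import structures.
From mathcomp Require Import all_boot all_order all_algebra.
From mathcomp Require Import complex.
From mathcomp Require Import all_classical all_reals all_analysis.

Set Implicit Arguments.
Unset Strict Implicit.
Unset Printing Implicit Defensive.

Import Order.TTheory GRing.Theory Num.Theory.
Import numFieldNormedType.Exports.

Local Open Scope classical_set_scope.
Local Open Scope ring_scope.

(* The inner product is linear in its first argument. *)
HB.mixin Record isHilbert (R : realType) (H : Type)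
    of CompleteNormedModule R[i] H := {
  inner : H -> H -> R[i];
  inner_linearl : forall y, linear (fun x => inner x y : R[i]^o);
  inner_conj : forall x y, inner y x = (inner x y)^*;
  inner_norm : forall x, inner x x = `|x| ^+ 2
}.

#[short(type="hilbertType")]
HB.structure Definition Hilbert (R : realType) :=
  {H of CompleteNormedModule R[i] H & isHilbert R H}.

(* Unital C*-algebras.  The ring structure is part of the mixin because the
   join of pzRingType and normedModType cannot be declared: both are already
   inherited by numDomainType.  The zero algebra is allowed. *)
HB.mixin Record isCStarAlgebra (R : realType) (A : Type)
    of CompleteNormedModule R[i] A := {
  cone : A;
  cmul : A -> A -> A;
  star : A -> A;
  cmulA : associative cmul;
  cmul1x : left_id cone cmul;
  cmulx1 : right_id cone cmul;
  cmul_linearl : forall y, linear (cmul^~ y);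
  cmul_linearr : forall x, linear (cmul x);
  starK : involutive star;
  star_semilinear :
    forall (k : R[i]) (x y : A), star (k *: x + y) = k^* *: star x + star y;
  starM : forall x y : A, star (cmul x y) = cmul (star y) (star x);
  cstar_normM : forall x y : A, `|cmul x y| <= `|x| * `|y|;
  cstar_norm : forall x : A, `|cmul (star x) x| = `|x| ^+ 2
}.

#[short(type="cstarType")]
HB.structure Definition CStarAlgebra (R : realType) :=
  {A of CompleteNormedModule R[i] A & isCStarAlgebra R A}.

Arguments cone {R s}.
Infix "**" := cmul (at level 40, left associativity) : ring_scope.

(* B(H) is a set of functions H -> H; the product is composition and the
   vector space structure is the pointwise one. *)
Notation op H := (H -> H).

Section Operators.
Variables (R : realType) (H : hilbertType R).
Implicit Types (S T : op H) (A : set (op H)).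

Definition bounded_op T : Prop := linear T /\ continuous T.

Definition adj T : op H :=
  get [set S : op H | forall x y, inner (T x) y = inner x (S y)].

Definition positive_op T : Prop := bounded_op T /\ forall x, 0 <= inner (T x) x.

Definition projection T : Prop := [/\ bounded_op T, adj T = T & T \o T = T].

Definition unitary T : Prop :=
  [/\ bounded_op T, adj T \o T = id & T \o adj T = id].

Definition opnorm T : R :=
  sup [set complex.Re `|T x| | x in [set x : H | `|x| <= 1]].

Definition op_closure A : set (op H) :=
  [set T | bounded_op T /\
     forall e : R, 0 < e -> exists2 S, A S & opnorm (T - S) < e].

Definition commutant A : set (op H) :=
  [set T | bounded_op T /\ forall S, A S -> T \o S = S \o T].

Definition von_neumann A : Prop :=
  [/\ forall T, A T -> bounded_op T,
      forall T, A T -> A (adj T) &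
      commutant (commutant A) = A].

Definition sigma_finite_vn A : Prop :=
  forall P : set (op H),
    (forall p, P p -> [/\ A p, projection p & p <> 0]) ->
    (forall p q, P p -> P q -> p <> q -> p \o q = 0) ->
    countable P.

Definition l2 (x : nat -> H) : Prop :=
  cvgn (series (fun n => `|x n| ^+ 2 : R[i]^o)).

Definition uw_form (x y : nat -> H) T : R[i]^o :=
  limn (series (fun n => inner (T (x n)) (y n) : R[i]^o)).

(* Convergence in the ultraweak topology, the initial topology of the
   functionals uw_form x y with x and y square summable. *)
Definition uw_cvg (F : set_system (op H)) T : Prop :=
  forall x y, l2 x -> l2 y -> uw_form x y @ F --> uw_form x y T.

End Operators.

(* Maps between operator algebras are functions on all of op H, of which only
   the restriction to the algebra A is ever constrained. *)
Section Maps.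
Variables (R : realType) (H K : hilbertType R).
Implicit Types (A : set (op H)) (phi : op H -> op K).

Definition linear_on A phi : Prop :=
  forall (k : R[i]) S T, A S -> A T -> phi (k *: S + T) = k *: phi S + phi T.

(* A *-homomorphism from A to B(K), not necessarily unital. *)
Definition star_hom_on A phi : Prop :=
  [/\ forall T, A T -> bounded_op (phi T),
      linear_on A phi,
      forall S T, A S -> A T -> phi (S \o T) = phi S \o phi T &
      forall T, A T -> phi (adj T) = adj (phi T)].

Definition uw_continuous_on A phi : Prop :=
  forall F : set_system (op H), ProperFilter F -> F A ->
  forall T, A T -> uw_cvg F T -> uw_cvg (phi @ F) (phi T).

(* Unital faithful normal *-homomorphism. *)
Definition vn_embedding A phi : Prop :=
  [/\ star_hom_on A phi, phi id = id, set_inj A phi & uw_continuous_on A phi].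

End Maps.

Record cond_exp (R : realType) (H : hilbertType R) (M B : set (op H))
    (E : op H -> op H) : Prop := {
  cond_exp_in : forall x, M x -> B (E x);
  cond_exp_id : forall b, B b -> E b = b;
  cond_exp_linear : linear_on M E;
  cond_exp_positive : forall x, M x -> positive_op x -> positive_op (E x);
  cond_exp_bimodule : forall b x b', B b -> M x -> B b' ->
    E (b \o x \o b') = b \o E x \o b'
}.

Definition fn_cond_exp (R : realType) (H : hilbertType R) (M B : set (op H))
    (E : op H -> op H) : Prop :=
  [/\ cond_exp M B E,
      forall x, M x -> positive_op x -> E x = 0 -> x = 0 &
      uw_continuous_on M E].

Section CStar.
Variables (R : realType).

Definition cstar_morphism (A C : cstarType R) (q : A -> C) : Prop :=
  [/\ linear q, forall x y, q (x ** y) = q x ** q y, q cone = cone &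
      forall x, q (star x) = star (q x)].

Definition closed_ideal (C : cstarType R) (J : set C) : Prop :=
  [/\ closed J, J 0,
      forall (k : R[i]) x y, J x -> J y -> J (k *: x + y) &
      forall c x, J x -> J (c ** x) /\ J (x ** c)].

(* q : C -> Q realizes Q as C/J; its norm is then the quotient norm, since an
   injective *-homomorphism of C*-algebras is isometric. *)
Definition cstar_quotient (C : cstarType R) (J : set C) (Q : cstarType R)
    (q : C -> Q) : Prop :=
  [/\ cstar_morphism q, forall y, exists x, q x = y &
      forall x, q x = 0 <-> J x].

Definition faithful_rep (C : cstarType R) (L : hilbertType R)
    (rho : C -> op L) : Prop :=
  [/\ forall c, bounded_op (rho c), linear rho,
      forall x y, rho (x ** y) = rho x \o rho y,
      forall x, rho (star x) = adj (rho x) & injective rho].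

(* T, with the map (x, y) |-> t x y, is the Hilbert space tensor product of
   H and L; this determines it up to a unique unitary. *)
Definition hilbert_tensor (H L T : hilbertType R) (t : H -> L -> T) : Prop :=
  [/\ forall y, linear (t^~ y), forall x, linear (t x),
      forall x x' y y', inner (t x y) (t x' y') = inner x x' * inner y y' &
      closure [set \sum_(p <- s) t p.1 p.2 | s in [set: seq (H * L)]] = setT].

Definition op_tensor (H L T : hilbertType R) (t : H -> L -> T)
    (a : op H) (b : op L) : op T :=
  get [set c : op T | bounded_op c /\ forall x y, c (t x y) = t (a x) (b y)].

(* The data used to realize M (x)min C spatially for M in B(H): a faithful
   representation of C on L, and the Hilbert space tensor product of H and L.
   The resulting norm does not depend on the choice. *)
Record spatial (H : hilbertType R) (C : cstarType R) := Spatial {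
  sp_space : hilbertType R;
  sp_rep : C -> op sp_space;
  sp_tensor : hilbertType R;
  sp_map : H -> sp_space -> sp_tensor;
  sp_repP : faithful_rep sp_rep;
  sp_mapP : hilbert_tensor sp_map
}.

Arguments sp_rep {H C} s c.
Arguments sp_map {H C} s x y.

Definition elt (H : hilbertType R) (C : cstarType R) (W : spatial H C)
    (a : op H) (c : C) : op (sp_tensor W) :=
  op_tensor (sp_map W) a (sp_rep W c).

Arguments elt {H C} W a c.

(* The closure of the span of the a (x) c with a in M and c in D, so that
   min_tensor W M setT is the minimal tensor product of M and C. *)
Definition min_tensor (H : hilbertType R) (C : cstarType R) (W : spatial H C)
    (M : set (op H)) (D : set C) : set (op (sp_tensor W)) :=
  op_closure [set \sum_(p <- s) elt W p.1 p.2 |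
    s in [set s : seq (op H * C) | forall p, p \in s -> M p.1 /\ D p.2]].

Arguments min_tensor {H C} W M D.

(* A sequence s of pairs stands for the element \sum a (x) (c + J) of
   M (.) (C/J), which the induced representation sends to
   \sum pi (a (x) c); continuity is boundedness of this linear map. *)
Definition weakly_exact (H : hilbertType R) (M : set (op H)) : Prop :=
  forall (C : cstarType R) (J : set C), closed_ideal J ->
  forall (W : spatial H C) (K : hilbertType R) (pi : op (sp_tensor W) -> op K),
    star_hom_on (min_tensor W M setT) pi ->
    (forall T, min_tensor W M J T -> pi T = 0) ->
    uw_continuous_on M (fun a => pi (elt W a cone)) ->
  forall (Q : cstarType R) (q : C -> Q), cstar_quotient J q ->
  forall V : spatial H Q,
  exists k : R, forall s : seq (op H * C), (forall p, p \in s -> M p.1) ->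
    opnorm (\sum_(p <- s) pi (elt W p.1 p.2)) <=
    k * opnorm (\sum_(p <- s) elt V p.1 (q p.2)).

End CStar.

Section HNN.
Variables (R : realType) (H K : hilbertType R).

(* An exponent in {-1, 1} is a boolean, true standing for 1. *)
Definition upow (u : op K) (e : bool) : op K := if e then u else adj u.

(* x_0 u^{e_1} x_1 ... u^{e_n} x_n, with M represented on K by iota. *)
Fixpoint word (iota : op H -> op K) (u : op K) (x : nat -> op H)
    (e : nat -> bool) (n : nat) : op K :=
  if n is m.+1
  then word iota u x e m \o upow u (e m.+1) \o iota (x m.+1)
  else iota (x 0%N).

(* E_B and E_theta are the expectations onto B = B_{-1} and theta(B) = B_1. *)
Definition reduced (E_B E_theta : op H -> op H) (x : nat -> op H)
    (e : nat -> bool) (n : nat) : Prop :=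
  forall i, (1 <= i < n)%N -> e i != e i.+1 ->
    (if e i then E_theta else E_B) (x i) = 0.

(* M need not act on the same space as N: it is included in N through iota. *)
Record is_HNN (M B : set (op H)) (theta E_B E_theta : op H -> op H)
    (N : set (op K)) (iota : op H -> op K) (E : op K -> op K) (u : op K)
    : Prop := {
  hnn_vn : von_neumann N;
  hnn_iota : vn_embedding M iota;
  hnn_incl : iota @` M `<=` N;
  hnn_E : fn_cond_exp N (iota @` M) E;
  hnn_unitary : unitary u;
  hnn_u : N u;
  hnn_generated : forall P : set (op K),
    von_neumann P -> iota @` M `<=` P -> P u -> N `<=` P;
  hnn_conj : forall b, B b -> u \o iota (theta b) \o adj u = iota b;
  hnn_reduced : forall (n : nat) (x : nat -> op H) (e : nat -> bool),
    (1 <= n)%N -> (forall i, (i <= n)%N -> M (x i)) ->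
    reduced E_B E_theta x e n ->
    E (word iota u x e n) = 0
}.

End HNN.

(* Main.v *)
(* Let A be the image of M in N, let pi be a representation of N (x) C killing
   N (x) J, and f the functional y |-> < pi(y) xi, xi > for a vector xi.  It is
   enough to bound f on N (.) C by f(1) times the norm of N (x) (C/J), whereas
   weak exactness of M only controls A (.) C.  Extend f, by Hahn-Banach, to a
   positive functional on all bounded operators of the space N (x)_A G, G the
   space of N (x) C.  The GNS space of the extension carries A, u, C and the
   projections p_e onto the words that start with u^e; J acts as zero there, so
   that weak exactness of M bounds A (.) C by the quotient norm.  On that space
   p_e u^e creates a letter, and a sum over reduced words w of r^|w| times
   creation operators is an isometry V_r into N (x)_A (GNS space).  Compressing
   by V_r yields functionals g_r bounded by f(1) times the quotient norm, with
   g_r(w (x) c) = r^|w| f(w (x) c) for reduced words w.  As r tends to 1 the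
   length multipliers converge pointwise on normal functionals, so that g_r
   tends to f. *)

Require Import Defs.
From HB Require Import structures.
From mathcomp Require Import all_boot all_order all_algebra.
From mathcomp Require Import complex ring lra.
From mathcomp Require Import all_classical all_reals all_analysis.

Set Implicit Arguments.
Unset Strict Implicit.
Unset Printing Implicit Defensive.

Import Order.TTheory GRing.Theory Num.Theory.
Import numFieldNormedType.Exports.

Local Open Scope classical_set_scope.
Local Open Scope ring_scope.

(** The extension is made on [N (x)_A G] rather than on [G] because the projections [p_e] live
    there, while [N (.) C] keeps its norm: one inequality is positivity of [E], the other its
    faithfulness. The main obstacle is normality. The extended functional need not be normal, but
    weak exactness speaks only of representations whose restriction to [M] is ultraweakly
    continuous. The GNS space is therefore spanned not by all operators but by a left module
    generated from [N (.) C] by [A], [C] and creation operators; normality of [E] keeps each of its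
    vectors below a normal functional, and such dominated vectors form a closed subspace. Weak
    exactness gives a bound with some constant, and compressions add others; the C*-identity applied
    to powers of [s^* s] removes them all. The isometry needs a defect operator whose square is
    [1 - r^2 P], with [P] the projection onto vectors that begin with a letter, so that the norms of
    its components telescope. Convergence for [r] tending to 1 is plain for functionals living on
    words of one length; reaching all normal functionals takes a bound uniform in [r], which comes
    from the same construction with [C] a point. *)

Local Notation Re := complex.Re.
Local Notation Im := complex.Im.

(** * Hilbert spaces and bounded operators *)

Section Scalars.
Variable R : realType.
Implicit Types (a b z : R[i]) (r : R).

(** Squared moduli, and later squared norms [n2], are kept in [R]: estimates stay polynomial, within
    reach of [lra] and [nra]. *)
Definition m2 z : R := Re z ^+ 2 + Im z ^+ 2.

Lemma eqC_ReIm a b : Re a = Re b -> Im a = Im b -> a = b.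
Proof. by case: a b => [? ?] [? ?] /= -> ->. Qed.
Lemma ReD a b : Re (a + b) = Re a + Re b. Proof. by case: a b => [? ?] []. Qed.
Lemma ImD a b : Im (a + b) = Im a + Im b. Proof. by case: a b => [? ?] []. Qed.
Lemma ReN a : Re (- a) = - Re a. Proof. by case: a. Qed.
Lemma ImN a : Im (- a) = - Im a. Proof. by case: a. Qed.
Lemma ReM a b : Re (a * b) = Re a * Re b - Im a * Im b. Proof. by case: a b => [? ?] []. Qed.
Lemma ImM a b : Im (a * b) = Re a * Im b + Im a * Re b. Proof. by case: a b => [? ?] []. Qed.
Lemma ReJ a : Re a^* = Re a. Proof. by case: a. Qed.
Lemma ImJ a : Im a^* = - Im a. Proof. by case: a. Qed.
Lemma ReC r : Re r%:C%C = r. Proof. by []. Qed.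
Lemma ImC r : Im r%:C%C = 0. Proof. by []. Qed.
Lemma Re0 : Re (0 : R[i]) = 0. Proof. by []. Qed.
Lemma Im0 : Im (0 : R[i]) = 0. Proof. by []. Qed.
Lemma Re1 : Re (1 : R[i]) = 1. Proof. by []. Qed.
Lemma Im1 : Im (1 : R[i]) = 0. Proof. by []. Qed.
Definition reim := (ReD, ImD, ReN, ImN, ReM, ImM, ReJ, ImJ, ReC, ImC, Re0, Im0, Re1, Im1).

Lemma m2_ge0 z : 0 <= m2 z. Proof. by rewrite addr_ge0 ?sqr_ge0. Qed.
Lemma m2J z : m2 z^* = m2 z. Proof. by rewrite /m2 !reim sqrrN. Qed.
Lemma m2M a b : m2 (a * b) = m2 a * m2 b. Proof. by rewrite /m2 !reim; ring. Qed.
Lemma m2N a : m2 (- a) = m2 a. Proof. by rewrite /m2 !reim !sqrrN. Qed.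
Lemma m2C r : m2 r%:C%C = r ^+ 2. Proof. by rewrite /m2 !reim expr0n addr0. Qed.
Lemma m20 : m2 0 = 0. Proof. by rewrite /m2 !reim expr0n addr0. Qed.
Lemma m21 : m2 1 = 1. Proof. by rewrite /m2 !reim expr1n expr0n addr0. Qed.
Lemma m2_eq0 z : m2 z = 0 -> z = 0.
Proof.
move=> /eqP; rewrite paddr_eq0 ?sqr_ge0// !sqrf_eq0 => /andP[/eqP ? /eqP ?].
exact: eqC_ReIm.
Qed.
Lemma mulJ z : z * z^* = (m2 z)%:C%C.
Proof. by apply: eqC_ReIm; rewrite /m2 !reim; ring. Qed.
Lemma ler_ReC a b : a <= b -> Re a <= Re b.
Proof. by rewrite lecE => /andP[]. Qed.
Lemma ge0C z : 0 <= z -> z = (Re z)%:C%C.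
Proof. by move=> h; apply: eqC_ReIm => //; rewrite (ger0_Im h). Qed.
Lemma ge0ReC z : Im z = 0 -> 0 <= Re z -> 0 <= z.
Proof. by move=> h1 h2; rewrite lecE /= h1 eqxx. Qed.
Lemma Re_le_m2 z r : 0 <= r -> m2 z <= r ^+ 2 -> Re z <= r.
Proof.
move=> r0 h; rewrite leNgt; apply/negP => hr.
have : r ^+ 2 < Re z ^+ 2 by rewrite ltr_pXn2r// nnegrE ltW// (le_lt_trans r0).
by have := sqr_ge0 (Im z); rewrite /m2 in h; lra.
Qed.
Lemma normC2 z : `|z| ^+ 2 = (m2 z)%:C%C.
Proof. by rewrite -add_Re2_Im2. Qed.
Lemma sq_le r s : 0 <= s -> r ^+ 2 <= s ^+ 2 -> r <= s.
Proof.
move=> s0 h; have [r0|/ltW r0] := leP 0 r; last exact: le_trans r0 s0.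
by move: h; rewrite ler_pXn2r.
Qed.
Lemma m2D a b : m2 (a + b) <= 2 * m2 a + 2 * m2 b.
Proof.
rewrite /m2 !reim; have := sqr_ge0 (Re a - Re b); have := sqr_ge0 (Im a - Im b).
by rewrite !expr2; lra.
Qed.
Lemma le_eps r s : (forall e, 0 < e -> r <= s + e) -> r <= s.
Proof. by move=> h; apply/ler_addgt0Pr. Qed.
End Scalars.

Section Hilb.
Variables (R : realType) (H : hilbertType R).
Implicit Types (x y z : H) (k : R[i]).

Definition n2 x : R := Re (inner x x).

Lemma ipDl x y z : inner (x + y) z = inner x z + inner y z.
Proof. by have := inner_linearl z 1 x y; rewrite !scale1r. Qed.
Lemma ip0l x : inner 0 x = 0.
Proof. by apply: (addrI (inner 0 x)); rewrite -ipDl !addr0. Qed.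
Lemma ipZl k x y : inner (k *: x) y = k * inner x y.
Proof. by have := inner_linearl y k x 0; rewrite ip0l !addr0. Qed.
Lemma ipNl x y : inner (- x) y = - inner x y.
Proof. by rewrite -scaleN1r ipZl mulN1r. Qed.
Lemma ipBl x y z : inner (x - y) z = inner x z - inner y z.
Proof. by rewrite ipDl ipNl. Qed.
Lemma ipJ x y : (inner x y)^* = inner y x.
Proof. by rewrite -inner_conj. Qed.
Lemma ipDr x y z : inner z (x + y) = inner z x + inner z y.
Proof. by rewrite inner_conj ipDl rmorphD /= !ipJ. Qed.
Lemma ip0r x : inner x 0 = 0.
Proof. by rewrite inner_conj ip0l rmorph0. Qed.
Lemma ipZr k x y : inner x (k *: y) = k^* * inner x y.
Proof. by rewrite inner_conj ipZl rmorphM /= ipJ. Qed.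
Lemma ipNr x y : inner x (- y) = - inner x y.
Proof. by rewrite inner_conj ipNl rmorphN /= ipJ. Qed.
Lemma ipBr x y z : inner z (x - y) = inner z x - inner z y.
Proof. by rewrite ipDr ipNr. Qed.
Lemma ip_suml (I : Type) (s : seq I) (f : I -> H) y :
  inner (\sum_(i <- s) f i) y = \sum_(i <- s) inner (f i) y.
Proof. by elim: s => [|i s ih]; rewrite ?big_nil ?ip0l// !big_cons ipDl ih. Qed.
Lemma ip_sumr (I : Type) (s : seq I) (f : I -> H) y :
  inner y (\sum_(i <- s) f i) = \sum_(i <- s) inner y (f i).
Proof. by elim: s => [|i s ih]; rewrite ?big_nil ?ip0r// !big_cons ipDr ih. Qed.

Lemma ipC x : inner x x = (n2 x)%:C%C.
Proof. by apply: ge0C; rewrite inner_norm exprn_ge0. Qed.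
Lemma n2_norm x : `|x| ^+ 2 = (n2 x)%:C%C.
Proof. by rewrite -inner_norm ipC. Qed.
Lemma n2_ge0 x : 0 <= n2 x.
Proof. by rewrite -ler0c -n2_norm exprn_ge0. Qed.
Lemma norm_n2 x : `|x| = (Num.sqrt (n2 x))%:C%C.
Proof.
apply: (pexpIrn (n := 2)) => //; rewrite ?nnegrE ?ler0c ?sqrtr_ge0//.
by rewrite n2_norm -rmorphXn /= sqr_sqrtr// n2_ge0.
Qed.
Lemma n20 : n2 0 = 0. Proof. by rewrite /n2 ip0l. Qed.
Lemma n2_eq0 x : n2 x = 0 -> x = 0.
Proof. by move=> h; apply/normr0_eq0; rewrite norm_n2 h sqrtr0. Qed.
Lemma n2_gt0 x : (0 < n2 x) = (n2 x != 0). Proof. by rewrite lt_neqAle eq_sym n2_ge0 andbT. Qed.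
Lemma n2D x y : n2 (x + y) = n2 x + n2 y + 2 * Re (inner x y).
Proof. by rewrite /n2 ipDl !ipDr !reim (inner_conj x y) ReJ; ring. Qed.
Lemma n2Z k x : n2 (k *: x) = m2 k * n2 x.
Proof. by rewrite /n2 ipZl ipZr mulrA mulJ !reim mul0r subr0. Qed.
Lemma n2N x : n2 (- x) = n2 x.
Proof. by rewrite /n2 ipNl ipNr opprK. Qed.
Lemma n2B x y : n2 (x - y) = n2 x + n2 y - 2 * Re (inner x y).
Proof. by rewrite n2D n2N ipNr reim mulrN. Qed.
Lemma n2C x y : n2 (x - y) = n2 (y - x).
Proof. by rewrite -n2N opprB. Qed.
Lemma n2D_le x y : n2 (x + y) <= 2 * n2 x + 2 * n2 y.
Proof. by have := n2_ge0 (x - y); rewrite n2B n2D; lra. Qed.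
Lemma n2B_le x y : n2 (x - y) <= 2 * n2 x + 2 * n2 y.
Proof. by have := n2D_le x (- y); rewrite n2N. Qed.
Lemma parallelogram x y : n2 (x + y) + n2 (x - y) = 2 * n2 x + 2 * n2 y.
Proof. by rewrite n2B n2D; ring. Qed.
Lemma n2_tri x y z : n2 (x - z) <= 2 * n2 (x - y) + 2 * n2 (y - z).
Proof. by have := n2D_le (x - y) (y - z); rewrite addrA subrK. Qed.

Lemma CS x y : m2 (inner x y) <= n2 x * n2 y.
Proof.
have [y0|/eqP yn0] := eqVneq (n2 y) 0.
  by rewrite (n2_eq0 y0) ip0r m20 n20 mulr0.
have yp : 0 < n2 y by rewrite n2_gt0; apply/eqP.
have := n2_ge0 ((n2 y)%:C%C *: x - inner x y *: y).
rewrite n2B !n2Z m2C ipZl ipZr (mulrC _^*) mulJ !reim => h.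
have : 0 <= n2 y * (n2 x * n2 y - m2 (inner x y)) by lra.
by rewrite pmulr_rge0// subr_ge0.
Qed.
Lemma CS_Re x y (a b : R) : 0 <= a -> 0 <= b -> n2 x <= a ^+ 2 -> n2 y <= b ^+ 2 ->
  Re (inner x y) <= a * b.
Proof.
move=> a0 b0 ha hb; apply: Re_le_m2; rewrite ?mulr_ge0// exprMn.
by apply: le_trans (CS _ _) _; rewrite ler_pM// n2_ge0.
Qed.
Lemma ip_ext x y : (forall z, inner x z = inner y z) -> x = y.
Proof.
by move=> h; apply/subr0_eq/n2_eq0; rewrite /n2 ipBl h subrr.
Qed.
Lemma ip_extr x y : (forall z, inner z x = inner z y) -> x = y.
Proof. by move=> h; apply: ip_ext => z; rewrite -ipJ h ipJ. Qed.

Lemma n2D_w x y (a b : R) : 0 <= a -> 0 <= b -> n2 x <= a ^+ 2 -> n2 y <= b ^+ 2 ->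
  n2 (x + y) <= (a + b) ^+ 2.
Proof.
move=> a0 b0 ha hb; have := CS_Re a0 b0 ha hb; rewrite n2D sqrrD -mulr_natl; lra.
Qed.

Definition hlim (u : nat -> H) (l : H) :=
  forall e : R, 0 < e -> exists N, forall n, (N <= n)%N -> n2 (u n - l) < e.

Definition hcau (u : nat -> H) :=
  forall e : R, 0 < e -> exists N, forall m n, (N <= m)%N -> (N <= n)%N -> n2 (u m - u n) < e.

Lemma norm_lt_n2 x (e : R) : 0 < e -> (`|x| < e%:C%C) = (n2 x < e ^+ 2).
Proof.
move=> e0; rewrite norm_n2 ltcR -[in RHS](sqr_sqrtr (n2_ge0 x)) ltr_pXn2r//.
  by rewrite nnegrE sqrtr_ge0.
by rewrite nnegrE ltW.
Qed.
Lemma norm_le_n2 x (e : R) : 0 <= e -> (`|x| <= e%:C%C) = (n2 x <= e ^+ 2).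
Proof.
move=> e0; rewrite norm_n2 lecR -[in RHS](sqr_sqrtr (n2_ge0 x)) ler_pXn2r//.
by rewrite nnegrE sqrtr_ge0.
Qed.

Lemma posC (e : R[i]) : 0 < e -> exists2 r : R, 0 < r & e = r%:C%C.
Proof.
by move=> e0; exists (Re e); [move: e0; rewrite ltcE => /andP[]|apply/ge0C/ltW].
Qed.

Lemma hlimP (u : nat -> H) l : (u @ \oo --> l) <-> hlim u l.
Proof.
split=> [/cvgrPdist_lt h e e0|h].
  have se0 : 0 < Num.sqrt e by rewrite sqrtr_gt0.
  have [N _ hN] := h (Num.sqrt e)%:C%C (etrans (ltcR _ _) se0).
  exists N => n Nn; have := hN n Nn; rewrite /= norm_lt_n2// sqr_sqrtr ?ltW//.
  by rewrite n2C.
apply/cvgrPdist_lt => e /posC[r r0 ->].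
have [N hN] := h (r ^+ 2) (exprn_gt0 _ r0).
by exists N => // n Nn /=; rewrite norm_lt_n2// n2C; apply: hN.
Qed.

Lemma hcomplete (u : nat -> H) : hcau u -> exists l, hlim u l.
Proof.
move=> hu; suff /cvg_ex[l /hlimP] : cvgn u by exists l.
apply/cauchy_cvgP/cauchy_ballP => e /posC[r r0 ->].
have [N hN] := hu (r ^+ 2) (exprn_gt0 _ r0).
pose A := u @` [set n | (N <= n)%N].
have FA : nbhs (u @ \oo) A by exists N => // n Nn; exists n.
exists (A, A) => // -[x y] [/= [m Nm <-] [n Nn <-]].
by rewrite -ball_normE /= norm_lt_n2//; apply: hN.
Qed.

(** Young's inequality, from [n2 (s x - y) >= 0]. A small [s] keeps the factor of [n2 x] near 1,
    which [n2D_le] with its factor 2 cannot do when a bound passes to a limit. *)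
Lemma n2_weight x y (s : R) : 0 < s -> n2 (x + y) <= (1 + s) * n2 x + (1 + s^-1) * n2 y.
Proof.
move=> s0; have := n2_ge0 (s%:C%C *: x - y).
rewrite n2B n2Z m2C ipZl !reim mul0r subr0 => h.
have : 0 <= s^-1 * (s ^+ 2 * n2 x + n2 y - 2 * (s * Re (inner x y))).
  by rewrite mulr_ge0// invr_ge0 ltW.
have -> : s^-1 * (s ^+ 2 * n2 x + n2 y - 2 * (s * Re (inner x y))) =
  s * n2 x + s^-1 * n2 y - 2 * Re (inner x y) by field; rewrite gt_eqF.
by rewrite n2D !mulrDl !mul1r; move: (_^-1 * _) (s * _) => *; lra.
Qed.
Lemma n2_lim_le u l (c : R) : hlim u l ->
  (forall e : R, 0 < e -> exists N, forall n, (N <= n)%N -> n2 (u n) <= c + e) -> n2 l <= c.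
Proof.
move=> ul h; have c0 : 0 <= c.
  apply: le_eps => e /h[N /(_ N (leqnn N))]; exact: le_trans (n2_ge0 _).
apply: le_eps => e e0.
(* This weight costs [s * (c + 1) = e / 4]; the error [l - u n] is then taken small against
   [1 + s^-1]. *)
have s0 : 0 < e / (4 * (c + 1)) by rewrite divr_gt0//; lra.
set s := e / _ in s0.
have sE : s * (c + 1) = e / 4 by rewrite /s; field; apply/eqP; lra.
have e1 : 0 < e / 4 / (1 + s) by rewrite !divr_gt0//; lra.
have e2 : 0 < e / 4 / (1 + s^-1) by rewrite !divr_gt0// ltr_pwDl// ltW// invr_gt0.
have [N1 h1] := h _ e1; have [N2 h2] := ul _ e2.
have {}h1 := h1 _ (leq_maxl N1 N2); have {}h2 := h2 _ (leq_maxr N1 N2).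
set n := maxn N1 N2 in h1 h2; have := n2_weight (u n) (l - u n) s0.
rewrite addrC subrK (n2C l) => /le_trans; apply.
have k1 : (1 + s) * n2 (u n) <= (1 + s) * c + e / 4.
  have -> : (1 + s) * c + e / 4 = (1 + s) * (c + e / 4 / (1 + s)).
    by rewrite mulrDr [X in _ = _ + X]mulrC divfK//; apply/eqP; lra.
  by rewrite ler_pM2l//; lra.
have k2 : (1 + s^-1) * n2 (u n - l) <= e / 4.
  rewrite mulrC -ler_pdivlMr ?ltW//.
  by rewrite ltr_pwDl// ltW// invr_gt0.
lra.
Qed.

Lemma hlim_uniq u l l' : hlim u l -> hlim u l' -> l = l'.
Proof.
move=> h h'; apply/subr0_eq/n2_eq0/eqP; rewrite eq_le n2_ge0 andbT.
apply: le_eps => e e0; have e4 : 0 < e / 4 by lra.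
have [N hN] := h _ e4; have [N' hN'] := h' _ e4.
have := n2_tri l (u (maxn N N')) l'; rewrite (n2C l (u _)).
by have := hN _ (leq_maxl N N'); have := hN' _ (leq_maxr N N'); lra.
Qed.
End Hilb.

Lemma inv_small (R : realType) (e : R) : 0 < e -> exists N, forall n, (N <= n)%N -> n.+1%:R^-1 < e.
Proof.
move=> e0; have /archi_boundP := ltW (etrans (invr_gt0 e) e0) => hN.
exists (Num.bound e^-1) => n Nn; rewrite invf_plt ?posrE//.
by apply: lt_le_trans hN _; rewrite ler_nat ltnW.
Qed.
Lemma app_eq (X Y : Type) x (f g : X -> Y) : f = g -> f x = g x. Proof. by move->. Qed.
Definition hclosed (R : realType) (H : hilbertType R) (S : set H) :=
  forall x, (forall e : R, 0 < e -> exists2 y, S y & n2 (x - y) < e) -> S x.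
Definition hdense (R : realType) (H : hilbertType R) (S : set H) :=
  forall x (e : R), 0 < e -> exists2 y, S y & n2 (x - y) < e.
Definition subsp (R : realType) (H : hilbertType R) (S : set H) :=
  S 0 /\ forall k x y, S x -> S y -> S (k *: x + y).

Lemma densP (R : realType) (H : hilbertType R) (S : set H) :
  closure S = setT -> hdense S.
Proof.
move=> h x e e0; have : closure S x by rewrite h.
move=> /(_ (ball x (Num.sqrt e)%:C%C)) [|y []].
  by apply: nbhsx_ballx; rewrite ltcR sqrtr_gt0.
rewrite -ball_normE /= norm_lt_n2 ?sqrtr_gt0// sqr_sqrtr ?ltW//.
by exists y.
Qed.

Section Bounded.
Variables (R : realType) (H K : hilbertType R).

Definition lin (T : H -> K) := forall (k : R[i]) x y, T (k *: x + y) = k *: T x + T y.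
Definition bnd (T : H -> K) (c : R) := forall x, n2 (T x) <= c * n2 x.
Definition blin (T : H -> K) := lin T /\ exists2 c : R, 0 <= c & bnd T c.

Variables (T : H -> K).
Hypothesis linT : lin T.
Lemma lin0 : T 0 = 0.
Proof. by have := linT (-1) 0 0; rewrite addr0 scaler0 scaleN1r addNr. Qed.
Lemma linD x y : T (x + y) = T x + T y.
Proof. by have := linT 1 x y; rewrite !scale1r. Qed.
Lemma linZ k x : T (k *: x) = k *: T x.
Proof. by have := linT k x 0; rewrite lin0 !addr0. Qed.
Lemma linN x : T (- x) = - T x.
Proof. by rewrite -scaleN1r linZ scaleN1r. Qed.
Lemma linB x y : T (x - y) = T x - T y.
Proof. by rewrite linD linN. Qed.
Lemma lin_sum (I : Type) (s : seq I) (f : I -> H) :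
  T (\sum_(i <- s) f i) = \sum_(i <- s) T (f i).
Proof. by elim: s => [|i s ih]; rewrite ?big_nil ?lin0// !big_cons linD ih. Qed.
End Bounded.

Section Bounded2.
Variables (R : realType) (H : hilbertType R).
Implicit Types (T S : op H).

Lemma scale_n2 (x : H) (r : R) : 0 < r -> exists2 k : R[i], k != 0 & m2 k * n2 x < r /\ (n2 x != 0 -> m2 k = r / 2 / n2 x).
Proof.
move=> r0; have [h|h] := eqVneq (n2 x) 0.
  by exists 1; rewrite ?oner_eq0// h mulr0; split.
have p : 0 < n2 x by rewrite n2_gt0.
have q : 0 < r / 2 / n2 x by rewrite !divr_gt0.
exists (Num.sqrt (r / 2 / n2 x))%:C%C.
  apply/eqP => -[] /eqP; rewrite sqrtr_eq0 leNgt q//.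
rewrite m2C sqr_sqrtr ?ltW//; split => //.
by rewrite divfK//; lra.
Qed.

Lemma bounded_opP T : bounded_op T <-> blin T.
Proof.
split=> [[lT cT]|[lT [c c0 hc]]]; split => //.
  have /cvgrPdist_lt /(_ 1 ltr01) := cT 0; rewrite (lin0 lT).
  move=> /nbhs_ballP[_ /= /posC[r r0 ->]] hr.
  have r2 : 0 < r ^+ 2 by rewrite exprn_gt0.
  exists (2 / r ^+ 2) => [|x]; first by rewrite ltW ?divr_gt0.
  have [k kn0 [kx kE]] := scale_n2 x r2.
  have := hr (k *: x); rewrite -ball_normE /= !sub0r !normrN norm_lt_n2// n2Z => /(_ kx).
  rewrite (_ : 1 = (1 : R)%:C%C)// norm_lt_n2// expr1n (linZ lT) n2Z => h.
  have [x0|xn0] := eqVneq (n2 x) 0.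
    by rewrite (n2_eq0 x0) (lin0 lT) !n20 mulr0.
  have xp : 0 < n2 x by rewrite n2_gt0.
  move: h; rewrite kE// => h.
  have -> : 2 / r ^+ 2 * n2 x = (r ^+ 2 / 2 / n2 x)^-1.
    by field; rewrite xn0 gt_eqF.
  by rewrite -[leRHS]mulr1 ler_pdivlMl ?divr_gt0// ltW.
move=> x; apply/cvgrPdist_lt => e /posC[r r0 ->].
have d0 : 0 < r / (1 + c) by rewrite divr_gt0// ltr_wpDr.
near=> y; rewrite -(linB lT) norm_lt_n2//.
have : n2 (x - y) < (r / (1 + c)) ^+ 2.
  rewrite -norm_lt_n2//; near: y; apply: cvgr_dist_lt => //.
  by rewrite ltcR.
move=> h; apply: le_lt_trans (hc _) _.
have c1 : c * n2 (x - y) <= (1 + c) ^+ 2 * n2 (x - y).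
  by rewrite ler_wpM2r ?n2_ge0//; have := sqr_ge0 c; rewrite sqrrD; lra.
apply: le_lt_trans c1 _.
rewrite -ltr_pdivlMl ?exprn_gt0 ?ltr_wpDr//.
by rewrite mulrC -exprVn -exprMn.
Unshelve. all: by end_near. Qed.

Lemma ball1_n2 (x : H) : (`|x| <= 1) = (n2 x <= 1).
Proof. by rewrite (_ : 1 = (1 : R)%:C%C)// norm_le_n2// expr1n. Qed.
Lemma opnorm_le T c : 0 <= c -> bnd T (c ^+ 2) -> opnorm T <= c.
Proof.
move=> c0 h; apply: ge_sup => [|_ [x /= hx <-]].
  by exists (complex.Re `|T 0|), 0 => //=; rewrite normr0.
rewrite norm_n2 ReC; apply: sq_le => //; rewrite sqr_sqrtr ?n2_ge0//.
apply: le_trans (h _) _; rewrite -[leRHS]mulr1 ler_wpM2l ?sqr_ge0//.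
by rewrite -ball1_n2.
Qed.
Lemma opnorm_has_sup T : blin T -> has_sup [set complex.Re `|T x| | x in [set x : H | `|x| <= 1]].
Proof.
move=> [lT [c c0 hc]]; split.
  by exists (complex.Re `|T 0|), 0 => //=; rewrite normr0.
exists (1 + c) => _ [x /= hx <-].
rewrite norm_n2 ReC; apply: sq_le; rewrite ?addr_ge0// sqr_sqrtr ?n2_ge0//.
apply: le_trans (hc _) _; move: hx; rewrite ball1_n2 => hx.
apply: (@le_trans _ _ c); first by rewrite -[leRHS]mulr1 ler_wpM2l.
by have := sqr_ge0 c; rewrite sqrrD; lra.
Qed.
Lemma opnorm_ge0 T : blin T -> 0 <= opnorm T.
Proof.
move=> hT; apply: le_trans (sup_upper_bound (opnorm_has_sup hT) _).
  2: by exists 0 => //=; rewrite normr0.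
by rewrite norm_n2 ReC sqrtr_ge0.
Qed.
Lemma opnorm_bnd T : blin T -> bnd T (opnorm T ^+ 2).
Proof.
move=> hT x; have lT := hT.1; have [x0|xn0] := eqVneq (n2 x) 0.
  by rewrite (n2_eq0 x0) (lin0 lT) !n20 mulr0.
have xp : 0 < n2 x by rewrite n2_gt0.
pose k : R[i] := (Num.sqrt (n2 x)^-1)%:C%C.
have kE : m2 k = (n2 x)^-1 by rewrite m2C sqr_sqrtr// invr_ge0 ltW.
have : complex.Re `|T (k *: x)| <= opnorm T.
  apply: (sup_upper_bound (opnorm_has_sup hT)); exists (k *: x) => //=.
  by rewrite ball1_n2 n2Z kE mulVf.
rewrite norm_n2 ReC -(@ler_pXn2r _ 2)// ?nnegrE ?sqrtr_ge0 ?opnorm_ge0//.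
rewrite sqr_sqrtr ?n2_ge0// (linZ lT) n2Z kE.
by rewrite mulrC -ler_pdivlMr ?invr_gt0// invrK.
Qed.
End Bounded2.

(** * Orthogonal projection and the Riesz representation theorem *)

Section Projection.
Variables (R : realType) (H : hilbertType R).
Implicit Types (x y z : H).

Lemma subspD (S : set H) x y : subsp S -> S x -> S y -> S (x + y).
Proof. by move=> [_ h] hx hy; have := h 1 _ _ hx hy; rewrite scale1r. Qed.
Lemma subspZ (S : set H) k x : subsp S -> S x -> S (k *: x).
Proof. by move=> [h0 h] hx; have := h k _ _ hx h0; rewrite addr0. Qed.
Lemma subspB (S : set H) x y : subsp S -> S x -> S y -> S (x - y).
Proof. by move=> hS hx hy; rewrite -scaleN1r; apply: subspD => //; apply: subspZ. Qed.
Lemma subsp_sum (S : set H) (I : Type) (s : seq I) (f : I -> H) :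
  subsp S -> (forall i, S (f i)) -> S (\sum_(i <- s) f i).
Proof.
move=> hS hf; elim: s => [|i s ih]; rewrite ?big_nil ?big_cons; first by case: hS.
exact: subspD.
Qed.

Lemma n2_ZD_lt k x y (e : R) : 0 < e -> n2 x < e / (4 * (1 + m2 k)) -> n2 y < e / 4 -> n2 (k *: x + y) < e.
Proof.
have k0 := m2_ge0 k; move=> e0 hx hy; apply: le_lt_trans (n2D_le _ _) _; rewrite n2Z.
have : m2 k * n2 x <= (1 + m2 k) * (e / (4 * (1 + m2 k))).
  by rewrite ler_pM ?m2_ge0 ?n2_ge0 ?ltW//; lra.
have -> : (1 + m2 k) * (e / (4 * (1 + m2 k))) = e / 4 by field; rewrite gt_eqF// ltr_pwDl.
lra.
Qed.
Lemma closure_hclosed (S : set H) : hclosed [set x | forall e : R, 0 < e -> exists2 y, S y & n2 (x - y) < e].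
Proof.
move=> w hw e e0; have e4 : 0 < e / 4 by lra.
have [z Sz hz] := hw _ e4; have [z' Az hz'] := Sz _ e4; exists z' => //.
by apply: le_lt_trans (n2_tri _ z _) _; lra.
Qed.
Lemma closure_subsp (S : set H) : subsp S -> subsp [set x | forall e : R, 0 < e -> exists2 y, S y & n2 (x - y) < e].
Proof.
move=> [S0 SZ]; split=> [|k w w' hw hw' e e0]; first by move=> e e0; exists 0; rewrite ?subrr ?n20.
have d0 : 0 < e / (4 * (1 + m2 k)) by rewrite divr_gt0// mulr_gt0// ltr_pwDl// m2_ge0.
have e4 : 0 < e / 4 by lra.
have [a Aa ha] := hw _ d0; have [b Ab hb] := hw' _ e4.
exists (k *: a + b); first exact: SZ.
by rewrite opprD addrACA -scalerBr; apply: n2_ZD_lt.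
Qed.
Lemma zero_hclosed : hclosed [set (0 : H)].
Proof.
move=> w hw; apply: n2_eq0; apply/eqP; rewrite eq_le n2_ge0 andbT; apply: le_eps => d d0.
by have [_ -> /ltW] := hw d d0; rewrite subr0 add0r.
Qed.
Lemma zero_subsp : subsp [set (0 : H)].
Proof. by split=> // k _ _ -> ->; rewrite scaler0 addr0. Qed.

Lemma proj_exists (S : set H) x : subsp S -> hclosed S ->
  exists2 y, S y & forall z, S z -> inner (x - y) z = 0.
Proof.
move=> sS cS; pose D := [set n2 (x - y) | y in S].
have D0 : has_inf D.
  split; first by exists (n2 (x - 0)), 0 => //; case: sS.
  by exists 0 => _ [y _ <-]; apply: n2_ge0.
pose d := inf D.
have dle y : S y -> d <= n2 (x - y).
  by move=> Sy; apply: ge_inf; [exact: D0.2|exists y].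
have : forall n : nat, exists y, S y /\ n2 (x - y) < d + n.+1%:R^-1.
  move=> n; have [|_ [y Sy <-] hy] := @inf_adherent _ D n.+1%:R^-1 _ D0.
    by rewrite invr_gt0.
  by exists y.
move=> /choice[u hu].
(* Parallelogram law at the midpoint of [y] and [z]: two nearly minimizing vectors are close to each
   other. *)
have mid y z : S y -> S z -> n2 (y - z) <= 2 * n2 (x - y) + 2 * n2 (x - z) - 4 * d.
  move=> Sy Sz; have := parallelogram (x - y) (x - z).
  have := dle (2^-1 *: (y + z)) (subspZ _ sS (subspD sS Sy Sz)).
  have -> : x - y + (x - z) = 2 *: (x - 2^-1 *: (y + z)).
    rewrite scalerBr scalerA divff ?pnatr_eq0// scale1r scaler_nat mulr2n.
    by rewrite addrACA opprD.
  rewrite n2Z (_ : m2 2 = 4); last by rewrite /m2 /=; ring.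
  rewrite (_ : x - y - (x - z) = z - y); last by rewrite opprB [x - y]addrC addrACA subrr addr0 addrC.
  by rewrite (n2C z); lra.
have [y hy] : exists y, hlim u y.
  apply: hcomplete => e e0; have [N hN] := inv_small (divr_gt0 e0 (ltr0Sn _ 3)).
  exists N => m n Nm Nn; apply: le_lt_trans (mid _ _ (hu m).1 (hu n).1) _.
  have := (hu m).2; have := (hu n).2; have := hN m Nm; have := hN n Nn.
  by move: (m.+1%:R^-1) (n.+1%:R^-1) => q q'; lra.
have Sy : S y.
  apply: cS => e /hy[N hN]; exists (u N); [exact: (hu N).1|].
  by rewrite n2C hN.
exists y => // z Sz.
have dy : n2 (x - y) <= d.
  apply: (@n2_lim_le _ _ (fun n => x - u n)) => [e /hy[N hN]|e /inv_small[N hN]].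
    by exists N => n /hN; rewrite n2C opprD opprK addrACA subrr add0r addrC.
  exists N => n /hN h; have := (hu n).2; move: (_^-1) h => q; lra.
apply: m2_eq0; apply/eqP; rewrite eq_le m2_ge0 andbT.
have [z0|zn0] := eqVneq (n2 z) 0; first by rewrite (n2_eq0 z0) ip0r m20.
have zp : 0 < n2 z by rewrite n2_gt0.
(* The coefficient that minimizes the distance along [z]: moving [y] by [k z] would lower it by
   [m2 (inner (x - y) z) / n2 z]. *)
pose k := inner (x - y) z * ((n2 z)^-1)%:C%C.
have := dle _ (subspD sS Sy (subspZ k sS Sz)).
rewrite opprD addrA n2B n2Z ipZr /k rmorphM /= mulrAC (mulrC _^*) mulJ.
rewrite (_ : (_%:C%C)^* = ((n2 z)^-1)%:C%C); last exact: conjc_real.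
rewrite m2M m2C -rmorphM ReC => h.
have : 0 <= - m2 (inner (x - y) z) / n2 z.
  rewrite mulNr; move: h; rewrite expr2 !mulrA divfK//; lra.
by rewrite mulNr oppr_ge0 pmulr_lle0 ?invr_gt0.
Qed.

Lemma riesz (f : H -> R[i]) (c : R) : (forall k x y, f (k *: x + y) = k * f x + f y) ->
  (forall x, m2 (f x) <= c * n2 x) -> exists y, forall x, f x = inner x y.
Proof.
move=> lf bf.
have fB a b : f (a - b) = f a - f b.
  by have := lf (-1) b a; rewrite scaleN1r addrC mulN1r => ->; rewrite addrC.
have f0 : f 0 = 0 by rewrite -(subrr 0) fB subrr.
have fZ k a : f (k *: a) = k * f a by have := lf k a 0; rewrite f0 !addr0.
(* The sign of [c] is not assumed; a negative bound forces [f] to vanish. *)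
have c0 : 0 <= c \/ forall x, f x = 0.
  have [c0|c0] := leP 0 c; [by left|right => x].
  apply/m2_eq0/eqP; rewrite eq_le m2_ge0 andbT; apply: le_trans (bf _) _.
  by rewrite nmulr_rle0// n2_ge0.
case: c0 => [c0|f00]; last by exists 0 => x; rewrite f00 ip0r.
pose S := [set x | f x = 0].
have sS : subsp S.
  by split=> [//|k x y /= hx hy]; rewrite /S /= lf hx hy mulr0 addr0.
have cS : hclosed S.
  move=> x hx; apply/m2_eq0/eqP; rewrite eq_le m2_ge0 andbT.
  apply: le_eps => e e0; have d0 : 0 < e / (1 + c) by rewrite divr_gt0//; lra.
  have [y /= Sy xy] := hx _ d0.
  have -> : f x = f (x - y) by rewrite fB Sy subr0.
  apply: le_trans (bf _) _; rewrite add0r.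
  apply: (@le_trans _ _ ((1 + c) * n2 (x - y))).
    by rewrite ler_wpM2r ?n2_ge0//; lra.
  by rewrite mulrC -ler_pdivlMr ?ltW//; lra.
have [f00|] := pselect (forall x, f x = 0); first by exists 0 => x; rewrite f00 ip0r.
move=> /existsNP[x0 fx0].
have [y0 Sy0 hy0] := proj_exists x0 sS cS.
pose e := x0 - y0; have fe : f e != 0 by rewrite fB Sy0 subr0; apply/eqP.
have en0 : n2 e != 0 by apply: contraNneq fe => /n2_eq0 ->; rewrite f0.
exists (((f e) / (n2 e)%:C%C)^* *: e) => x.
have Sx : S (x - (f x / f e) *: e) by rewrite /S /= fB fZ divfK// subrr.
have := hy0 _ Sx; rewrite -/e => h0.
have : inner (x - (f x / f e) *: e) e = 0 by rewrite -ipJ h0 rmorph0.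
rewrite ipBl ipZl ipC => /subr0_eq h.
have n0 : (n2 e)%:C%C != 0 :> R[i] by apply/eqP => -[] /eqP; apply/negP.
by rewrite ipZr conjCK h; field; rewrite fe n0.
Qed.
End Projection.

(** * Adjoints of bounded operators between two spaces *)

Section Adjoint.
Variables (R : realType) (H K : hilbertType R).
Implicit Types (T : H -> K).
(** The counterpart of [adj] for operators between different spaces; on one space the two are
    convertible. *)
Definition dag T : K -> H :=
  get [set S : K -> H | forall x y, inner (T x) y = inner x (S y)].
Lemma dag_uniq T S : (forall x y, inner (T x) y = inner x (S y)) -> dag T = S.
Proof.
move=> h; apply/funext => y; apply: ip_extr => x.
by rewrite -h; symmetry; apply: (@getPex _ [set S : K -> H | forall x y, inner (T x) y = inner x (S y)]); exists S.
Qed.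
Lemma dagP T : blin T -> forall x y, inner (T x) y = inner x (dag T y).
Proof.
move=> [lT [c c0 bT]].
have : forall y, exists z, forall x, inner (T x) y = inner x z.
  move=> y; apply: (@riesz _ _ _ (c * n2 y)) => [k x x'|x].
    by rewrite lT ipDl ipZl.
  by apply: le_trans (CS _ _) _; rewrite mulrAC ler_wpM2r// n2_ge0.
by move=> /choice[S hS] x y; rewrite (@dag_uniq T S) => [|x' y']; rewrite hS.
Qed.
Lemma dagPr T : blin T -> forall x y, inner (dag T y) x = inner y (T x).
Proof. by move=> hT x y; rewrite -ipJ -dagP// ipJ. Qed.
Lemma bnd_adj T (S : K -> H) c : bnd T c -> 0 <= c ->
  (forall x y, inner (T x) y = inner x (S y)) -> bnd S c.
Proof.
move=> bT c0 h y; have [->|n0] := eqVneq (n2 (S y)) 0; first by rewrite mulr_ge0// n2_ge0.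
have p : 0 < n2 (S y) by rewrite n2_gt0.
have := CS (T (S y)) y; rewrite h ipC m2C => h1.
have : n2 (S y) * n2 (S y) <= n2 (S y) * (c * n2 y).
  rewrite -expr2; apply: le_trans h1 _.
  by rewrite mulrCA mulrA ler_wpM2r ?n2_ge0.
by rewrite ler_pM2l.
Qed.
Lemma adj_lin T (S : K -> H) : (forall x y, inner (T x) y = inner x (S y)) -> lin S.
Proof.
move=> h k x y; apply: ip_extr => z.
by rewrite -h !ipDr !ipZr !h.
Qed.
Lemma dag_bnd T c : blin T -> 0 <= c -> bnd T c -> bnd (dag T) c.
Proof. by move=> hT c0 hc; apply: bnd_adj hc c0 _; apply: dagP. Qed.
Lemma blinJ T : blin T -> blin (dag T).
Proof.
move=> hT; have [lT [c c0 bT]] := hT; split; first exact: adj_lin (dagP hT).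
by exists c => //; apply: dag_bnd.
Qed.
End Adjoint.
Lemma adjE (R : realType) (H : hilbertType R) (T : op H) : adj T = dag T.
Proof. by []. Qed.
Lemma dagK (R : realType) (H K : hilbertType R) (T : H -> K) : blin T -> dag (dag T) = T.
Proof. by move=> hT; apply: dag_uniq => x y; rewrite dagPr. Qed.

Section BlinOps.
Variables (R : realType) (H K L : hilbertType R).
Lemma blin_id : blin (@id H).
Proof. by split => // ; exists 1 => // x; rewrite mul1r. Qed.
Lemma bnd_comp (T : K -> L) (S : H -> K) a b : 0 <= a -> bnd T a -> bnd S b -> bnd (T \o S) (a * b).
Proof.
by move=> a0 hT hS x; apply: le_trans (hT _) _; rewrite -mulrA ler_wpM2l.
Qed.
Lemma blinM (T : K -> L) (S : H -> K) : blin T -> blin S -> blin (T \o S).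
Proof.
move=> [lT [a a0 hT]] [lS [b b0 hS]]; split; first by move=> k x y /=; rewrite lS lT.
by exists (a * b); [rewrite mulr_ge0|apply: bnd_comp].
Qed.
Lemma blin0 : blin (0 : H -> K).
Proof. by split; [move=> k x y; rewrite scaler0 addr0|exists 0 => // x; rewrite n20 mul0r]. Qed.
Lemma blinZD k (T S : H -> K) : blin T -> blin S -> blin (k *: T + S).
Proof.
move=> [lT [a a0 hT]] [lS [b b0 hS]]; split.
  move=> c x y; rewrite !fctE lT lS !scalerDr !scalerA [k * c]mulrC.
  by rewrite addrACA.
exists (2 * (m2 k * a) + 2 * b) => [|x].
  by rewrite addr_ge0// !mulr_ge0// m2_ge0.
rewrite !fctE; apply: le_trans (n2D_le _ _) _; rewrite n2Z.
have := ler_wpM2l (m2_ge0 k) (hT x); have := hS x.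
move: (n2 x) (n2 (T x)) (n2 (S x)) (m2 k) => X TX SX m h1.
nra.
Qed.
Lemma blinZ k (T : H -> K) : blin T -> blin (k *: T).
Proof. by move=> h; rewrite -[_ *: _]addr0; apply: blinZD => //; apply: blin0. Qed.
Lemma blinD (T S : H -> K) : blin T -> blin S -> blin (T + S).
Proof. by move=> hT hS; rewrite -[T]scale1r; apply: blinZD. Qed.
Lemma blinN (T : H -> K) : blin T -> blin (- T).
Proof. by rewrite -scaleN1r; apply: blinZ. Qed.
Lemma blinB (T S : H -> K) : blin T -> blin S -> blin (T - S).
Proof. by move=> hT hS; apply: blinD => //; apply: blinN. Qed.
Lemma blin_sum (I : Type) (s : seq I) (f : I -> H -> K) :
  (forall i, blin (f i)) -> blin (\sum_(i <- s) f i).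
Proof.
move=> h; elim: s => [|i s ih]; rewrite ?big_nil ?big_cons; first exact: blin0.
exact: blinD.
Qed.
Lemma sumE (I : Type) (s : seq I) (f : I -> H -> K) x :
  (\sum_(i <- s) f i) x = \sum_(i <- s) f i x.
Proof. by elim: s => [|i s ih]; rewrite ?big_nil// !big_cons fctE ih. Qed.
Lemma dagM (T : K -> L) (S : H -> K) : blin T -> blin S -> dag (T \o S) = dag S \o dag T.
Proof. by move=> hT hS; apply: dag_uniq => x y /=; rewrite !dagP. Qed.
Lemma dagZD k (T S : H -> K) : blin T -> blin S -> dag (k *: T + S) = k^* *: dag T + dag S.
Proof.
move=> hT hS; apply: dag_uniq => x y.
by rewrite !fctE ipDl ipZl ipDr ipZr conjCK !dagP.
Qed.
Lemma dag0 : dag (0 : H -> K) = 0.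
Proof. by apply: dag_uniq => x y; rewrite ip0l ip0r. Qed.
Lemma dagD (T S : H -> K) : blin T -> blin S -> dag (T + S) = dag T + dag S.
Proof. by move=> hT hS; rewrite -[T]scale1r dagZD// rmorph1 !scale1r. Qed.
Lemma dagZ k (T : H -> K) : blin T -> dag (k *: T) = k^* *: dag T.
Proof. by move=> hT; rewrite -[k *: T]addr0 dagZD ?dag0 ?addr0//; apply: blin0. Qed.
Lemma dagB (T S : H -> K) : blin T -> blin S -> dag (T - S) = dag T - dag S.
Proof. by move=> hT hS; rewrite dagD ?dagZ//; [rewrite -scaleN1r dagZ// rmorphN1 scaleN1r|apply: blinN]. Qed.
Lemma dag_id : dag (@id H) = id.
Proof. exact: dag_uniq. Qed.
Lemma dag_sum (I : Type) (s : seq I) (f : I -> H -> K) :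
  (forall i, blin (f i)) -> dag (\sum_(i <- s) f i) = \sum_(i <- s) dag (f i).
Proof.
move=> h; elim: s => [|i s ih]; rewrite ?big_nil ?big_cons ?dag0// dagD ?ih//.
exact: blin_sum.
Qed.
End BlinOps.

(** * The Hilbert space of a positive kernel *)

Section Clim.
Variable R : realType.
Implicit Types (w : nat -> R[i]).

(** Cauchy-Schwarz in abstract form: [a], [b], [z] are the entries of a positive semidefinite 2 by 2
    matrix. It serves kernels, their completions and the forms of positive operators, degenerate
    cases included. *)
Lemma CSq (a b : R) (z : R[i]) : 0 <= a -> 0 <= b ->
  (forall c : R[i], 0 <= a + m2 c * b + 2 * Re (c^* * z)) -> m2 z <= a * b.
Proof.
move=> a0 b0 h; have [bz|bn] := eqVneq b 0.
  rewrite bz mulr0; have [->|zn] := eqVneq (m2 z) 0; first by [].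
  (* With [b = 0] the expression is affine in [c]; this multiple of [z] gives it the value
     [- a - 2]. *)
  have := h (- ((a + 1) / m2 z)%:C%C * z).
  rewrite bz mulr0 addr0 rmorphM rmorphN /= -mulrA (mulrC z^*) mulJ.
  rewrite (_ : (_%:C%C)^* = ((a + 1) / m2 z)%:C%C); last exact: conjc_real.
  by rewrite mulNr ReN -rmorphM ReC divfK//; lra.
have bp : 0 < b by rewrite lt_neqAle eq_sym bn.
have := h (- (b^-1)%:C%C * z).
have -> : (- (b^-1)%:C%C * z)^* * z = - (b^-1 * m2 z)%:C%C.
  rewrite rmorphM rmorphN /= (_ : (_%:C%C)^* = (b^-1)%:C%C); last exact: conjc_real.
  by rewrite !mulNr -mulrA [_^* * z]mulrC mulJ -rmorphM.
rewrite m2M m2N m2C ReN ReC.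
have -> : a + b^-1 ^+ 2 * m2 z * b + 2 * - (b^-1 * m2 z) = b^-1 * (a * b - m2 z).
  by field.
by rewrite pmulr_rge0 ?invr_gt0// subr_ge0.
Qed.

Definition clim w z := forall e : R, 0 < e -> exists N, forall n, (N <= n)%N -> m2 (w n - z) < e.
Lemma clim_cst z : clim (fun=> z) z.
Proof. by move=> e e0; exists 0%N => n _; rewrite subrr m20. Qed.
Lemma climD w w' z z' : clim w z -> clim w' z' -> clim (fun n => w n + w' n) (z + z').
Proof.
move=> h h' e e0; have e4 : 0 < e / 4 by lra.
have [N hN] := h _ e4; have [N' hN'] := h' _ e4; exists (maxn N N') => n.
rewrite geq_max => /andP[/hN h1 /hN' h2]; rewrite opprD addrACA.
by apply: le_lt_trans (m2D _ _) _; lra.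
Qed.
Lemma climZ k w z : clim w z -> clim (fun n => k * w n) (k * z).
Proof.
move=> h e e0; have d0 : 0 < e / (1 + m2 k) by rewrite divr_gt0// ltr_pwDl// m2_ge0.
have [N hN] := h _ d0; exists N => n /hN; rewrite -mulrBr m2M.
rewrite ltr_pdivlMr ?ltr_pwDl ?m2_ge0// mulrC; apply: le_lt_trans.
by rewrite ler_wpM2r ?m2_ge0//; lra.
Qed.
Lemma climN w z : clim w z -> clim (fun n => - w n) (- z).
Proof. by move=> /(climZ (-1)); rewrite mulN1r; under eq_fun do rewrite mulN1r. Qed.
Lemma climJ w z : clim w z -> clim (fun n => (w n)^*) z^*.
Proof. by move=> h e /h[N hN]; exists N => n /hN; rewrite -rmorphB /= m2J. Qed.
Lemma clim_ext w w' z : (forall n, w n = w' n) -> clim w z -> clim w' z.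
Proof. by move=> h; congr clim; apply/funext. Qed.
Lemma clim_null w z : (forall e : R, 0 < e -> exists N, forall n, (N <= n)%N -> m2 (w n) < e) -> clim w z -> z = 0.
Proof.
move=> h h'; apply/m2_eq0/eqP; rewrite eq_le m2_ge0 andbT; apply: le_eps => e e0.
have e4 : 0 < e / 4 by lra.
have [N hN] := h _ e4; have [N' hN'] := h' _ e4.
have := hN _ (leq_maxl N N'); have := hN' _ (leq_maxr N N').
set n := maxn _ _ => h1 h2; have := m2D (w n) (- (w n - z)); rewrite m2N.
by rewrite {1}opprB addrC subrK; lra.
Qed.
Lemma clim_uniq w z z' : clim w z -> clim w z' -> z = z'.
Proof.
move=> h h'; apply/subr0_eq; apply: (clim_null (w := fun n => w n - w n)).
  by move=> e e0; exists 0%N => n _; rewrite subrr m20.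
by apply: climD => //; apply: climN.
Qed.
Lemma clim_ge0 w z : (forall n, 0 <= Re (w n)) -> clim w z -> 0 <= Re z.
Proof.
move=> h0 h; rewrite leNgt; apply/negP => z0.
have [N /(_ N (leqnn N))] := h (Re z ^+ 2) ltac:(by rewrite expr2 nmulr_rgt0).
rewrite ltNge => /negP; apply; rewrite /m2 !reim.
have := sqr_ge0 (Im (w N) - Im z); have := h0 N.
rewrite !sqrrB => h1 h2; have : 0 <= Re (w N) * - Re z by rewrite mulr_ge0// oppr_ge0 ltW.
by have := sqr_ge0 (Re (w N)); lra.
Qed.

Definition ccau w := forall e : R, 0 < e -> exists N, forall m n, (N <= m)%N -> (N <= n)%N -> m2 (w m - w n) < e.

Lemma rcomplete (u : nat -> R) : (forall e : R, 0 < e -> exists N, forall m n, (N <= m)%N -> (N <= n)%N -> (u m - u n) ^+ 2 < e) ->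
  exists l, forall e : R, 0 < e -> exists N, forall n, (N <= n)%N -> (u n - l) ^+ 2 < e.
Proof.
move=> hu; suff /cvg_ex[l /cvgrPdist_lt hl] : cvgn u.
  exists l => e e0; have [|N _ hN] := hl (Num.sqrt e); first by rewrite sqrtr_gt0.
  exists N => n Nn; have := hN n Nn => /= h.
  rewrite -(sqr_sqrtr (ltW e0)) -sqrrN opprB -real_normK ?num_real//.
  by rewrite ltr_pXn2r// ?nnegrE ?sqrtr_ge0.
apply/cauchy_cvgP/cauchy_ballP => e e0.
have [N hN] := hu (e ^+ 2) (exprn_gt0 _ e0).
pose A := u @` [set n | (N <= n)%N].
have FA : nbhs (u @ \oo) A by exists N => // n Nn; exists n.
exists (A, A) => // -[x y] [/= [m Nm <-] [n Nn <-]].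
rewrite -ball_normE /=; have := hN _ _ Nm Nn.
by rewrite -real_normK ?num_real// ltr_pXn2r// ?nnegrE ?normr_ge0// ltW.
Qed.
Lemma ccomplete w : ccau w -> exists z, clim w z.
Proof.
move=> h; have [|x hx] := @rcomplete (fun n => Re (w n)).
  move=> e /h[N hN]; exists N => m n Nm Nn; apply: le_lt_trans (hN m n Nm Nn).
  by rewrite /m2 !reim lerDl sqr_ge0.
have [|y hy] := @rcomplete (fun n => Im (w n)).
  move=> e /h[N hN]; exists N => m n Nm Nn; apply: le_lt_trans (hN m n Nm Nn).
  by rewrite /m2 !reim lerDr sqr_ge0.
exists (x +i* y)%C => e e0; have e2 : 0 < e / 2 by lra.
have [N hN] := hx _ e2; have [N' hN'] := hy _ e2; exists (maxn N N') => n.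
by rewrite geq_max => /andP[/hN h1 /hN' h2]; rewrite /m2 !reim /=; lra.
Qed.
End Clim.

Record kernel (R : realType) (X : Type) := Kernel {
  kf :> X -> X -> R[i];
  kherm : forall x y, kf y x = (kf x y)^*;
  kpos : forall s : seq (R[i] * X),
    0 <= Re (\sum_(p <- s) \sum_(q <- s) p.1 * q.1^* * kf p.2 q.2)
}.

Section KH.
Variables (R : realType) (X : Type) (k : kernel R X).
Implicit Types (s t : seq (R[i] * X)) (u v : nat -> seq (R[i] * X)) (f g : X -> R[i]^o).

Definition kB s t := \sum_(p <- s) \sum_(q <- t) p.1 * q.1^* * k p.2 q.2.
Definition kZ (c : R[i]) s := [seq (c * p.1, p.2) | p <- s].
Definition kq s : R := Re (kB s s).
Definition kev s x := kB s [:: (1, x)].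
Lemma kBDl s s' t : kB (s ++ s') t = kB s t + kB s' t.
Proof. by rewrite /kB big_cat. Qed.
Lemma kBJ s t : kB t s = (kB s t)^*.
Proof.
rewrite /kB rmorph_sum exchange_big; apply: eq_bigr => p _ /=.
rewrite rmorph_sum; apply: eq_bigr => q _ /=.
by rewrite (kherm k) !rmorphM /= conjCK (mulrC q.1).
Qed.
Lemma kBDr s s' t : kB t (s ++ s') = kB t s + kB t s'.
Proof. by rewrite kBJ kBDl rmorphD /= -!kBJ. Qed.
Lemma kBZl c s t : kB (kZ c s) t = c * kB s t.
Proof.
rewrite /kB big_map mulr_sumr; apply: eq_bigr => p _.
by rewrite mulr_sumr; apply: eq_bigr => q _; rewrite !mulrA.
Qed.
Lemma kBZr c s t : kB t (kZ c s) = c^* * kB t s.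
Proof. by rewrite kBJ kBZl rmorphM /= -kBJ. Qed.
Lemma kq_ge0 s : 0 <= kq s. Proof. exact: kpos. Qed.
Lemma kqD s t : kq (s ++ t) = kq s + kq t + 2 * Re (kB s t).
Proof. by rewrite /kq kBDl !kBDr !reim (kBJ s t) reim; ring. Qed.
Lemma kqZ c s : kq (kZ c s) = m2 c * kq s.
Proof. by rewrite /kq kBZl kBZr mulrA mulJ !reim mul0r subr0. Qed.
Lemma kCS s t : m2 (kB s t) <= kq s * kq t.
Proof.
apply: CSq => [||c]; rewrite ?kq_ge0//.
by have := kq_ge0 (s ++ kZ c t); rewrite kqD kqZ kBZr.
Qed.
Definition ksub s t := s ++ kZ (-1) t.
Lemma kBsubl s s' t : kB (ksub s s') t = kB s t - kB s' t.
Proof. by rewrite kBDl kBZl mulN1r. Qed.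
Lemma kBsubr s s' t : kB t (ksub s s') = kB t s - kB t s'.
Proof. by rewrite kBDr kBZr rmorphN1 mulN1r. Qed.
Lemma kq_sub s t : kq (ksub s t) = kq s + kq t - 2 * Re (kB s t).
Proof. by rewrite kqD kqZ kBZr m2N m21 rmorphN1 mul1r mulN1r ReN; ring. Qed.
Lemma kq_le s t : kq s <= 2 * kq (ksub s t) + 2 * kq t.
Proof. by have := kq_ge0 (ksub s (kZ 2 t)); rewrite !kq_sub kqZ kBZr conjC_nat /m2 /= !reim /=; lra. Qed.
Lemma kq_ext s t : (forall r, kB s r = kB t r) -> kq s = kq t.
Proof. by move=> h; rewrite /kq h kBJ reim h. Qed.
Definition kcau u := forall e : R, 0 < e -> exists N, forall m n, (N <= m)%N -> (N <= n)%N -> kq (ksub (u m) (u n)) < e.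
(** Vectors of the completion are functions on [X], as in a reproducing kernel space: [f] is the
    pointwise limit of a sequence of combinations that is Cauchy for the kernel seminorm. Null
    combinations are then the function 0, and no quotient is formed. *)
Definition krep u f := kcau u /\ forall x, clim (fun n => kev (u n) x) (f x).
Lemma kevE s x : kev s x = \sum_(p <- s) p.1 * k p.2 x.
Proof. by apply: eq_bigr => p _; rewrite big_seq1 rmorph1 mulr1. Qed.
Lemma kB_ev s t : kB s t = \sum_(q <- t) q.1^* * kev s q.2.
Proof.
rewrite /kB exchange_big; apply: eq_bigr => q _.
rewrite kevE mulr_sumr; apply: eq_bigr => p _ /=.
by rewrite mulrA (mulrC p.1).
Qed.
Lemma clim_kB u f t : (forall x, clim (fun n => kev (u n) x) (f x)) ->
  clim (fun n => kB (u n) t) (\sum_(q <- t) q.1^* * f q.2).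
Proof.
move=> h; apply: (clim_ext (w := fun n => \sum_(q <- t) q.1^* * kev (u n) q.2)) => [n|].
  by rewrite kB_ev.
elim: t => [|q t ih].
  by rewrite big_nil; apply: (clim_ext (w := fun=> 0)) => [n|]; [rewrite big_nil|exact: clim_cst].
rewrite big_cons; apply: (clim_ext (w := fun n => q.1^* * kev (u n) q.2 + \sum_(q <- t) q.1^* * kev (u n) q.2)) => [n|].
  by rewrite big_cons.
by apply: climD => //; apply: climZ.
Qed.
(** The inner product of the completion is well defined because of this: [u N] is a finite
    combination, so pointwise convergence sends [kB (u n) (u N)] to 0 while [u n] stays close to
    [u N]. *)
Lemma krep_null u : krep u (fun=> 0) -> forall e : R, 0 < e -> exists N, forall n, (N <= n)%N -> kq (u n) < e.
Proof.
move=> [cu hu] e e0; have e2 : 0 < e / 2 by lra.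
have [N hN] := cu _ e2.
have d0 : 0 < (e / 4) ^+ 2 by rewrite exprn_gt0//; lra.
have [M hM] := clim_kB (u N) hu d0; exists (maxn N M) => n.
rewrite geq_max => /andP[Nn /hM]; rewrite big1 ?subr0 => [h|q _]; last by rewrite mulr0.
have := hN n N Nn (leqnn N); rewrite kq_sub.
have := Re_le_m2 (r := e / 4) ltac:(lra) (ltW h).
by have := kq_ge0 (u N); lra.
Qed.
Lemma kcau_bnd u : kcau u -> exists c N, 0 < c /\ forall n, (N <= n)%N -> kq (u n) <= c.
Proof.
move=> /(_ 1 ltr01)[N hN]; exists (2 + 2 * kq (u N)), N; split.
  by have := kq_ge0 (u N); lra.
move=> n Nn; have := kq_le (u n) (u N); have := hN n N Nn (leqnn N); lra.
Qed.
Lemma kcauZD c u v : kcau u -> kcau v -> kcau (fun n => kZ c (u n) ++ v n).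
Proof.
move=> hu hv e e0.
have e1 : 0 < e / (4 * (1 + m2 c)) by rewrite divr_gt0// mulr_gt0// ltr_pwDl// m2_ge0.
have [N hN] := hu _ e1; have e4 : 0 < e / 4 by lra.
have [M hM] := hv _ e4; exists (maxn N M) => m n.
rewrite !geq_max => /andP[Nm Mm] /andP[Nn Mn].
have h1 := hN _ _ Nm Nn; have h2 := hM _ _ Mm Mn.
have -> : kq (ksub (kZ c (u m) ++ v m) (kZ c (u n) ++ v n)) =
  kq (kZ c (ksub (u m) (u n)) ++ ksub (v m) (v n)).
  by apply: kq_ext => t; rewrite !kBsubl !kBDl !kBZl !kBsubl; ring.
have k1 : kq (kZ c (ksub (u m) (u n))) <= e / 4.
  rewrite kqZ; have h3 : m2 c * kq (ksub (u m) (u n)) <= (1 + m2 c) * (e / (4 * (1 + m2 c))).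
    by apply: ler_pM; rewrite ?m2_ge0 ?kq_ge0//; [lra|exact: ltW].
  apply: le_trans h3 _; rewrite le_eqVlt; apply/orP; left; apply/eqP; field.
  by rewrite gt_eqF// ltr_pwDl// m2_ge0.
set a := kZ c _ in k1 *; set b := ksub (v m) _ in h2 *.
rewrite kqD; have := kq_ge0 (ksub a b); rewrite kq_sub; lra.
Qed.
Lemma krepZD c u v f g : krep u f -> krep v g ->
  krep (fun n => kZ c (u n) ++ v n) (c *: f + g).
Proof.
move=> [cu hu] [cv hv]; split; first exact: kcauZD.
move=> x; rewrite !fctE; apply: (clim_ext (w := fun n => c * kev (u n) x + kev (v n) x)).
  by move=> n; rewrite /kev kBDl kBZl.
by apply: climD => //; apply: climZ.
Qed.
Lemma clim_krep u v : kcau u -> kcau v -> exists z, clim (fun n => kB (u n) (v n)) z.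
Proof.
move=> cu cv; apply: ccomplete => e e0.
have [c [N [c0 hc]]] := kcau_bnd cu; have [c' [N' [c'0 hc']]] := kcau_bnd cv.
have [M hM] := cu (e / (4 * c')) ltac:(by rewrite divr_gt0// mulr_gt0).
have [M' hM'] := cv (e / (4 * c)) ltac:(by rewrite divr_gt0// mulr_gt0).
exists (maxn (maxn N N') (maxn M M')) => m n; rewrite !geq_max.
move=> /andP[/andP[a1 a2] /andP[a3 a4]] /andP[/andP[b1 b2] /andP[b3 b4]].
have -> : kB (u m) (v m) - kB (u n) (v n) = kB (ksub (u m) (u n)) (v m) + kB (u n) (ksub (v m) (v n)).
  by rewrite kBsubl kBsubr addrA subrK.
apply: le_lt_trans (m2D _ _) _.
have h1 := kCS (ksub (u m) (u n)) (v m); have h2 := kCS (u n) (ksub (v m) (v n)).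
have g1 : kq (ksub (u m) (u n)) * kq (v m) < e / 4.
  apply: (@le_lt_trans _ _ (kq (ksub (u m) (u n)) * c')).
    by rewrite ler_wpM2l ?kq_ge0 ?hc'.
  rewrite -ltr_pdivlMr// (lt_le_trans (hM _ _ a3 b3))// le_eqVlt; apply/orP; left.
  by apply/eqP; field; rewrite gt_eqF.
have g2 : kq (u n) * kq (ksub (v m) (v n)) < e / 4.
  apply: (@le_lt_trans _ _ (c * kq (ksub (v m) (v n)))).
    by rewrite ler_wpM2r ?kq_ge0 ?hc.
  rewrite mulrC -ltr_pdivlMr// (lt_le_trans (hM' _ _ a4 b4))// le_eqVlt; apply/orP; left.
  by apply/eqP; field; rewrite gt_eqF.
lra.
Qed.
Lemma krep_uniq u u' v f g z : krep u f -> krep u' f -> krep v g ->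
  clim (fun n => kB (u n) (v n)) z -> clim (fun n => kB (u' n) (v n)) z.
Proof.
move=> ru ru' rv h.
have r0 : krep (fun n => kZ (-1) (u n) ++ u' n) (fun=> 0).
  by have := krepZD (-1) ru ru'; rewrite scaleN1r addNr.
have [c [N [c0 hc]]] := kcau_bnd rv.1.
have hd : clim (fun n => kB (kZ (-1) (u n) ++ u' n) (v n)) 0.
  move=> e e0; have [M hM] := krep_null r0 (e := e / c) ltac:(by rewrite divr_gt0).
  exists (maxn N M) => n; rewrite geq_max => /andP[/hc h1 /hM h2].
  rewrite subr0; apply: le_lt_trans (kCS _ _) _.
  apply: (@le_lt_trans _ _ (kq (kZ (-1) (u n) ++ u' n) * c)).
    by rewrite ler_wpM2l ?kq_ge0.
  by rewrite -ltr_pdivlMr.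
have := climD h hd; rewrite addr0; apply: clim_ext => n.
by rewrite kBDl kBZl mulN1r addrA subrr add0r.
Qed.
Definition khP f := exists u, krep u f.
Definition kh_pred : pred (X -> R[i]^o) := fun f => `[< khP f >].
Lemma khP0 : khP 0.
Proof.
exists (fun=> [::]); split => [e e0|x]; first by exists 0%N => m n _ _; rewrite /kq /kB big_nil.
apply: (clim_ext (w := fun=> 0)); last exact: clim_cst.
by move=> n; rewrite kevE big_nil.
Qed.
Lemma kh_submod : GRing.submod_closed kh_pred.
Proof.
split; first by apply/asboolP; exact: khP0.
move=> c f g /asboolP[u ru] /asboolP[v rv]; apply/asboolP.
by exists (fun n => kZ c (u n) ++ v n); apply: krepZD.
Qed.

HB.instance Definition _ := GRing.isSubmodClosed.Build _ _ kh_pred kh_submod.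
Record KH := MkKH {khval : X -> R[i]^o; _ : khval \in kh_pred}.
HB.instance Definition _ := [isSub for khval].
HB.instance Definition _ := [Choice of KH by <:].
HB.instance Definition _ := [SubChoice_isSubLmodule of KH by <:].

Lemma khE (f : KH) : khP (khval f). Proof. by case: f => f /= /asboolP. Qed.
Definition kip (f g : KH) : R[i] :=
  xget 0 [set z | exists u v, [/\ krep u (khval f), krep v (khval g) & clim (fun n => kB (u n) (v n)) z]].
Lemma kBsym_clim u v z : clim (fun n => kB (u n) (v n)) z -> clim (fun n => kB (v n) (u n)) z^*.
Proof. by move=> /climJ; apply: clim_ext => n; rewrite -kBJ. Qed.
Lemma kipP (f g : KH) u v : krep u (khval f) -> krep v (khval g) ->
  clim (fun n => kB (u n) (v n)) (kip f g).
Proof.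
move=> ru rv; have [z hz] := clim_krep ru.1 rv.1.
have [u' [v' [ru' rv' h]]] : [set z | exists u v, [/\ krep u (khval f), krep v (khval g) & clim (fun n => kB (u n) (v n)) z]] (kip f g).
  by apply: xgetPex; exists z, u, v.
have /kBsym_clim h1 := krep_uniq ru' ru rv' h.
have /kBsym_clim := krep_uniq rv' rv ru h1.
by rewrite conjCK.
Qed.
Lemma kipDl (c : R[i]) (f g h : KH) : kip (c *: f + g) h = c * kip f h + kip g h.
Proof.
have [u ru] := khE f; have [v rv] := khE g; have [w rw] := khE h.
have r : krep (fun n => kZ c (u n) ++ v n) (khval (c *: f + g)) by exact: krepZD.
apply: (clim_uniq (kipP r rw)).
apply: (clim_ext (w := fun n => c * kB (u n) (w n) + kB (v n) (w n))) => [n|].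
  by rewrite kBDl kBZl.
by apply: climD; [apply: climZ|]; apply: kipP.
Qed.
Lemma kipJ (f g : KH) : kip g f = (kip f g)^*.
Proof.
have [u ru] := khE f; have [v rv] := khE g.
exact: (clim_uniq (kipP rv ru)) (kBsym_clim (kipP ru rv)).
Qed.
Lemma kip_ge0 (f : KH) : 0 <= Re (kip f f).
Proof.
have [u ru] := khE f.
by apply: (clim_ge0 (w := fun n => kB (u n) (u n))) => [n|]; [exact: kq_ge0|exact: kipP].
Qed.
Lemma kip_real (f : KH) : kip f f = (Re (kip f f))%:C%C.
Proof.
have := congr1 (fun z : R[i] => Im z) (kipJ f f); rewrite !reim; case: (kip f f) => a b /= h.
by rewrite (_ : b = 0)//; lra.
Qed.
Lemma kevCS s x : m2 (kev s x) <= kq s * Re (k x x).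
Proof.
apply: le_trans (kCS _ _) _; rewrite /kq /kB !big_seq1 /= rmorph1 !mul1r //.
Qed.
Lemma kip_eq0 (f : KH) : Re (kip f f) = 0 -> f = 0.
Proof.
move=> h0; have [u ru] := khE f; have h := kipP ru ru.
apply: val_inj => /=; apply/funext => x.
have hx := ru.2 x; apply: (clim_null _ hx) => e e0.
have d0 : 0 < e / (1 + Re (k x x)).
  have := kq_ge0 [:: (1, x)]; rewrite /kq /kB !big_seq1 /= rmorph1 !mul1r => ?.
  by rewrite divr_gt0//; lra.
have := kq_ge0 [:: (1, x)]; rewrite /kq /kB !big_seq1 /= rmorph1 !mul1r => kx.
have [N hN] := h ((e / (1 + Re (k x x))) ^+ 2) (exprn_gt0 _ d0).
exists N => n /hN; rewrite kip_real h0 subr0 => /ltW/(Re_le_m2 (ltW d0)) hq.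
apply: le_lt_trans (kevCS _ _) _.
apply: (@le_lt_trans _ _ (e / (1 + Re (k x x)) * Re (k x x))).
  by rewrite ler_wpM2r.
by rewrite mulrAC ltr_pdivrMr ?ltr_pM2l//; lra.
Qed.
Lemma kipDr (c : R[i]) (f g h : KH) : kip h (c *: f + g) = c^* * kip h f + kip h g.
Proof. by rewrite kipJ kipDl rmorphD rmorphM /= -!kipJ. Qed.
Lemma kip_expand c (f g : KH) : Re (kip (c *: f + g) (c *: f + g)) =
  Re (kip g g) + m2 c * Re (kip f f) + 2 * Re (c^* * kip g f).
Proof.
rewrite kipDl !kipDr mulrDr mulrA mulJ (kipJ g f) /m2 !reim; ring.
Qed.
Lemma kipCS (f g : KH) : m2 (kip g f) <= Re (kip g g) * Re (kip f f).
Proof.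
apply: CSq => [||c]; rewrite ?kip_ge0//.
by rewrite -kip_expand kip_ge0.
Qed.
Definition knorm (f : KH) : R[i] := (Num.sqrt (Re (kip f f)))%:C%C.
Lemma knormD (f g : KH) : knorm (f + g) <= knorm f + knorm g.
Proof.
rewrite -rmorphD lecR; apply: sq_le; rewrite ?addr_ge0 ?sqrtr_ge0//.
rewrite sqr_sqrtr ?kip_ge0// -[f]scale1r kip_expand scale1r m21 rmorph1 !mul1r.
rewrite sqrrD !sqr_sqrtr ?kip_ge0//.
have := @Re_le_m2 _ (kip g f) (Num.sqrt (Re (kip f f)) * Num.sqrt (Re (kip g g))).
rewrite mulr_ge0 ?sqrtr_ge0// exprMn !sqr_sqrtr ?kip_ge0// mulrC kipCS => /(_ isT isT).
by rewrite -mulr_natl; lra.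
Qed.
Lemma kip0l (f : KH) : kip 0 f = 0.
Proof. by have := kipDl (-1) f f f; rewrite scaleN1r addNr mulN1r addNr. Qed.
Lemma kipZl c (f h : KH) : kip (c *: f) h = c * kip f h.
Proof. by have := kipDl c f 0 h; rewrite kip0l !addr0. Qed.
Lemma kipZr c (f h : KH) : kip h (c *: f) = c^* * kip h f.
Proof. by rewrite kipJ kipZl rmorphM /= -kipJ. Qed.
Lemma knormZ (c : R[i]) (f : KH) : knorm (c *: f) = `|c| * knorm f.
Proof.
rewrite /knorm kipZl kipZr mulrA mulJ ReM ReC ImC mul0r subr0.
by rewrite normc_def -rmorphM /= sqrtrM ?m2_ge0.
Qed.
Lemma knorm0 (f : KH) : knorm f = 0 -> f = 0.
Proof.
move=> [] /eqP; rewrite sqrtr_eq0 => h; apply: kip_eq0.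
by apply/eqP; rewrite eq_le h kip_ge0.
Qed.
HB.instance Definition _ := Lmodule_isNormed.Build R[i] KH knormD knormZ knorm0.

Lemma kball (f : KH) (e : R) (g : KH) : 0 < e -> ball f e%:C%C g = (Re (kip (f - g) (f - g)) < e ^+ 2) :> Prop.
Proof.
move=> e0; rewrite -ball_normE /= [`|_|]/(knorm _) ltcR -[in RHS](sqr_sqrtr (kip_ge0 _)) ltr_pXn2r//.
  by rewrite nnegrE sqrtr_ge0.
by rewrite nnegrE ltW.
Qed.
Definition kdist (f g : KH) : R := Re (kip (f - g) (f - g)).
Lemma kdist_tri (f g h : KH) : kdist f h <= 2 * kdist f g + 2 * kdist g h.
Proof.
have e c (a b : KH) : 0 <= Re (kip b b) + m2 c * Re (kip a a) + 2 * Re (c^* * kip b a).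
  by rewrite -kip_expand kip_ge0.
rewrite /kdist; have -> : f - h = 1 *: (f - g) + (g - h) by rewrite scale1r addrA subrK.
have := e (-1) (f - g) (g - h); rewrite kip_expand m2N m21 rmorphN1 rmorph1 mulN1r !mul1r ReN; lra.
Qed.
Lemma kdistC (f g : KH) : kdist f g = kdist g f.
Proof.
rewrite /kdist; have -> : g - f = (-1) *: (f - g) by rewrite scaleN1r opprB.
by rewrite kipZl kipZr rmorphN1 mulrA mulN1r opprK mul1r.
Qed.
Lemma khval_krep s : krep (fun=> s) (fun x => kev s x).
Proof.
split=> [e e0|x]; last exact: clim_cst.
by exists 0%N => m n _ _; rewrite kq_sub (_ : kq s + kq s - 2 * kq s = 0)//; ring.
Qed.
Lemma kcomb_pred s : (fun x => kev s x : R[i]^o) \in kh_pred.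
Proof. by apply/asboolP; exists (fun=> s); apply: khval_krep. Qed.
Definition kcomb s : KH := MkKH (kcomb_pred s).
Lemma kdist_comb (f : KH) u : krep u (khval f) -> forall e : R, 0 < e ->
  exists N, forall n, (N <= n)%N -> kdist f (kcomb (u n)) < e.
Proof.
move=> ru e e0; have e2 : 0 < e / 2 by lra.
have [N hN] := ru.1 _ e2; exists N => n Nn.
have r : krep (fun m => kZ (-1) (u n) ++ u m) (khval (f - kcomb (u n))).
  have := krepZD (-1) (khval_krep (u n)) ru; congr krep; apply/funext => x.
  by rewrite !fctE scaleN1r addrC.
rewrite /kdist; apply: (@le_lt_trans _ _ (e / 2)); last lra.
apply: le_eps => d d0.
have [M hM] := kipP r r (exprn_gt0 2 d0).
have := hM (maxn N M) (leq_maxr _ _) => /ltW; rewrite -m2N opprB => /(Re_le_m2 (ltW d0)).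
rewrite ReD ReN; have := hN (maxn N M) n (leq_maxl _ _) Nn.
rewrite (kq_ext (t := kZ (-1) (u n) ++ u (maxn N M))) => [|t]; last first.
  by rewrite !kBDl addrC.
rewrite /kq; lra.
Qed.
Lemma kip_comb s t : kip (kcomb s) (kcomb t) = kB s t.
Proof.
apply: (clim_uniq (w := fun=> kB s t)); last exact: clim_cst.
exact: (@kipP (kcomb s) (kcomb t) _ _ (khval_krep s) (khval_krep t)).
Qed.
Lemma kh_seqcomplete (F : nat -> KH) :
  (forall e : R, 0 < e -> exists N, forall m n, (N <= m)%N -> (N <= n)%N -> kdist (F m) (F n) < e) ->
  exists l, forall e : R, 0 < e -> exists N, forall n, (N <= n)%N -> kdist (F n) l < e.
Proof.
move=> cF.
have : forall n, exists s, kdist (F n) (kcomb s) < n.+1%:R^-1.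
  move=> n; have [u ru] := khE (F n).
  have [N hN] := kdist_comb ru (e := n.+1%:R^-1) ltac:(by rewrite invr_gt0).
  by exists (u N); apply: hN.
move=> /choice[s hs].
have cs : kcau s.
  move=> e e0; have e8 : 0 < e / 16 by lra.
  have [N hN] := cF _ e8; have [M hM] := inv_small e8; exists (maxn N M) => m n.
  rewrite !geq_max => /andP[Nm Mm] /andP[Nn Mn].
  have -> : kq (ksub (s m) (s n)) = kdist (kcomb (s m)) (kcomb (s n)).
    rewrite /kdist; have -> : kcomb (s m) - kcomb (s n) = kcomb (ksub (s m) (s n)).
      by apply: val_inj; apply/funext => x; rewrite /= !fctE /kev kBsubl.
    by rewrite kip_comb.
  have t1 := kdist_tri (kcomb (s m)) (F m) (kcomb (s n)).
  have t2 := kdist_tri (F m) (F n) (kcomb (s n)).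
  have a := hs m; have b := hs n; rewrite kdistC in a.
  have c := hM _ Mm; have d := hM _ Mn; have g := hN _ _ Nm Nn.
  move: a b c d g t1 t2; move: (kdist (kcomb (s m)) (kcomb (s n))) (kdist (kcomb (s m)) (F m)) (kdist (F m) (kcomb (s n))) (kdist (F m) (F n)) (kdist (F n) (kcomb (s n))) (m.+1%:R^-1) (n.+1%:R^-1) => *; lra.
have : forall x, exists z, clim (fun n => kev (s n) x) z.
  move=> x; have [z hz] := clim_krep cs (khval_krep [:: (1, x)]).1.
  by exists z.
move=> /choice[f hf].
have rf : krep s (f : X -> R[i]^o) by split.
have fp : (f : X -> R[i]^o) \in kh_pred by apply/asboolP; exists s.
exists (MkKH fp) => e e0; have e8 : 0 < e / 8 by lra.
have [N hN] := @kdist_comb (MkKH fp) s rf _ e8; have [M hM] := inv_small e8.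
exists (maxn N M) => n; rewrite geq_max => /andP[/hN h1 /hM h2].
have t := kdist_tri (F n) (kcomb (s n)) (MkKH fp); have a := hs n.
rewrite kdistC in h1; move: h1 h2 t a; move: (n.+1%:R^-1) (kdist (F n) (MkKH fp)) (kdist (F n) _) (kdist _ (MkKH fp)) => *; lra.
Qed.
Lemma kh_complete (F : set_system KH) : ProperFilter F -> cauchy F -> cvg F.
Proof.
move=> PF cF.
have bx (n : nat) : exists x : KH, F (ball x (n.+1%:R^-1 : R)%:C%C).
  by apply: ((cauchyP F).1 cF); rewrite ltcR invr_gt0.
move: bx => /choice[x hx].
have inv_small2 (e : R) : 0 < e -> exists N, forall n, (N <= n)%N -> n.+1%:R^-1 ^+ 2 < e.
  move=> /inv_small[N hN]; exists N => n /hN; apply: le_lt_trans.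
  by rewrite expr2 ler_piMr ?invr_ge0// invf_le1 ?ler1n.
have hx2 n : F [set y | kdist (x n) y < n.+1%:R^-1 ^+ 2].
  by apply: filterS (hx n) => y; rewrite kball ?invr_gt0.
have [l hl] : exists l, forall e : R, 0 < e -> exists N, forall n, (N <= n)%N -> kdist (x n) l < e.
  apply: kh_seqcomplete => e e0; have e4 : 0 < e / 4 by lra.
  have [N hN] := inv_small2 _ e4; exists N => m n /hN h1 /hN h2.
  have [y [/= h3 h4]] := filter_ex (filterI (hx2 m) (hx2 n)).
  have t := kdist_tri (x m) y (x n); rewrite kdistC in h4.
  move: h1 h2 h3 h4 t; move: (m.+1%:R^-1 ^+ 2) (n.+1%:R^-1 ^+ 2) (kdist (x m) (x n)) (kdist (x m) y) (kdist y (x n)) => *; lra.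
apply/cvg_ex; exists l; apply/cvg_ballP => e /posC[r r0 ->].
have r4 : 0 < r ^+ 2 / 4 by rewrite divr_gt0// exprn_gt0.
have [N hN] := inv_small2 _ r4; have [M hM] := hl _ r4.
apply: filterS (hx2 (maxn N M)) => y /= h; rewrite kball//.
have t := kdist_tri l (x (maxn N M)) y.
have a := hN _ (leq_maxl N M); have b := hM _ (leq_maxr N M); rewrite kdistC in b.
move: h t a b; rewrite -/(kdist l y).
move: (_^-1 ^+ 2) (kdist l y) (kdist l _) (kdist (x _) y) => *; lra.
Qed.
HB.instance Definition _ := Uniform_isComplete.Build KH kh_complete.
Lemma kip_linearl (h : KH) : linear (fun f : KH => kip f h : R[i]^o).
Proof. by move=> c f g; rewrite kipDl. Qed.
Lemma kip_norm (f : KH) : kip f f = `|f| ^+ 2.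
Proof. by rewrite kip_real [`|f|]/(knorm f) -rmorphXn /= sqr_sqrtr ?kip_ge0. Qed.
HB.instance Definition _ := isHilbert.Build R KH kip_linearl kipJ kip_norm.

Definition kphi (x : X) : KH := kcomb [:: (1, x)].
Lemma kphiE x y : inner (kphi x) (kphi y) = k x y.
Proof. by rewrite [LHS]kip_comb /kB !big_seq1 /= rmorph1 !mul1r. Qed.
Lemma kcombE s : kcomb s = \sum_(p <- s) p.1 *: kphi p.2.
Proof.
elim: s => [|p s ih].
  rewrite big_nil; apply: val_inj; apply/funext => x /=.
  by rewrite kevE big_nil.
rewrite big_cons -ih; apply: val_inj; apply/funext => x /=.
by rewrite !fctE !kevE big_cons big_seq1 mul1r.
Qed.
Lemma kphi_dense : hdense [set \sum_(p <- s) p.1 *: kphi p.2 | s in [set: seq (R[i] * X)]].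
Proof.
move=> f e e0; have [u ru] := khE f; have [N hN] := kdist_comb ru e0.
exists (kcomb (u N)); first by exists (u N) => //; rewrite kcombE.
exact: hN.
Qed.
End KH.

(** * Norm-closed algebras of operators *)

Section Total.
Variables (R : realType) (X : Type) (G : hilbertType R) (phi : X -> G).
Definition fcomb (V : lmodType R[i]) (f : X -> V) (s : seq (R[i] * X)) : V := \sum_(p <- s) p.1 *: f p.2.
Definition total := hdense [set fcomb phi s | s in [set: seq (R[i] * X)]].
Lemma fcomb_cat (V : lmodType R[i]) (f : X -> V) s t : fcomb f (s ++ t) = fcomb f s + fcomb f t.
Proof. exact: big_cat. Qed.
Lemma fcombZ (V : lmodType R[i]) (f : X -> V) c s : fcomb f (kZ c s) = c *: fcomb f s.
Proof.
by rewrite /fcomb big_map scaler_sumr; apply: eq_bigr => p _; rewrite scalerA.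
Qed.
Lemma lin_fcomb (K : hilbertType R) (T : G -> K) s : lin T ->
  T (fcomb phi s) = fcomb (fun x => T (phi x)) s.
Proof. by move=> lT; rewrite (lin_sum lT); apply: eq_bigr => p _; rewrite (linZ lT). Qed.
Lemma eq_fcomb (V : lmodType R[i]) (f g : X -> V) s : (forall x, f x = g x) -> fcomb f s = fcomb g s.
Proof. by move=> h; apply: eq_bigr => p _; rewrite h. Qed.

Hypothesis tphi : total.
Lemma total_vec u v : (forall x, inner u (phi x) = inner v (phi x)) -> u = v.
Proof.
move=> h; apply/subr0_eq; set w := u - v.
have h0 x : inner w (phi x) = 0 by rewrite ipBl h subrr.
apply: n2_eq0; apply/eqP; rewrite eq_le n2_ge0 andbT; apply: le_eps => e e0.
have [_ [s _ <-] hs] := tphi w e0.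
have : inner w (fcomb phi s) = 0.
  by rewrite ip_sumr big1// => p _; rewrite ipZr h0 mulr0.
move: hs; rewrite n2B => hs h1; have := n2_ge0 (fcomb phi s).
by move: hs; rewrite h1 Re0; lra.
Qed.
Lemma total_vecr u v : (forall x, inner (phi x) u = inner (phi x) v) -> u = v.
Proof. by move=> h; apply: total_vec => x; rewrite -ipJ h ipJ. Qed.
Lemma total_op (K : hilbertType R) (T S : G -> K) : blin T -> blin S ->
  (forall x, T (phi x) = S (phi x)) -> T = S.
Proof.
move=> bT bS h; apply/funext => y; apply: ip_ext => z.
rewrite !dagP//; congr inner; apply: total_vecr => x.
by rewrite -!dagP// h.
Qed.
Lemma total_approx u (e : R) : 0 < e -> exists s, n2 (u - fcomb phi s) < e.
Proof. by move=> /(tphi u)[_ [s _ <-]] h; exists s. Qed.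

Lemma total_seq u : exists s : nat -> seq (R[i] * X), hlim (fun n => fcomb phi (s n)) u.
Proof.
have : forall n : nat, exists s, n2 (u - fcomb phi s) < n.+1%:R^-1.
  by move=> n; apply: total_approx; rewrite invr_gt0.
move=> /choice[s hs]; exists s => e e0.
have /archi_boundP := ltW (etrans (invr_gt0 e) e0) => hN.
exists (Num.bound e^-1) => n Nn; rewrite n2C; apply: lt_trans (hs n) _.
rewrite invf_plt ?posrE//; apply: lt_le_trans hN _; by rewrite ler_nat ltnW.
Qed.

(** The operators on the kernel, induced and tensor spaces below are built from this lemma; the
    inequality on combinations also says that the prescription [psi] respects all linear relations
    among the [phi x]. *)
Lemma total_ext (K : hilbertType R) (psi : X -> K) c : 0 <= c ->
  (forall s, n2 (fcomb psi s) <= c * n2 (fcomb phi s)) ->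
  exists T : G -> K, [/\ blin T, bnd T c & forall x, T (phi x) = psi x].
Proof.
move=> c0 hc.
have sub s t (V : lmodType R[i]) (f : X -> V) : fcomb f (s ++ kZ (-1) t) = fcomb f s - fcomb f t.
  by rewrite fcomb_cat fcombZ scaleN1r.
have : forall y, exists z, forall s, hlim (fun n => fcomb phi (s n)) y -> hlim (fun n => fcomb psi (s n)) z.
  move=> y; have [s hs] := total_seq y.
  have hcs : hcau (fun n => fcomb psi (s n)).
    move=> e e0; have d0 : 0 < e / (4 * (1 + c)) by rewrite divr_gt0//; lra.
    have [N hN] := hs _ d0; exists N => m n Nm Nn; rewrite -sub.
    apply: le_lt_trans (hc _) _; rewrite sub.
    have h1 := hN m Nm; have h2 := hN n Nn.
    have h3 := n2_tri (fcomb phi (s m)) y (fcomb phi (s n)); rewrite (n2C y) in h3.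
    have h4 : n2 (fcomb phi (s m) - fcomb phi (s n)) < e / (1 + c).
      have -> : e / (1 + c) = 4 * (e / (4 * (1 + c))) by field; apply/eqP; lra.
      by lra.
    apply: (@le_lt_trans _ _ ((1 + c) * n2 (fcomb phi (s m) - fcomb phi (s n)))).
      by rewrite ler_wpM2r ?n2_ge0//; lra.
    by rewrite mulrC -ltr_pdivlMr//; lra.
  have [z hz] := hcomplete hcs; exists z => t ht e e0.
  have d0 : 0 < e / (16 * (1 + c)) by rewrite divr_gt0//; lra.
  have e4 : 0 < e / 4 by lra.
  have [N1 h1] := hs _ d0; have [N2 h2] := ht _ d0; have [N3 h3] := hz _ e4.
  exists (maxn N1 (maxn N2 N3)) => n; rewrite !geq_max => /and3P[/h1 {}h1 /h2 {}h2 /h3 {}h3].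
  have h5 := n2_tri (fcomb psi (t n)) (fcomb psi (s n)) z.
  have h6 := hc (t n ++ kZ (-1) (s n)); rewrite !sub in h6.
  have h7 := n2_tri (fcomb phi (t n)) y (fcomb phi (s n)); rewrite (n2C y) in h7.
  have h8 : c * n2 (fcomb phi (t n) - fcomb phi (s n)) <= (1 + c) * (4 * (e / (16 * (1 + c)))).
    by rewrite ler_pM ?n2_ge0//; lra.
  have h9 : (1 + c) * (4 * (e / (16 * (1 + c)))) = e / 4 by field; apply/eqP; lra.
  by lra.
move=> /choice[T hT].
have Tphi s : T (fcomb phi s) = fcomb psi s.
  apply: (@hlim_uniq _ _ (fun=> fcomb psi s)).
    by apply: (hT _ (fun=> s)) => e e0; exists 0%N => n _; rewrite subrr n20.
  by move=> e e0; exists 0%N => n _; rewrite subrr n20.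
have hb : bnd T c.
  move=> y; have [s hs] := total_seq y; apply: (n2_lim_le (hT _ _ hs)) => e e0.
  have [y0|yn0] := eqVneq c 0.
    by exists 0%N => n _; apply: le_trans (hc _) _; rewrite y0 !mul0r add0r ltW.
  have cp : 0 < c by rewrite lt_neqAle eq_sym yn0.
  have [x0|xn0] := eqVneq (n2 y) 0.
    have d0 : 0 < e / c by rewrite divr_gt0.
    have [N hN] := hs _ d0; exists N => n /hN; rewrite (n2_eq0 x0) subr0 n20 mulr0 add0r => h.
    apply: le_trans (hc _) _; rewrite mulrC -ler_pdivlMr//; exact: ltW.
  have yp : 0 < n2 y by rewrite n2_gt0.
  pose w := e / (2 * c * n2 y).
  have w0 : 0 < w by rewrite divr_gt0// !mulr_gt0.
  have d0 : 0 < e / (2 * c) / (1 + w^-1) by rewrite !divr_gt0// ?mulr_gt0// addr_gt0// invr_gt0.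
  have [N hN] := hs _ d0; exists N => n /hN h; apply: le_trans (hc _) _.
  have := n2_weight y (fcomb phi (s n) - y) w0; rewrite addrC subrK => h1.
  have h2 : (1 + w^-1) * n2 (fcomb phi (s n) - y) <= e / (2 * c).
    by rewrite mulrC -ler_pdivlMr ?addr_gt0 ?invr_gt0// ltW.
  apply: (@le_trans _ _ (c * ((1 + w) * n2 y + e / (2 * c)))).
    by rewrite ler_pM2l//; lra.
  rewrite le_eqVlt; apply/orP; left; apply/eqP; rewrite /w; field.
  by rewrite !gt_eqF.
exists T; split => //.
  split; last by exists c.
  move=> k x y; have [s hs] := total_seq x; have [t ht] := total_seq y.
  have hl (V : lmodType R[i]) (f : X -> V) n : fcomb f (kZ k (s n) ++ t n) = k *: fcomb f (s n) + fcomb f (t n).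
    by rewrite fcomb_cat fcombZ.
  have lm (V : hilbertType R) (f : X -> V) a b : hlim (fun n => fcomb f (s n)) a ->
      hlim (fun n => fcomb f (t n)) b -> hlim (fun n => fcomb f (kZ k (s n) ++ t n)) (k *: a + b).
    move=> ha hb' e e0; have d0 : 0 < e / (4 * (1 + m2 k)).
      by rewrite divr_gt0// mulr_gt0// ltr_pwDl// m2_ge0.
    have e4 : 0 < e / 4 by lra.
    have [N hN] := ha _ d0; have [M hM] := hb' _ e4; exists (maxn N M) => n.
    rewrite geq_max => /andP[/hN h1 /hM h2]; rewrite hl opprD addrACA -scalerBr.
    apply: le_lt_trans (n2D_le _ _) _; rewrite n2Z.
    have h3 : m2 k * n2 (fcomb f (s n) - a) <= (1 + m2 k) * (e / (4 * (1 + m2 k))).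
      by rewrite ler_pM ?m2_ge0 ?n2_ge0 ?ltW//; lra.
    have h4 : (1 + m2 k) * (e / (4 * (1 + m2 k))) = e / 4.
      by field; rewrite gt_eqF// ltr_pwDl// m2_ge0.
    lra.
  exact: (hlim_uniq (hT _ _ (lm _ _ _ _ hs ht)) (lm _ _ _ _ (hT _ _ hs) (hT _ _ ht))).
move=> x; have := Tphi [:: (1, x)]; rewrite /fcomb !big_seq1 /= !scale1r.
done.
Qed.
End Total.

(** * Powers of operators, norm bounds and norm limits *)

Section Pow.
Variable R : realType.
Implicit Types (x C M N : R).
Lemma pow_unbounded x C : 1 < x -> exists m, C < x ^+ (2 ^ m)%N.
Proof.
move=> x1; have b n : 1 + n%:R * (x - 1) <= x ^+ n.
  elim: n => [|n ih]; first by rewrite mul0r addr0.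
  have h : x * (1 + n%:R * (x - 1)) <= x * x ^+ n by rewrite ler_pM2l//; lra.
  rewrite exprS; apply: le_trans h; rewrite -natr1.
  have : 0 <= n%:R * (x - 1) ^+ 2 by rewrite mulr_ge0// sqr_ge0.
  move: (n%:R : R) => t; rewrite expr2; lra.
have /archi_boundP : 0 <= `|C| / (x - 1) by rewrite divr_ge0//; lra.
set m := Num.bound _; rewrite ltr_pdivrMr; last by lra.
move=> hm; exists m; apply: lt_le_trans (b _).
have : m%:R * (x - 1) <= (2 ^ m)%:R * (x - 1).
  by apply: ler_wpM2r; [lra|rewrite ler_nat ltnW// ltn_expl].
by have := ler_norm C; move: hm; move: (_%:R * _) (_%:R * _) => *; lra.
Qed.

(* the C*-identity trick: a 1 grows at most like the square roots of the a (2 ^ m) *)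
Lemma powtrick (a : nat -> R) N M C : 0 <= N -> 0 < M -> 0 <= a 1%N ->
  (forall k, a k ^+ 2 <= a (2 * k)%N * N) -> (forall k, a k <= C * M ^+ k) -> a 1%N <= M * N.
Proof.
move=> N0 M0 a1 h1 h2; have [NZ|Nn] := eqVneq N 0.
  have := h1 1%N; rewrite NZ !mulr0 => h.
  by rewrite (_ : a 1%N = 0)//; apply/eqP; rewrite -sqrf_eq0 eq_le h sqr_ge0.
have Np : 0 < N by rewrite lt_neqAle eq_sym Nn.
have ind m : a 1%N ^+ (2 ^ m) * N <= N ^+ (2 ^ m) * a (2 ^ m)%N.
  elim: m => [|m ih]; first by rewrite expn0 !expr1 mulrC.
  have := h1 (2 ^ m)%N; rewrite -expnS => h3.
  have h4 : (a 1%N ^+ (2 ^ m) * N) ^+ 2 <= (N ^+ (2 ^ m) * a (2 ^ m)%N) ^+ 2.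
    have p1 : 0 <= a 1%N ^+ (2 ^ m) * N by apply: mulr_ge0 => //; apply: exprn_ge0.
    by rewrite ler_pXn2r// nnegrE//; apply: le_trans ih.
  rewrite !exprMn -!exprM mulnC -expnS in h4.
  rewrite -(ler_pM2r Np) -mulrA -expr2; apply: le_trans h4 _.
  by rewrite -mulrA ler_pM2l ?exprn_gt0.
rewrite leNgt; apply/negP => hlt.
have MN : 0 < M * N by rewrite mulr_gt0.
have x1 : 1 < a 1%N / (M * N) by rewrite ltr_pdivlMr// mul1r.
have [m hm] := pow_unbounded (C / N) x1.
have := ind m; apply/negP; rewrite -ltNge.
apply: (@le_lt_trans _ _ (N ^+ (2 ^ m) * (C * M ^+ (2 ^ m)))).
  by rewrite ler_pM2l ?exprn_gt0.
move: hm; rewrite expr_div_n ltr_pdivrMr// mulrAC ltr_pdivlMr ?exprn_gt0//.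
by rewrite exprMn; move: (_ ^+ _) (M ^+ _) (N ^+ _) => p q r; rewrite [r * _]mulrC mulrA [p * N]mulrC -mulrA.
Qed.
End Pow.

Section Norms.
Variables (R : realType) (G K : hilbertType R).
Implicit Types (T S : G -> K).
(** Norm bounds are kept as a relation, so that no supremum is handled before [opnorm] comes back at
    the end. *)
Definition nb T (c : R) := 0 <= c /\ bnd T (c ^+ 2).
Lemma nbP T c : nb T c -> forall x, n2 (T x) <= (c * Num.sqrt (n2 x)) ^+ 2.
Proof. by move=> [c0 h] x; rewrite exprMn sqr_sqrtr ?n2_ge0. Qed.
Lemma nbD T S a b : nb T a -> nb S b -> nb (T + S) (a + b).
Proof.
move=> hT hS; split => [|x]; first by rewrite addr_ge0 ?hT.1 ?hS.1.
have := n2D_w _ _ (nbP hT x) (nbP hS x); rewrite !mulr_ge0 ?sqrtr_ge0 ?hT.1 ?hS.1//.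
by rewrite -mulrDl exprMn sqr_sqrtr ?n2_ge0//; apply.
Qed.
Lemma nbZ k T a r : nb T a -> 0 <= r -> m2 k <= r ^+ 2 -> nb (k *: T) (r * a).
Proof.
move=> [a0 h] r0 hk; split => [|x]; first by rewrite mulr_ge0.
rewrite fctE n2Z exprMn -mulrA ler_pM ?m2_ge0 ?n2_ge0//.
Qed.
Lemma nbN T a : nb T a -> nb (- T) a.
Proof. by move=> [a0 h]; split => // x; rewrite fctE n2N. Qed.
Lemma nbB T S a b : nb T a -> nb S b -> nb (T - S) (a + b).
Proof. by move=> hT hS; apply: nbD => //; apply: nbN. Qed.
Lemma nb_le T a b : nb T a -> a <= b -> nb T b.
Proof.
move=> [a0 h] ab; split => [|x]; first exact: le_trans ab.
apply: le_trans (h x) _; rewrite ler_wpM2r ?n2_ge0// ler_pXn2r// nnegrE//.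
exact: le_trans ab.
Qed.
Lemma nb0 : nb (0 : G -> K) 0.
Proof. by split => // x; rewrite n20 expr0n mul0r. Qed.
Lemma blin_nb T : blin T -> exists2 c, 0 < c & nb T c.
Proof.
move=> [lT [c c0 h]]; exists (1 + c) => [|]; first lra.
split=> [|x]; first lra.
apply: le_trans (h x) _; rewrite ler_wpM2r ?n2_ge0//.
have := sqr_ge0 c; rewrite sqrrD; lra.
Qed.

Definition ncvg (T : nat -> G -> K) S := forall e : R, 0 < e -> exists N, forall n, (N <= n)%N -> nb (S - T n) e.
Lemma ncvg_hlim (T : nat -> G -> K) S x : ncvg T S -> hlim (fun n => T n x) (S x).
Proof.
move=> h e e0; have d0 : 0 < Num.min 1 (e / (1 + n2 x)).
  by rewrite lt_min ltr01 divr_gt0//; have := n2_ge0 x; lra.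
have [N hN] := h _ d0; exists N => n /hN[_ /(_ x)]; rewrite !fctE n2C.
move/le_lt_trans; apply; have x0 := n2_ge0 x.
set d := Num.min _ _ in d0 hN *.
have d1 : d <= 1 by rewrite ge_min lexx.
have d2 : d <= e / (1 + n2 x) by rewrite ge_min lexx orbT.
apply: (@le_lt_trans _ _ (e / (1 + n2 x) * n2 x)).
  rewrite ler_wpM2r// expr2; apply: le_trans d2.
  by rewrite -[leRHS]mul1r ler_wpM2r// ltW.
by rewrite mulrAC ltr_pdivrMr ?ltr_pM2l//; lra.
Qed.
Lemma op_lim (T : nat -> G -> K) C q : 0 <= C -> 0 <= q -> q < 1 ->
  (forall n, blin (T n)) -> (forall n, nb (T n.+1 - T n) (C * q ^+ n)) ->
  exists S, blin S /\ forall e : R, 0 < e -> exists N, forall n, (N <= n)%N -> nb (S - T n) e.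
Proof.
move=> C0 q0 q1 bT hT.
have p0 : 0 < 1 - q by lra.
have hk n k : nb (T (n + k)%N - T n) (C * q ^+ n / (1 - q) * (1 - q ^+ k)).
  elim: k => [|k ih]; first by rewrite addn0 subrr expr0 subrr mulr0; apply: nb0.
  have -> : T (n + k.+1)%N - T n = (T (n + k).+1 - T (n + k)%N) + (T (n + k)%N - T n).
    by rewrite addnS addrA subrK.
  apply: nb_le (nbD (hT _) ih) _; rewrite le_eqVlt; apply/orP; left; apply/eqP.
  by rewrite exprD exprS; field; rewrite gt_eqF.
pose D n := C * q ^+ n / (1 - q).
have D0 n : 0 <= D n.
  by apply: divr_ge0; [apply: mulr_ge0 => //; apply: exprn_ge0|exact: ltW].
have hD n m : (n <= m)%N -> nb (T m - T n) (D n).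
  move=> nm; rewrite -(subnKC nm); apply: nb_le (hk n _) _.
  apply: ler_piMr; first exact: D0.
  by rewrite lerBlDr lerDl; apply: exprn_ge0.
have Dlim (e : R) : 0 < e -> exists N, forall n, (N <= n)%N -> D n <= e.
  move=> e0; have [qz|qn] := eqVneq q 0.
    by exists 1%N => -[|n]// _; rewrite /D qz exprS mul0r mulr0 mul0r ltW.
  have qp : 0 < q by rewrite lt_neqAle eq_sym qn.
  have [m hm] := @pow_unbounded _ q^-1 (C / (1 - q) / e) ltac:(by rewrite invf_gt1).
  exists (2 ^ m)%N => n nm; apply: (@le_trans _ _ (D (2 ^ m)%N)).
    apply: ler_wpM2r; first by rewrite invr_ge0 ltW.
    apply: ler_wpM2l => //; apply: ler_wiXn2l => //; exact: ltW.
  move: hm; rewrite ltr_pdivrMr// exprVn ltr_pdivlMl ?exprn_gt0// /D.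
  by rewrite mulrA [_ * C]mulrC => /ltW.
have : forall x, exists y, hlim (fun n => T n x) y.
  move=> x; apply: hcomplete => e e0.
  have d0 : 0 < Num.min 1 (e / (4 * (1 + n2 x))).
    rewrite lt_min ltr01 divr_gt0// mulr_gt0//; have := n2_ge0 x; lra.
  have [N hN] := Dlim _ d0; exists N => m n Nm Nn.
  have h k : (N <= k)%N -> n2 (T k x - T N x) < e / 4.
    move=> Nk; have := (hD _ _ Nk).2 x; rewrite !fctE => /le_lt_trans; apply.
    have := hN N (leqnn N); rewrite le_min => /andP[h1 h2].
    have : D N ^+ 2 * n2 x <= e / (4 * (1 + n2 x)) * n2 x.
      rewrite ler_wpM2r ?n2_ge0// expr2; apply: le_trans h2.
      by rewrite -[leRHS]mul1r ler_wpM2r.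
    move/le_lt_trans; apply; have := n2_ge0 x => x0.
    rewrite mulrAC ltr_pdivrMr; last by lra.
    by rewrite (_ : e / 4 * (4 * (1 + n2 x)) = e * (1 + n2 x)); [rewrite ltr_pM2l//; lra|field].
  have := n2_tri (T m x) (T N x) (T n x); rewrite (n2C (T N x)).
  have := h m Nm; have := h n Nn; lra.
move=> /choice[S hS].
have hSD n x : n2 (S x - T n x) <= D n ^+ 2 * n2 x.
  apply: (@n2_lim_le _ _ (fun m => T m x - T n x)).
    by move=> e /(hS x)[N hN]; exists N => m /hN; rewrite opprB addrA subrK.
  move=> e e0; exists n => m nm; have := (hD _ _ nm).2 x; rewrite !fctE => h.
  by apply: le_trans h _; rewrite lerDl ltW.
have lS : lin S.
  move=> k x y; apply: (hlim_uniq (hS _)) => e e0.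
  have d0 : 0 < e / (4 * (1 + m2 k)) by rewrite divr_gt0// mulr_gt0// ltr_pwDl// m2_ge0.
  have e4 : 0 < e / 4 by lra.
  have [N hN] := hS x _ d0; have [M hM] := hS y _ e4; exists (maxn N M) => n.
  rewrite geq_max => /andP[/hN h1 /hM h2]; rewrite (bT n).1 opprD addrACA -scalerBr.
  exact: n2_ZD_lt.
exists S; split; last first.
  move=> e /Dlim[N hN]; exists N => n /hN h; split => [|x]; first exact: le_trans h.
  rewrite !fctE; apply: le_trans (hSD n x) _.
  by rewrite ler_wpM2r ?n2_ge0// ler_pXn2r// nnegrE//; apply: le_trans h.
split=> //; have [lT [c c0 hc]] := bT 0%N.
exists (2 * D 0%N ^+ 2 + 2 * c) => [|x].
  by apply: addr_ge0; apply: mulr_ge0 => //; apply: sqr_ge0.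
have -> : S x = (S x - T 0%N x) + T 0%N x by rewrite subrK.
apply: le_trans (n2D_le _ _) _; have := hSD 0%N x; have := hc x.
by move: (n2 (S x - _)) (n2 (T _ x)) (n2 x) (D _ ^+ 2) => *; lra.
Qed.
End Norms.

Section PowBnd.
Variables (R : realType) (G : hilbertType R).
Implicit Types (T S : op G).
Lemma iter_sa T n x y : (forall x y, inner (T x) y = inner x (T y)) ->
  inner (iter n T x) y = inner x (iter n T y).
Proof. by move=> h; elim: n x y => [//|n ih] x y; rewrite iterSr ih h. Qed.
(** The moments [a n] of [T^* T] at [x] satisfy [a k ^ 2 <= a (2 k) n2 x] by Cauchy-Schwarz;
    [powtrick] then replaces the unknown constant [C] by [n2 x]. *)
Lemma pow_bnd_vec T M x C : 0 < M -> blin T ->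
  (forall n, Re (inner (iter n (dag T \o T) x) x) <= C * M ^+ n) -> n2 (T x) <= M * n2 x.
Proof.
move=> M0 bT h; set B := dag T \o T in h.
have sB u v : inner (B u) v = inner u (B v) by rewrite /B /= dagPr// -dagP.
pose a n := Re (inner (iter n B x) x).
have a1 : a 1%N = n2 (T x) by rewrite /a /= dagPr.
rewrite -a1; apply: (@powtrick _ a _ _ C) => //; rewrite ?a1 ?n2_ge0//.
move=> k; have -> : a (2 * k)%N = n2 (iter k B x).
  by rewrite /a mul2n -addnn iterD iter_sa.
apply: le_trans (CS _ _); rewrite /m2 lerDl sqr_ge0//.
Qed.
End PowBnd.

(** * Positive operators and their square roots *)

Section Positive.
Variables (R : realType) (G : hilbertType R).
Implicit Types (T S : op G) (A : set (op G)).
Definition hpos T := forall x, 0 <= inner (T x) x.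
Lemma hposP T : hpos T -> forall x, inner (T x) x = (Re (inner (T x) x))%:C%C.
Proof. by move=> h x; apply: ge0C. Qed.
Lemma hpos_Re T x : hpos T -> 0 <= Re (inner (T x) x).
Proof. by move=> h; have := ler_ReC (h x). Qed.
Lemma hposI T : blin T -> dag T = T -> (forall x, 0 <= Re (inner (T x) x)) -> hpos T.
Proof.
move=> bT sT h x; apply: ge0ReC => //.
have : inner (T x) x = (inner (T x) x)^* by rewrite ipJ -{2}sT dagP// dagK.
by move=> /(congr1 (fun z : R[i] => Im z)); rewrite ImJ => e; lra.
Qed.
Lemma positive_opP T : positive_op T <-> blin T /\ hpos T.
Proof. by rewrite /positive_op bounded_opP. Qed.
Lemma sa_polar T : lin T -> (forall x, Im (inner (T x) x) = 0) -> forall x y, inner (T x) y = inner x (T y).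
Proof.
move=> lT h x y.
have h1 : Im (inner (T x) y) + Im (inner (T y) x) = 0.
  by have := h (x + y); rewrite (linD lT) ipDl !ipDr !reim !h; lra.
have h2 : Re (inner (T x) y) = Re (inner (T y) x).
  have [j [j0 j1]] : exists j : R[i], Re j = 0 /\ Im j = 1 by exists (Complex 0 1).
  have := h (x + j *: y).
  by rewrite (linD lT) (linZ lT) ipDl !ipDr !ipZl !ipZr !reim !h j0 j1; lra.
apply: eqC_ReIm; rewrite (inner_conj (T y)) ?ReJ ?ImJ; lra.
Qed.
Lemma hpos_sa T : blin T -> hpos T -> dag T = T.
Proof.
move=> bT hT; apply: dag_uniq => x y; apply: sa_polar bT.1 _ _ _ => z.
by rewrite (hposP hT) ImC.
Qed.
Lemma hpos_CS T x y : blin T -> hpos T -> m2 (inner (T x) y) <= Re (inner (T x) x) * Re (inner (T y) y).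
Proof.
move=> bT hT; apply: CSq => [||c]; rewrite ?hpos_Re//.
have := hpos_Re (x + c *: y) hT.
have sT : inner (T y) x = (inner (T x) y)^*.
  by rewrite ipJ -{1}(hpos_sa bT hT) dagPr.
rewrite (linD bT.1) (linZ bT.1) ipDl !ipDr !ipZl !ipZr sT (hposP hT x) (hposP hT y) /m2 !reim; lra.
Qed.
(** Cauchy-Schwarz for the form of [T] at [x] and [T x]: for a positive operator the numerical
    radius bounds the norm without loss. *)
Lemma hpos_bnd T c : blin T -> hpos T -> (forall x, Re (inner (T x) x) <= c * n2 x) -> bnd T (c ^+ 2).
Proof.
move=> bT hT h x; have [z|nz] := eqVneq (n2 (T x)) 0.
  by rewrite z mulr_ge0 ?sqr_ge0 ?n2_ge0.
have p : 0 < n2 (T x) by rewrite lt_neqAle eq_sym nz n2_ge0.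
have := hpos_CS x (T x) bT hT; rewrite ipC m2C expr2 => h1.
have h2 : n2 (T x) * n2 (T x) <= n2 (T x) * (c ^+ 2 * n2 x).
  apply: le_trans h1 _; have h3 := ler_pM (hpos_Re x hT) (hpos_Re (T x) hT) (h x) (h (T x)).
  by apply: le_trans h3 _; rewrite le_eqVlt; apply/orP; left; apply/eqP; ring.
by rewrite ler_pM2l in h2.
Qed.
Lemma bnd_form T c x : 0 <= c -> bnd T (c ^+ 2) -> Re (inner (T x) x) <= c * n2 x.
Proof.
move=> c0 h; have -> : c * n2 x = (c * Num.sqrt (n2 x)) * Num.sqrt (n2 x).
  by rewrite -mulrA -expr2 sqr_sqrtr ?n2_ge0.
apply: CS_Re; rewrite ?mulr_ge0 ?sqrtr_ge0//.
  by rewrite exprMn sqr_sqrtr ?n2_ge0.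
by rewrite sqr_sqrtr ?n2_ge0.
Qed.
Lemma hpos_sandwich T S : blin T -> blin S -> hpos T -> hpos (dag S \o T \o S).
Proof. by move=> bT bS hT x /=; rewrite dagPr. Qed.
Lemma hpos_eq0 T x : blin T -> hpos T -> inner (T x) x = 0 -> T x = 0.
Proof.
move=> bT hT h; apply: n2_eq0; have := hpos_CS x (T x) bT hT.
rewrite h Re0 mul0r ipC m2C => h1; apply/eqP; rewrite -sqrf_eq0 eq_le h1 sqr_ge0 //.
Qed.
Lemma hpos0 T : blin T -> hpos T -> hpos (- T) -> T = 0.
Proof.
move=> bT h1 h2; apply/funext => x; apply: hpos_eq0 => //.
by apply/eqP; rewrite eq_le h1 andbT; have := h2 x; rewrite fctE ipNl oppr_ge0.
Qed.
End Positive.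

(* norm-closed unital *-algebras of operators *)
Record calg (R : realType) (G : hilbertType R) (A : set (op G)) : Prop := {
  calgW : forall T, A T -> blin T;
  calg1 : A id;
  calg_ZD : forall k T S, A T -> A S -> A (k *: T + S);
  calgM : forall T S, A T -> A S -> A (T \o S);
  calgJ : forall T, A T -> A (dag T);
  calg_closed : forall T, blin T -> (forall e : R, 0 < e -> exists2 S, A S & nb (T - S) e) -> A T
}.

Section Sqrt.
Variables (R : realType) (G : hilbertType R).
Implicit Types (T S b : op G) (A : set (op G)).
Lemma calg0 A : calg A -> A 0.
Proof. by move=> cA; have := calg_ZD cA (-1) (calg1 cA) (calg1 cA); rewrite scaleN1r addNr. Qed.
Lemma calgZ A k T : calg A -> A T -> A (k *: T).
Proof. by move=> cA hT; rewrite -[_ *: _]addr0; apply: calg_ZD => //; apply: calg0. Qed.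
Lemma calgD A T S : calg A -> A T -> A S -> A (T + S).
Proof. by move=> cA hT hS; rewrite -[T]scale1r; apply: calg_ZD. Qed.
Lemma calgB A T S : calg A -> A T -> A S -> A (T - S).
Proof. by move=> cA hT hS; rewrite addrC -scaleN1r; apply: calg_ZD. Qed.

Lemma nb_comp T S (a b : R) : nb T a -> nb S b -> nb (T \o S) (a * b).
Proof.
move=> [a0 hT] [b0 hS]; split; first by rewrite mulr_ge0.
by rewrite exprMn; apply: bnd_comp => //; rewrite sqr_ge0.
Qed.
Lemma lim_comm (T : nat -> op G) S U : blin S -> blin U ->
  (forall e : R, 0 < e -> exists N, forall n, (N <= n)%N -> nb (S - T n) e) ->
  (forall n, T n \o U = U \o T n) -> S \o U = U \o S.
Proof.
move=> bS bU hS h; apply/subr0_eq/funext => x.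
have [u u0 hu] := blin_nb bU.
apply: n2_eq0; apply/eqP; rewrite eq_le n2_ge0 andbT; apply: le_eps => e e0.
have d0 : 0 < Num.min 1 (e / (4 * u ^+ 2 * (1 + n2 x))).
  by rewrite lt_min ltr01 divr_gt0// !mulr_gt0 ?exprn_gt0//; have := n2_ge0 x; lra.
have [N /(_ N (leqnn N)) hN] := hS _ d0.
set d := Num.min _ _ in d0 hN.
have -> : ((S \o U) - (U \o S)) x = (((S - T N) \o U) - (U \o (S - T N))) x.
  have := app_eq x (h N); rewrite !fctE /= => hx.
  by rewrite /= (linB bU.1) -hx opprB addrA subrK.
have := nbB (nb_comp hN hu) (nb_comp hu hN) => -[_ /(_ x)]; move/le_trans; apply.
rewrite [u * d]mulrC -mulr2n -mulr_natl !exprMn add0r.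
have d1 : d <= 1 by rewrite ge_min lexx.
have d2 : d <= e / (4 * u ^+ 2 * (1 + n2 x)) by rewrite ge_min lexx orbT.
have d3 : d ^+ 2 <= e / (4 * u ^+ 2 * (1 + n2 x)).
  by rewrite expr2; apply: le_trans d2; rewrite -[leRHS]mul1r ler_wpM2r// ltW.
have p : 0 < 4 * u ^+ 2 * (1 + n2 x) by rewrite !mulr_gt0 ?exprn_gt0//; have := n2_ge0 x; lra.
rewrite ler_pdivlMr// in d3; apply: le_trans d3.
have q : 0 <= d ^+ 2 * u ^+ 2 by rewrite mulr_ge0 ?sqr_ge0.
have := n2_ge0 x; move: (n2 x) (d ^+ 2) (u ^+ 2) q => X D U2 q X0; rewrite expr2.
have : 0 <= D * U2 * X by rewrite mulr_ge0.
lra.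
Qed.

(* s = 1 - X, where X is the fixed point of X |-> (b + X^2) / 2 *)
Lemma sqrt_small A b q : calg A -> A b -> dag b = b -> nb b q -> q < 1 ->
  exists s, [/\ A s, hpos s, s \o s = id - b &
    forall U, blin U -> b \o U = U \o b -> s \o U = U \o s].
Proof.
move=> cA Ab sb nbq q1; have [q0 _] := nbq.
pose X := fix X n : op G := if n is m.+1 then 2^-1 *: (b + (X m \o X m)) else 0.
have AX n : A (X n).
  elim: n => [|n ih] /=; first exact: calg0.
  by apply: calgZ => //; apply: calgD => //; apply: calgM.
have bX n : blin (X n) by apply: (calgW cA).
have h2 : m2 (2^-1 : R[i]) <= (2^-1 : R) ^+ 2.
  have -> : (2^-1 : R[i]) = (2^-1 : R)%:C%C by rewrite fmorphV rmorph_nat.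
  by rewrite m2C.
have nX n : nb (X n) q.
  elim: n => [|n ih] /=; first exact: nb_le (nb0 _ _) q0.
  apply: nb_le (nbZ (nbD nbq (nb_comp ih ih)) _ h2) _; first by rewrite invr_ge0.
  have : q * q <= q by rewrite -[leRHS]mulr1 ler_wpM2l// ltW.
  lra.
have dX n : nb (X n.+1 - X n) (1 * q ^+ n).
  elim: n => [|n ih].
    rewrite /= subr0; apply: nb_le (nbZ (nbD nbq (nb_comp (nb0 _ _) (nb0 _ _))) _ h2) _.
      by rewrite invr_ge0.
    by rewrite mulr0 addr0 expr0; lra.
  have -> : X n.+2 - X n.+1 = 2^-1 *: ((X n.+1 \o (X n.+1 - X n)) + ((X n.+1 - X n) \o X n)).
    apply/funext => x; have l := linB (bX n.+1).1; rewrite !fctE.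
    have -> : X n.+2 x = 2^-1 *: (b x + X n.+1 (X n.+1 x)) by [].
    rewrite [Y in _ - Y = _](_ : _ = 2^-1 *: (b x + X n (X n x)))//.
    rewrite -scalerBr; congr (_ *: _); rewrite l.
    by rewrite opprD addrACA subrr add0r addrA subrK.
  apply: nb_le (nbZ (nbD (nb_comp (nX n.+1) ih) (nb_comp ih (nX n))) _ h2) _.
    by rewrite invr_ge0.
  by rewrite exprS; lra.
have sX n : dag (X n) = X n.
  elim: n => [|n ih] /=; first exact: dag0.
  rewrite dagZ; last by apply: blinD; [exact: (calgW cA)|apply: blinM].
  rewrite dagD; [|exact: (calgW cA)|exact: blinM].
  by rewrite dagM// ih sb fmorphV /= conjC_nat.
have cX U : blin U -> b \o U = U \o b -> forall n, X n \o U = U \o X n.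
  move=> bU hU; elim=> [|n ih]; first by apply/funext => x; rewrite /= (lin0 bU.1).
  apply/funext => x; have := app_eq x hU; rewrite /= !fctE /= (linZ bU.1) (linD bU.1) => ->.
  have e y : X n (U y) = U (X n y) by have := app_eq y ih.
  by rewrite !e.
have [S [bS hS]] := op_lim ler01 q0 q1 bX dX.
have AS : A S.
  by apply: (calg_closed cA) => // e /hS[N hN]; exists (X N) => //; apply: hN.
have nS : nb S q.
  split=> // x; apply: (@n2_lim_le _ _ (fun n => X n x)); first exact: (ncvg_hlim x hS).
  by move=> e e0; exists 0%N => n _; apply: le_trans ((nX n).2 x) _; rewrite lerDl ltW.
have fS : S = 2^-1 *: (b + (S \o S)).
  apply/subr0_eq/funext => x; apply: n2_eq0; apply/eqP; rewrite eq_le n2_ge0 andbT.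
  apply: le_eps => e e0; have d0 : 0 < Num.min 1 (e / (9 * (1 + n2 x))).
    by rewrite lt_min ltr01 divr_gt0// mulr_gt0//; have := n2_ge0 x; lra.
  have [N hN] := hS _ d0; set d := Num.min _ _ in d0 hN.
  have hN0 := hN N (leqnn N); have hN1 := hN N.+1 (leqnSn N).
  have -> : (S - 2^-1 *: (b + (S \o S))) x =
    ((S - X N.+1) - 2^-1 *: ((S \o (S - X N)) + ((S - X N) \o X N))) x.
    rewrite [X N.+1]/= !fctE /= (linB bS.1) addrA subrK.
    by rewrite -[Y in _ = Y]addrA -opprD -scalerDr [b x + _ + _ in RHS]addrC addrCA subrK.
  have v0 : 0 <= (2^-1 : R) by rewrite invr_ge0.
  have h3 := nbB hN1 (nbZ (nbD (nb_comp nS hN0) (nb_comp hN0 (nX N))) v0 h2).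
  apply: le_trans (h3.2 x) _; rewrite add0r; have x0 := n2_ge0 x.
  have d1 : d <= 1 by rewrite ge_min lexx.
  have d2 : d <= e / (9 * (1 + n2 x)) by rewrite ge_min lexx orbT.
  have d3 : d ^+ 2 <= e / (9 * (1 + n2 x)).
    by rewrite expr2; apply: le_trans d2; rewrite -[leRHS]mul1r ler_wpM2r// ltW.
  have d4 : d + 2^-1 * (q * d + d * q) <= 3 * d by nra.
  apply: (@le_trans _ _ ((3 * d) ^+ 2 * n2 x)).
    rewrite ler_wpM2r// ler_pXn2r ?nnegrE//; last by rewrite mulr_ge0// ltW.
    by rewrite addr_ge0 ?mulr_ge0 ?addr_ge0 ?mulr_ge0 ?invr_ge0// ltW.
  rewrite ler_pdivlMr in d3; last by rewrite mulr_gt0//; lra.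
  apply: le_trans d3; rewrite exprMn; have := sqr_ge0 d; move: (d ^+ 2) (n2 x) x0 => D Y Y0 D0.
  by have : 0 <= D * Y; [rewrite mulr_ge0|lra].
have sS : dag S = S.
  apply/subr0_eq/funext => x; apply: n2_eq0; apply/eqP; rewrite eq_le n2_ge0 andbT.
  apply: le_eps => e e0; have d0 : 0 < Num.min 1 (e / (4 * (1 + n2 x))).
    by rewrite lt_min ltr01 divr_gt0// mulr_gt0//; have := n2_ge0 x; lra.
  have [N /(_ N (leqnn N)) hN] := hS _ d0; set d := Num.min _ _ in d0 hN.
  have -> : (dag S - S) x = (dag (S - X N) - (S - X N)) x.
    by rewrite dagB// sX !fctE opprB addrA subrK.
  have h3 : nb (dag (S - X N)) d.
    by split; [exact: hN.1|apply: dag_bnd (sqr_ge0 _) hN.2; apply: blinB].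
  apply: le_trans ((nbB h3 hN).2 x) _; rewrite add0r; have x0 := n2_ge0 x.
  have d1 : d <= 1 by rewrite ge_min lexx.
  have d2 : d <= e / (4 * (1 + n2 x)) by rewrite ge_min lexx orbT.
  have d3 : d ^+ 2 <= e / (4 * (1 + n2 x)).
    by rewrite expr2; apply: le_trans d2; rewrite -[leRHS]mul1r ler_wpM2r// ltW.
  rewrite ler_pdivlMr in d3; last by rewrite mulr_gt0//; lra.
  apply: le_trans d3; rewrite (_ : d + d = 2 * d); last by rewrite mulr_natl.
  rewrite exprMn; have := sqr_ge0 d.
  move: (d ^+ 2) (n2 x) x0 => D Y Y0 D0.
  by have : 0 <= D * Y; [rewrite mulr_ge0|rewrite expr2; lra].
exists (id - S); split.
- by apply: calgB => //; apply: calg1.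
- apply: hposI => [||x].
  + by apply: blinB => //; apply: blin_id.
  + by rewrite dagB ?dag_id ?sS//; apply: blin_id.
  + rewrite !fctE ipBl ReD ReN ipC ReC; have := bnd_form x nS.1 nS.2.
    have : q * n2 x <= n2 x by rewrite -[leRHS]mul1r ler_wpM2r ?n2_ge0// ltW.
    lra.
- apply/funext => x; have := app_eq x fS; rewrite !fctE /= (linB bS.1) => h.
  have h4 : b x + S (S x) = S x + S x.
    by rewrite {2 3}h -scalerDl -[2^-1]mul1r -mulrDl divff ?pnatr_eq0// scale1r.
  have -> : b x = S x + S x - S (S x) by rewrite -h4 addrK.
  by rewrite !opprB opprD !addrA; congr (_ + _); rewrite addrAC.
- move=> U bU hU; apply/funext => x; rewrite !fctE /= (linB bU.1).
  by have /(app_eq x) /= -> := lim_comm bS bU hS (cX U bU hU).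
Qed.
End Sqrt.

Section StarHom.
Variables (R : realType) (G K : hilbertType R).
Implicit Types (T S b : op G) (A : set (op G)) (l : op G -> op K).

(** Only [b + e] gets a square root: divided by [c + e] it is [id - d] with [d] of norm at most
    [c / (c + e) < 1], the case of [sqrt_small]. The applications either let [e] tend to 0 or
    tolerate it. *)
Lemma sqrt_eps A b (e : R) : calg A -> A b -> hpos b -> 0 < e ->
  exists s, [/\ A s, hpos s, s \o s = b + e%:C%C *: id &
    forall U, blin U -> b \o U = U \o b -> s \o U = U \o s].
Proof.
move=> cA Ab pb e0; have bb := calgW cA Ab; have [c c0 nbc] := blin_nb bb.
have p : 0 < c + e by lra.
pose k : R := (c + e)^-1; have k0 : 0 < k by rewrite invr_gt0.
pose d := k%:C%C *: (c%:C%C *: id - b).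
have Ad : A d.
  by apply: calgZ => //; apply: calgB => //; apply: calgZ => //; apply: calg1.
have bd := calgW cA Ad.
have dE x : inner (d x) x = (k * (c * n2 x - Re (inner (b x) x)))%:C%C.
  by rewrite /d !fctE ipZl ipBl ipZl ipC (hposP pb) -rmorphM -rmorphB -rmorphM.
have pd : hpos d.
  move=> x; rewrite dE ler0c mulr_ge0 ?(ltW k0)// subr_ge0.
  exact: bnd_form (ltW c0) nbc.2.
have nd : nb d (c * k).
  split; first by rewrite mulr_ge0// ltW.
  apply: hpos_bnd => // x; rewrite dE ReC [c * k]mulrC -mulrA ler_pM2l//.
  by rewrite gerBl hpos_Re.
have q1 : c * k < 1 by rewrite ltr_pdivrMr// mul1r; lra.
have [s [As ps ss cs]] := sqrt_small cA Ad (hpos_sa bd pd) nd q1.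
have bs := calgW cA As.
exists ((Num.sqrt (c + e))%:C%C *: s); split.
- exact: calgZ.
- by move=> x; rewrite fctE ipZl mulr_ge0// ler0c sqrtr_ge0.
- apply/funext => x; rewrite /= !fctE (linZ bs.1) scalerA -rmorphM -expr2 sqr_sqrtr ?(ltW p)//.
  have := app_eq x ss; rewrite /= !fctE => ->.
  rewrite [d x](_ : _ = k%:C%C *: (c%:C%C *: x - b x))// scalerBr scalerA -rmorphM.
  have -> : (c + e) * k = 1 by rewrite /k divff ?gt_eqF.
  rewrite rmorph1 scale1r rmorphD scalerDl.
  by rewrite opprB [LHS]addrC addrA subrK.
- move=> U bU hU; apply/funext => x; rewrite /= !fctE (linZ bU.1).
  have hd : d \o U = U \o d.
    apply/funext => y; have /= hy := app_eq y hU.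
    by rewrite /= /d !fctE (linZ bU.1) (linB bU.1) (linZ bU.1) hy.
  by have /(app_eq x) /= -> := cs U bU hd.
Qed.

(** [z] is a defect operator of [T]: [d - T^* T = z^2] with [d = c^2 + 1], the 1 being the [e] of
    [sqrt_eps]. A defect that is a square inside [A] still makes sense after [A] is represented
    elsewhere; [sos] turns it into a norm bound there. *)
Lemma defect A T : calg A -> A T -> exists z (d : R), [/\ A z, forall x y, inner (z x) y = inner x (z y), 0 <= d &
  forall x, d%:C%C *: x = z (z x) + dag T (T x)].
Proof.
move=> cA AT; have bT := calgW cA AT; have [c c0 nc] := blin_nb bT.
pose b := (c ^+ 2)%:C%C *: id - (dag T \o T).
have Ab : A b.
  by apply: (calgB cA); [exact: (calgZ _ cA (calg1 cA))|exact: (calgM cA (calgJ cA AT) AT)].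
have pb : hpos b.
  move=> x; rewrite /b !fctE ipBl ipZl ipC /= dagPr// ipC -rmorphM -rmorphB ler0c subr_ge0.
  exact: nc.2.
have [z [Az pz zz _]] := sqrt_eps cA Ab pb ltr01; exists z, (c ^+ 2 + 1).
have bz := calgW cA Az; split=> // [x y||x]; last 2 first.
- by rewrite addr_ge0 ?sqr_ge0.
- have /(app_eq x) /= -> := zz; rewrite /b !fctE scale1r rmorphD scalerDl /= scale1r.
  by rewrite addrAC subrK.
- by rewrite (dagP bz) (hpos_sa bz pz).
Qed.

Variables (A : set (op G)) (l : op G -> op K).
Hypotheses (cA : calg A) (sl : star_hom_on A l).
Lemma sh_blin T : A T -> blin (l T).
Proof. by case: sl => h _ _ _ /h/bounded_opP. Qed.
Lemma sh_lin k S T : A S -> A T -> l (k *: S + T) = k *: l S + l T.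
Proof. by case: sl => _ h _ _; apply: h. Qed.
Lemma sh_comp S T : A S -> A T -> l (S \o T) = l S \o l T.
Proof. by case: sl => _ _ h _; apply: h. Qed.
Lemma sh_dag T : A T -> l (dag T) = dag (l T).
Proof. by case: sl => _ _ _ h; apply: h. Qed.
Lemma sh0 : l 0 = 0.
Proof.
have A0 := calg0 cA; have := sh_lin (-1) A0 A0.
by rewrite scaler0 addr0 scaleN1r addNr.
Qed.
Lemma shZ k T : A T -> l (k *: T) = k *: l T.
Proof. by move=> h; have := sh_lin k h (calg0 cA); rewrite !addr0 sh0 addr0. Qed.
Lemma shD S T : A S -> A T -> l (S + T) = l S + l T.
Proof. by move=> hS hT; have := sh_lin 1 hS hT; rewrite !scale1r. Qed.
Lemma shB S T : A S -> A T -> l (S - T) = l S - l T.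
Proof.
move=> hS hT; have -> : S - T = (-1) *: T + S by rewrite scaleN1r addrC.
by rewrite sh_lin// scaleN1r addrC.
Qed.
Lemma sh_sq T x : A T -> inner (l (dag T \o T) x) x = inner (l T x) (l T x).
Proof.
move=> h; rewrite sh_comp ?sh_dag //=; last exact: calgJ.
by rewrite dagPr//; apply: sh_blin.
Qed.
(** [l] need not be unital: [l id] is a projection, and the estimates below work with [n2 (l id x)]
    in place of [n2 x]. *)
Lemma sh_id_n2 x : inner (l id x) x = (n2 (l id x))%:C%C.
Proof. by rewrite -ipC -sh_sq ?dag_id//; apply: calg1. Qed.
Lemma sh_id_le x : n2 (l id x) <= n2 x.
Proof.
have [->|z] := eqVneq (n2 (l id x)) 0; first exact: n2_ge0.
have p : 0 < n2 (l id x) by rewrite lt_neqAle eq_sym z n2_ge0.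
by have := CS (l id x) x; rewrite sh_id_n2 m2C expr2 ler_pM2l.
Qed.
Lemma sh_pos b : A b -> hpos b -> hpos (l b).
Proof.
move=> Ab pb; have bb := calgW cA Ab.
have sb := hpos_sa bb pb.
apply: hposI; [exact: sh_blin|by rewrite -sh_dag ?sb|move=> x].
rewrite leNgt; apply/negP => lt0.
(* Adding so small an [e] to [b] leaves the form at [x] negative, although [b + e] is the square of
   a positive element of [A]. *)
have e0 : 0 < - Re (inner (l b x) x) / (1 + n2 x).
  by rewrite divr_gt0 ?oppr_gt0// ltr_pwDl// n2_ge0.
have [s [As ps ss _]] := sqrt_eps cA Ab pb e0.
have := ipC (l s x); rewrite -sh_sq// (hpos_sa (calgW cA As) ps) ss.
rewrite shD ?shZ//; [|exact: calg1|by apply: calgZ => //; apply: calg1].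
rewrite !fctE ipDl ipZl sh_id_n2 => /(congr1 (fun z : R[i] => Re z)).
rewrite !reim mul0r subr0 => h; have := n2_ge0 (l s x); rewrite -h.
have h1 := sh_id_le x; have x0 := n2_ge0 x; apply/negP; rewrite -ltNge.
rewrite addrC -ltrBrDr sub0r mulrAC ltr_pdivrMr; last by lra.
by rewrite ltr_pM2l ?oppr_gt0//; lra.
Qed.
Lemma sh_contr T c : A T -> nb T c -> nb (l T) c.
Proof.
move=> AT [c0 h]; split=> // x; have bT := calgW cA AT.
have Ad := calgJ cA AT; have ATT := calgM cA Ad AT.
have A1 := calg1 cA.
have /(_ x) : hpos (l ((c ^+ 2)%:C%C *: id - (dag T \o T))).
  apply: sh_pos; first by apply: calgB => //; apply: calgZ.
  by move=> y; rewrite !fctE ipBl ipZl dagPr// !ipC -rmorphM -rmorphB ler0c subr_ge0.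
rewrite shB ?shZ//; last exact: calgZ.
rewrite !fctE ipBl ipZl sh_sq// sh_id_n2 ipC -rmorphM -rmorphB ler0c subr_ge0.
move/le_trans; apply; rewrite ler_wpM2l ?sqr_ge0//; exact: sh_id_le.
Qed.
End StarHom.

Lemma JC (R : realType) (r : R) : (r%:C%C)^* = r%:C%C.
Proof. exact: conjc_real. Qed.
Lemma pow_small (R : realType) (q e : R) : 0 <= q -> q < 1 -> 0 < e ->
  exists N, forall n, (N <= n)%N -> q ^+ n < e.
Proof.
move=> q0 q1 e0; have q1' : `|q| < 1 by rewrite ger0_norm.
have /cvgrPdist_lt /(_ _ e0)[N _ hN] := cvg_expr q1'.
exists N => n /hN; rewrite sub0r normrN; apply: le_lt_trans; exact: ler_norm.
Qed.

Section Limits.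
Variables (R : realType) (G K : hilbertType R).
Lemma clim_ip (u v : nat -> G) a b : hlim u a -> hlim v b -> clim (fun n => inner (u n) (v n)) (inner a b).
Proof.
move=> hu hv e e0.
have [N1 h1] := hu 1 ltr01.
have pa : 0 < e / (8 * (1 + 2 * n2 a + 2)) by rewrite divr_gt0// mulr_gt0//; have := n2_ge0 a; lra.
have pb : 0 < e / (8 * (1 + n2 b)) by rewrite divr_gt0// mulr_gt0//; have := n2_ge0 b; lra.
have [N2 h2] := hu _ pb; have [N3 h3] := hv _ pa.
exists (maxn N1 (maxn N2 N3)) => n; rewrite !geq_max => /and3P[/h1 {}h1 /h2 {}h2 /h3 {}h3].
have -> : inner (u n) (v n) - inner a b = inner (u n) (v n - b) + inner (u n - a) b.
  by rewrite ipBr ipBl addrA subrK.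
apply: le_lt_trans (m2D _ _) _.
have k1 := CS (u n) (v n - b); have k2 := CS (u n - a) b.
have a0 := n2_ge0 a; have b0 := n2_ge0 b.
have nu : n2 (u n) <= 2 * n2 a + 2.
  by have := n2D_le (u n - a) a; rewrite subrK; move: (n2 _) (n2 _) (n2 _) h1 => x y z *; lra.
have k3 : n2 (u n) * n2 (v n - b) <= e / 8.
  have := ler_pM (n2_ge0 _) (n2_ge0 _) (le_trans nu (_ : _ <= 1 + 2 * n2 a + 2)) (ltW h3).
  have -> : (1 + 2 * n2 a + 2) * (e / (8 * (1 + 2 * n2 a + 2))) = e / 8 by field; apply/eqP; lra.
  by apply; lra.
have k4 : n2 (u n - a) * n2 b <= e / 8.
  have := ler_pM (n2_ge0 _) (n2_ge0 _) (ltW h2) (_ : n2 b <= 1 + n2 b).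
  have -> : e / (8 * (1 + n2 b)) * (1 + n2 b) = e / 8 by field; apply/eqP; lra.
  by apply; lra.
move: (m2 _) (m2 _) k1 k2 => x y *; lra.
Qed.
Lemma hlim_cst (a : G) : hlim (fun=> a) a.
Proof. by move=> e e0; exists 0%N => n _; rewrite subrr n20. Qed.
Lemma hlim_blin (T : G -> K) u a : blin T -> hlim u a -> hlim (fun n => T (u n)) (T a).
Proof.
move=> [lT [c c0 hc]] hu e e0.
have d0 : 0 < e / (1 + c) by rewrite divr_gt0//; lra.
have [N hN] := hu _ d0; exists N => n /hN h; rewrite -(linB lT).
apply: le_lt_trans (hc _) _; rewrite ltr_pdivlMr in h; last by lra.
by apply: le_lt_trans h; rewrite mulrC ler_wpM2l ?n2_ge0//; lra.
Qed.
End Limits.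

(** * The absolute value of a self-adjoint element *)

Section Abs.
Variables (R : realType) (G : hilbertType R).
Implicit Types (S T p y a b : op G) (A : set (op G)).

Lemma saP T : blin T -> dag T = T -> forall x z, inner (T x) z = inner x (T z).
Proof. by move=> bT sT x z; rewrite dagP// sT. Qed.
(** [T + e] is a square [s^2] with [s] commuting with [S], so that the form becomes that of [S] at
    [s x]; then [e] tends to 0. *)
Lemma hpos_prod A S T x : calg A -> A T -> blin S -> hpos S -> hpos T -> S \o T = T \o S ->
  0 <= Re (inner (S x) (T x)).
Proof.
move=> cA AT bS pS pT ST.
have key (e : R) : 0 < e -> 0 <= Re (inner (S x) (T x)) + e * Re (inner (S x) x).
  move=> e0; have [s [As ps ss cs]] := sqrt_eps cA AT pT e0.
  have bs := calgW cA As.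
  have /(app_eq x) /= h := cs S bS (esym ST).
  have := hpos_Re (s x) pS; rewrite -h dagP// (hpos_sa bs ps).
  have /(app_eq x) /= -> := ss.
  by rewrite !fctE ipDr ipZr JC !reim mul0r subr0.
have p0 := hpos_Re x pS; rewrite -(addr0 0); apply: le_eps => e e0.
have := key (e / (1 + Re (inner (S x) x))) ltac:(by rewrite divr_gt0//; lra).
have : e / (1 + Re (inner (S x) x)) * Re (inner (S x) x) <= e.
  by rewrite mulrAC ler_pdivrMr ?ler_pM2l//; lra.
lra.
Qed.

(** The absolute value is the norm limit of the roots [s n] of [y^2 + e n] with [e n = 4^-n]. The
    product of [s n.+1 - s n] and [s n.+1 + s n] is the scalar [e n.+1 - e n], and [s n] is at least
    [2^-n], which bounds the differences by [2^-n]. *)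
Lemma abs_exists A y : calg A -> A y -> dag y = y ->
  exists p, [/\ A p, hpos p, p \o p = y \o y & p \o y = y \o p].
Proof.
move=> cA Ay sy; have by_ := calgW cA Ay.
have Ayy := calgM cA Ay Ay; have byy := calgW cA Ayy.
have pyy : hpos (y \o y) by move=> x /=; rewrite dagP// sy ipC ler0c n2_ge0.
pose e n : R := (2^-1 ^+ n) ^+ 2.
have q0 : 0 < (2^-1 : R) by rewrite invr_gt0.
have q1 : (2^-1 : R) < 1 by lra.
have e0 n : 0 < e n by rewrite exprn_gt0// exprn_gt0.
have /choice[s hs] := fun n => sqrt_eps cA Ayy pyy (e0 n).
have As n : A (s n) by case: (hs n).
have ps n : hpos (s n) by case: (hs n).
have ss n : s n \o s n = (y \o y) + (e n)%:C%C *: id by case: (hs n).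
have cs n U : blin U -> (y \o y) \o U = U \o (y \o y) -> s n \o U = U \o s n.
  by case: (hs n) => _ _ _; apply.
have bs n : blin (s n) by apply: calgW cA _ _.
have syy n : (y \o y) \o s n = s n \o (y \o y) by rewrite -cs.
have sc n m : s n \o s m = s m \o s n by apply: cs.
have sy_ n : s n \o y = y \o s n by apply: cs.
have n2s n x : n2 (s n x) = n2 (y x) + e n * n2 x.
  rewrite /n2 -{1}(hpos_sa (bs n) (ps n)) dagPr//.
  have /(app_eq x) /= -> := ss n.
  by rewrite !fctE /= ipDr ipZr JC -(saP by_ sy) !reim mul0r subr0.
have dn n : nb (s n.+1 - s n) (1 * 2^-1 ^+ n).
  rewrite mul1r; split=> [|x]; first by rewrite exprn_ge0// ltW.
  set v := (s n.+1 - s n) x.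
  have hv : s n.+1 v + s n v = (e n.+1 - e n)%:C%C *: x.
    have /(app_eq x) /= h1 := ss n; have /(app_eq x) /= h2 := ss n.+1.
    have /(app_eq x) /= h3 := sc n n.+1.
    rewrite /v !fctE (linB (bs n.+1).1) (linB (bs n).1) h3 addrA subrK h1 h2 !fctE.
    by rewrite opprD addrACA subrr add0r rmorphB scalerBl.
  (* The cross term is nonnegative, the two roots being positive and commuting, and [n2 (s n v)]
     alone is at least [e n * n2 v]. *)
  have h4 : e n * n2 v <= n2 (s n.+1 v + s n v).
    rewrite n2D [n2 (s n v)]n2s; have := n2_ge0 (y v); have := n2_ge0 (s n.+1 v).
    have := hpos_prod v cA (As n) (bs n.+1) (ps n.+1) (ps n) (sc n.+1 n).
    move: (n2 (y v)) (n2 (s n.+1 v)) (Re _) (e n * _) => *; lra.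
  move: h4; rewrite hv n2Z m2C => h4.
  have en : e n.+1 = 4^-1 * e n by rewrite /e [2^-1 ^+ n.+1]exprS exprMn; congr (_ * _); lra.
  have h5 : (e n.+1 - e n) ^+ 2 <= e n * e n.
    rewrite en; have := sqr_ge0 (e n); move: (e n) => t; rewrite !expr2; lra.
  rewrite -/(e n) -(ler_pM2l (e0 n)); apply: le_trans h4 _.
  by rewrite mulrA ler_wpM2r ?n2_ge0.
have [p [bp hp]] := op_lim ler01 (ltW q0) q1 bs dn; clear dn n2s.
have lp x := ncvg_hlim x (hp : ncvg s p).
have sp x z : inner (p x) z = inner x (p z).
  apply: (@clim_uniq _ (fun n => inner (s n x) z)).
    by apply: clim_ip; [apply: lp|apply: hlim_cst].
  apply: (@clim_ext _ (fun n => inner x (s n z))).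
    by move=> n; rewrite dagP// (hpos_sa (bs n) (ps n)).
  by apply: clim_ip; [apply: hlim_cst|apply: lp].
exists p; split.
- apply: (calg_closed cA) => // d /hp[N hN]; exists (s N) => //; exact: hN.
- apply: hposI => //; first exact: dag_uniq.
  move=> x; apply: (@clim_ge0 _ (fun n => inner (s n x) x)).
    by move=> n; apply: hpos_Re.
  by apply: clim_ip; [apply: lp|apply: hlim_cst].
- apply/funext => x; apply: ip_ext => z /=; rewrite sp.
  apply: (@clim_uniq _ (fun n => inner (s n x) (s n z))); first by apply: clim_ip; apply: lp.
  apply: (@clim_ext _ (fun n => inner (y (y x)) z + (e n)%:C%C * inner x z)).
    move=> n; rewrite (saP (bs n) (hpos_sa (bs n) (ps n))).
    have /(app_eq z) /= -> := ss n.
    by rewrite !fctE ipDr ipZr JC /= -!(saP by_ sy).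
  rewrite -[X in clim _ X]addr0; apply: climD; first exact: clim_cst.
  move=> d d0; have d1 : 0 < d / (1 + m2 (inner x z)) by rewrite divr_gt0// ltr_pwDl// m2_ge0.
  have q41 : (2^-1 ^+ 4 : R) < 1 by rewrite exprn_ilt1// ?invf_lt1 ?ltr1n// invr_ge0.
  have [N hN] := pow_small (exprn_ge0 4 (ltW q0)) q41 d1.
  exists N => n /hN; rewrite subr0 m2M m2C.
  have -> : e n ^+ 2 = 2^-1 ^+ 4 ^+ n by rewrite /e -!exprM -mulnA mulnC.
  rewrite ltr_pdivlMr ?ltr_pwDl ?m2_ge0//; apply: le_lt_trans.
  by rewrite ler_wpM2l ?exprn_ge0 ?(ltW q0)//; lra.
- apply: (lim_comm bp by_ hp) => n; exact: sy_.
Qed.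
End Abs.
Section Calg.
Variables (R : realType) (K : hilbertType R).
Implicit Types (S T a b x y : op K) (A : set (op K)).
Lemma eps_seq (G : hilbertType R) (f : G -> Prop) (y : G) : (forall e : R, 0 < e -> exists2 z, f z & n2 (y - z) < e) ->
  exists s : nat -> G, (forall n, f (s n)) /\ hlim s y.
Proof.
move=> h; have /choice[s hs] : forall n : nat, exists z, f z /\ n2 (y - z) < n.+1%:R^-1.
  by move=> n; have [|z fz hz] := h n.+1%:R^-1; [rewrite invr_gt0|exists z].
exists s; split=> [n|e e0]; first by case: (hs n).
have [N hN] := inv_small e0; exists N => n /hN; rewrite n2C; exact/lt_trans/(hs n).2.
Qed.
Lemma ncvg_seq A T : (forall e : R, 0 < e -> exists2 S, A S & nb (T - S) e) ->
  exists s : nat -> op K, (forall n, A (s n)) /\ ncvg s T.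
Proof.
move=> h; have /choice[s hs] : forall n : nat, exists z, A z /\ nb (T - z) n.+1%:R^-1.
  by move=> n; have [|z fz hz] := h n.+1%:R^-1; [rewrite invr_gt0|exists z].
exists s; split=> [n|e e0]; first by case: (hs n).
have [N hN] := inv_small e0; exists N => n /hN h1; exact: nb_le (hs n).2 (ltW h1).
Qed.
Lemma calg_blins : calg [set T : op K | blin T].
Proof.
split=> //; [exact: blin_id|move=> *; exact: blinZD|move=> *; exact: blinM|].
by move=> *; exact: blinJ.
Qed.
Lemma calg_commutant A : (forall S, A S -> blin S) -> (forall S, A S -> A (dag S)) ->
  calg (commutant A).
Proof.
move=> bA dA; split.
- by move=> T [/bounded_opP].
- by split=> //; apply/bounded_opP/blin_id.
- move=> k T S [/bounded_opP bT hT] [/bounded_opP bS hS]; split.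
    by apply/bounded_opP/blinZD.
  move=> U AU; apply/funext => x; rewrite /= !fctE (bA _ AU).1.
  by have /(app_eq x) /= -> := hT U AU; have /(app_eq x) /= -> := hS U AU.
- move=> T S [/bounded_opP bT hT] [/bounded_opP bS hS]; split.
    by apply/bounded_opP/blinM.
  by move=> U AU; rewrite compA -hT// -compA hS.
- move=> T [/bounded_opP bT hT]; split; first by apply/bounded_opP/blinJ.
  move=> U AU; have bU := bA _ AU.
  apply/funext => x; apply: ip_ext => z /=.
  rewrite (dagPr bT) (dagP bU); have /(app_eq z) /= <- := hT _ (dA _ AU).
  by rewrite -(dagPr bT) -(dagP bU).
- move=> T bT /ncvg_seq[s [hs cs]]; split; first exact/bounded_opP.
  move=> U AU; apply: (lim_comm bT (bA _ AU) cs) => n.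
  by case: (hs n) => _; apply.
Qed.
Lemma calg_vn A : von_neumann A -> calg A.
Proof.
move=> [bA dA <-]; have bA' S : A S -> blin S by move=> /bA/bounded_opP.
have cA' := calg_commutant bA' dA.
by apply: calg_commutant; [exact: calgW|exact: calgJ].
Qed.
Lemma calg_sum A (I : Type) (s : seq I) (f : I -> op K) : calg A -> (forall i, A (f i)) ->
  A (\sum_(i <- s) f i).
Proof.
move=> cA h; elim: s => [|i s ih]; rewrite ?big_nil ?big_cons; first exact: calg0.
exact: calgD.
Qed.
End Calg.

Record CE (R : realType) (K : hilbertType R) (N A : set (op K)) (E : op K -> op K) : Prop := {
  ceN : calg N;
  ceA : calg A;
  ce_sub : A `<=` N;
  ce_in : forall x, N x -> A (E x);
  ce_fix : forall a, A a -> E a = a;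
  ce_lin : linear_on N E;
  ce_pos : forall x, N x -> hpos x -> hpos (E x);
  ce_bim : forall a x b, A a -> N x -> A b -> E (a \o x \o b) = a \o E x \o b;
  ce_faith : forall x, N x -> hpos x -> E x = 0 -> x = 0
}.

(** * Faithful conditional expectations between norm-closed algebras *)

Section CondExp.
Variables (R : realType) (K : hilbertType R) (N A : set (op K)) (E : op K -> op K).
Hypothesis ce : CE N A E.
Implicit Types (S T a b x y : op K).
Let cN := ceN ce.
Let cA := ceA ce.
Lemma ce_blin x : N x -> blin (E x).
Proof. by move=> Nx; apply: (calgW cA); apply: (ce_in ce). Qed.
Lemma ce0 : E 0 = 0. Proof. by rewrite (ce_fix ce)//; apply: calg0. Qed.
Lemma ce1 : E id = id. Proof. by rewrite (ce_fix ce)//; apply: calg1. Qed.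
Lemma ceZ k x : N x -> E (k *: x) = k *: E x.
Proof. by move=> Nx; have := ce_lin ce k Nx (calg0 cN); rewrite !addr0 ce0 addr0. Qed.
Lemma ceD x y : N x -> N y -> E (x + y) = E x + E y.
Proof. by move=> Nx Ny; have := ce_lin ce 1 Nx Ny; rewrite !scale1r. Qed.
Lemma ceB x y : N x -> N y -> E (x - y) = E x - E y.
Proof.
by move=> Nx Ny; have := ce_lin ce (-1) Ny Nx; rewrite !scaleN1r addrC => ->; rewrite addrC.
Qed.
Lemma ce_sum (I : Type) (s : seq I) (f : I -> op K) : (forall i, N (f i)) ->
  E (\sum_(i <- s) f i) = \sum_(i <- s) E (f i).
Proof.
move=> h; elim: s => [|i s ih]; rewrite ?big_nil ?big_cons ?ce0// ceD ?ih//.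
exact: calg_sum.
Qed.
Lemma ce_dagsa x : N x -> dag x = x -> dag (E x) = E x.
Proof.
move=> Nx sx; have bx := calgW cN Nx; have [c c0 hc] := blin_nb bx.
apply: dag_uniq => v w; apply: sa_polar; first exact: (ce_blin Nx).1.
move=> z; have Nc : N (c%:C%C *: id) by apply: calgZ => //; apply: calg1.
(* [x + c] is positive as [c] bounds [x]; so is its image [E x + c], and the form of [E x] is
   real. *)
have /(ce_pos ce) /(_ z) : hpos (x + c%:C%C *: id).
  move=> y; apply: ge0ReC.
    rewrite !fctE ipDl ipZl ipC !reim mul0r mulr0 !addr0.
    have := congr1 (fun z : R[i] => Im z) (ipJ (x y) y); rewrite ImJ -(saP bx sx) => h.
    lra.
  rewrite !fctE ipDl ipZl ipC !reim mul0r subr0.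
  have := bnd_form y hc.1 (T := - x); rewrite !fctE ipNl ReN => h.
  have : - Re (inner (x y) y) <= c * n2 y by apply: h => u; rewrite n2N; apply: hc.2.
  lra.
rewrite ceD// ceZ ?ce1; [|exact: calg1] => /(_ (calgD cN Nx Nc)).
rewrite !fctE ipDl ipZl ipC => /ger0_Im; rewrite !reim mulr0 mul0r !addr0 => //.
Qed.
Lemma ce_dag x : N x -> E (dag x) = dag (E x).
Proof.
move=> Nx; have Nd := calgJ cN Nx; have bx := calgW cN Nx; have bd := calgW cN Nd.
pose h := x + dag x; pose j : R[i] := Complex 0 1; pose k := j *: (dag x - x).
have jJ : j^* = - j by apply: eqC_ReIm; rewrite !reim /= ?oppr0.
have jj : j * j = -1 by exact: sqr_i.
have Nh : N h by apply: calgD.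
have Nk : N k by apply: calgZ => //; apply: calgB.
have sh : dag (E h) = E h by apply: ce_dagsa => //; rewrite /h dagD// dagK// addrC.
have sk : dag (E k) = E k.
  apply: ce_dagsa => //; rewrite /k dagZ; last exact: blinB.
  by rewrite dagB// dagK// jJ scaleNr -scalerN opprB.
have bEh := ce_blin Nh; have bEk := ce_blin Nk.
have hx : 2 *: E x = E h + j *: E k.
  rewrite -!ceZ// -ceD//; last exact: calgZ.
  by congr E; rewrite /k scalerA jj scaleN1r opprB /h addrACA subrr addr0 scaler_nat mulr2n.
have hd : 2 *: E (dag x) = E h - j *: E k.
  rewrite -!ceZ// -ceB//; last exact: calgZ.
  congr E; rewrite /k scalerA jj scaleN1r opprK /h addrC addrA subrK scaler_nat mulr2n //.
have n0 : (2 : R[i]) != 0 by rewrite pnatr_eq0.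
apply: (scalerI n0); rewrite hd -[in RHS](conjC_nat _ 2) -dagZ ?hx; last exact: ce_blin.
by rewrite dagD ?dagZ// ?sh ?sk ?jJ ?scaleNr//; apply: blinZ.
Qed.
(** Faithfulness detects positivity. Let [p] be the absolute value of [y] and [a = p - y], twice the
    negative part. Then [y a = - p a], so with [b = a] both [E (a p a)] and its negative are
    positive. Hence [a p a = 0], then [p a = 0] and [a^2 = 0]. *)
Lemma ce_order y : N y -> dag y = y -> (forall b, N b -> hpos (E (dag b \o y \o b))) -> hpos y.
Proof.
move=> Ny sy h; have [p [Np pp py pc]] := abs_exists cN Ny sy.
have by_ := calgW cN Ny; have bp := calgW cN Np; have sp := hpos_sa bp pp.
pose a := p - y; have Na : N a by apply: calgB.
have ba := calgW cN Na; have sa : dag a = a by rewrite dagB// sp sy.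
have pyx (x : K) : p (p x) = y (y x) by have /(app_eq x) := py.
have pcx (x : K) : p (y x) = y (p x) by have /(app_eq x) := pc.
have aE (x : K) : a x = p x - y x by [].
have ya (x : K) : y (a x) = - p (a x).
  by rewrite aE (linB by_.1) (linB bp.1) -pcx pyx opprB.
have Npa : N (dag a \o p \o a) by do !apply: calgM => //; apply: calgJ.
have E0 : E (dag a \o p \o a) = 0.
  apply: hpos0; [exact: ce_blin|by apply: (ce_pos ce) => //; apply: hpos_sandwich|].
  have -> : - E (dag a \o p \o a) = E (dag a \o y \o a); last exact: h.
  rewrite -scaleN1r -ceZ//; congr E; apply/funext => x.
  by rewrite /= !fctE /= scaleN1r ya (linN (blinJ ba).1).
have pa (x : K) : p (a x) = 0.
  apply: hpos_eq0 => //.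
  have /(congr1 (fun T : op K => inner (T x) x)) := ce_faith ce Npa (hpos_sandwich bp ba pp) E0.
  by rewrite /= dagPr// => ->; rewrite ip0l.
have a0 (x : K) : a x = 0.
  by apply: n2_eq0; rewrite /n2 (saP ba sa) [a (a x)]aE ya pa oppr0 subrr ip0r.
move=> x; have -> : y x = p x by apply/esym/subr0_eq; rewrite -aE.
exact: pp.
Qed.
End CondExp.

(** * Induced representations *)

Section Cut.
Variables (R : realType) (K : hilbertType R) (N : set (op K)).
(** Kernels are indexed by a type, here all of [op K]; an operator outside [N] is counted as 0. *)
Definition cut (x : op K) : op K := if `[< N x >] then x else 0.
Lemma cutE x : N x -> cut x = x.
Proof. by rewrite /cut; case: asboolP. Qed.
Lemma cut_in x : calg N -> N (cut x).
Proof. by move=> cN; rewrite /cut; case: asboolP => // _; apply: calg0. Qed.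
End Cut.

(* Ind is the interior tensor product N (x)_A G, the completion of N (.) G for
   < x (x) h, x' (x) h' > = < Pi (E (x'^* x)) h, h' > *)
Section Ind.
Variables (R : realType) (K : hilbertType R) (N A : set (op K)) (E : op K -> op K).
Hypothesis ce : CE N A E.
Variables (G : hilbertType R) (Pi : op K -> op G).
Hypotheses (sP : star_hom_on A Pi) (P1 : Pi id = id).
Implicit Types (S T a b x y : op K) (v w : G).
Let cN := ceN ce.
Let cA := ceA ce.

Definition om x v w := inner (Pi (E x) v) w.
Lemma om_blin x : N x -> blin (Pi (E x)).
Proof. by move=> Nx; apply: (sh_blin sP); apply: (ce_in ce). Qed.
Lemma omZD k x y v w : N x -> N y -> om (k *: x + y) v w = k * om x v w + om y v w.
Proof.
move=> Nx Ny; rewrite /om (ce_lin ce)// (sh_lin sP); try exact: (ce_in ce).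
by rewrite !fctE ipDl ipZl.
Qed.
Lemma om0 v w : om 0 v w = 0.
Proof. by rewrite /om (ce0 ce) (sh0 cA sP) ip0l. Qed.
Lemma omD x y v w : N x -> N y -> om (x + y) v w = om x v w + om y v w.
Proof. by move=> Nx Ny; have := omZD 1 v w Nx Ny; rewrite scale1r mul1r. Qed.
Lemma omZ k x v w : N x -> om (k *: x) v w = k * om x v w.
Proof. by move=> Nx; have := omZD k v w Nx (calg0 cN); rewrite addr0 om0 addr0. Qed.
Lemma om_dag x v w : N x -> om (dag x) v w = (om x w v)^*.
Proof.
move=> Nx; rewrite /om (ce_dag ce)// (sh_dag sP); last exact: (ce_in ce).
by rewrite dagPr ?ipJ//; apply: om_blin.
Qed.
Lemma om_bim a x b v w : A a -> N x -> A b ->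
  om (dag a \o x \o b) v w = om x (Pi b v) (Pi a w).
Proof.
move=> Aa Nx Ab; have Ad := calgJ cA Aa; have Ae := ce_in ce Nx.
rewrite /om (ce_bim ce)// (sh_comp sP (calgM cA Ad Ae) Ab) (sh_comp sP Ad Ae) (sh_dag sP Aa).
by rewrite /= dagPr//; apply: (sh_blin sP).
Qed.
Lemma om_sum (I : Type) (s : seq I) (f : I -> op K) v w : (forall i, N (f i)) ->
  om (\sum_(i <- s) f i) v w = \sum_(i <- s) om (f i) v w.
Proof.
move=> h; elim: s => [|i s ih]; rewrite ?big_nil ?big_cons ?om0// omD ?ih//.
exact: calg_sum.
Qed.
Lemma om_pos x v : N x -> 0 <= Re (om (dag x \o x) v v).
Proof.
move=> Nx; apply: hpos_Re; have Nd := calgJ cN Nx; have Nx2 := calgM cN Nd Nx.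
have bx := calgW cN Nx.
apply: (sh_pos cA sP); first exact: (ce_in ce).
by apply: (ce_pos ce) => // y /=; rewrite dagPr// ipC ler0c n2_ge0.
Qed.

Definition gram (t : seq (op K * G)) : R[i] :=
  \sum_(p <- t) \sum_(q <- t) om (dag q.1 \o p.1) p.2 q.2.
Definition inN (t : seq (op K * G)) := forall p, p \in t -> N p.1.

Lemma clim_sum (I : eqType) (s : seq I) (f : nat -> I -> R[i]) (g : I -> R[i]) :
  (forall i, i \in s -> clim (f^~ i) (g i)) ->
  clim (fun n => \sum_(i <- s) f n i) (\sum_(i <- s) g i).
Proof.
elim: s => [|i s ih] h.
  by rewrite big_nil; apply: (clim_ext (w := fun=> 0)) => [n|]; [rewrite big_nil|exact: clim_cst].
rewrite big_cons; apply: (clim_ext (w := fun n => f n i + \sum_(i <- s) f n i)) => [n|].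
  by rewrite big_cons.
apply: climD; first by apply: h; rewrite mem_head.
by apply: ih => j js; apply: h; rewrite in_cons js orbT.
Qed.

(** For vectors in the orbit of a single [v], bimodularity of [E] collects the double sum into
    [om (X^* X) v v] with [X] the sum of the [x_i a_i]. *)
Lemma gram_cyc v (t : seq (op K * G)) (al : G -> op K) : inN t -> (forall z, A (al z)) ->
  0 <= Re (gram [seq (p.1, Pi (al p.2) v) | p <- t]).
Proof.
move=> Nt Aal.
pose f (p : op K * G) := cut N p.1 \o al p.2.
have Nf p : N (f p) by apply: (calgM cN); [apply: cut_in|apply: (ce_sub ce)].
have -> : gram [seq (p.1, Pi (al p.2) v) | p <- t] =
  om (dag (\sum_(p <- t) f p) \o (\sum_(p <- t) f p)) v v; last first.
  by apply: om_pos; apply: calg_sum.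
have NS : N (\sum_(p <- t) f p) by apply: calg_sum.
have -> : dag (\sum_(p <- t) f p) \o \sum_(p <- t) f p = \sum_(p <- t) (dag (\sum_(p <- t) f p) \o f p).
  apply/funext => z /=; rewrite !sumE (lin_sum (blinJ (calgW cN NS)).1).
  by apply: eq_bigr.
rewrite om_sum => [|p]; last by apply: (calgM cN) => //; apply: (calgJ cN).
rewrite /gram big_map; apply: eq_big_seq => p pt; rewrite big_map.
have -> : dag (\sum_(p <- t) f p) \o f p = \sum_(q <- t) (dag (f q) \o f p).
  rewrite dag_sum => [|i]; last exact: (calgW cN).
  by apply/funext => z; rewrite /= !sumE.
rewrite om_sum => [|q]; last by apply: (calgM cN) => //; apply: (calgJ cN).
apply: eq_big_seq => q qt /=; rewrite -om_bim//; last first.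
  by apply: (calgM cN); [apply: (calgJ cN)|]; apply: Nt.
rewrite /f !cutE; try exact: Nt.
by rewrite dagM//; [apply: (calgW cN); exact: Nt|apply: (calgW cA)].
Qed.

(** This replaces complete positivity of [E]. The closed span of [Pi a v], with [v] the first
    vector, reduces [Pi (A)], so the sum splits along the projection onto it. The part inside is a
    limit of sums as in [gram_cyc]; in the orthogonal part the first vector has become 0 and
    induction on the length applies. *)
Lemma gram_pos (t : seq (op K * G)) : inN t -> 0 <= Re (gram t).
Proof.
elim: {t}(size t) {-2}t (leqnn (size t)) => [|n ih] [|[x v] t]//= sz Nt; try by rewrite /gram big_nil.
pose S w := forall e : R, 0 < e -> exists2 z, (exists2 a, A a & z = Pi a v) & n2 (w - z) < e.
have Sa a : A a -> S (Pi a v).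
  by move=> Aa e e0; exists (Pi a v); [exists a|rewrite subrr n20].
have sS : subsp S.
  apply: closure_subsp; split; first by exists 0; [exact: calg0|rewrite (sh0 cA sP)].
  move=> k _ _ [a Aa ->] [b Ab ->]; exists (k *: a + b); first exact: calg_ZD.
  by rewrite (sh_lin sP).
have cS : hclosed S by exact: closure_hclosed.
have SP a w : A a -> S w -> S (Pi a w).
  move=> Aa Sw e e0; have [c c0 nc] := blin_nb (sh_blin sP Aa).
  have d0 : 0 < e / c ^+ 2 by rewrite divr_gt0// exprn_gt0.
  have [_ [b Ab ->] hb] := Sw _ d0; exists (Pi (a \o b) v); first by exists (a \o b) => //; apply: calgM.
  rewrite (sh_comp sP)//= -(linB (sh_blin sP Aa).1); apply: le_lt_trans (nc.2 _) _.
  by rewrite mulrC -ltr_pdivlMr// exprn_gt0.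
have /choice[pr hpr] : forall w, exists z, S z /\ forall z', S z' -> inner (w - z) z' = 0.
  by move=> w; have [z Sz hz] := proj_exists w sS cS; exists z.
have prv : pr v = v.
  have Sv : S v by have := Sa id (calg1 cA); rewrite P1.
  apply/esym/subr0_eq/n2_eq0; rewrite /n2 (hpr v).2//.
  exact: (subspB sS Sv (hpr v).1).
have split_ a w w' : N a -> om a w w' = om a (pr w) (pr w') + om a (w - pr w) (w' - pr w').
  move=> Na; have Ea := ce_in ce Na; have b := om_blin Na.
  have -> : om a w w' = om a (w - pr w + pr w) (w' - pr w' + pr w') by rewrite !subrK.
  rewrite /om (linD b.1 (w - pr w)) ipDl !(ipDr (w' - pr w') (pr w')).
  have -> : inner (Pi (E a) (w - pr w)) (pr w') = 0.
    rewrite dagP// -(sh_dag sP)// (hpr w).2//; apply: SP; first exact: calgJ.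
    exact: (hpr w').1.
  have -> : inner (Pi (E a) (pr w)) (w' - pr w') = 0.
    have h : S (Pi (E a) (pr w)) by apply: SP => //; apply: (hpr w).1.
    by rewrite -ipJ (hpr w').2// rmorph0.
  by rewrite addr0 add0r addrC.
have Nm f : inN [seq (p.1, f p.2) | p <- (x, v) :: t].
  by move=> q /mapP[p pt ->]; apply: (Nt p pt).
have -> : gram ((x, v) :: t) = gram [seq (p.1, pr p.2) | p <- (x, v) :: t] +
    gram [seq (p.1, p.2 - pr p.2) | p <- (x, v) :: t].
  rewrite /gram [in RHS]big_map [X in _ + X]big_map -big_split; apply: eq_big_seq => p pt.
  rewrite !big_map -big_split; apply: eq_big_seq => q qt.
  by apply: split_; apply: (calgM cN); [apply: (calgJ cN)|]; apply: Nt.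
rewrite ReD addr_ge0//.
  have /choice[al hal] : forall w, exists al : nat -> op K, (forall n, A (al n)) /\
      (S w -> hlim (fun n => Pi (al n) v) w).
    move=> w; have [Sw|nS] := pselect (S w); last by exists (fun=> id); split=> // ?; apply: calg1.
    have [s [hs lim]] := eps_seq Sw.
    have /choice[al hal] : forall m, exists a, A a /\ s m = Pi a v by move=> m; have [a] := hs m; exists a.
    exists al; split=> [m|_]; first by case: (hal m).
    by rewrite (_ : (fun m => _) = s)//; apply/funext => m; case: (hal m).
  apply: (@clim_ge0 _ (fun m => gram [seq (p.1, Pi (al (pr p.2) m) v) | p <- (x, v) :: t])).
    move=> m; apply: (@gram_cyc v _ (fun w => al (pr w) m)) => // z; by case: (hal (pr z)).
  rewrite /gram [X in clim _ X]big_map.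
  under [fun m => _]eq_fun do rewrite big_map.
  apply: clim_sum => p pt; rewrite [X in clim _ X]big_map.
  under [fun m => _]eq_fun do rewrite big_map.
  apply: clim_sum => q qt; apply: clim_ip; last by apply: (hal _).2; apply: (hpr _).1.
  rewrite /=; apply: (hlim_blin _ ((hal _).2 (hpr _).1)).
  by apply: om_blin; apply: (calgM cN); [apply: (calgJ cN)|]; apply: Nt.
have -> : gram [seq (p.1, p.2 - pr p.2) | p <- (x, v) :: t] = gram [seq (p.1, p.2 - pr p.2) | p <- t].
  have z1 q : N q.1 -> om (dag q.1 \o x) 0 q.2 = 0.
    move=> Nq; rewrite /om lin0 ?ip0l//; apply: (om_blin _).1.
    by apply: (calgM cN); [apply: (calgJ cN)|apply: (Nt (x, v)); rewrite mem_head].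
  have Nt' p : p \in t -> N p.1 by move=> pt; apply: Nt; rewrite in_cons pt orbT.
  rewrite /gram /= prv subrr !big_cons /= [om _ 0 0]/om ip0r add0r.
  rewrite big1_seq ?add0r; last first.
    by move=> q /= /mapP[p pt ->]; apply: z1; apply: (Nt' p).
  apply: eq_bigr => p _; rewrite big_cons [om _ _ 0]/om ip0r add0r //.
apply: ih; first by rewrite size_map.
by move=> q /mapP[p pt ->]; apply: (Nt p); rewrite in_cons pt orbT.
Qed.

Definition ikf (p q : op K * G) := om (dag (cut N q.1) \o cut N p.1) p.2 q.2.
Lemma Ncut x : N (cut N x). Proof. exact: cut_in. Qed.
Lemma Nds x y : N x -> N y -> N (dag x \o y).
Proof. by move=> Nx Ny; apply: (calgM cN) => //; apply: (calgJ cN). Qed.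
Lemma ikherm p q : ikf q p = (ikf p q)^*.
Proof.
have h := Nds (Ncut q.1) (Ncut p.1); rewrite /ikf -om_dag//.
by rewrite dagM ?dagK//; try exact: (calgW cN (Ncut _)); apply/blinJ/(calgW cN (Ncut _)).
Qed.
Lemma ikpos (s : seq (R[i] * (op K * G))) :
  0 <= Re (\sum_(p <- s) \sum_(q <- s) p.1 * q.1^* * ikf p.2 q.2).
Proof.
have /gram_pos : inN [seq (cut N p.2.1, p.1 *: p.2.2) | p <- s].
  by move=> _ /mapP[p _ ->]; apply: Ncut.
rewrite /gram big_map; congr (0 <= Re _); apply: eq_bigr => p _; rewrite big_map.
apply: eq_bigr => q _; rewrite /ikf /om /=.
by rewrite (linZ (om_blin (Nds (Ncut _) (Ncut _))).1) ipZl ipZr mulrA.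
Qed.
Definition iker := Kernel ikherm ikpos.
Definition Ind : hilbertType R := KH iker.
Definition tau x v : Ind := kphi iker (x, v).
Definition tau2 (p : op K * G) := tau p.1 p.2.
Lemma tauE x y v w : N x -> N y -> inner (tau x v) (tau y w) = om (dag y \o x) v w.
Proof. by move=> Nx Ny; rewrite kphiE /= /ikf /= !cutE. Qed.
Lemma tau_total : total tau2.
Proof.
move=> y e /(kphi_dense y)[_ [s _ <-] h]; exists (fcomb tau2 s); first by exists s.
by apply: le_lt_trans h; rewrite /fcomb; under eq_bigr do rewrite /tau2 /tau -surjective_pairing.
Qed.
Lemma cut_cut x : cut N (cut N x) = cut N x. Proof. exact/cutE/Ncut. Qed.
Lemma tau_cut x v : tau x v = tau (cut N x) v.
Proof. by apply: (total_vec tau_total) => -[y w]; rewrite !kphiE /= /ikf /= cut_cut. Qed.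
Lemma ind_vec (u w : Ind) : (forall x v, N x -> inner u (tau x v) = inner w (tau x v)) -> u = w.
Proof. by move=> h; apply: (total_vec tau_total) => -[x v]; rewrite /tau2 tau_cut; apply/h/Ncut. Qed.
Lemma ind_op (L : hilbertType R) (T S : Ind -> L) : blin T -> blin S ->
  (forall x v, N x -> T (tau x v) = S (tau x v)) -> T = S.
Proof.
move=> bT bS h; apply: (total_op tau_total) => // -[x v]; rewrite /tau2 tau_cut; apply/h/Ncut.
Qed.
Lemma tauDl k x y v : N x -> N y -> tau (k *: x + y) v = k *: tau x v + tau y v.
Proof.
move=> Nx Ny; have Nk := calg_ZD cN k Nx Ny; apply: ind_vec => z w Nz.
rewrite ipDl ipZl !tauE// -omZD; try exact: Nds.
by congr om; apply/funext => t; rewrite /= !fctE (blinJ (calgW cN Nz)).1.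
Qed.
Lemma tau_lin x : N x -> lin (tau x).
Proof.
move=> Nx k v w; apply: ind_vec => z u Nz.
by rewrite ipDl ipZl !tauE// /om (om_blin (Nds Nz Nx)).1 ipDl ipZl.
Qed.
Lemma tau_bal x a v : N x -> A a -> tau (x \o a) v = tau x (Pi a v).
Proof.
move=> Nx Aa; have Na := ce_sub ce Aa; have Nxa := calgM cN Nx Na.
apply: ind_vec => z w Nz; rewrite !tauE//.
have h := Nds Nz Nx; rewrite compA -[_ \o _ \o a](_ : dag id \o (dag z \o x) \o a = _); last by rewrite dag_id.
by rewrite om_bim ?P1//; apply: (calg1 cA).
Qed.
Lemma tau_blin x : N x -> blin (tau x).
Proof.
move=> Nx; split; first exact: tau_lin.
have [c c0 nc] := blin_nb (om_blin (Nds Nx Nx)); exists c => [|v]; first exact: ltW.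
by rewrite /n2 tauE//; apply: bnd_form nc.2; apply: ltW.
Qed.

(** Sum of squares: [c] times the Gram matrix of [f] minus that of [g] is the Gram matrix of [h].
    With [h] made from the operator of [defect], this is the inequality that [total_ext] asks
    for. *)
Lemma sos (X : Type) (G1 G2 G3 : hilbertType R) (f : X -> G1) (g : X -> G2) (h : X -> G3) (c : R) s :
  (forall p q, inner (h p) (h q) = c%:C%C * inner (f p) (f q) - inner (g p) (g q)) ->
  n2 (fcomb g s) <= c * n2 (fcomb f s).
Proof.
move=> hh; have ipE (V : hilbertType R) (k : X -> V) :
    inner (fcomb k s) (fcomb k s) = \sum_(p <- s) \sum_(q <- s) p.1 * q.1^* * inner (k p.2) (k q.2).
  rewrite ip_suml; apply: eq_bigr => p _; rewrite ip_sumr; apply: eq_bigr => q _.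
  by rewrite ipZl ipZr mulrA.
have := n2_ge0 (fcomb h s); rewrite /n2 !ipE -subr_ge0.
suff -> : \sum_(p <- s) \sum_(q <- s) p.1 * q.1^* * inner (h p.2) (h q.2) =
  c%:C%C * (\sum_(p <- s) \sum_(q <- s) p.1 * q.1^* * inner (f p.2) (f q.2)) -
  \sum_(p <- s) \sum_(q <- s) p.1 * q.1^* * inner (g p.2) (g q.2).
  by rewrite reim ReN ReM ReC ImC !mul0r !subr0 subr_ge0.
under eq_bigr do under eq_bigr do rewrite hh mulrBr mulrCA.
under eq_bigr do rewrite sumrB -mulr_sumr.
by rewrite sumrB -mulr_sumr.
Qed.
Lemma omB x y v w : N x -> N y -> om (x - y) v w = om x v w - om y v w.
Proof. by move=> Nx Ny; have := omZD (-1) v w Ny Nx; rewrite scaleN1r mulN1r addrC => ->; rewrite addrC. Qed.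

Lemma sig_exists y : N y -> exists T : op Ind, blin T /\ forall x v, N x -> T (tau x v) = tau (y \o x) v.
Proof.
move=> Ny; have by_ := calgW cN Ny; have [z [d [Nz sz d0 hd]]] := defect cN Ny.
have bz := calgW cN Nz.
have [|T [bT _ hT]] := total_ext (psi := fun p => tau (y \o cut N p.1) p.2) tau_total d0.
  move=> s; apply: (@sos _ _ _ _ _ _ (fun p => tau (z \o cut N p.1) p.2)) => p q.
  have Np := Ncut p.1; have Nq := Ncut q.1; rewrite /tau2 (tau_cut p.1) (tau_cut q.1).
  move: (cut N p.1) (cut N q.1) Np Nq => x w Nx Nw.
  have Nwx := Nds Nw Nx; have bw := calgW cN Nw.
  have Nyw := calgM cN Ny Nw; have Nyx := calgM cN Ny Nx.
  rewrite !tauE//; try exact: (calgM cN).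
  rewrite -omZ// -omB//; [|exact: calgZ|exact: Nds].
  have dz : dag z = z by exact: dag_uniq.
  congr om; apply/funext => u; rewrite (dagM bz bw) (dagM by_ bw) dz !fctE /=.
  by have bd := (blinJ bw).1; rewrite -(linZ bd) -(linB bd) hd addrK.
by exists T; split=> // x v Nx; rewrite -/(tau2 (x, v)) hT /= cutE.
Qed.
Definition sig y : op Ind :=
  xget 0 [set T : op Ind | blin T /\ forall x v, N x -> T (tau x v) = tau (y \o x) v].
Lemma sigP y : N y -> blin (sig y) /\ forall x v, N x -> sig y (tau x v) = tau (y \o x) v.
Proof. by move=> /sig_exists h; exact: (@xgetPex _ 0 [set T : op Ind | _] h). Qed.
Lemma sig_blin y : N y -> blin (sig y). Proof. by move=> /sigP[]. Qed.
Lemma sig_tau y x v : N y -> N x -> sig y (tau x v) = tau (y \o x) v.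
Proof. by move=> /sigP[_ h] /h. Qed.
Lemma sig1 : sig id = id.
Proof.
have N1 := calg1 cN; apply: ind_op => [||x v Nx]; [exact: sig_blin|exact: blin_id|].
by rewrite sig_tau.
Qed.
Lemma sig_star : star_hom_on N sig.
Proof.
split=> [y Ny|k y z Ny Nz|y z Ny Nz|y Ny].
- exact/bounded_opP/sig_blin.
- have Nk := calg_ZD cN k Ny Nz; apply: ind_op => [||x v Nx]; first exact: sig_blin.
    by apply: blinZD; apply: sig_blin.
  rewrite !fctE !sig_tau// -tauDl; try exact: (calgM cN).
  by congr tau; apply/funext.
- have Nyz := calgM cN Ny Nz; apply: ind_op => [||x v Nx]; first exact: sig_blin.
    by apply: blinM; apply: sig_blin.
  by rewrite /= !sig_tau//; exact: (calgM cN).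
- have Nd := calgJ cN Ny; have bs := sig_blin Ny; apply: ind_op => [||x v Nx].
  + exact: sig_blin.
  + exact: blinJ.
  apply: ind_vec => z w Nz; rewrite adjE dagPr// !sig_tau// !tauE//; try exact: (calgM cN).
  by rewrite (dagM (calgW cN Ny) (calgW cN Nz)).
Qed.

(** The operators that pass to the second leg of the interior tensor product; [ind T] below is
    [1 (x) T]. *)
Definition Cm : set (op G) := commutant (Pi @` A).
Lemma Cm_calg : calg Cm.
Proof.
apply: calg_commutant => [_ [a Aa <-]|_ [a Aa <-]]; first exact: (sh_blin sP).
by exists (dag a); [exact: (calgJ cA)|rewrite (sh_dag sP)].
Qed.
Lemma Cm_blin (T : op G) : Cm T -> blin T. Proof. exact: (calgW Cm_calg). Qed.
Lemma CmE (T : op G) a v : Cm T -> A a -> T (Pi a v) = Pi a (T v).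
Proof. by move=> [_ h] Aa; have /(app_eq v) := h (Pi a) (imageP _ Aa). Qed.
Lemma ind_exists (T : op G) : Cm T -> exists U : op Ind, blin U /\ forall x v, U (tau x v) = tau x (T v).
Proof.
move=> CT; have bT := Cm_blin CT; have [z [d [Cz sz d0 hd]]] := defect Cm_calg CT.
have [|U [bU _ hU]] := total_ext (psi := fun p => tau p.1 (T p.2)) tau_total d0.
  move=> s; apply: (@sos _ _ _ _ _ _ (fun p => tau p.1 (z p.2))) => p q.
  have Np := Ncut p.1; have Nq := Ncut q.1; rewrite /tau2 !(tau_cut p.1) !(tau_cut q.1).
  move: (cut N p.1) (cut N q.1) Np Nq => x w Nx Nw; rewrite !tauE// /om.
  have Ah := ce_in ce (Nds Nw Nx).
  rewrite -(CmE _ Cz Ah) sz -(CmE _ CT Ah) (dagP bT).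
  by apply/esym/eqP; rewrite subr_eq -ipDr -hd ipZr JC.
by exists U; split=> // x v; rewrite -/(tau2 (x, v)) hU.
Qed.
Definition ind (T : op G) : op Ind :=
  xget 0 [set U : op Ind | blin U /\ forall x v, U (tau x v) = tau x (T v)].
Lemma indP (T : op G) : Cm T -> blin (ind T) /\ forall x v, ind T (tau x v) = tau x (T v).
Proof. by move=> /ind_exists h; exact: (@xgetPex _ 0 [set U : op Ind | _] h). Qed.
Lemma ind_blin (T : op G) : Cm T -> blin (ind T). Proof. by move=> /indP[]. Qed.
Lemma ind_tau (T : op G) x v : Cm T -> ind T (tau x v) = tau x (T v).
Proof. by move=> /indP[]. Qed.
Lemma ind_id : ind id = id.
Proof.
have C1 := calg1 Cm_calg.
by apply: ind_op => [||x v Nx]; [exact: ind_blin|exact: blin_id|rewrite ind_tau].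
Qed.
Lemma ind_comp (S : op G) (T : op G) : Cm S -> Cm T -> ind (S \o T) = ind S \o ind T.
Proof.
move=> CS CT; have h := calgM Cm_calg CS CT; apply: ind_op => [||x v Nx]; first exact: ind_blin.
  by apply: blinM; apply: ind_blin.
by rewrite /= !ind_tau.
Qed.
Lemma ind_ZD k (S : op G) (T : op G) : Cm S -> Cm T -> ind (k *: S + T) = k *: ind S + ind T.
Proof.
move=> CS CT; have h := calg_ZD Cm_calg k CS CT; apply: ind_op => [||x v Nx]; first exact: ind_blin.
  by apply: blinZD; apply: ind_blin.
by rewrite (ind_tau _ _ h) -[RHS]/(k *: ind S (tau x v) + ind T (tau x v)) !ind_tau// -(tau_lin Nx).
Qed.
Lemma ind_dag (T : op G) : Cm T -> ind (dag T) = dag (ind T).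
Proof.
move=> CT; have Cd := calgJ Cm_calg CT; have bT := Cm_blin CT; have b := ind_blin CT.
apply: ind_op => [||x v Nx]; [exact: ind_blin|exact: blinJ|].
apply: ind_vec => z w Nz; rewrite dagPr// !ind_tau// !tauE// /om.
by rewrite -(CmE _ Cd) ?dagPr//; apply: (ce_in ce); apply: Nds.
Qed.
Lemma ind_sig (T : op G) y : Cm T -> N y -> ind T \o sig y = sig y \o ind T.
Proof.
move=> CT Ny; have bT := ind_blin CT; have bs := sig_blin Ny.
apply: ind_op => [||x v Nx]; try exact: blinM.
by rewrite /= sig_tau// !ind_tau// sig_tau.
Qed.

Definition delta v : Ind := tau id v.
Lemma delta_iso v w : inner (delta v) (delta w) = inner v w.
Proof.
have N1 := calg1 cN.
by rewrite tauE// dag_id /om -[_ \o _]/(@id K) (ce1 ce) P1.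
Qed.
End Ind.

Section TotalInd.
Variables (R : realType) (G : hilbertType R) (X : Type) (f : X -> G).
Lemma fcomb_subsp : subsp [set fcomb f s | s in [set: seq (R[i] * X)]].
Proof.
split; first by exists [::] => //; rewrite /fcomb big_nil.
move=> k _ _ [s _ <-] [t _ <-]; exists (kZ k s ++ t) => //.
by rewrite fcomb_cat fcombZ.
Qed.
Lemma fcomb1 x : fcomb f [:: (1, x)] = f x.
Proof. by rewrite /fcomb big_seq1 scale1r. Qed.
(** The form in which totality is mostly used: a condition that cuts out a closed subspace is
    checked on the family only. *)
Lemma totalP : total f <-> forall S : set G, subsp S -> hclosed S -> (forall i, S (f i)) -> forall x, S x.
Proof.
split=> [h S sS cS hS x|h].
  apply: cS => e e0; have [s hs] := total_approx h x e0; exists (fcomb f s) => //.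
  by apply: subsp_sum => // p; apply: subspZ.
move=> x; apply: (h _ (closure_subsp fcomb_subsp) (@closure_hclosed _ _ _)) => i e e0.
by exists (f i); [exists [:: (1, i)] => //; apply: fcomb1|rewrite subrr n20].
Qed.
Lemma preim_closed (K : hilbertType R) (T : K -> G) (S : set G) : blin T -> hclosed S -> hclosed (T @^-1` S).
Proof.
move=> [lT [c c0 hc]] cS x hx; apply: cS => e e0.
have d0 : 0 < e / (1 + c) by rewrite divr_gt0//; lra.
have [y Sy hy] := hx _ d0; exists (T y) => //; rewrite -(linB lT).
apply: le_lt_trans (hc _) _; rewrite ltr_pdivlMr in hy; last by lra.
by apply: le_lt_trans hy; rewrite mulrC ler_wpM2l ?n2_ge0//; lra.
Qed.
Lemma preim_subsp (K : hilbertType R) (T : K -> G) (S : set G) : lin T -> subsp S -> subsp (T @^-1` S).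
Proof.
move=> lT [S0 SZ]; split; first by rewrite /= (lin0 lT).
by move=> k x y hx hy; rewrite /= lT; apply: SZ.
Qed.
Lemma bnd_total (K : hilbertType R) (T : G -> K) (c : R) : total f -> blin T -> 0 <= c ->
  (forall s, n2 (T (fcomb f s)) <= c * n2 (fcomb f s)) -> bnd T c.
Proof.
move=> tf bT c0 h; have [|S [bS hS e]] := @total_ext _ _ _ f tf K (fun x => T (f x)) c c0.
  by move=> s; rewrite -(lin_fcomb f s bT.1).
by rewrite (total_op tf bT bS (fun x => esym (e x))).
Qed.
Lemma nb_lim (K : hilbertType R) (T : G -> K) (c : R) : 0 <= c -> (forall e : R, 0 < e -> nb T (c + e)) -> nb T c.
Proof.
move=> c0 h; split=> // x; apply: le_eps => e e0; have x0 := n2_ge0 x.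
have p : 0 < (2 * c + 1) * (1 + n2 x) by rewrite mulr_gt0//; lra.
have d0 : 0 < Num.min 1 (e / ((2 * c + 1) * (1 + n2 x))) by rewrite lt_min ltr01 divr_gt0.
have [_ /(_ x)] := h _ d0; move/le_trans; apply; set d := Num.min _ _ in d0 *.
have d1 : d <= 1 by rewrite ge_min lexx.
have : d <= e / ((2 * c + 1) * (1 + n2 x)) by rewrite ge_min lexx orbT.
rewrite ler_pdivlMr// => d2.
have d3 : d ^+ 2 <= d by rewrite expr2 -[leRHS]mulr1 ler_wpM2l// ltW.
have : d ^+ 2 * n2 x <= d * n2 x by rewrite ler_wpM2r.
have : 0 <= d * c by rewrite mulr_ge0// ltW.
have : 0 <= d * c * n2 x by rewrite !mulr_ge0// ltW.
move: d2 d3; rewrite sqrrD -mulr_natl; move: (n2 x) x0 (d ^+ 2) (c ^+ 2) => y y0 d' c'; nra.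
Qed.
End TotalInd.

(* I x K -> G, a tensor-like map: G is a Hilbert tensor product of K with the
   space of the kernel kap; amp T is the operator 1 (x) T *)
Section Amp.
Variables (R : realType) (I : Type) (K G : hilbertType R) (t : I -> K -> G) (kap : I -> I -> R[i]).
Hypothesis tE : forall i k j l, inner (t i k) (t j l) = kap i j * inner k l.
Hypothesis tt : total (fun p : I * K => t p.1 p.2).
Implicit Types (S T : op K).
Definition amp T : op G :=
  xget 0 [set U : op G | blin U /\ forall i k, U (t i k) = t i (T k)].
Lemma ampP T : blin T -> blin (amp T) /\ forall i k, amp T (t i k) = t i (T k).
Proof.
move=> bT; apply: (@xgetPex _ 0 [set U : op G | blin U /\ forall i k, U (t i k) = t i (T k)]).
have [z [d [bz sz d0 hd]]] := defect (@calg_blins R K) bT.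
have [|U [bU _ hU]] := total_ext (psi := fun p => t p.1 (T p.2)) tt d0.
  move=> s; apply: (@sos _ _ _ _ _ _ _ (fun p => t p.1 (z p.2))) => p q.
  rewrite !tE sz (dagP bT); apply/esym/eqP; rewrite subr_eq -mulrDr -ipDr -hd ipZr JC.
  by rewrite mulrCA.
by exists U; split=> // i k; rewrite (hU (i, k)).
Qed.
Lemma amp_blin T : blin T -> blin (amp T). Proof. by move=> /ampP[]. Qed.
Lemma ampE T i k : blin T -> amp T (t i k) = t i (T k). Proof. by move=> /ampP[]. Qed.
Lemma amp_op (L : hilbertType R) (U V : G -> L) : blin U -> blin V ->
  (forall i k, U (t i k) = V (t i k)) -> U = V.
Proof. by move=> bU bV h; apply: (total_op tt) => // -[i k]; apply: h. Qed.
Lemma t_lin i : lin (t i).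
Proof.
move=> c k l; apply: (total_vec tt) => -[j m] /=.
by rewrite ipDl ipZl !tE ipDl ipZl mulrDr mulrCA.
Qed.
Lemma t_blin i : blin (t i).
Proof.
split; first exact: t_lin.
exists `|Re (kap i i)| => // k; rewrite /n2 tE ipC ReM ReC ImC mulr0 subr0.
by rewrite ler_wpM2r ?n2_ge0 ?ler_norm.
Qed.
Lemma amp_id : amp id = id.
Proof.
by apply: amp_op => [||i k]; [exact/amp_blin/blin_id|exact: blin_id|rewrite ampE//; exact: blin_id].
Qed.
Lemma amp_star : star_hom_on [set T : op K | blin T] amp.
Proof.
split=> [T bT|k S T bS bT|S T bS bT|T bT].
- exact/bounded_opP/amp_blin.
- have b := blinZD k bS bT; apply: amp_op => [||i x]; first exact: amp_blin.
    by apply: blinZD; apply: amp_blin.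
  by rewrite ampE// -[RHS]/(k *: amp S (t i x) + amp T (t i x)) !ampE// -t_lin.
- have b := blinM bS bT; apply: amp_op => [||i x]; first exact: amp_blin.
    by apply: blinM; apply: amp_blin.
  by rewrite /= !ampE.
- have bd := blinJ bT; apply: amp_op => [||i x]; first exact: amp_blin.
    exact/blinJ/amp_blin.
  apply: (total_vec tt) => -[j y] /=; rewrite adjE dagPr ?ampE//; last exact: amp_blin.
  by rewrite !tE dagPr.
Qed.
Lemma amp_comp S T : blin S -> blin T -> amp (S \o T) = amp S \o amp T.
Proof. by case: amp_star => _ _ h _; apply: h. Qed.
Lemma amp_dag T : blin T -> amp (dag T) = dag (amp T).
Proof. by case: amp_star => _ _ _; apply. Qed.
End Amp.

(* ev Phi s is the image of sum a (x) c; the norm of a representation of the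
   algebraic tensor product is compared with that of another one through
   the powers of (ev s)^* (ev s), so that only crude bounds are needed. *)
Section Birep.
Variables (R : realType) (K : hilbertType R) (C : choiceType) (cm : C -> C -> C) (cs : C -> C).
Implicit Types (s t : seq (op K * C)) (N : set (op K)).
Definition ev (G : hilbertType R) (Phi : op K -> C -> op G) s : op G := \sum_(p <- s) Phi p.1 p.2.
Definition mulS s t := [seq (p.1 \o q.1, cm p.2 q.2) | p <- s, q <- t].
Definition starS s : seq (op K * C) := [seq (dag p.1, cs p.2) | p <- s].
Definition inS N s := forall p, p \in s -> N p.1.
Record birep N (G : hilbertType R) (Phi : op K -> C -> op G) : Prop := {
  bi_blin : forall x c, N x -> blin (Phi x c);
  bi_mul : forall x y c d, N x -> N y -> Phi (x \o y) (cm c d) = Phi x c \o Phi y d;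
  bi_star : forall x c, N x -> Phi (dag x) (cs c) = dag (Phi x c)
}.
Lemma inS_cons N p s : inS N (p :: s) -> N p.1 /\ inS N s.
Proof.
by move=> h; split=> [|q qs]; [apply: (h p); rewrite mem_head|apply: (h q); rewrite in_cons qs orbT].
Qed.
Lemma inS_mul N s t : calg N -> inS N s -> inS N t -> inS N (mulS s t).
Proof.
move=> cN hs ht r /allpairsP[[p q] [/= ps qt ->]] /=.
by apply: (calgM cN); [apply: (hs p)|apply: (ht q)].
Qed.
Lemma inS_star N s : calg N -> inS N s -> inS N (starS s).
Proof. by move=> cN hs r /mapP[p ps ->] /=; apply: (calgJ cN); apply: (hs p). Qed.

Section Ev.
Variables (N : set (op K)) (G : hilbertType R) (Phi : op K -> C -> op G).
Hypotheses (cN : calg N) (bP : birep N Phi).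
Lemma evE s v : ev Phi s v = \sum_(p <- s) Phi p.1 p.2 v.
Proof. exact: sumE. Qed.
Lemma ev_blin s : inS N s -> blin (ev Phi s).
Proof.
rewrite /ev; elim: s => [|p s ih] h; rewrite ?big_nil ?big_cons; first exact: blin0.
by have [Np hs] := inS_cons h; apply: blinD; [apply: (bi_blin bP)|apply: ih].
Qed.
Lemma ev_mul s t : inS N s -> inS N t -> ev Phi (mulS s t) = ev Phi s \o ev Phi t.
Proof.
move=> hs ht; apply/funext => v; rewrite /= !evE big_allpairs_dep /=; apply: eq_big_seq => p ps.
rewrite (lin_sum (bi_blin bP _ (hs p ps)).1); apply: eq_big_seq => q qt.
by rewrite (bi_mul bP) //=; [apply: hs|apply: ht].
Qed.
Lemma ev_star s : inS N s -> ev Phi (starS s) = dag (ev Phi s).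
Proof.
rewrite /ev /starS big_map; elim: s => [|p s ih] h; rewrite ?big_nil ?big_cons ?dag0//.
have [Np hs] := inS_cons h; rewrite dagD ?ih ?(bi_star bP)//.
  exact: (bi_blin bP).
exact: ev_blin.
Qed.
End Ev.

Lemma iterB_pos (G : hilbertType R) (T : op G) n v : blin T -> 0 <= Re (inner (iter n (dag T \o T) v) v).
Proof.
move=> bT; set B := dag T \o T.
have sB u w : inner (B u) w = inner u (B w) by rewrite /B /= dagPr// -dagP.
move: v; have [m] := ubnP n; elim: m n => // m ih [|[|n]] hn v.
- exact: n2_ge0.
- by rewrite /= dagPr//; apply: n2_ge0.
- by rewrite iterSr iterS sB ih// -ltnS ltnW.
Qed.

Lemma transfer N (G1 G2 : hilbertType R) (Phi1 : op K -> C -> op G1) (Phi2 : op K -> C -> op G2)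
    (I : Type) (v : I -> G1) : calg N -> birep N Phi1 -> birep N Phi2 -> total v ->
  (forall i, exists2 c : R, 0 <= c & forall s M, inS N s -> nb (ev Phi2 s) M ->
     Re (inner (ev Phi1 s (v i)) (v i)) <= c * M) ->
  forall s M, inS N s -> nb (ev Phi2 s) M -> nb (ev Phi1 s) M.
Proof.
move=> cN b1 b2 tv hv s M hs hM; have [M0 _] := hM.
apply: (nb_lim M0) => e e0; have {}hM : nb (ev Phi2 s) (M + e) by apply: nb_le hM _; lra.
have M1 : 0 < M + e by lra.
move: (M + e) M1 hM => {e e0 M0}M M0 hM.
have bT := ev_blin b1 hs; set T := ev Phi1 s in bT *.
pose B := mulS (starS s) s.
have hB : inS N B by apply: inS_mul => //; apply: inS_star.
(* Formal powers of [s^* s], with [pw n] the power of exponent [n.+1]: they remain in the algebraic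
   tensor product, where the crude bounds hold. *)
pose pw := fix pw n := if n is m.+1 then mulS B (pw m) else B.
have hpw n : inS N (pw n) by elim: n => //= n ih; apply: inS_mul.
have B1 : ev Phi1 B = dag T \o T by rewrite (ev_mul b1) ?(ev_star b1)//; apply: inS_star.
have pw1 n : ev Phi1 (pw n) = iter n.+1 (dag T \o T).
  by elim: n => [|n ih]; rewrite ?B1//= (ev_mul b1)// ih B1.
have nB : nb (ev Phi2 B) (M ^+ 2).
  rewrite (ev_mul b2) ?(ev_star b2)//; [|exact: inS_star]; rewrite expr2; apply: nb_comp => //.
  by split; [exact: hM.1|apply: dag_bnd hM.2; [exact: (ev_blin b2)|exact: sqr_ge0]].
have pw2 n : nb (ev Phi2 (pw n)) ((M ^+ 2) ^+ n.+1).
  elim: n => [|n ih]; first by rewrite expr1.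
  by rewrite exprS /= (ev_mul b2)//; apply: nb_comp.
pose q n w := Re (inner (iter n (dag T \o T) w) w).
have qv i : exists c, forall n, q n (v i) <= c * (M ^+ 2) ^+ n.
  have [c c0 hc] := hv i; exists (c + n2 (v i)) => -[|n].
    by rewrite expr0 mulr1 /q /= -/(n2 (v i)) lerDr.
  rewrite /q -pw1; apply: le_trans (hc _ _ (hpw n) (pw2 n)) _.
  by rewrite ler_wpM2r ?lerDl ?n2_ge0// exprn_ge0// sqr_ge0.
have lB n : lin (iter n (dag T \o T)).
  elim: n => [//|n ih] k x y; rewrite /= ih bT.1; exact: (blinJ bT).1.
(* Growth of order [(M ^ 2) ^ n] survives linear combinations, so constants that depend on the
   vector do no harm and the [v i] suffice. *)
have qD n x y : q n (x + y) <= 2 * q n x + 2 * q n y.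
  have := iterB_pos n (x - y) bT.
  by rewrite /q (linB (lB n)) (linD (lB n)) !ipDl !ipDr !ipNl !ipNr !reim; lra.
have qZ n k x : q n (k *: x) = m2 k * q n x.
  by rewrite /q (linZ (lB n)) ipZl ipZr mulrA mulJ !reim mul0r subr0.
have qs u : exists c, forall n, q n (fcomb v u) <= c * (M ^+ 2) ^+ n.
  elim: u => [|[k i] u [c hc]].
    exists 0 => n; rewrite mul0r /q /fcomb big_nil ip0r //.
  have [d hd] := qv i; exists (2 * (m2 k * d) + 2 * c) => n.
  rewrite /fcomb big_cons; apply: le_trans (qD _ _ _) _.
  have h1 : m2 k * q n (v i) <= m2 k * (d * (M ^+ 2) ^+ n) by rewrite ler_wpM2l ?m2_ge0.
  have h2 := hc n; rewrite /fcomb in h2; rewrite qZ.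
  by move: (q n _) (q n _) ((M ^+ 2) ^+ n) h1 h2 => x y z; lra.
have M2 : 0 < M ^+ 2 by rewrite exprn_gt0.
have pb := fun x C0 => @pow_bnd_vec _ _ T _ x C0 M2 bT.
split; first exact: ltW.
apply: bnd_total tv bT (sqr_ge0 _) _ => u; have [c hc] := qs u.
exact: (pb _ _ hc).
Qed.
End Birep.

(** * Tensor products *)

Section TensorKernel.
Variables (R : realType) (H L : hilbertType R).
Implicit Types (s : seq (H * L)).
(** The Schur product theorem, by induction: splitting each second component along [y] separates the
    term [n2 y * n2 w], and in the remainder the first pair has disappeared since [r y = 0]. *)
Lemma schur_pos s : 0 <= Re (\sum_(p <- s) \sum_(q <- s) inner p.1 q.1 * inner p.2 q.2).
Proof.
elim: {s}(size s) {-2}s (leqnn (size s)) => [|n ih] [|[x y] s]//= sz; try by rewrite big_nil.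
pose a z := inner z y / (n2 y)%:C%C.
have aD z : inner z y = a z * (n2 y)%:C%C.
  rewrite /a; have [h|h] := eqVneq (n2 y) 0.
    by rewrite (n2_eq0 h) ip0r !mul0r.
  by rewrite divfK// -(rmorph0 (real_complex R)) (inj_eq (@complexI R)).
have aJ z : inner y z = (a z)^* * (n2 y)%:C%C by rewrite -ipJ aD rmorphM /= JC.
pose r z := z - a z *: y.
have rE z z' : inner z z' = a z * (a z')^* * (n2 y)%:C%C + inner (r z) (r z').
  by rewrite /r ipBl !ipBr !ipZl !ipZr !ipC !aD aJ; ring.
have ry : r y = 0.
  have [h|h] := eqVneq (n2 y) 0; first by rewrite /r (n2_eq0 h) scaler0 subr0.
  rewrite /r /a ipC divff ?scale1r ?subrr// -(rmorph0 (real_complex R)) (inj_eq (@complexI R)) //.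
pose w := \sum_(p <- (x, y) :: s) a p.2 *: p.1.
have -> : \sum_(p <- (x, y) :: s) \sum_(q <- (x, y) :: s) inner p.1 q.1 * inner p.2 q.2 =
    (n2 y * n2 w)%:C%C + \sum_(p <- [seq (p.1, r p.2) | p <- s]) \sum_(q <- [seq (p.1, r p.2) | p <- s]) inner p.1 q.1 * inner p.2 q.2.
  have z0 (p : H * L) : \sum_(q <- (x, y) :: s) inner p.1 q.1 * inner p.2 q.2 =
      (n2 y)%:C%C * inner (a p.2 *: p.1) w + \sum_(q <- s) inner p.1 q.1 * inner (r p.2) (r q.2).
    rewrite /w ip_sumr mulr_sumr; transitivity (\sum_(q <- (x, y) :: s)
      ((n2 y)%:C%C * inner (a p.2 *: p.1) (a q.2 *: q.1) + inner p.1 q.1 * inner (r p.2) (r q.2))).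
      by apply: eq_bigr => q _; rewrite rE ipZl ipZr; ring.
    rewrite big_split /=; congr (_ + _); rewrite big_cons /= ry ip0r mulr0 add0r //.
  transitivity (\sum_(p <- (x, y) :: s) ((n2 y)%:C%C * inner (a p.2 *: p.1) w + \sum_(q <- s) inner p.1 q.1 * inner (r p.2) (r q.2))).
    by apply: eq_bigr => p _; apply: z0.
  rewrite big_split -mulr_sumr -ip_suml -/w ipC -rmorphM; congr (_ + _).
  rewrite big_cons /= ry big1 ?add0r => [|q _]; last by rewrite ip0l mulr0.
  by rewrite big_map; apply: eq_bigr => p _; rewrite big_map.
by rewrite ReD addr_ge0 ?ReC ?mulr_ge0 ?n2_ge0// ih// size_map.
Qed.
Definition tkf (p q : H * L) := inner p.1 q.1 * inner p.2 q.2.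
Lemma tkherm p q : tkf q p = (tkf p q)^*.
Proof. by rewrite /tkf rmorphM /= !ipJ. Qed.
Lemma tkpos (s : seq (R[i] * (H * L))) :
  0 <= Re (\sum_(p <- s) \sum_(q <- s) p.1 * q.1^* * tkf p.2 q.2).
Proof.
have := schur_pos [seq (p.1 *: p.2.1, p.2.2) | p <- s]; rewrite big_map.
congr (0 <= Re _); apply: eq_bigr => p _; rewrite big_map; apply: eq_bigr => q _.
by rewrite /tkf /= ipZl ipZr !mulrA.
Qed.
Definition tker := Kernel tkherm tkpos.
Definition Tens : hilbertType R := KH tker.
Definition tens x y : Tens := kphi tker (x, y).
Lemma tensE x y x' y' : inner (tens x y) (tens x' y') = inner x x' * inner y y'.
Proof. by rewrite kphiE. Qed.
Lemma tens_total : total (fun p : H * L => tens p.1 p.2).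
Proof.
move=> y e /(kphi_dense y)[_ [s _ <-] h]; exists (fcomb (fun p : H * L => tens p.1 p.2) s); first by exists s.
by apply: le_lt_trans h; rewrite /fcomb /tens; under eq_bigr do rewrite -surjective_pairing.
Qed.
Lemma tens_linr x : lin (tens x).
Proof.
move=> k y z; apply: (total_vec tens_total) => -[x' y'] /=.
by rewrite ipDl ipZl !tensE ipDl ipZl mulrDr mulrCA.
Qed.
Lemma tens_linl y : lin (tens^~ y).
Proof.
move=> k x z; apply: (total_vec tens_total) => -[x' y'] /=.
by rewrite ipDl ipZl !tensE ipDl ipZl mulrDl mulrA.
Qed.
Lemma hdens_closure (G : hilbertType R) (S : set G) : hdense S -> closure S = setT.
Proof.
move=> h; apply/seteqP; split=> // x _ B /nbhs_ballP[e /= e0 hB].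
have [r r0 er] := posC e0; have [y Sy hy] := h x (r ^+ 2) ltac:(by rewrite exprn_gt0).
exists y; split=> //; apply: hB; rewrite -ball_normE /= er norm_lt_n2//.
Qed.
Lemma tens_hilbert : hilbert_tensor tens.
Proof.
split; [exact: tens_linl|exact: tens_linr|by move=> *; apply: tensE|].
apply: hdens_closure => x e e0; have [s hs] := total_approx tens_total x e0.
exists (fcomb (fun p : H * L => tens p.1 p.2) s) => //.
exists [seq (p.1 *: p.2.1, p.2.2) | p <- s] => //; rewrite big_map; apply: eq_bigr => p _ /=.
exact: (linZ (tens_linl _)).
Qed.
End TensorKernel.

Section Tensor.
Variables (R : realType) (H L T : hilbertType R) (t : H -> L -> T).
Hypothesis ht : hilbert_tensor t.
Lemma htE x y x' y' : inner (t x y) (t x' y') = inner x x' * inner y y'.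
Proof. by case: ht => _ _ h _; apply: h. Qed.
Lemma ht_total : total (fun p : H * L => t p.1 p.2).
Proof.
case: ht => _ _ _ /densP h x e /(h x)[_ [s _ <-] hs].
exists (fcomb (fun p : H * L => t p.1 p.2) [seq (1, p) | p <- s]); first by exists [seq (1, p) | p <- s].
by rewrite /fcomb big_map; under eq_bigr do rewrite scale1r.
Qed.
Lemma ht_totalC : total (fun p : L * H => t p.2 p.1).
Proof. by apply/totalP => S sS cS h; apply: (proj1 (totalP _) ht_total) => // -[x y]; apply: (h (y, x)). Qed.
Lemma htEC y x y' x' : inner (t x y) (t x' y') = inner y y' * inner x x'.
Proof. by rewrite htE mulrC. Qed.
Definition aH := amp (fun y x => t x y).
Definition aL := amp t.
Lemma aHE a x y : blin a -> aH a (t x y) = t (a x) y.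
Proof. exact: (ampE htEC ht_totalC y x). Qed.
Lemma aLE b x y : blin b -> aL b (t x y) = t x (b y).
Proof. exact: (ampE htE ht_total). Qed.
Lemma aH_blin a : blin a -> blin (aH a). Proof. exact: (amp_blin htEC ht_totalC). Qed.
Lemma aL_blin b : blin b -> blin (aL b). Proof. exact: (amp_blin htE ht_total). Qed.
Lemma ht_op (G : hilbertType R) (U V : T -> G) : blin U -> blin V ->
  (forall x y, U (t x y) = V (t x y)) -> U = V.
Proof. exact: (amp_op ht_total). Qed.
Lemma aHL a b : blin a -> blin b -> aH a \o aL b = aL b \o aH a.
Proof.
move=> ba bb; have hA := aH_blin ba; have hB := aL_blin bb.
by apply: ht_op; try exact: blinM; move=> x y; rewrite /= aHE ?aLE ?aHE.
Qed.
Lemma op_tensorE a b : blin a -> blin b -> op_tensor t a b = aH a \o aL b.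
Proof.
move=> ba bb; have hA := aH_blin ba; have hB := aL_blin bb.
have [] : [set c : op T | bounded_op c /\ forall x y, c (t x y) = t (a x) (b y)] (op_tensor t a b).
  apply: getPex; exists (aH a \o aL b); split; first by apply/bounded_opP/blinM.
  by move=> x y; rewrite /= aLE ?aHE.
move=> /bounded_opP bo h; apply: ht_op => //; first exact: blinM.
by move=> x y; rewrite h /= aLE ?aHE.
Qed.
Lemma aH_star : star_hom_on [set a : op H | blin a] aH.
Proof. exact: (amp_star htEC ht_totalC). Qed.
Lemma aH_id : aH id = id. Proof. exact: (amp_id htEC ht_totalC). Qed.
Lemma aL_star : star_hom_on [set a : op L | blin a] aL.
Proof. exact: (amp_star htE ht_total). Qed.
End Tensor.

(** * The countable amplification of a representation *)

Section Kinf.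
Variables (R : realType) (K : hilbertType R).
(** The kernel of [l^2 (x) K]. A square summable sequence in [K] becomes one vector of [Kinf], and
    the ultraweak functionals become [x |-> inner (am x z) z']. *)
Definition ekf (p q : nat * K) : R[i] := (p.1 == q.1)%:R * inner p.2 q.2.
Lemma ekherm p q : ekf q p = (ekf p q)^*.
Proof. by rewrite /ekf rmorphM /= conjC_nat ipJ eq_sym. Qed.
Lemma ek_pos (s : seq (nat * K)) : 0 <= Re (\sum_(p <- s) \sum_(q <- s) ekf p q).
Proof.
have [m] := ubnP (size s); elim: m s => // m ih [|[i x] s] hm; first by rewrite big_nil.
set S := _ :: s; pose b (p : nat * K) := p.1 == i.
have z p q : b p != b q -> ekf p q = 0.
  by rewrite /ekf /b; case: (eqVneq p.1 q.1) => [->|_]; rewrite ?eqxx ?mul0r.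
rewrite (bigID b) /= ReD addr_ge0//.
  have -> : \sum_(p <- S | b p) \sum_(q <- S) ekf p q = inner (\sum_(p <- seq.filter b S) p.2) (\sum_(p <- seq.filter b S) p.2).
    rewrite -big_filter ip_suml; apply: eq_big_seq => p; rewrite mem_filter => /andP[bp _].
    rewrite ip_sumr big_filter (bigID b) /= [X in _ + X]big1 ?addr0 => [|q nq]; last first.
      by apply: z; rewrite bp (negbTE nq).
    by apply: eq_bigr => q bq; rewrite /ekf (eqP bp) (eqP bq) eqxx mul1r.
  exact: n2_ge0.
have -> : \sum_(p <- S | ~~ b p) \sum_(q <- S) ekf p q = \sum_(p <- seq.filter (predC b) S) \sum_(q <- seq.filter (predC b) S) ekf p q.
  rewrite [RHS]big_filter; apply: eq_bigr => p nb_; rewrite big_filter (bigID b) /= big1 ?add0r// => q bq.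
  by apply: z; rewrite bq (negbTE nb_).
apply: ih; have -> : seq.filter (predC b) S = seq.filter (predC b) s by rewrite /S /= /b /= eqxx.
by rewrite size_filter; apply: leq_ltn_trans (count_size _ _) _.
Qed.
Lemma ekpos (s : seq (R[i] * (nat * K))) :
  0 <= Re (\sum_(p <- s) \sum_(q <- s) p.1 * q.1^* * ekf p.2 q.2).
Proof.
have := ek_pos [seq (p.2.1, p.1 *: p.2.2) | p <- s]; rewrite big_map.
congr (0 <= Re _); apply: eq_bigr => p _; rewrite big_map; apply: eq_bigr => q _.
by rewrite /ekf /= ipZl ipZr; ring.
Qed.
Definition eker := Kernel ekherm ekpos.
Definition Kinf : hilbertType R := KH eker.
Definition ei n k : Kinf := kphi eker (n, k).
Lemma eiE n k m l : inner (ei n k) (ei m l) = (n == m)%:R * inner k l.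
Proof. by rewrite kphiE. Qed.
Lemma ei_total : total (fun p : nat * K => ei p.1 p.2).
Proof.
move=> y e /(kphi_dense y)[_ [s _ <-] h]; exists (fcomb (fun p : nat * K => ei p.1 p.2) s); first by exists s.
by apply: le_lt_trans h; rewrite /fcomb /ei; under eq_bigr do rewrite -surjective_pairing.
Qed.
Definition am := amp ei.
Lemma amE a n k : blin a -> am a (ei n k) = ei n (a k). Proof. exact: (ampE eiE ei_total). Qed.
Lemma am_blin a : blin a -> blin (am a). Proof. exact: (amp_blin eiE ei_total). Qed.
Lemma am_star : star_hom_on [set a : op K | blin a] am. Proof. exact: (amp_star eiE ei_total). Qed.
Lemma ei_blin n : blin (ei n). Proof. exact: (t_blin eiE ei_total). Qed.
Lemma am_id : am id = id. Proof. exact: (amp_id eiE ei_total). Qed.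
Lemma ei_op (G : hilbertType R) (U V : Kinf -> G) : blin U -> blin V ->
  (forall x y, U (ei x y) = V (ei x y)) -> U = V.
Proof. exact: (amp_op ei_total). Qed.
End Kinf.

(** * Dominated vectors and normality *)

Section Sub.
Variables (R : realType) (X : Type) (G : hilbertType R) (f : X -> G).
Lemma subkherm x y : inner (f y) (f x) = (inner (f x) (f y))^*.
Proof. by rewrite ipJ. Qed.
Lemma fcomb_ip (V : hilbertType R) (k : X -> V) s :
  inner (fcomb k s) (fcomb k s) = \sum_(p <- s) \sum_(q <- s) p.1 * q.1^* * inner (k p.2) (k q.2).
Proof.
rewrite ip_suml; apply: eq_bigr => p _; rewrite ip_sumr; apply: eq_bigr => q _.
by rewrite ipZl ipZr mulrA.
Qed.
Lemma subkpos (s : seq (R[i] * X)) :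
  0 <= Re (\sum_(p <- s) \sum_(q <- s) p.1 * q.1^* * inner (f p.2) (f q.2)).
Proof. by rewrite -fcomb_ip; apply: n2_ge0. Qed.
Definition subk := Kernel subkherm subkpos.
Lemma kphi_total (Y : Type) (k : kernel R Y) : total (kphi k).
Proof. by move=> y e /(kphi_dense y)[_ [s _ <-] h]; exists (fcomb (kphi k) s); first by exists s. Qed.
(** A closed span is a subset and not a [hilbertType]; its Gram kernel provides an isometric copy,
    through which [total_ext] also serves families that are not total. *)
Lemma sub_iso : exists J : KH subk -> G, [/\ blin J, forall x, J (kphi subk x) = f x & dag J \o J = id].
Proof.
have [|J [bJ _ hJ]] := @total_ext _ _ _ _ (kphi_total (k := subk)) _ f 1 ler01.
  move=> s; rewrite mul1r /n2 !fcomb_ip le_eqVlt; apply/orP; left; apply/eqP; congr Re.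
  by apply: eq_bigr => p _; apply: eq_bigr => q _; rewrite kphiE.
have bd := blinJ bJ; exists J; split=> //.
apply: (total_op (kphi_total (k := subk))); [exact: blinM|exact: blin_id|move=> x].
by apply: (total_vec (kphi_total (k := subk))) => y; rewrite /= dagPr// !hJ kphiE.
Qed.
Lemma ext_sub (L : hilbertType R) (psi : X -> L) c : 0 <= c ->
  (forall s, n2 (fcomb psi s) <= c * n2 (fcomb f s)) ->
  exists T : G -> L, [/\ blin T, bnd T c, forall x, T (f x) = psi x &
    forall y, (forall x, inner y (f x) = 0) -> T y = 0].
Proof.
move=> c0 h; have [J [bJ hJ JJ]] := sub_iso; have bd := blinJ bJ.
have nJ : bnd (dag J) 1.
  apply: dag_bnd => // x; rewrite mul1r /n2 dagP//.
  by have /(app_eq x) /= -> := JJ.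
have [|T [bT nT hT]] := @total_ext _ _ _ _ (kphi_total (k := subk)) _ psi c c0.
  move=> s; apply: le_trans (h s) _; rewrite le_eqVlt; apply/orP; left; apply/eqP.
  congr (_ * _); rewrite /n2 !fcomb_ip; congr Re.
  by apply: eq_bigr => p _; apply: eq_bigr => q _; rewrite kphiE.
exists (T \o dag J); split; first exact: blinM.
- move=> y; apply: le_trans (nT _) _; rewrite ler_wpM2l//.
  by apply: le_trans (nJ _) _; rewrite mul1r.
- by move=> x; rewrite -hJ /=; have /(app_eq (kphi subk x)) /= -> := JJ.
- move=> y hy /=; have -> : dag J y = 0; last exact: (lin0 bT.1).
  by apply: (total_vec (kphi_total (k := subk))) => x; rewrite ip0l dagPr// hJ.
Qed.
Lemma sub_proj : exists P : op G, [/\ blin P, dag P = P, P \o P = P, forall x, P (f x) = f x &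
  forall y, (forall x, inner y (f x) = 0) -> P y = 0].
Proof.
have [J [bJ hJ JJ]] := sub_iso; have bd := blinJ bJ; have bP := blinM bJ bd.
exists (J \o dag J); split=> //.
- by rewrite dagM// dagK.
- by rewrite compA -[_ \o J]compA JJ.
- by move=> x; rewrite -hJ /=; have /(app_eq (kphi subk x)) /= -> := JJ.
- move=> y hy /=; have -> : dag J y = 0; last exact: (lin0 bJ.1).
  by apply: (total_vec (kphi_total (k := subk))) => x; rewrite ip0l dagPr// hJ.
Qed.
Lemma sub_zero (L : hilbertType R) (T : G -> L) : blin T -> (forall x, T (f x) = 0) ->
  (forall y, (forall x, inner y (f x) = 0) -> T y = 0) -> T = 0.
Proof.
move=> bT h1 h2; have [J [bJ hJ JJ]] := sub_iso; have bd := blinJ bJ.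
have TJ : T \o J = 0.
  apply: (total_op (kphi_total (k := subk))); [exact: blinM|exact: blin0|move=> x].
  by rewrite /= hJ h1.
apply/funext => y; rewrite -[y](subrK (J (dag J y))) (linD bT.1) h2.
  by rewrite add0r; have /(app_eq (dag J y)) := TJ.
move=> x; rewrite -hJ -dagPr// (linB bd.1).
by have /(app_eq (dag J y)) /= -> := JJ; rewrite subrr ip0l.
Qed.
End Sub.

Section Coord.
Variables (R : realType) (K : hilbertType R).
Implicit Types (X Y : Kinf K).
Lemma climP (w : nat -> R[i]^o) z : (w @ \oo --> z) <-> clim w z.
Proof.
split=> [/cvgrPdist_lt h e e0|h].
  have s0 : 0 < (Num.sqrt e)%:C%C :> R[i] by rewrite -(rmorph0 (real_complex R)) ltcR sqrtr_gt0.
  have [N _ hN] := h _ s0; exists N => n /hN /= h1.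
  rewrite -ltcR -normC2 -(sqr_sqrtr (ltW e0)) rmorphXn /= ltrXn2r ?nnegrE ?normr_ge0//.
  by rewrite distrC.
apply/cvgrPdist_lt => e /posC[r r0 ->]; have [N hN] := h (r ^+ 2) (exprn_gt0 _ r0).
exists N => // n /hN /=; rewrite -ltcR -normC2 rmorphXn /= distrC => h1.
by rewrite -(ltr_pXn2r (n := 2)) ?nnegrE ?normr_ge0 ?ler0c ?(ltW r0).
Qed.
Local Notation e_ := (@ei R K).
Lemma am_dag (T : op K) : blin T -> am (dag T) = dag (am T).
Proof. by case: (am_star K) => _ _ _; apply. Qed.
Definition co X n : K := dag (e_ n) X.
Lemma co_am (T : op K) X n : blin T -> co (am T X) n = T (co X n).
Proof.
move=> bT; have be := ei_blin K n; have bd := blinJ bT; apply: ip_ext => y.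
by rewrite /co (dagPr be) (dagP (am_blin bT)) -am_dag// amE// -(dagPr be) -dagP.
Qed.
Definition cut_ (N : nat) X : Kinf K := \sum_(0 <= n < N) e_ n (co X n).
Lemma co_ei m k n : co (e_ m k) n = (m == n)%:R *: k.
Proof. by apply: ip_ext => y; rewrite (dagPr (ei_blin K n)) eiE ipZl. Qed.
Lemma co_lin n : lin (co^~ n). Proof. exact: (blinJ (ei_blin K n)).1. Qed.
Lemma ei_sum N (x : nat -> K) Y : inner (\sum_(0 <= n < N) e_ n (x n)) Y = \sum_(0 <= n < N) inner (x n) (co Y n).
Proof. by rewrite ip_suml; apply: eq_bigr => n _; rewrite (dagP (ei_blin K n)). Qed.
Lemma cut_ip N X Y : inner (cut_ N X) Y = \sum_(0 <= n < N) inner (co X n) (co Y n).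
Proof. exact: ei_sum. Qed.
Lemma ei_sum_orth (x : nat -> K) M n y : (M <= n)%N -> inner (\sum_(0 <= i < M) e_ i (x i)) (e_ n y) = 0.
Proof.
move=> Mn; rewrite ip_suml big1_seq// => i; rewrite mem_index_iota => /andP[_ iM].
by rewrite eiE (ltn_eqF (leq_trans iM Mn)) mul0r.
Qed.
Lemma n2_ei n y : n2 (e_ n y) = n2 y.
Proof. by rewrite /n2 eiE eqxx mul1r. Qed.
Lemma n2_ei_sum N (x : nat -> K) : n2 (\sum_(0 <= n < N) e_ n (x n)) = \sum_(0 <= n < N) n2 (x n).
Proof.
elim: N => [|N ih]; first by rewrite !big_nil n20.
by rewrite !big_nat_recr//= n2D ih ei_sum_orth// n2_ei Re0 mulr0 addr0.
Qed.
Lemma cut_le N X : n2 (cut_ N X) <= n2 X.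
Proof.
have := n2_ge0 (X - cut_ N X); rewrite n2B -ipJ ReJ cut_ip /cut_ n2_ei_sum.
have -> : Re (\sum_(0 <= n < N) inner (co X n) (co X n)) = \sum_(0 <= n < N) n2 (co X n).
  by elim: N => [|N ih]; rewrite ?big_nil// !big_nat_recr//= ReD ih.
lra.
Qed.
Lemma cut_lin N : lin (cut_ N).
Proof.
move=> k X Y; rewrite /cut_ scaler_sumr -big_split; apply: eq_bigr => n _ /=.
by rewrite co_lin (ei_blin K n).1.
Qed.
Lemma cut_lim X : hlim (fun N => cut_ N X) X.
Proof.
move=> e e0; have e16 : 0 < e / 16 by lra.
have [s hs] := total_approx (@ei_total R K) X e16.
exists (\max_(p <- s) p.2.1.+1)%N => N hN; set Y := fcomb _ s in hs.
have YN : cut_ N Y = Y.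
  rewrite /Y /fcomb (lin_sum (cut_lin N)); apply: eq_big_seq => p ps.
  rewrite (linZ (cut_lin N)); congr (_ *: _).
  have lt : (p.2.1 < N)%N by apply: leq_trans hN; rewrite (big_rem p ps)/= leq_maxl.
  rewrite /cut_ big_mkord (bigD1 (Ordinal lt))//= co_ei eqxx scale1r big1 ?addr0// => i ne.
  by rewrite co_ei (_ : (_ == _) = false) ?scale0r ?(lin0 (ei_blin K i).1)//; apply/negbTE; rewrite eq_sym.
have h1 := n2_tri (cut_ N X) Y X; rewrite (n2C Y) in h1.
have h2 : n2 (cut_ N X - Y) <= n2 (X - Y) by rewrite -{1}YN -(linB (cut_lin N)); apply: cut_le.
by move: (n2 _) (n2 _) (n2 _) h1 h2 hs => x y z *; lra.
Qed.
Lemma uw_ip T X Y : blin T -> clim (fun N => \sum_(0 <= n < N) inner (T (co X n)) (co Y n)) (inner (am T X) Y).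
Proof.
move=> bT; apply: (@clim_ext _ (fun N => inner (cut_ N (am T X)) Y)).
  by move=> N; rewrite cut_ip; apply: eq_bigr => n _; rewrite co_am.
by apply: clim_ip; [apply: cut_lim|apply: hlim_cst].
Qed.
Lemma uwE T X Y : blin T -> uw_form (co X) (co Y) T = inner (am T X) Y.
Proof. by move=> bT; apply/cvg_lim/climP/uw_ip. Qed.
Lemma co_l2 X : l2 (co X).
Proof.
apply/cvg_ex; exists (inner X X); apply/climP; have := @uw_ip id X X (blin_id K).
by rewrite am_id; apply: clim_ext => N; apply: eq_bigr => n _; rewrite inner_norm.
Qed.
Lemma l2_co (x : nat -> K) : l2 x -> exists X, x = co X.
Proof.
move=> /cvg_ex[z /climP hz]; pose Y N := \sum_(0 <= n < N) e_ n (x n).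
have dY m n : (m <= n)%N -> n2 (Y n - Y m) = \sum_(0 <= i < n) n2 (x i) - \sum_(0 <= i < m) n2 (x i).
  move=> /subnKC <-; elim: (n - m)%N => [|k ih]; first by rewrite addn0 !subrr n20.
  rewrite addnS /Y !big_nat_recr//= -/(Y _) -/(Y m) addrAC n2D ih n2_ei ipBl.
  by rewrite !ei_sum_orth ?leq_addr// subrr Re0 mulr0 addr0 addrAC.
have sE N : series (fun n => `|x n| ^+ 2 : R[i]^o) N = (\sum_(0 <= i < N) n2 (x i))%:C%C.
  by rewrite /series /= rmorph_sum; apply: eq_bigr => i _; rewrite n2_norm.
have cY : hcau Y.
  move=> e e0; have d0 : 0 < (e / 4) ^+ 2 by rewrite exprn_gt0//; lra.
  have [N hN] := hz _ d0; exists N => m n Nm Nn.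
  wlog mn : m n Nm Nn / (m <= n)%N.
    by move=> h; case/orP: (leq_total m n) => h'; [|rewrite n2C]; apply: h.
  rewrite n2C dY//; have := hN m Nm; have := hN n Nn; rewrite !sE.
  rewrite /m2 !reim; move: (\sum_(0 <= i < n) _) (\sum_(0 <= i < m) _) (Re z) (Im z) => a b c d h1 h2.
  have k1 : a - c <= e / 4 by apply: sq_le; [lra|have := sqr_ge0 (0 - d); lra].
  have k2 : c - b <= e / 4.
    by apply: sq_le; [lra|rewrite -sqrrN opprB; have := sqr_ge0 (0 - d); lra].
  by clear h1 h2; lra.
have [X hX] := hcomplete cY; exists X; apply/funext => n.
apply: (@hlim_uniq _ _ (fun N => co (Y N) n)); last exact: (hlim_blin (blinJ (ei_blin K n)) hX).
move=> e e0; exists n.+1 => N nN; suff -> : co (Y N) n = x n by rewrite subrr n20.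
rewrite /Y (lin_sum (co_lin n)) big_mkord (bigD1 (Ordinal nN))//= co_ei eqxx scale1r big1 ?addr0// => i ne.
by rewrite co_ei (_ : (_ == _) = false) ?scale0r//; apply/negbTE.
Qed.
End Coord.
Section Wiso.
Variables (R : realType) (K : hilbertType R).
(** Isometries with pairwise orthogonal ranges that commute with all [am a], from the injection
    [pickle] of pairs into [nat]. They pack several, even countably many, dominating vectors into
    one. *)
Lemma W_exists (k : nat) : exists W : op (Kinf K), [/\ blin W, bnd W 1 &
  forall n x, W (ei n x) = ei (pickle (k, n)) x].
Proof.
have [|W [bW nW hW]] := @total_ext _ _ _ _ (@ei_total R K) _ (fun p => ei (pickle (k, p.1)) p.2) 1 ler01.
  move=> s; rewrite mul1r le_eqVlt; apply/orP; left; apply/eqP.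
  rewrite /n2 !fcomb_ip; congr Re; apply: eq_bigr => p _; apply: eq_bigr => q _.
  by rewrite !eiE (inj_eq (pcan_inj (@pickleK (nat * nat)%type))) xpair_eqE eqxx.
by exists W; split=> // n x; rewrite (hW (n, x)).
Qed.
Definition Wk (k : nat) : op (Kinf K) := xget 0 [set W : op (Kinf K) | [/\ blin W, bnd W 1 &
  forall n x, W (ei n x) = ei (pickle (k, n)) x]].
Lemma WkP k : [/\ blin (Wk k), bnd (Wk k) 1 & forall n x, Wk k (ei n x) = ei (pickle (k, n)) x].
Proof. by have := W_exists k => h; exact: (@xgetPex _ 0 [set W : op (Kinf K) | _] h). Qed.
Lemma Wk_blin k : blin (Wk k). Proof. by case: (WkP k). Qed.
Lemma Wk_ip k l X Y : inner (Wk k X) (Wk l Y) = (k == l)%:R * inner X Y.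
Proof.
have bk := Wk_blin k; have bl := Wk_blin l.
have e : dag (Wk l) \o Wk k = (k == l)%:R *: id.
  apply: ei_op; [by apply: blinM => //; apply: blinJ|exact/blinZ/blin_id|move=> n x].
  apply: (total_vec (@ei_total R K)) => -[m y] /=.
  case: (WkP k) => _ _ hk; case: (WkP l) => _ _ hl.
  rewrite dagPr// hk hl fctE ipZl !eiE (inj_eq (pcan_inj (@pickleK (nat * nat)%type))) xpair_eqE.
  by rewrite -mulnb natrM mulrA.
by rewrite -(dagPr bl); have /(app_eq X) /= -> := e; rewrite ipZl.
Qed.
Lemma am_W a k X : blin a -> am a (Wk k X) = Wk k (am a X).
Proof.
move=> ba; have bk := Wk_blin k; have bam := am_blin ba; case: (WkP k) => _ _ hk.
suff /(app_eq X) : am a \o Wk k = Wk k \o am a by [].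
by apply: ei_op; try exact: blinM; move=> n x; rewrite /= hk !amE.
Qed.
End Wiso.

Section Dom.
Variables (R : realType) (K G : hilbertType R) (A : set (op K)) (phi : op K -> op G).
Hypotheses (cA : calg A) (sP : star_hom_on A phi).
Implicit Types (a b : op K) (v w : G) (z : Kinf K).
(** [a |-> n2 (phi a v)] lies below a normal functional. Holding for all [v], this gives ultraweak
    continuity of the representation ([dom_uw]); unlike continuity it concerns single vectors and
    cuts out a closed subspace invariant under [phi]. *)
Definition dom v := exists z, forall a, A a -> n2 (phi a v) <= n2 (am a z).

Lemma sh_fcomb (L : hilbertType R) (psi : op K -> op L) (w : L) s : star_hom_on A psi ->
  fcomb (fun a => psi (cut A a) w) s = psi (fcomb (cut A) s) w /\ A (fcomb (cut A) s).
Proof.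
move=> sp; rewrite /fcomb; elim: s => [|[k a] s [ih1 ih2]].
  by rewrite !big_nil (sh0 cA sp); split=> //; apply: calg0.
have Ac : A (cut A a) by apply: cut_in.
rewrite !big_cons ih1 (sh_lin sp)//; split=> //.
exact: calg_ZD.
Qed.
Lemma am_starA : star_hom_on A (@am R K).
Proof.
case: (am_star K) => h1 h2 h3 h4; have bA := calgW cA.
by split=> [T /bA/h1//|k S T /bA hS /bA|S T /bA hS /bA|T /bA]; [exact: h2|exact: h3|exact: h4].
Qed.
Lemma am_comp a b : A a -> A b -> am (a \o b) = am a \o am b.
Proof. by case: am_starA => _ _ h _; apply: h. Qed.

(** A Radon-Nikodym type argument: [am a z |-> phi a v] is a contraction on the cyclic subspace of
    [z]. The orthogonal complement of that subspace is invariant too, so extension by 0 intertwines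
    everywhere. *)
Lemma dom_inter v z : (forall a, A a -> n2 (phi a v) <= n2 (am a z)) ->
  exists S : Kinf K -> G, [/\ blin S, forall a, A a -> S (am a z) = phi a v &
    forall a x, A a -> S (am a x) = phi a (S x)].
Proof.
move=> h; pose f a := am (cut A a) z.
have [|S [bS nS hS S0]] := @ext_sub _ _ _ f G (fun a => phi (cut A a) v) 1 ler01.
  move=> s; have [e1 As] := sh_fcomb v s sP; have [e2 _] := sh_fcomb z s am_starA.
  by rewrite mul1r e1 e2 h.
have SE a : A a -> S (am a z) = phi a v by move=> Aa; have := hS a; rewrite /f cutE.
exists S; split=> // a x Aa; have ba := calgW cA Aa; have bp := sh_blin sP Aa.
have bam := am_blin ba.
have b1 := blinM bS bam; have b2 := blinM bp bS.
suff /(app_eq x) /subr0_eq : (S \o am a) - (phi a \o S) = 0 by [].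
apply: (@sub_zero _ _ _ f) => [|b|y hy]; first exact: blinB.
  have Ab : A (cut A b) by apply: cut_in.
  rewrite !fctE /= /f -[am a (am _ z)]/((am a \o am _) z) -am_comp//.
  by rewrite !SE//; [rewrite (sh_comp sP)// subrr|exact: calgM].
rewrite !fctE /= (S0 y hy) (lin0 bp.1) subr0; apply: S0 => b.
have Ab : A (cut A b) by apply: cut_in.
have Ada := calgJ cA Aa; have Adb := calgM cA Ada Ab.
rewrite dagP// -am_dag// /f -[am _ (am _ z)]/((am _ \o am _) z) -am_comp//.
by have := hy (dag a \o cut A b); rewrite /f cutE.
Qed.

Lemma dom_subsp : subsp dom.
Proof.
split=> [|k v w [z hz] [z' hz']].
  by exists 0 => a Aa; rewrite (lin0 (sh_blin sP Aa).1) (lin0 (am_blin (calgW cA Aa)).1) !n20.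
have /(_ (2 * m2 k) 0)[r [r0 hr]] : forall c d : R, exists r, 0 <= r /\ c <= r ^+ 2.
  by move=> c _; exists (1 + `|c|); split; [rewrite addr_ge0|have := ler_norm c; have := sqr_ge0 `|c|; have := normr_ge0 c; rewrite sqrrD; lra].
exists (Wk 0 (r%:C%C *: z) + Wk 1 (2 *: z')) => a Aa.
have ba := calgW cA Aa; have bam := am_blin ba; have bp := sh_blin sP Aa.
rewrite (linD bam.1) !am_W// n2D Wk_ip mul0r Re0 mulr0 addr0 bp.1.
apply: le_trans (n2D_le _ _) _; rewrite /n2 !Wk_ip !eqxx !mul1r -!/(n2 _).
rewrite !(linZ bam.1) !n2Z m2C.
have h1 := hz _ Aa; have h2 := hz' _ Aa.
have -> : m2 (2 : R[i]) = 4 by rewrite (_ : 2 = (2 : R)%:C%C) ?m2C ?rmorph_nat// expr2; lra.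
have h3 : 2 * m2 k * n2 (phi a v) <= r ^+ 2 * n2 (am a z).
  by rewrite ler_pM// ?mulr_ge0 ?m2_ge0 ?n2_ge0.
have := n2_ge0 (phi a w); move: h2 h3; move: (n2 (phi a w)) (n2 (phi a v)) (n2 _) (r ^+ 2 * _) => x y u d; lra.
Qed.
Lemma dom_phi a v : A a -> dom v -> dom (phi a v).
Proof.
move=> Aa [z hz]; exists (am a z) => b Ab; have Aba := calgM cA Ab Aa.
by have := hz _ Aba; rewrite (sh_comp sP)// am_comp.
Qed.
(** Replaces [z] by [s z], with [s] a root of [S^* S] plus a small scalar and [S] the intertwiner.
    As [s] commutes with [am a], the vector still dominates, and it is hardly longer than [v]:
    series of dominating vectors can then converge. *)
Lemma dom_short v (e : R) : 0 < e -> dom v ->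
  exists2 z, n2 z <= n2 v + e & forall a, A a -> n2 (phi a v) <= n2 (am a z).
Proof.
move=> e0 [z hz]; have [S [bS Sz SI]] := dom_inter hz.
have bd := blinJ bS; pose T := dag S \o S; have bT : blin T by apply: blinM.
have pT : hpos T by move=> x; rewrite /T /= dagPr// ipC ler0c n2_ge0.
have d0 : 0 < e / (1 + n2 z) by rewrite divr_gt0//; have := n2_ge0 z; lra.
have [s [bs ps ss cs]] := sqrt_eps (@calg_blins R _) bT pT d0.
have sE x : n2 (s x) = n2 (S x) + e / (1 + n2 z) * n2 x.
  rewrite /n2 (saP bs (hpos_sa bs ps)); have /(app_eq x) /= -> := ss.
  by rewrite !fctE ipDr ipZr JC /T /= -dagP// !reim mul0r subr0.
have N1 := calg1 cA.
have Sv : S z = phi id v by have := Sz _ N1; rewrite am_id.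
exists (s z) => [|a Aa].
  rewrite sE Sv; apply: lerD; first exact: sh_id_le cA sP _.
  by rewrite mulrAC ler_pdivrMr ?ler_pM2l//; have := n2_ge0 z; lra.
have ba := calgW cA Aa; have bam := am_blin ba.
have Tam : T \o am a = am a \o T.
  apply/funext => x; rewrite /T /= SI//; apply: ip_ext => y.
  have Ad := calgJ cA Aa.
  rewrite dagPr// (dagP (sh_blin sP Aa)) -(sh_dag sP Aa) -SI// -dagPr//.
  by rewrite am_dag// -dagP.
have /(app_eq z) /= <- := cs _ bam Tam.
by rewrite sE -Sz// lerDl mulr_ge0 ?n2_ge0 ?ltW.
Qed.

Lemma hlim_n2 (V : hilbertType R) (u : nat -> V) l (e : R) : hlim u l -> 0 < e ->
  exists N, forall n, (N <= n)%N -> n2 (u n) <= n2 l + e.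
Proof.
move=> h e0; have [N hN] := clim_ip h h (exprn_gt0 2 e0).
exists N => n /hN h1; have := Re_le_m2 (ltW e0) (ltW h1).
by rewrite ReD ReN -!/(n2 _); lra.
Qed.
Lemma dom_closed : hclosed dom.
Proof.
move=> v hv.
(* Rapid approximation: [v] is the sum of dominated [d n] with squared norms of order [64^-n],
   leaving room for weights [4^(n+1)] below. *)
pose q : R := 64^-1; have q0 n : 0 < q ^+ n by rewrite exprn_gt0// invr_gt0.
have qS n : q ^+ n.+1 <= q ^+ n / 64 by rewrite exprS mulrC.
have /choice[w hw] : forall n : nat, exists w, dom w /\ n2 (v - w) < q ^+ n.
  by move=> n; have [w] := hv _ (q0 n); exists w.
pose d n := if n is m.+1 then w m.+1 - w m else w 0%N.
have dd n : dom (d n).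
  case: n => [|n]; first exact: (hw 0%N).1.
  exact: (subspB dom_subsp (hw _).1 (hw _).1).
have dn n : n2 (d n.+1) <= 4 * q ^+ n.
  have := n2_tri (w n.+1) v (w n); rewrite (n2C (w n.+1) v).
  by have := (hw n.+1).2; have := (hw n).2; have := qS n; have := q0 n; move: (n2 _) (n2 _) (n2 _) => *; lra.
have /choice[z hz] : forall n, exists z, n2 z <= n2 (d n) + q ^+ n /\ forall a, A a -> n2 (phi a (d n)) <= n2 (am a z).
  by move=> n; have [z h1 h2] := dom_short (q0 n) (dd n); exists z.
(* The weights pay for cross terms: [n2 (sum of f i)] is at most the sum of [4^(i+1) n2 (f i)], see
   [sumv]. The squared norms of the [y n] still decay like [16^-n]. *)
pose y n := (2 ^+ n.+1)%:C%C *: z n.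
pose Z n := \sum_(0 <= i < n) Wk i (y i).
have Zorth n k u : (n <= k)%N -> inner (Z n) (Wk k u) = 0.
  move=> nk; rewrite ip_suml big1_seq// => i; rewrite mem_index_iota => /andP[_ ik].
  by rewrite Wk_ip (ltn_eqF (leq_trans ik nk)) mul0r.
have n2W k u : n2 (Wk k u) = n2 u by rewrite /n2 Wk_ip eqxx mul1r.
have y_le n : n2 (y n.+1) <= 1600 * 16^-1 ^+ n.
  rewrite n2Z m2C -exprM mulnC exprM.
  have : n2 (z n.+1) <= 5 * q ^+ n.
    by have := (hz n.+1).1; have := dn n; have := qS n; have := q0 n; lra.
  have -> : (2 ^+ 2 : R) ^+ n.+2 = 16 * 4 ^+ n.
    rewrite (_ : 2 ^+ 2 = 4 :> R); last by rewrite expr2; lra.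
    by rewrite !exprS mulrA; congr (_ * _); lra.
  have -> : 1600 * 16^-1 ^+ n = 16 * 4 ^+ n * (100 * q ^+ n).
    rewrite (_ : 16^-1 = 4 * q); last by rewrite /q; lra.
    rewrite exprMn; move: (4 ^+ n) (q ^+ n) => u t; lra.
  move=> h; rewrite ler_pM2l ?mulr_gt0 ?exprn_gt0//; have := q0 n; lra.
have Zk n k : n2 (Z (n.+1 + k)%N - Z n.+1) <= 3200 * 16^-1 ^+ n * (1 - 16^-1 ^+ k).
  elim: k => [|k ih]; first by rewrite addn0 subrr n20 expr0 subrr mulr0.
  rewrite addnS /Z big_nat_recr//= -/(Z _) -/(Z n.+1) addrAC n2D ipBl !Zorth ?leq_addr//.
  rewrite subrr Re0 mulr0 addr0 n2W; have := y_le (n + k)%N; rewrite -addSn exprD.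
  have : 0 <= (16^-1 : R) ^+ n * 16^-1 ^+ k by rewrite mulr_ge0// exprn_ge0// invr_ge0.
  rewrite exprS; move: ih; move: (n2 _) (n2 _) (_ ^+ n) (_ ^+ k) => a b c e; nra.
have cZ : hcau Z.
  move=> e e0; have d0 : 0 < e / 12801 by lra.
  have p0 : 0 <= (16^-1 : R) by rewrite invr_ge0.
  have p1 : (16^-1 : R) < 1 by lra.
  have [N hN] := pow_small p0 p1 d0.
  have b m : (N < m)%N -> n2 (Z m - Z N.+1) < e / 4.
    move=> /subnKC <-; apply: le_lt_trans (Zk _ _) _.
    have := hN N (leqnn N).
    have : 0 <= (16^-1 : R) ^+ (m - N.+1) by rewrite exprn_ge0// invr_ge0.
    have : 0 <= (16^-1 : R) ^+ N by rewrite exprn_ge0// invr_ge0.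
    move: (_ ^+ N) (_ ^+ (m - _)) => a c a0 c0 h; have := mulr_ge0 a0 c0; nra.
  exists N.+1 => m n /b h1 /b h2; have := n2_tri (Z m) (Z N.+1) (Z n).
  rewrite (n2C (Z N.+1)); move: (n2 _) (n2 _) (n2 _) h1 h2 => *; lra.
have [X hX] := hcomplete cZ; exists X => a Aa.
have ba := calgW cA Aa; have bam := am_blin ba; have bp := sh_blin sP Aa.
have aZ n : n2 (am a (Z n)) = \sum_(0 <= i < n) 4 ^+ i.+1 * n2 (am a (z i)).
  elim: n => [|n ih]; first by rewrite /Z !big_nil (lin0 bam.1) n20.
  have orth : inner (am a (Z n)) (Wk n (am a (y n))) = 0.
    rewrite dagP// -am_dag// am_W ?Zorth//; exact: blinJ.
  rewrite /Z !big_nat_recr//= -/(Z n) (linD bam.1) am_W// n2D orth Re0 mulr0 addr0 ih n2W.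
  by rewrite /y (linZ bam.1) n2Z m2C -exprM mulnC exprM (_ : 2 ^+ 2 = 4)// expr2; lra.
have sumv : forall (f : nat -> G) n, n2 (\sum_(0 <= i < n) f i) <= \sum_(0 <= i < n) 4 ^+ i.+1 * n2 (f i).
  move=> f n; elim: n f => [|n ih] f; first by rewrite !big_nil n20.
  rewrite !big_nat_recl//; apply: le_trans (n2D_le _ _) _; rewrite expr1.
  have h1 := ih (fun i => f i.+1).
  have h2 : 4 * \sum_(0 <= i < n) 4 ^+ i.+1 * n2 (f i.+1) = \sum_(0 <= i < n) 4 ^+ i.+2 * n2 (f i.+1).
    by rewrite mulr_sumr; apply: eq_bigr => i _; rewrite mulrA -exprS.
  have := n2_ge0 (f 0%N); have := n2_ge0 (\sum_(0 <= i < n) f i.+1).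
  rewrite -h2; move: h1 {h2}; set x := n2 (\sum_(_ <= _ < _) _); set y' := n2 (f _).
  by set S := \sum_(_ <= _ < _) _; move: x y' S => x y' S *; lra.
have sw n : \sum_(0 <= i < n.+1) d i = w n.
  by elim: n => [|n ih]; rewrite big_nat_recr//= ?big_nil ?add0r// ih addrC subrK.
have lw : hlim w v.
  move=> e e0; have p0 : 0 <= q by rewrite invr_ge0.
  have p1 : q < 1 by rewrite /q; lra.
  have [N hN] := pow_small p0 p1 e0.
  exists N => n Nn; rewrite n2C; apply: lt_trans (hw n).2 _.
  exact: hN.
apply: (n2_lim_le (hlim_blin bp lw)) => e e0.
have [N hN] := hlim_n2 (hlim_blin bam hX) e0; exists N => n Nn.
apply: le_trans (hN n.+1 (leqW Nn)); rewrite aZ -sw (lin_sum bp.1).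
apply: le_trans (sumv _ _) _; apply: ler_sum => i _.
by rewrite ler_pM2l ?exprn_gt0// (hz i).2.
Qed.

Lemma am_riesz (h : op K -> R[i]) z : (forall k a b, A a -> A b -> h (k *: a + b) = k * h a + h b) ->
  (forall a, A a -> m2 (h a) <= n2 (am a z)) -> exists z', forall a, A a -> h a = inner (am a z) z'.
Proof.
move=> lh bh.
(* A one-dimensional [hilbertType], from the constant kernel on a point, so that the functional
   becomes an operator and [ext_sub] applies. *)
have [L [e1 e1E]] : exists (L : hilbertType R) (e1 : L), inner e1 e1 = 1.
  have herm (x y : unit) : (1 : R[i]) = 1^* by rewrite rmorph1.
  have pos (s : seq (R[i] * unit)) : 0 <= Re (\sum_(p <- s) \sum_(q <- s) p.1 * q.1^* * 1).
    have -> : \sum_(p <- s) \sum_(q <- s) p.1 * q.1^* * 1 = (\sum_(p <- s) p.1) * (\sum_(p <- s) p.1)^*.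
      rewrite rmorph_sum mulr_suml; apply: eq_bigr => p _; rewrite mulr_sumr.
      by apply: eq_bigr => q _; rewrite mulr1.
    by rewrite mulJ ReC m2_ge0.
  by exists (KH (Kernel herm pos)), (kphi (Kernel herm pos) tt); rewrite kphiE.
have [|S [bS _ hS _]] := @ext_sub _ _ _ (fun a => am (cut A a) z) L (fun a => h (cut A a) *: e1) 1 ler01.
  move=> s; have [-> As] := sh_fcomb z s am_starA.
  have -> : fcomb (fun a => h (cut A a) *: e1) s = h (fcomb (cut A) s) *: e1.
    have h0 : h 0 = 0.
      have := lh 0 0 0 (calg0 cA) (calg0 cA); rewrite scaler0 addr0 mul0r add0r => _.
      by apply: m2_eq0; apply/eqP; rewrite eq_le m2_ge0 andbT; apply: le_trans (bh _ (calg0 cA)) _; rewrite (sh0 cA am_starA) n20.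
    rewrite /fcomb; elim: {As}s => [|[k a] s ih]; first by rewrite !big_nil h0 scale0r.
    have Ac : A (cut A a) by apply: cut_in.
    have [_ Af] := sh_fcomb z s am_starA.
    by rewrite !big_cons ih lh//= scalerDl scalerA.
  by rewrite n2Z mul1r (_ : n2 e1 = 1) ?mulr1 ?bh// /n2 e1E.
exists (dag S e1) => a Aa; rewrite -dagP//.
by have := hS a; rewrite cutE// => ->; rewrite ipZl e1E mulr1.
Qed.
(** Write [h b = inner (am b z) z']. Positivity of [b] at [z - z'] bounds the real part by the form
    at half of [z + z']. *)
Lemma posdom (h : op K -> R[i]) z : (forall k a b, A a -> A b -> h (k *: a + b) = k * h a + h b) ->
  (forall a, A a -> m2 (h a) <= n2 (am a z)) ->
  exists Z, forall b, A b -> hpos b -> Re (h b) <= Re (inner (am b Z) Z).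
Proof.
move=> lh bh; have [z' hz'] := am_riesz lh bh; exists ((2^-1)%:C%C *: (z + z')) => b Ab pb.
have pB := sh_pos cA am_starA Ab pb; have bB := sh_blin am_starA Ab; have sB := hpos_sa bB pB.
rewrite hz'// (linZ bB.1) ipZl ipZr JC.
have := hpos_Re (z - z') pB.
rewrite (linB bB.1) (linD bB.1) !ipDl !ipDr !ipNl !ipNr.
have -> : inner (am b z') z = (inner (am b z) z')^* by rewrite ipJ -(saP bB sB).
rewrite !reim; move: (Re _) (Re _) (Re _) => x y t; lra.
Qed.
End Dom.

Section Normal.
Variables (R : realType) (K G : hilbertType R) (A : set (op K)) (phi : op K -> op G).
Hypothesis cA : calg A.
Implicit Types (a b : op K) (z : Kinf K) (Z : Kinf G).

(** Continuity at 0 yields finitely many seminorms and a threshold [e]; homogeneity turns the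
    implication into an inequality, and the isometries [Wk] merge the seminorms into one vector. *)
Lemma uw_norm_bnd Z Z' : linear_on A phi -> (forall a, A a -> blin (phi a)) -> uw_continuous_on A phi ->
  exists z, forall a, A a -> m2 (inner (am (phi a) Z) Z') <= n2 (am a z).
Proof.
move=> lphi bphi uphi; have A0 := calg0 cA; have bA := calgW cA.
have p0 : phi 0 = 0.
  by have := lphi (-1) 0 0 A0 A0; rewrite scaler0 addr0 scaleN1r addNr.
have phiZ k a : A a -> phi (k *: a) = k *: phi a.
  by move=> Aa; have := lphi k a 0 Aa A0; rewrite !addr0 p0 addr0.
have amZ (L : hilbertType R) k (T : op L) X : blin T -> am (k *: T) X = k *: am T X.
  move=> bT; case: (am_star L) => _ h _ _.
  by have := h k T 0 bT (@blin0 _ L L); rewrite addr0 (sh0 (@calg_blins _ _) (am_star L)) addr0 => ->.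
(* Basic ultraweak neighbourhoods of 0 in [A], given by finitely many pairs of vectors and a
   radius. *)
pose D (i : seq (Kinf K * Kinf K) * R) := 0 < i.2.
pose B (i : seq (Kinf K * Kinf K) * R) : set (op K) :=
  [set a | A a /\ forall p, p \in i.1 -> m2 (inner (am a p.1) p.2) < i.2].
pose F := filter_from D B.
have B0 i : D i -> B i 0.
  move=> Di; split=> // p _; rewrite (sh0 (@calg_blins _ _) (am_star K)) ip0l m20 //.
have FF : ProperFilter F.
  apply: filter_from_proper => [|i /B0 h]; last by exists 0.
  apply: filter_from_filter; first by exists ([::], 1); rewrite /D /=.
  move=> i j Di Dj; exists (i.1 ++ j.1, Num.min i.2 j.2); first by rewrite /D /= lt_min; apply/andP.
  move=> a [Aa h]; split; split=> // p pi.
    by have := h p; rewrite mem_cat pi lt_min => /(_ isT)/andP[].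
  by have := h p; rewrite mem_cat pi orbT lt_min => /(_ isT)/andP[].
have FA : F A by exists ([::], 1); [rewrite /D /=|move=> a []].
have F0 : uw_cvg F 0.
  move=> x y /l2_co[X ->] /l2_co[Y ->]; rewrite uwE; last exact: blin0.
  rewrite (sh0 (@calg_blins _ _) (am_star K)) ip0l; apply/cvgrPdist_lt => e /posC[r r0 ->].
  exists ([:: (X, Y)], r ^+ 2); first by rewrite /D /= exprn_gt0.
  move=> a [Aa /(_ (X, Y))]; rewrite mem_head => /(_ isT) /= h.
  rewrite sub0r normrN uwE; last exact: bA.
  move: h; rewrite -ltcR -normC2 rmorphXn /= => h.
  by rewrite -(ltr_pXn2r (n := 2)) ?nnegrE ?normr_ge0 ?ler0c ?(ltW r0).
have := uphi F FF FA 0 A0 F0 (co Z) (co Z') (@co_l2 _ _ Z) (@co_l2 _ _ Z').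
rewrite p0 uwE; last exact: blin0.
rewrite (sh0 (@calg_blins _ _) (am_star G)) ip0l => /cvgrPdist_lt /(_ 1 ltr01)[[s e] /= e0 hs].
have {}e0 : 0 < e by [].
have {hs}hs a : A a -> (forall p, p \in s -> m2 (inner (am a p.1) p.2) < e) -> m2 (inner (am (phi a) Z) Z') < 1.
  move=> Aa h; have := hs a (conj Aa h); rewrite /= sub0r normrN uwE; last exact: bphi.
  by move=> h1; rewrite -ltcR -normC2 exprn_ilt1.
have [z hz] : exists z, forall a, A a -> forall p, p \in s -> m2 (inner (am a p.1) p.2) <= n2 (am a z).
  elim: s {hs} => [|[X Y] s [z hz]]; first by exists 0.
  exists (Wk 0 z + Wk 1 ((Num.sqrt (n2 Y))%:C%C *: X)) => a Aa p.
  have ba := bA _ Aa; have bam := am_blin ba.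
  rewrite (linD bam.1) !am_W// n2D Wk_ip mul0r Re0 mulr0 addr0 /n2 !Wk_ip !mul1r -!/(n2 _).
  rewrite (linZ bam.1) n2Z m2C sqr_sqrtr ?n2_ge0// in_cons => /orP[/eqP->|/(hz a Aa) h] /=.
    apply: le_trans (CS _ _) _; have := n2_ge0 (am a z).
    by rewrite mulrC lerDr.
  by apply: le_trans h _; rewrite lerDl mulr_ge0 ?n2_ge0.
exists ((Num.sqrt (2 / e))%:C%C *: z) => a Aa; have ba := bA _ Aa.
rewrite (linZ (am_blin ba).1) n2Z m2C sqr_sqrtr ?divr_ge0 ?(ltW e0)//.
set h := m2 _; set q := n2 _; rewrite leNgt; apply/negP => hq.
have h0 : 0 < h by apply: le_lt_trans hq; rewrite mulr_ge0 ?n2_ge0// divr_ge0 ?ltW.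
have q0 : 0 <= q by apply: n2_ge0.
(* Rescaling [a] by [t] brings the left side to exactly 1 while all seminorms of [t a] stay below
   [e], a contradiction. *)
pose t := Num.sqrt h^-1; have t2 : t ^+ 2 = h^-1 by rewrite sqr_sqrtr// invr_ge0 ltW.
have At : A (t%:C%C *: a) by apply: calgZ.
have := hs _ At; rewrite phiZ// amZ; last exact: bphi.
rewrite ipZl m2M m2C t2 -/h mulVf ?gt_eqF// ltxx => hf.
suff: false by []; apply: hf => p ps; rewrite amZ// ipZl m2M m2C t2.
apply: le_lt_trans (_ : h^-1 * q < e); first by rewrite ler_wpM2l ?hz// invr_ge0 ltW.
rewrite mulrC ltr_pdivrMr//; move: hq; rewrite mulrAC ltr_pdivrMr//.
by move: q0 h0 e0; clear; move: q h => x y *; lra.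
Qed.
Lemma amZD (L : hilbertType R) k (S T : op L) X : blin S -> blin T ->
  am (k *: S + T) X = k *: am S X + am T X.
Proof. by move=> bS bT; case: (am_star L) => _ h _ _; rewrite h. Qed.
Lemma uw_posdom Z : linear_on A phi -> (forall a, A a -> blin (phi a)) -> uw_continuous_on A phi ->
  exists z, forall b, A b -> hpos b -> Re (inner (am (phi b) Z) Z) <= Re (inner (am b z) z).
Proof.
move=> lphi bphi uphi; have [z hz] := uw_norm_bnd Z Z lphi bphi uphi.
apply: (posdom cA (h := fun b => inner (am (phi b) Z) Z)) hz => k a b Aa Ab.
by rewrite lphi// amZD ?ipDl ?ipZl//; apply: bphi.
Qed.
Lemma am_star_comp : star_hom_on A phi -> star_hom_on A (fun a => am (phi a)).
Proof.
move=> sP; case: (am_star G) => h1 h2 h3 h4; have b := sh_blin sP; split.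
- by move=> T /b/h1.
- by move=> k S T AS AT; rewrite (sh_lin sP)// h2//; apply: b.
- by move=> S T AS AT; rewrite (sh_comp sP)// h3//; apply: b.
- by move=> T AT; rewrite adjE (sh_dag sP)// h4//; apply: b.
Qed.
(** Domination passes to the amplification of [phi]; by [am_riesz] each ultraweak functional
    composed with [phi] is then an ultraweak functional on [A]. *)
Lemma dom_uw : star_hom_on A phi -> (forall v, dom A phi v) -> uw_continuous_on A phi.
Proof.
move=> sP hd F FF FA T AT cT x y /l2_co[X ->] /l2_co[Y ->].
have sQ := am_star_comp sP.
have [z hz] : dom A (fun a => am (phi a)) X.
  apply: (proj1 (totalP _) (@ei_total R G) _ (dom_subsp cA sQ) (dom_closed cA sQ)) => -[n v].
  have [z hz] := hd v; exists z => a Aa /=; rewrite amE; last exact: (sh_blin sP).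
  by rewrite /n2 eiE eqxx mul1r hz.
have lh k a b : A a -> A b -> inner (am (phi (k *: a + b)) X) Y = k * inner (am (phi a) X) Y + inner (am (phi b) X) Y.
  move=> Aa Ab; rewrite (sh_lin sP)// amZD ?ipDl ?ipZl//; exact: (sh_blin sP).
have [|z' hz'] := @am_riesz _ _ _ cA (fun a => inner (am (phi a) X) Y) ((Num.sqrt (n2 Y))%:C%C *: z) lh.
  move=> a Aa; apply: le_trans (CS _ _) _.
  rewrite (linZ (am_blin (calgW cA Aa)).1) n2Z m2C sqr_sqrtr ?n2_ge0// mulrC.
  by rewrite ler_wpM2l ?n2_ge0 ?hz.
set z1 := (_ *: z) in hz'.
have e S : A S -> uw_form (co X) (co Y) (phi S) = uw_form (co z1) (co z') S.
  by move=> AS; rewrite !uwE ?hz'//; [exact: (calgW cA)|exact: (sh_blin sP)].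
rewrite e//; have := cT _ _ (@co_l2 _ _ z1) (@co_l2 _ _ z').
move=> h B /h hB; have {}hB : F [set S | B (uw_form (co z1) (co z') S)] := hB.
suff h2 : F [set S | B (uw_form (co X) (co Y) (phi S))] by exact: h2.
by apply: filterS (filterI FA hB) => S [AS]; rewrite /= e.
Qed.
End Normal.

(** * Reduced words *)

Section Words.
Variables (R : realType) (K : hilbertType R) (N A : set (op K)) (E : op K -> op K) (u : op K).
Implicit Types (a b m x y w : op K).
Definition Ueps (e : bool) : op K := upow u e.
Local Notation U := Ueps.
(** On the image of [M] this is [E_B] followed by [theta] for [e = 1], and [E_theta] followed by the
    inverse of [theta] for [e = -1] ([F_true], [F_false]). Reducedness expressed by [E] and [u]
    alone frees the main argument from [B] and [theta]. *)
Definition Feps (e : bool) x := E (U (~~ e) \o x \o U e).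
Local Notation F := Feps.
Definition Eeps (e : bool) x := U e \o F e x \o U (~~ e).
Local Notation Ee := Eeps.
(* reduced words u^e x_1 u^{e_2} ... u^d of length n *)
Inductive RW : bool -> bool -> nat -> op K -> Prop :=
| RW1 e : RW e e 1 (U e)
| RWc e e' d n x w : A x -> (e != e' -> F e' x = 0) -> RW e' d n w ->
    RW e d n.+1 (U e \o x \o w).
Definition Wg x := A x \/
  exists m e d n w m', [/\ A m, A m', RW e d n w & x = m \o w \o m'].

(** What the main argument retains of an HNN extension; obtained in [hnn_HD]. *)
Record HD : Prop := {
  hd_ce : CE N A E;
  hd_uw : uw_continuous_on N E;
  hd_u : N u;
  hd_uu : u \o dag u = id;
  hd_uu' : dag u \o u = id;
  hd_E : forall e x, A x -> A (Ee e x);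
  hd_red : forall e d n w, RW e d n w -> E w = 0;
  hd_gen : forall P, von_neumann P -> A `<=` P -> P u -> N `<=` P
}.
Hypothesis hd : HD.
Let ce := hd_ce hd.
Let cN := ceN ce.
Let cA := ceA ce.
Lemma AN a : A a -> N a. Proof. exact: (ce_sub ce). Qed.
Lemma N_U e : N (U e).
Proof. by case: e => /=; [exact: (hd_u hd)|apply: (calgJ cN); exact: (hd_u hd)]. Qed.
Lemma U_blin e : blin (U e). Proof. exact/(calgW cN)/N_U. Qed.
Lemma UV e : U e \o U (~~ e) = id.
Proof. by case: e; [exact: (hd_uu hd)|exact: (hd_uu' hd)]. Qed.
Lemma UVx e (x : K) : U e (U (~~ e) x) = x. Proof. by have /(app_eq x) := UV e. Qed.
Lemma VUx e (x : K) : U (~~ e) (U e x) = x. Proof. by have := UVx (~~ e) x; rewrite negbK. Qed.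
Lemma U_dag e : dag (U e) = U (~~ e).
Proof. by case: e => //=; rewrite /upow adjE dagK//; exact: (U_blin true). Qed.
Lemma NC x y : N x -> N y -> N (x \o y). Proof. exact: (calgM cN). Qed.
Lemma NUxU e x : N x -> N (U (~~ e) \o x \o U e).
Proof. by move=> Nx; apply: NC; [apply: NC => //|]; apply: N_U. Qed.
Lemma F_in e x : A x -> A (F e x).
Proof. by move=> Ax; apply: (ce_in ce); apply/NUxU/AN. Qed.
Lemma FB e x y : A x -> A y -> F e (x - y) = F e x - F e y.
Proof.
move=> Ax Ay; rewrite /Feps -(ceB ce); try exact/NUxU/AN.
by congr E; apply/funext => z; rewrite /= !fctE (linB (U_blin _).1).
Qed.
Lemma F_Ee e x : A x -> F e (Ee e x) = F e x.
Proof.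
move=> Ax; rewrite {1}/Feps -[RHS](ce_fix ce (F_in e Ax)); congr E.
by apply/funext => z; rewrite /Eeps /= VUx VUx.
Qed.
Lemma F_sub e x : A x -> F e (x - Ee e x) = 0.
Proof. by move=> Ax; rewrite FB ?F_Ee ?subrr//; apply: (hd_E hd). Qed.
Lemma F_dag e x : A x -> F e (dag x) = dag (F e x).
Proof.
move=> Ax; have b := U_blin; have bx := calgW cA Ax.
have b2 := blinM (b (~~ e)) bx.
rewrite /Feps -(ce_dag ce); last exact/NUxU/AN.
by rewrite (dagM b2 (b e)) (dagM (b _) bx) !U_dag negbK compA.
Qed.
Lemma F_bim e d x : A d -> A (U (~~ e) \o d \o U e) -> A x ->
  F e (d \o x) = (U (~~ e) \o d \o U e) \o F e x.
Proof.
move=> Ad Ad' Ax; have A1 := calg1 cA.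
apply: (etrans _ (ce_bim ce Ad' (NUxU e (AN Ax)) A1)); congr E.
by apply/funext => z; rewrite /= UVx.
Qed.
Lemma RW_N e d n w : RW e d n w -> N w.
Proof.
elim=> [e'|e' e'' d' n' x w' Ax _ _ Nw]; first exact: N_U.
by apply: NC => //; apply: NC; [exact: N_U|exact: AN].
Qed.
Lemma RW_cat e d n w x e' d' n' w' : RW e d n w -> A x -> (d != e' -> F e' x = 0) ->
  RW e' d' n' w' -> RW e d' (n + n') (w \o x \o w').
Proof.
move=> h; elim: h => [e0|e0 e1 d0 n0 y w0 Ay cy hw ih] Ax cx hw'.
  by rewrite add1n; apply: RWc hw'.
have := RWc Ay cy (ih Ax cx hw'); by rewrite addSn.
Qed.
Lemma RW_star e d n w : RW e d n w -> RW (~~ d) (~~ e) n (dag w).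
Proof.
elim=> [e0|e0 e1 d0 n0 x w0 Ax cx hw ih]; first by rewrite U_dag; apply: RW1.
have b := U_blin; have bx := calgW cA Ax; have bw := calgW cN (RW_N hw).
rewrite (dagM (blinM (b _) bx) bw) (dagM (b _) bx) U_dag.
rewrite -addn1 compA; apply: RW_cat ih _ _ (RW1 _); first exact: (calgJ cA).
move=> ne; have e10 : e1 = ~~ e0 by move: ne; clear; case: e0 e1 => -[].
by rewrite F_dag// -e10 cx ?dag0// e10; case: (e0).
Qed.
Lemma E_word m e d n w m' : A m -> RW e d n w -> A m' -> E (m \o w \o m') = 0.
Proof.
move=> Am hw Am'; rewrite (ce_bim ce)//; last exact: RW_N hw.
by rewrite (hd_red hd hw); apply/funext => z; rewrite /= (lin0 (calgW cA Am).1).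
Qed.
Lemma Wg_N x : Wg x -> N x.
Proof.
case=> [/AN//|[m [e [d [n [w [m' [Am Am' hw ->]]]]]]]].
by apply: NC; [apply: NC|]; try exact: AN; exact: RW_N hw.
Qed.
Lemma Wg_A a x : A a -> Wg x -> Wg (a \o x).
Proof.
move=> Aa [Ax|[m [e [d [n [w [m' [Am Am' hw ->]]]]]]]].
  by left; apply: (calgM cA).
by right; exists (a \o m), e, d, n, w, m'; split=> //; apply: (calgM cA).
Qed.
(** Only [u^e] before a word in [u^-e] needs thought: the coefficient [m] between them splits into
    [m - Ee m], which keeps the product reduced, and [Ee m], through which the two letters
    cancel. *)
Lemma Wg_U e x : Wg x -> exists x1 x2, [/\ Wg x1, Wg x2 & U e \o x = x1 + x2].
Proof.
have A1 := calg1 cA; have A0 := calg0 cA.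
case=> [Ax|[m [e' [d [n [w [m' [Am Am' hw ->]]]]]]]].
  exists (U e \o x), 0; split; [|by left|by rewrite addr0].
  by right; exists id, e, e, 1%N, (U e), x; split=> //; apply: RW1.
have [ee|ne] := eqVneq e e'.
  exists (U e \o m \o w \o m'), 0; split; [|by left|by rewrite addr0].
  right; exists id, e, d, n.+1, (U e \o m \o w), m'; split=> //.
  by apply: RWc hw => //; rewrite ee eqxx.
have {}ne : e = ~~ e' by move: ne; clear; case: e e' => -[].
have AE := hd_E hd e' Am; have AF := F_in e' Am.
have wE : Wg (F e' m \o (U e \o w) \o m').
  case: hw AF ne => [e0|e0 e1 d0 n0 y w0 Ay cy hw] AF ->.
    have -> : U (~~ e0) \o U e0 = id by have := UV (~~ e0); rewrite negbK.
    by left; apply: (calgM cA).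
  right; exists (F e0 m \o y), e1, d0, n0, w0, m'; split=> //.
    exact: (calgM cA).
  by apply/funext => z /=; rewrite VUx.
exists (U e \o (m - Ee e' m) \o w \o m'), (F e' m \o (U e \o w) \o m'); split=> //.
  right; exists id, e, d, n.+1, (U e \o (m - Ee e' m) \o w), m'; split=> //.
  apply: RWc hw; first exact: (calgB cA).
  by move=> _; apply: F_sub.
apply/funext => z; rewrite /= !fctE -[LHS](_ : U e (m (w (m' z)) - Ee e' m (w (m' z)) + Ee e' m (w (m' z))) = _).
  by rewrite (linD (U_blin e).1); congr (_ + _); rewrite /Eeps /= ne VUx.
by rewrite subrK.
Qed.

Lemma bicomm_vn (S : set (op K)) : (forall x, S x -> blin x) -> (forall x, S x -> S (dag x)) ->
  von_neumann (commutant (commutant S)).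
Proof.
move=> bS dS; have cS := calg_commutant bS dS.
have bS' x : commutant S x -> blin x by exact: (calgW cS).
have cSS := calg_commutant bS' (calgJ cS).
split=> [T /(calgW cSS)/bounded_opP//|T /(calgJ cSS)//|].
have inc (B : set (op K)) : (forall x, B x -> blin x) -> B `<=` commutant (commutant B).
  by move=> bB x Bx; split=> [|y [_ hy]]; [apply/bounded_opP/bB|rewrite hy].
apply/seteqP; split; last by apply: inc => x /(calgW cSS).
move=> T [bT hT]; split=> // y hy; apply: hT; apply: inc hy => x; exact: bS'.
Qed.
Definition Gs : set (op K) := [set x | A x \/ exists e, x = U e].
Lemma Gs_blin x : Gs x -> blin x.
Proof. by case=> [/(calgW cA)//|[e ->]]; apply: U_blin. Qed.
Lemma Gs_dag x : Gs x -> Gs (dag x).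
Proof.
case=> [/(calgJ cA) h|[e ->]]; first by left.
by right; exists (~~ e); rewrite U_dag.
Qed.
Lemma N_gen x T : N x -> commutant Gs T -> x \o T = T \o x.
Proof.
move=> Nx hT; have inc : Gs `<=` commutant (commutant Gs).
  by move=> y Gy; split=> [|S [_ hS]]; [exact/bounded_opP/Gs_blin|rewrite hS].
have [] : commutant (commutant Gs) x; last by move=> _; apply.
apply: (hd_gen hd) Nx; first exact: (bicomm_vn Gs_blin Gs_dag).
  by move=> a Aa; apply: inc; left.
by apply: inc; right; exists true.
Qed.
(** Each matrix entry of [T] commutes with the generators, so [N_gen] applies entry by entry. *)
Lemma am_gen x T : N x -> blin T -> (forall y, Gs y -> am y \o T = T \o am y) -> am x \o T = T \o am x.
Proof.
move=> Nx bT hT; have bx := calgW cN Nx; have bam := am_blin bx.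
apply: ei_op => [||j k]; try exact: blinM.
apply: (total_vec (@ei_total R K)) => -[i l] /=; rewrite amE//.
have bi := ei_blin K i; have bj := ei_blin K j; have bd := blinJ bi.
have bTj := blinM bT bj.
have hc : commutant Gs (dag (@ei R K i) \o (T \o @ei R K j)).
  split; first exact/bounded_opP/blinM.
  move=> y Gy; have by_ := Gs_blin Gy; apply/funext => v; apply: ip_ext => t /=.
  have /(app_eq (ei j v)) /= h := hT y Gy.
  have bdy := blinJ by_; rewrite amE// in h; rewrite -h (dagPr bi) (dagP (am_blin by_)).
  by rewrite -am_dag// amE// [RHS](dagP by_) (dagPr bi).
have /(app_eq k) /= e := N_gen Nx hc.
have bdx := blinJ bx.
rewrite -[RHS](dagPr bi) -e [RHS](dagP bx) [RHS](dagPr bi) (dagP (am_blin bx)).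
by rewrite -am_dag// amE.
Qed.

(** The bicommutant argument at one vector of the amplification: the projection [P] onto the closed
    span of the [am w z], with [w] a word, commutes with [am] of the generators and hence with
    [am x], so that it fixes [am x z]. *)
Lemma Wg_dens x (z : Kinf K) (e : R) : N x -> 0 < e ->
  exists y, N y /\ (exists s : seq (R[i] * op K), (forall p, p \in s -> Wg p.2) /\ y = \sum_(p <- s) p.1 *: p.2) /\ n2 (am (x - y) z) < e.
Proof.
move=> Nx e0; pose f y := am (cut Wg y) z.
have A1 := calg1 cA; have A0 := calg0 cA.
have Wc y : Wg (cut Wg y) by rewrite /cut; case: asboolP => // _; left.
have [P [bP sP PP Pf Pz]] := sub_proj f.
have PW y : Wg y -> P (am y z) = am y z by move=> Wy; have := Pf y; rewrite /f cutE.
have inv y v : Gs y -> P (am y (P v)) = am y (P v).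
  move=> Gy; have by_ := Gs_blin Gy; have bam := am_blin by_.
  suff /(app_eq v) /subr0_eq : (P \o am y \o P) - (am y \o P) = 0 by [].
  apply: (@sub_zero _ _ _ f) => [|b|w hw].
  - have b1 := blinM bP bam; exact: blinB (blinM b1 bP) (blinM bam bP).
  - rewrite !fctE /= Pf /f.
    have -> : am y (am (cut Wg b) z) = am (y \o cut Wg b) z.
      case: (am_star K) => _ _ h _; rewrite h//; exact: (calgW cN (Wg_N (Wc b))).
    case: Gy => [Ay|[d ->]]; first by rewrite PW ?subrr//; apply: Wg_A.
    have [x1 [x2 [W1 W2 ->]]] := Wg_U d (Wc b).
    have b1 := calgW cN (Wg_N W1); have b2 := calgW cN (Wg_N W2).
    have -> : x1 + x2 = 1 *: x1 + x2 by rewrite scale1r.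
    by rewrite amZD// scale1r (linD bP.1) !PW// subrr.
  - by rewrite !fctE /= (Pz w hw) (lin0 bam.1) (lin0 bP.1) subrr.
have com y : Gs y -> am y \o P = P \o am y.
  move=> Gy; have by_ := Gs_blin Gy; have bam := am_blin by_.
  apply/funext => v; apply: ip_ext => w /=; rewrite [RHS](saP bP sP) [RHS](dagP bam) -am_dag//.
  rewrite -(inv _ w (Gs_dag Gy)) -(saP bP sP) am_dag// -(dagP bam) -(saP bP sP).
  by rewrite inv.
have Px : P (am x z) = am x z.
  have /(app_eq z) /= <- := am_gen Nx bP com.
  have W1 : Wg id by left.
  by have := PW _ W1; rewrite am_id => ->.
have [y Sy hy] := proj_exists (am x z) (closure_subsp (fcomb_subsp f)) (@closure_hclosed _ _ _).
have Py : P y = y.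
  have bD : blin (P - id) by apply: blinB => //; apply: blin_id.
  apply/subr0_eq; apply: (preim_closed bD (@zero_hclosed _ _)) => d d0; have [_ [s _ <-] hs] := Sy _ d0.
  exists (fcomb f s) => //; rewrite /= fctE (lin_fcomb f s bP.1) (eq_fcomb s Pf) subrr //.
have yE : am x z = y.
  rewrite -Px -[X in P X](subrK y) (linD bP.1) Py Pz ?add0r// => b.
  apply: hy => d d0; exists (f b); last by rewrite subrr n20.
  by exists [:: (1, b)] => //; apply: fcomb1.
have [_ [s _ <-] hs] := Sy _ e0.
have [fs Ns] : am (fcomb (cut Wg) s) z = fcomb f s /\ N (fcomb (cut Wg) s).
  rewrite /fcomb; elim: {hs}s => [|[k b] s [ih1 ih2]].
    by rewrite !big_nil (sh0 (@calg_blins _ _) (am_star K)); split=> //; apply: calg0.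
  have Nb := Wg_N (Wc b); rewrite !big_cons amZD; try exact: (calgW cN).
  by rewrite ih1; split=> //; apply: (calg_ZD cN).
exists (fcomb (cut Wg) s); split=> //; split.
  exists [seq (p.1, cut Wg p.2) | p <- s]; split=> [_ /mapP[p _ ->]|].
    exact: Wc.
  by rewrite big_map.
have -> : am (x - fcomb (cut Wg) s) z = am x z - fcomb f s.
  have -> : x - fcomb (cut Wg) s = (-1) *: fcomb (cut Wg) s + x by rewrite scaleN1r addrC.
  by rewrite amZD// ?fs ?scaleN1r 1?addrC//; exact: (calgW cN).
by rewrite yE.
Qed.
End Words.

(** Domination speaks of elements [a^* a]; a positive [b] is of this form up to a scalar [e]. *)
Lemma dom_pos (R : realType) (K G : hilbertType R) (A : set (op K)) (phi : op K -> op G) v z b :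
  calg A -> star_hom_on A phi -> (forall a, A a -> n2 (phi a v) <= n2 (am a z)) -> A b -> hpos b ->
  Re (inner (phi b v) v) <= Re (inner (am b z) z).
Proof.
move=> cA sP h Ab pb; apply: le_eps => e e0.
have d0 : 0 < e / (1 + n2 z) by rewrite divr_gt0//; have := n2_ge0 z; lra.
have [s [As ps ss _]] := sqrt_eps cA Ab pb d0.
have bs := calgW cA As; have sa := hpos_sa bs ps; have A1 := calg1 cA.
have Ae : A ((e / (1 + n2 z))%:C%C *: id) by apply: calgZ.
have key (L : hilbertType R) (psi : op K -> op L) w : star_hom_on A psi ->
    n2 (psi s w) = Re (inner (psi b w) w) + e / (1 + n2 z) * n2 (psi id w).
  move=> sp; rewrite /n2 -(sh_sq cA sp w As) sa ss (shD sp Ab Ae) (shZ cA sp _ A1).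
  by rewrite ipDl ipZl (sh_id_n2 cA sp) !reim mul0r subr0.
have := h s As; rewrite (key _ _ _ sP) (key _ _ _ (am_starA cA)) am_id.
have := n2_ge0 (phi id v); have := n2_ge0 z => z0 p0.
have : e / (1 + n2 z) * n2 z <= e by rewrite mulrAC ler_pdivrMr ?ler_pM2l//; lra.
have : 0 <= e / (1 + n2 z) * n2 (phi id v) by rewrite mulr_ge0// ltW.
move: (Re _) (Re _) (_ * n2 z) (_ * n2 (phi _ _)) => *; lra.
Qed.

Section TS.
Variables (R : realType) (K : hilbertType R) (A : set (op K)) (E : op K -> op K) (u : op K).
Local Notation F := (Feps E u).
Local Notation Ee := (Eeps E u).
(* the relations between A, u and the projections onto words starting with
   u^e; p e o ups e creates a letter *)
Record TS (G : hilbertType R) (Pi : op K -> op G) (ups p : bool -> op G) : Prop := {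
  ts_star : star_hom_on A Pi;
  ts_1 : Pi id = id;
  ts_blin : forall e, blin (ups e);
  ts_dag : forall e, dag (ups e) = ups (~~ e);
  ts_inv : forall e, ups e \o ups (~~ e) = id;
  ts_cov : forall e a, A a -> Pi (Ee e a) = ups e \o Pi (F e a) \o ups (~~ e);
  ts_pblin : forall e, blin (p e);
  ts_psa : forall e, dag (p e) = p e;
  ts_pp : forall e, p e \o p e = p e;
  ts_r1 : forall e v, ups e (v - p (~~ e) v) = p e (ups e v);
  ts_r2 : forall e m v, A m -> p e (Pi m (p e v)) = Pi (Ee e m) (p e v);
  ts_r3 : forall e m v, A m -> p (~~ e) (Pi m (p e v)) = 0
}.
End TS.

Section IndTotal.
Variables (R : realType) (K : hilbertType R) (N A : set (op K)) (E : op K -> op K) (u : op K).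
Hypothesis hd : HD N A E u.
Let ce := hd_ce hd.
Let cN := ceN ce.
Let cA := ceA ce.
Local Notation Wg := (Wg A E u).
Implicit Types (a b m x y w : op K).
Variables (G : hilbertType R) (Pi : op K -> op G).
Hypotheses (sA : star_hom_on A Pi) (Pi1 : Pi id = id) (dA : forall v, dom A Pi v).
Local Notation I0 := (Ind ce sA Pi1).
Local Notation t0 := (tau ce sA Pi1).
(** Normality of [E] turns a vector dominated over [A] into one whose functional [om] is dominated
    over [N]. *)
Lemma om_dom v : exists Z : Kinf K, forall y, N y -> Re (om E Pi (dag y \o y) v v) <= n2 (am y Z).
Proof.
have [z hz] := dA v; have [Z hZ] := uw_posdom cN z (ce_lin ce) (fun a Na => ce_blin ce Na) (hd_uw hd).
exists Z => y Ny; have by_ := calgW cN Ny; have Nyy := calgM cN (calgJ cN Ny) Ny.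
have pyy : hpos (dag y \o y) by move=> x /=; rewrite dagPr// ipC ler0c n2_ge0.
have AE := ce_in ce Nyy; rewrite /om.
apply: le_trans (dom_pos cA sA hz AE (ce_pos ce Nyy pyy)) _.
apply: le_trans (hZ _ Nyy pyy) _.
by have /= -> := sh_sq cN (am_starA cN) Z Ny.
Qed.
Lemma tau_B x y v : N x -> N y -> t0 (x - y) v = t0 x v - t0 y v.
Proof.
move=> Nx Ny; have := tauDl ce sA Pi1 (-1) v Ny Nx.
by rewrite !scaleN1r addrC => ->; rewrite addrC.
Qed.
(** Combinations of words need not be norm dense in [N]; they span the induced space because the
    domination of [v] makes [x |-> x (x) v] continuous enough for [Wg_dens]. *)
Lemma Wg_totalP (S : set I0) : subsp S -> hclosed S -> (forall x v, Wg x -> S (t0 x v)) -> forall z : I0, S z.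
Proof.
move=> sS cS hS; apply: (proj1 (totalP _) (@tau_total _ _ _ _ _ ce _ _ sA Pi1) S sS cS) => -[x v].
rewrite /tau2 /= tau_cut; have Nx := Ncut ce x; move: (cut N x) Nx => {}x Nx; apply: cS => e e0.
have [Z hZ] := om_dom v; have [y [Ny [[s [Ws ys]] hy]]] := Wg_dens hd Z Nx e0.
exists (t0 y v); last first.
  have Nxy : N (x - y) by apply: (calgB cN).
  by rewrite -tau_B// /n2 tauE//; apply: le_lt_trans (hZ _ Nxy) hy.
rewrite {}ys {Ny hy} in Ws *; elim: s Ws => [|[k w] s ih] Ws.
  by rewrite big_nil; have A0 := calg0 cA; apply: hS; left.
have Ww : Wg w by apply: (Ws (k, w)); rewrite mem_head.
have Ws' p : p \in s -> Wg p.2 by move=> ps; apply: (Ws p); rewrite in_cons ps orbT.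
have Nsum : N (\sum_(p <- s) p.1 *: p.2).
  rewrite big_seq; elim/big_rec: _ => [|p z /Ws' /(Wg_N hd) Np Nz]; first exact: (calg0 cN).
  exact: (calg_ZD cN).
rewrite big_cons tauDl//; last exact: (Wg_N hd).
by case: sS => _; apply; [apply: hS|apply: ih].
Qed.
Lemma ind_opW (L : hilbertType R) (S T : I0 -> L) : blin S -> blin T ->
  (forall x v, Wg x -> S (t0 x v) = T (t0 x v)) -> S = T.
Proof.
move=> bS bT h; apply/funext => y; apply/subr0_eq.
have bD := blinB bS bT.
apply: (Wg_totalP (preim_subsp bD.1 (@zero_subsp _ _)) (preim_closed bD (@zero_hclosed _ _))) => x v Wx.
by rewrite /= fctE h// subrr.
Qed.

End IndTotal.

(** * Projections onto words with a given first letter in [N (x)_A G] *)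

Section IndTS.
Variables (R : realType) (K : hilbertType R) (N A : set (op K)) (E : op K -> op K) (u : op K).
Hypothesis hd : HD N A E u.
Let ce := hd_ce hd.
Let cN := ceN ce.
Let cA := ceA ce.
Local Notation F := (Feps E u).
Local Notation Ee := (Eeps E u).
Local Notation U := (Ueps u).
Local Notation RW := (RW A E u).
Local Notation Wg := (Wg A E u).
Implicit Types (a b m x y w : op K).

(** The [x] for which [u^e x] is reduced as it stands, up to a right factor in [A]. *)
Definition TL (e : bool) x := A x \/
  exists m e' d n w m', [/\ A m, A m', RW e' d n w, (e != e' -> F e' m = 0) & x = m \o w \o m'].
Lemma TL_word e x : TL e x -> exists d n w m', [/\ RW e d n w, A m' & U e \o x = w \o m'].
Proof.
case=> [Ax|[m [e' [d [n [w [m' [Am Am' hw cm ->]]]]]]]].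
  by exists e, 1%N, (U e), x; split=> //; apply: RW1.
by exists d, n.+1, (U e \o m \o w), m'; split=> //; apply: RWc hw.
Qed.
Lemma TL_Wg e x : TL e x -> Wg x.
Proof.
case=> [Ax|[m [e' [d [n [w [m' [Am Am' hw cm ->]]]]]]]]; first by left.
by right; exists m, e', d, n, w, m'.
Qed.
Lemma TL_N e x : TL e x -> N x.
Proof. by move=> /TL_Wg; apply: (Wg_N hd). Qed.
Lemma Uneg (e e' : bool) : e != e' -> e' = ~~ e. Proof. by case: e e' => -[]. Qed.
Lemma F_FE e m x : A m -> A x -> F (~~ e) x = 0 -> F (~~ e) (F e m \o x) = 0.
Proof.
move=> Am Ax Fx; have AE := hd_E hd e Am.
rewrite (F_bim hd (F_in hd e Am)) ?Fx ?negbK//.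
by apply/funext => z; exact: (lin0 (calgW cA AE).1).
Qed.
Lemma TL_F e m x : A m -> TL e x -> TL e (F e m \o x).
Proof.
move=> Am; have AF := F_in hd e Am.
case=> [Ax|[m1 [e' [d [n [w [m' [Am1 Am' hw cm ->]]]]]]]]; first by left; apply: (calgM cA).
right; exists (F e m \o m1), e', d, n, w, m'; split=> //; first exact: (calgM cA).
by move=> ne; have := cm ne; rewrite (Uneg ne) => h; apply: F_FE.
Qed.
(** Separates the part of a word that a letter [u^e] lengthens from the part whose first letter it
    cancels; relation [ts_r1] rests on this. *)
Lemma TL_dec e x : Wg x -> exists x1 x2, [/\ TL e x1, TL (~~ e) x2 & x = x1 + (U (~~ e) \o x2)].
Proof.
have A0 := calg0 cA; have U0 : U (~~ e) \o (0 : op K) = 0 by apply/funext => z; exact: (lin0 (U_blin hd _).1).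
case=> [Ax|[m [e' [d [n [w [m' [Am Am' hw ->]]]]]]]].
  by exists x, 0; split; [left|left|rewrite U0 addr0].
have [ee|ne] := eqVneq e e'.
  exists (m \o w \o m'), 0; split; [|by left|by rewrite U0 addr0].
  by right; exists m, e', d, n, w, m'; split=> //; rewrite ee eqxx.
have e'E := Uneg ne; subst e'.
have AE := hd_E hd (~~ e) Am; have AF := F_in hd (~~ e) Am.
have [y Ty yE] : exists2 y, TL (~~ e) y & U (~~ e) \o y = Ee (~~ e) m \o w \o m'.
  move: e Am AF AE hw {ne U0} => e; move: (~~ e) => e0 Am AF AE hw.
  case: hw AF AE => {e0 d n w} [e0|e0 e1 d n x0 w Ax0 cx hw] AF AE.
    exists (F e0 m \o m'); first by left; apply: (calgM cA).
    by apply/funext => z; rewrite /Eeps /= (VUx hd).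
  exists ((F e0 m \o x0) \o w \o m'); last by apply/funext => z; rewrite /Eeps /= (VUx hd).
  right; exists (F e0 m \o x0), e1, d, n, w, m'; split=> //; first exact: (calgM cA).
  by move=> ne; have := cx ne; rewrite (Uneg ne) => h; apply: F_FE.
exists ((m - Ee (~~ e) m) \o w \o m'), y; split=> //.
  right; exists (m - Ee (~~ e) m), (~~ e), d, n, w, m'; split=> //; first exact: (calgB cA).
  by move=> _; apply: (F_sub hd).
by rewrite yE; apply/funext => z; rewrite /= !fctE subrK.
Qed.
(** The condition on [m] makes the whole product a reduced word between elements of [A], where [E]
    vanishes. *)
Lemma TL_orth2 d e m x y : TL d y -> TL e x -> A m -> (~~ d != e -> F e m = 0) ->
  E (dag (U d \o y) \o m \o (U e \o x)) = 0.
Proof.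
move=> /TL_word[d1 [n1 [w1 [m1 [h1 A1 ->]]]]] /TL_word[d2 [n2 [w2 [m2 [h2 A2 ->]]]]] Am cm.
have b1 := calgW cN (RW_N hd h1); rewrite (dagM b1 (calgW cA A1)).
have := E_word hd (calgJ cA A1) (RW_cat (RW_star hd h1) Am cm h2) A2.
by move=> h; apply: etrans h.
Qed.
Lemma TL_orth e x y : TL e x -> TL (~~ e) y -> E (dag (U (~~ e) \o y) \o x) = 0.
Proof.
move=> Tx Ty; have [d1 [n1 [w1 [m1 [h1 A1 ->]]]]] := TL_word Ty.
have b1 := calgW cN (RW_N hd h1); rewrite (dagM b1 (calgW cA A1)).
have hs := RW_star hd h1; rewrite negbK in hs; have Ad := calgJ cA A1.
case: Tx => [Ax|[m [e' [d [n [w [m' [Am Am' hw cm ->]]]]]]]].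
  exact: (E_word hd Ad hs Ax).
by have := E_word hd Ad (RW_cat hs Am cm hw) Am' => h; apply: etrans h.
Qed.

Variables (G : hilbertType R) (Pi : op K -> op G).
Hypotheses (sN : star_hom_on N Pi) (Pi1 : Pi id = id) (dN : forall v, dom N Pi v).
Lemma star_sub : star_hom_on A Pi.
Proof.
have AN := AN hd; case: sN => h1 h2 h3 h4; split=> [T /AN|k S T /AN hS /AN|S T /AN hS /AN|T /AN].
- exact: h1.
- exact: h2.
- exact: h3.
- exact: h4.
Qed.
Let sA := star_sub.
Let dA v : dom A Pi v.
Proof. by have [z hz] := dN v; exists z => a /(AN hd); apply: hz. Qed.
Local Notation I0 := (Ind ce sA Pi1).
Local Notation t0 := (tau ce sA Pi1).
Local Notation s0 := (@sig _ _ _ _ _ ce _ _ sA Pi1).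
Definition pfam e (p : op K * G) : I0 := t0 (U e \o cut (TL e) p.1) p.2.
Definition p0 e : op I0 := xget 0 [set P : op I0 | [/\ blin P, dag P = P, P \o P = P,
  forall q, P (pfam e q) = pfam e q & forall z : I0, (forall q, inner z (pfam e q) = 0) -> P z = 0]].
Lemma p0P e : [/\ blin (p0 e), dag (p0 e) = p0 e, p0 e \o p0 e = p0 e,
  forall q, p0 e (pfam e q) = pfam e q & forall z : I0, (forall q, inner z (pfam e q) = 0) -> p0 e z = 0].
Proof. by have := sub_proj (pfam e) => h; exact: (@xgetPex _ 0 [set P : op I0 | _] h). Qed.
Lemma TLc e x : TL e (cut (TL e) x).
Proof. by rewrite /cut; case: asboolP => // _; left; apply: (calg0 cA). Qed.
Lemma p0_blin e : blin (p0 e). Proof. by case: (p0P e). Qed.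
Lemma p0_in e x v : TL e x -> p0 e (t0 (U e \o x) v) = t0 (U e \o x) v.
Proof. by move=> Tx; case: (p0P e) => _ _ _ /(_ (x, v)); rewrite /pfam /= cutE. Qed.
Lemma p0_out e (y : I0) : (forall x v, TL e x -> inner y (t0 (U e \o x) v) = 0) -> p0 e y = 0.
Proof. by move=> h; case: (p0P e) => _ _ _ _; apply => -[x v]; apply/h/TLc. Qed.
Lemma N_Ux e x : TL e x -> N (U e \o x).
Proof. by move=> Tx; apply: (NC hd); [apply: (N_U hd)|apply: TL_N Tx]. Qed.
Lemma p0_orth e x v : TL (~~ e) x -> p0 e (t0 x v) = 0.
Proof.
move=> Tx; apply: p0_out => y w Ty; have Nx := TL_N Tx; have Ny := N_Ux Ty.
have := TL_orth Tx; rewrite negbK => /(_ _ Ty) h.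
by rewrite tauE// /om h (sh0 cA sA) ip0l.
Qed.
Lemma p0_orth2 d e m x v : TL e x -> A m -> (~~ d != e -> F e m = 0) -> p0 d (t0 (m \o (U e \o x)) v) = 0.
Proof.
move=> Tx Am cm; apply: p0_out => y w Ty; have Nx := N_Ux Tx; have Ny := N_Ux Ty.
have Nm := NC hd (AN hd Am) Nx.
rewrite tauE// /om (_ : E _ = 0) ?(sh0 cA sA) ?ip0l//.
by have h := TL_orth2 Ty Tx Am cm; apply: etrans h.
Qed.
Lemma p0_ext (L : hilbertType R) e (S T : I0 -> L) : blin S -> blin T ->
  (forall x v, TL e x -> S (t0 (U e \o x) v) = T (t0 (U e \o x) v)) -> forall y : I0, S (p0 e y) = T (p0 e y).
Proof.
move=> bS bT h y; have [bp sp pp pin pout] := p0P e.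
suff /(app_eq y) /subr0_eq : (S \o p0 e) - (T \o p0 e) = 0 by [].
apply: (@sub_zero _ _ _ (pfam e)) => [|[x v]|z hz]; first by apply: blinB; apply: blinM.
  by rewrite !fctE /= pin /pfam h ?subrr//; apply: TLc.
by rewrite !fctE /= pout// (lin0 bS.1) (lin0 bT.1) subrr.
Qed.
Lemma ind_TS : TS A E u s0 (fun e => s0 (U e)) p0.
Proof.
have sS := sig_star ce sA Pi1; have NU := N_U hd; have bU e := sig_blin ce sA Pi1 (NU e).
split.
- case: sS => h1 h2 h3 h4; have NA := AN hd.
  by split=> [T /NA|k S T /NA hS /NA|S T /NA hS /NA|T /NA]; [exact: h1|exact: h2|exact: h3|exact: h4].
- exact: sig1.
- exact: bU.
- by move=> e; rewrite -(sh_dag sS)// (U_dag hd).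
- by move=> e; rewrite -(sh_comp sS)// (UV hd); apply: sig1.
- move=> e a Aa; have NF := AN hd (F_in hd e Aa); rewrite -(sh_comp sS)//.
  by rewrite -(sh_comp sS)//; apply: (NC hd).
- exact: p0_blin.
- by move=> e; case: (p0P e).
- by move=> e; case: (p0P e).
- move=> e v; have [bp sp pp pin pout] := p0P (~~ e); have [bp' sp' pp' pin' pout'] := p0P e.
  have b1 : blin (id - p0 (~~ e)) by apply: blinB => //; apply: blin_id.
  suff /(app_eq v) : s0 (U e) \o (id - p0 (~~ e)) = p0 e \o s0 (U e) by [].
  apply: (ind_opW dA) => [||x w Wx]; try exact: blinM.
  (* [p_-e] keeps exactly the part [u^-e x2], which [u^e] sends to [x2], orthogonal to the range of
     [p_e]; the part [x1] is carried into that range. *)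
  have [x1 [x2 [T1 T2 xE]]] := TL_dec e Wx; rewrite /= !fctE.
  have N1 := TL_N T1; have N2 := N_Ux T2.
  have tx : t0 x w = t0 x1 w + t0 (U (~~ e) \o x2) w.
    by have := tauDl ce sA Pi1 1 w N1 N2; rewrite !scale1r -xE.
  rewrite tx (linD bp.1) (p0_in _ T2) p0_orth ?negbK// add0r addrK.
  rewrite (linD (bU e).1) !sig_tau// (linD bp'.1) (p0_in _ T1).
  rewrite (_ : U e \o (U (~~ e) \o x2) = x2); last by apply/funext => z; rewrite /= (UVx hd).
  by rewrite (p0_orth _ T2) addr0.
- move=> e m v Am; have bp := p0_blin e; have NA := AN hd; have AE := hd_E hd e Am.
  have bm := sig_blin ce sA Pi1 (NA _ Am); have bE := sig_blin ce sA Pi1 (NA _ AE).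
  apply: (p0_ext (S := p0 e \o s0 m)) => [||x w Tx]; [exact: blinM|exact: bE|].
  have Nx := N_Ux Tx; have TF := TL_F Am Tx.
  have NE := NC hd (NA _ AE) Nx.
  have A0 : A (m - Ee e m) by apply: (calgB cA).
  have N0 := NC hd (NA _ A0) Nx.
  rewrite /= !sig_tau//; try exact: NA.
  (* [Ee e m] moves past the letter as [F e m] and stays in the range of [p_e]; [m - Ee e m] sends
     [u^e x] to something orthogonal to it. *)
  have -> : t0 (m \o (U e \o x)) w = t0 (Ee e m \o (U e \o x)) w + t0 ((m - Ee e m) \o (U e \o x)) w.
    have := tauDl ce sA Pi1 1 w NE N0; rewrite !scale1r => <-; congr tau.
    by apply/funext => z; rewrite /= !fctE addrC subrK.
  rewrite (linD bp.1) (p0_orth2 _ Tx A0) ?addr0; last by move=> _; apply: (F_sub hd).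
  have -> : Ee e m \o (U e \o x) = U e \o (F e m \o x) by apply/funext => z; rewrite /Eeps /= (VUx hd).
  exact: p0_in.
- move=> e m v Am; have NA := AN hd; have bm := sig_blin ce sA Pi1 (NA _ Am).
  apply: (p0_ext (S := p0 (~~ e) \o s0 m) (T := 0)) => [||x w Tx]; [|exact: blin0|].
    by apply: blinM => //; apply: p0_blin.
  rewrite /= sig_tau//; [|exact: NA|exact: N_Ux].
  by apply: p0_orth2 => //; rewrite negbK eqxx.
Qed.
Lemma p0_ind e T (y : I0) : Cm A Pi T -> p0 e (ind T y) = ind T (p0 e y) :> I0.
Proof.
have [bp sp pp pin pout] := p0P e.
have inv S z : Cm A Pi S -> p0 e (ind S (p0 e z)) = ind S (p0 e z) :> I0.
  move=> CS; have b := ind_blin ce sA Pi1 CS.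
  apply: (p0_ext (S := p0 e \o ind S)) => [||x w Tx]; [exact: blinM|by []|].
  by rewrite /= ind_tau// p0_in.
move=> CT; have Cd := calgJ (Cm_calg ce sA) CT; have b := ind_blin ce sA Pi1 CT.
apply: ip_ext => w; rewrite (saP bp sp) (dagP b) -ind_dag// -inv//.
by rewrite -(saP bp sp) ind_dag// -(dagP b) -(saP bp sp) inv.
Qed.
End IndTS.

(** * Extension of positive functionals *)

Section HahnBanach.
Variables (R : realType) (V : lmodType R[i]) (Dm Y : set V) (D : V -> R -> Prop) (g0 : V -> R).
Implicit Types (v w : V) (r c : R) (X : set (V * R)).
Definition rsub (S : set V) := S 0 /\ forall r v w, S v -> S w -> S (r%:C%C *: v + w).
Hypotheses (sDm : rsub Dm) (sY : rsub Y) (YD : Y `<=` Dm).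
Hypotheses (D0 : D 0 0) (DD : forall v w c d, D v c -> D w d -> D (v + w) (c + d)).
Hypotheses (DZ : forall r v c, 0 < r -> D v c -> D (r%:C%C *: v) (r * c)).
Hypotheses (Dex : forall v, Dm v -> exists c, D v c).
Hypotheses (g0lin : forall r v w, Y v -> Y w -> g0 (r%:C%C *: v + w) = r * g0 v + g0 w).
Hypotheses (g0D : forall v c, Y v -> D v c -> g0 v <= c).
Let Y0 : set (V * R) := [set p | Y p.1 /\ p.2 = g0 p.1].
(** [X] holds the graph points added to those of [g0]. Adjoining [Y0] inside the predicate makes the
    empty set admissible, as the union of the empty chain must be. *)
Definition hbP X := [/\ forall p, (X `|` Y0) p -> Dm p.1,
  forall r p q, (X `|` Y0) p -> (X `|` Y0) q -> (X `|` Y0) (r%:C%C *: p.1 + q.1, r * p.2 + q.2) &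
  forall p c, (X `|` Y0) p -> D p.1 c -> p.2 <= c].

Lemma hahn_banach : exists g : V -> R,
  [/\ forall r v w, Dm v -> Dm w -> g (r%:C%C *: v + w) = r * g v + g w,
      forall v, Y v -> g v = g0 v & forall v c, Dm v -> D v c -> g v <= c].
Proof.
have Y0P : hbP set0.
  rewrite /hbP set0U; split=> [p [/YD//]|r p q [Yp ->] [Yq ->]|p c [Yp ->]]; last exact: g0D.
  by split=> /=; [apply: sY.2|rewrite g0lin].
have [|X [[XD Xl Xd] Xmax]] := @Zorn_bigcup _ hbP.
  move=> F FP tF; have [->|/set0P[X0 FX0]] := eqVneq F set0; first by rewrite bigcup_set0.
  have UP p : ((\bigcup_(X in F) X) `|` Y0) p -> exists2 X, F X & (X `|` Y0) p.
    by case=> [[X FX Xp]|Yp]; [exists X => //; left|exists X0 => //; right].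
  have PU X p : F X -> (X `|` Y0) p -> ((\bigcup_(X in F) X) `|` Y0) p.
    by move=> FX [Xp|Yp]; [left; exists X|right].
  split=> [p /UP[X /FP[h _ _]]|r p q /UP[X FX Xp] /UP[X' FX' Xq]|p c /UP[X /FP[_ _ h]]]; [exact: h| |exact: h].
  have [X2 [F2 s1 s2]] : exists X2, [/\ F X2, X `<=` X2 & X' `<=` X2].
    by have [h|h] := tF _ _ FX FX'; [exists X'|exists X]; split=> // ?.
  have lift (B : set (V * R)) t : B `<=` X2 -> (B `|` Y0) t -> (X2 `|` Y0) t.
    by move=> h [/h ?|?]; [left|right].
  by apply: (PU X2) => //; case: (FP _ F2) => _ h _; apply: h; [apply: lift Xp|apply: lift Xq].
set Z := X `|` Y0 in XD Xl Xd.
have Z0 : Z (0, 0).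
  by right; split=> /=; [exact: sY.1|have := g0lin 1 sY.1 sY.1; rewrite scaler0 addr0 mul1r; lra].
have ZZ r p : Z p -> Z (r%:C%C *: p.1, r * p.2).
  by move=> Zp; have := Xl r _ _ Zp Z0; rewrite /= !addr0.
have tot v : Dm v -> exists a, Z (v, a).
  move=> Dv; have [//|nv] := pselect (exists a, Z (v, a)); exfalso.
  have Dl r w : Dm w -> Dm (r%:C%C *: v + w) by move=> Dw; apply: sDm.2.
  pose S : set R := [set b | exists w a c, [/\ Z (w, a), D (w - v) c & b = a - c]].
  (* Lower bounds [a - c] for the value at [v] lie below the upper bounds; the supremum [al] of the
     former will be the value. *)
  have key w a c w' a' c' t : Z (w, a) -> D (w - v) c -> Z (w', a') -> D (w' + t%:C%C *: v) c' -> 0 < t ->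
      a - c <= (c' - a') / t.
    move=> Zw Dw Zw' Dw' t0; rewrite ler_pdivlMr//.
    have h1 := DD (DZ t0 Dw) Dw'; have h2 := Xl t _ _ Zw Zw'; have := Xd _ _ h2.
    rewrite /= => /(_ (t * c + c')) h3; have {}h3 : t * a + a' <= t * c + c'.
      by apply: h3; move: h1; rewrite scalerBr [w' + _]addrC addrA subrK.
    lra.
  have [c0 hc0] := Dex (Dl (-1) 0 sDm.1); have [c1 hc1] := Dex (Dl 1 0 sDm.1).
  rewrite addr0 in hc0 hc1.
  have S0 : S (0 - c0).
    by exists 0, 0, c0; split=> //; move: hc0; rewrite rmorphN rmorph1 scaleN1r sub0r.
  have Sub : ubound S ((c1 - 0) / 1).
    move=> _ [w [a [c [Zw Dw ->]]]]; have h : D (0 + 1%:C%C *: v) c1 by rewrite addrC.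
    exact: (key _ _ _ _ _ _ _ Zw Dw Z0 h ltr01).
  have hsS : has_sup S by split; [exists (0 - c0)|exists ((c1 - 0) / 1)].
  pose al := sup S.
  pose X2 : set (V * R) := [set p | exists w a t, [/\ Z (w, a), p.1 = w + t%:C%C *: v & p.2 = a + t * al]].
  have ZX2 : Z `<=` X2.
    by move=> -[w a] Zw; exists w, a, 0; rewrite /= rmorph0 scale0r mul0r !addr0.
  have X2Y : X2 `|` Y0 = X2 by apply/setUidPl => p Yp; apply: ZX2; right.
  apply: (Xmax X2).
    split; first by move=> p Xp; apply: ZX2; left.
    move=> h; apply: nv; exists al; left; apply: h; exists 0, 0, 1.
    by rewrite /= rmorph1 scale1r mul1r !add0r.
  rewrite /hbP X2Y; split.
  - move=> p [w [a [t [Zw -> _]]]]; rewrite addrC; apply: Dl; exact: (XD (w, a)).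
  - move=> r p q [w [a [t [Zw -> ->]]]] [w' [a' [t' [Zw' -> ->]]]].
    exists (r%:C%C *: w + w'), (r * a + a'), (r * t + t'); split; first exact: (Xl r _ _ Zw Zw').
      by rewrite /= rmorphD rmorphM scalerDl scalerDr scalerA addrACA.
    by rewrite /=; ring.
  - move=> p c [w [a [t [Zw -> ->]]]] hc.
    have [t0|t0|t0] := ltgtP t 0.
    + have s0 : 0 < (- t)^-1 by rewrite invr_gt0 oppr_gt0.
      have h : S ((- t)^-1 * a - (- t)^-1 * c).
        exists ((- t)^-1%:C%C *: w), ((- t)^-1 * a), ((- t)^-1 * c); split=> //; first exact: (ZZ _ (w, a)).
        have := DZ s0 hc; rewrite scalerDr scalerA -rmorphM (_ : (- t)^-1 * t = -1) ?rmorphN ?rmorph1 ?scaleN1r//.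
        by field; apply/eqP; lra.
      have := sup_upper_bound hsS h; rewrite -mulrBr ler_pdivrMl ?oppr_gt0// -/al; lra.
    + have : al <= (c - a) / t.
        apply: ge_sup; first by exists (0 - c0).
        by move=> _ [w1 [a1 [c1' [Z1 D1 ->]]]]; apply: key Z1 D1 Zw hc t0.
      by rewrite ler_pdivlMr//; lra.
    + rewrite t0 mul0r addr0; apply: (Xd (w, a)) => //.
      by move: hc; rewrite t0 rmorph0 scale0r addr0.
have uni v a b : Z (v, a) -> Z (v, b) -> a = b.
  have h x y : Z (v, x) -> Z (v, y) -> x <= y.
    move=> hx hy; have := Xd _ 0 (Xl (-1) _ _ hy hx); rewrite /= rmorphN rmorph1 scaleN1r addNr.
    by move=> /(_ D0); lra.
  by move=> ha hb; apply/eqP; rewrite eq_le !h.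
exists (fun v => xget 0 [set a | Z (v, a)]).
have gP v : Dm v -> Z (v, xget 0 [set a | Z (v, a)]).
  by move=> /tot[a Za]; exact: (xgetI 0 (Za : [set a | Z (v, a)] a)).
split=> [r v w Dv Dw|v Yv|v c Dv]; last exact: (Xd _ _ (gP _ Dv)).
  by apply: uni; [apply: gP; apply: sDm.2|apply: (Xl r _ _ (gP _ Dv) (gP _ Dw))].
by apply: uni; [apply/gP/YD|right].
Qed.
End HahnBanach.

Section PositiveExtension.
Variables (R : realType) (G : hilbertType R) (Y : set (op G)) (f : op G -> R[i]) (Fc : R).
Implicit Types (S T : op G).
Hypotheses (Y0 : Y 0) (YZD : forall k S T, Y S -> Y T -> Y (k *: S + T)) (Yb : forall T, Y T -> blin T).
Hypotheses (flin : forall k S T, Y S -> Y T -> f (k *: S + T) = k * f S + f T).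
Hypotheses (fle : forall T l, Y T -> (forall v, Re (inner (T v) v) <= l * n2 v) -> Re (f T) <= Fc * l).

(** The gauge of [T] is [Fc] times the upper end of its numerical range. Being dominated by it
    already gives positivity: for positive [T] the upper end for [- T] is at most 0. *)
Lemma pos_ext : exists h : op G -> R[i],
  [/\ forall k S T, blin S -> blin T -> h (k *: S + T) = k * h S + h T,
      forall T, blin T -> hpos T -> 0 <= h T & forall T, Y T -> h T = f T].
Proof.
pose Dm : set (op G) := [set T | blin T].
pose D T c := exists l : R, c = Fc * l /\ forall v, Re (inner (T v) v) <= l * n2 v.
have sDm : rsub Dm by split=> [|r v w]; [exact: blin0|exact: blinZD].
have sY : rsub Y by split=> // r v w; apply: YZD.
have [||||||g [glin gY gD]] := @hahn_banach R _ Dm Y D (fun T => Re (f T)) sDm sY Yb.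
- by exists 0; rewrite mulr0; split=> // v; rewrite ip0l mul0r.
- move=> S T _ _ [l [-> hl]] [m [-> hm]]; exists (l + m); split; first by rewrite mulrDr.
  by move=> v; rewrite fctE ipDl ReD mulrDl lerD.
- move=> r T _ r0 [l [-> hl]]; exists (r * l); split; first by rewrite mulrCA.
  by move=> v; rewrite fctE ipZl ReM ReC ImC mul0r subr0 -mulrA ler_pM2l.
- move=> T bT; have [c c0 nc] := blin_nb bT; exists (Fc * c), c; split=> // v.
  exact: bnd_form (ltW c0) nc.2.
- by move=> r S T YS YT; rewrite flin// ReD ReM ReC ImC mul0r subr0.
- by move=> T _ YT [l [-> hl]]; apply: fle.
have gN T : blin T -> g (- T) = - g T.
  move=> bT; have g00 : g 0 = 0 by have := glin 1 0 0 (@blin0 _ _ _) (@blin0 _ _ _); rewrite scaler0 addr0 mul1r; lra.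
  have := glin (-1) T 0 bT (@blin0 _ _ _); rewrite rmorphN rmorph1 scaleN1r addr0 g00 => ->; lra.
have gDd S T : blin S -> blin T -> g (S + T) = g S + g T.
  by move=> bS bT; have := glin 1 S T bS bT; rewrite rmorph1 scale1r mul1r.
have gZ r T : blin T -> g (r%:C%C *: T) = r * g T.
  move=> bT; have := glin r T 0 bT (@blin0 _ _ _); rewrite addr0 => ->.
  by have := gN 0 (@blin0 _ _ _); rewrite oppr0; lra.
pose j : R[i] := Complex 0 1.
have jE (k : R[i]) : k = (Re k)%:C%C + (Im k)%:C%C * j.
  by apply: eqC_ReIm; rewrite !reim /= ?mulr0 ?mulr1 ?mul0r ?subr0 ?addr0 ?add0r.
have jj : j * j = -1 by exact: sqr_i.
(* The usual complexification of a real linear functional. *)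
pose h T : R[i] := Complex (g T) (- g (j *: T)).
have bj T : blin T -> blin (j *: T) by apply: blinZ.
exists h; split.
- move=> k S T bS bT; rewrite /h.
  have e1 : k *: S = (Re k)%:C%C *: S + (Im k)%:C%C *: (j *: S) by rewrite scalerA -scalerDl -jE.
  have e2 : j *: (k *: S) = (Re k)%:C%C *: (j *: S) + (- Im k)%:C%C *: S.
    rewrite !scalerA -scalerDl; congr (_ *: _).
    transitivity (j * ((Re k)%:C%C + (Im k)%:C%C * j)); first by rewrite -jE.
    by rewrite mulrDr [j * (Re k)%:C%C]mulrC mulrCA jj mulrN1 rmorphN.
  have b1 : blin (k *: S) by apply: blinZ.
  rewrite gDd// scalerDr gDd; [|exact: bj|exact: bj].
  rewrite e2 e1 !gDd ?gZ//; try exact: bj; try exact/blinZ/bj; try exact: blinZ.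
  apply: eqC_ReIm; rewrite ?ReD ?ImD ?ReM ?ImM /=.
    by move: (g S) (g (j *: S)) (g T) => x y z; ring.
  by move: (g S) (g (j *: S)) (g (j *: T)) => x y z; ring.
- move=> T bT pT; have bjT := bj _ bT.
  have D1 S : (forall v, Re (inner (S v) v) <= 0) -> D S 0.
    by move=> hS; exists 0; rewrite mulr0; split=> // v; rewrite mul0r.
  have gp : 0 <= g T.
    have := gD (- T) 0 (blinN bT); rewrite gN// => hg.
    have : - g T <= 0; last lra.
    by apply/hg/D1 => v; rewrite fctE ipNl ReN; have := hpos_Re v pT; lra.
  have gj : g (j *: T) = 0.
    have Rz v : Re (inner ((j *: T) v) v) = 0.
      by rewrite fctE ipZl (hposP pT) ReM ImC mulr0 subr0 /= mul0r.
    have h1 : g (j *: T) <= 0 by apply: gD => //; apply: D1 => v; rewrite Rz.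
    have h2 : - g (j *: T) <= 0.
      rewrite -gN//; apply: gD; first exact: blinN.
      by apply: D1 => v; rewrite fctE ipNl ReN Rz oppr0.
    lra.
  by rewrite /h gj oppr0; apply: ge0ReC.
- move=> T YT; have YjT : Y (j *: T) by have := YZD j YT Y0; rewrite addr0.
  have f0 : f 0 = 0.
    have := flin 1 Y0 Y0; rewrite scaler0 addr0 mul1r => hh.
    by apply: (addrI (f 0)); rewrite addr0 -hh.
  apply: eqC_ReIm => /=; rewrite gY//.
  by have := flin j YT Y0; rewrite addr0 f0 addr0 => ->; rewrite ReM /j /= mul0r mul1r sub0r opprK.
Qed.
End PositiveExtension.

(** * The GNS construction over a subspace of operators *)

Section GNS.
Variables (R : realType) (G : hilbertType R) (h : op G -> R[i]) (D : set (op G)).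
Implicit Types (S T X Y : op G).
Hypotheses (hlin : forall k S T, blin S -> blin T -> h (k *: S + T) = k * h S + h T).
Hypothesis (hp : forall T, blin T -> hpos T -> 0 <= h T).
Hypotheses (D0 : D 0) (DZD : forall k S T, D S -> D T -> D (k *: S + T)) (Db : forall T, D T -> blin T).
Lemma h0 : h 0 = 0.
Proof.
have := hlin 1 (@blin0 _ G G) (@blin0 _ _ _); rewrite scaler0 addr0 mul1r => hh.
by apply: (addrI (h 0)); rewrite addr0 -hh.
Qed.
Lemma hD S T : blin S -> blin T -> h (S + T) = h S + h T.
Proof. by move=> bS bT; have := hlin 1 bS bT; rewrite scale1r mul1r. Qed.
Lemma hZ k S : blin S -> h (k *: S) = k * h S.
Proof. by move=> bS; have := hlin k bS (@blin0 _ _ _); rewrite !addr0 h0 addr0. Qed.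
Lemma hB S T : blin S -> blin T -> h (S - T) = h S - h T.
Proof. by move=> bS bT; rewrite hD//; [rewrite -scaleN1r hZ// mulN1r|apply: blinN]. Qed.
Lemma h_sa X : blin X -> dag X = X -> Im (h X) = 0.
Proof.
move=> bX sX; have [c c0 nc] := blin_nb bX.
have b1 : blin (c%:C%C *: @id G) by apply/blinZ/blin_id.
have p1 : hpos (@id G) by move=> v; rewrite ipC ler0c n2_ge0.
have : 0 <= h (X + c%:C%C *: id).
  apply: hp; first exact: blinD.
  apply: hposI => [||v]; first exact: blinD.
    by rewrite dagD// sX dagZ ?dag_id ?JC//; exact: blin_id.
  rewrite fctE ipDl ipZl ipC !reim mul0r subr0.
  have := bnd_form v nc.1 (T := - X); rewrite fctE ipNl ReN => h1.
  have : - Re (inner (X v) v) <= c * n2 v by apply: h1 => w; rewrite n2N; exact: nc.2.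
  lra.
rewrite hD// hZ; last exact: blin_id.
move=> /ger0_Im; rewrite ImD ImM ImC mul0r addr0 => e.
have := ger0_Im (hp (@blin_id _ _) p1) => i0; move: e; rewrite i0 mulr0 addr0 //.
Qed.
Lemma h_dag X : blin X -> h (dag X) = (h X)^*.
Proof.
move=> bX; have bd := blinJ bX; pose j : R[i] := Complex 0 1.
have jJ : j^* = - j by apply: eqC_ReIm; rewrite !reim /= ?oppr0.
have s1 : Im (h (X + dag X)) = 0.
  by apply: h_sa; [exact: blinD|rewrite dagD// dagK// addrC].
have s2 : Im (h (j *: (dag X - X))) = 0.
  have b1 := blinB bd bX; apply: h_sa; first exact: blinZ.
  by rewrite dagZ// dagB// dagK// jJ scaleNr -scalerN opprB.
move: s1 s2; rewrite hD// hZ; last exact: blinB.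
rewrite hB// ImD ImM ReD ReN ImD ImN /j /= mul0r add0r mul1r => s1 s2.
by apply: eqC_ReIm; rewrite ?ReJ ?ImJ; lra.
Qed.

(** Only the operators in [D] give vectors. [D] is no algebra; what acts on the resulting space is
    the set of [X] that map [D] into itself ([stab]). *)
Definition gk (S T : op G) := h (dag (cut D T) \o cut D S).
Lemma Dc S : D (cut D S). Proof. by rewrite /cut; case: asboolP. Qed.
Lemma gkherm S T : gk T S = (gk S T)^*.
Proof.
have bS := Db (Dc S); have bT := Db (Dc T); rewrite /gk -h_dag.
  by rewrite dagM ?dagK//; exact: blinJ.
by apply: blinM => //; apply: blinJ.
Qed.
Lemma h_sum (s : seq (R[i] * op G)) (g : op G -> op G) : (forall T, blin (g T)) ->
  h (\sum_(p <- s) p.1 *: g p.2) = \sum_(p <- s) p.1 * h (g p.2) /\ blin (\sum_(p <- s) p.1 *: g p.2).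
Proof.
move=> bg; elim: s => [|p s [ih1 ih2]]; first by rewrite !big_nil h0; split=> //; apply: blin0.
by rewrite !big_cons hlin// ih1; split=> //; apply: blinZD.
Qed.
Lemma gkE (s : seq (R[i] * op G)) : \sum_(p <- s) \sum_(q <- s) p.1 * q.1^* * gk p.2 q.2 =
  h (dag (fcomb (cut D) s) \o fcomb (cut D) s).
Proof.
have bc T : blin (cut D T) by apply/Db/Dc.
have [_ bX] := h_sum s bc; set X := fcomb _ s in bX *; have bd := blinJ bX.
have -> : dag X \o X = \sum_(p <- s) p.1 *: (dag X \o cut D p.2).
  apply/funext => v; rewrite /= {2}/X /fcomb !sumE (lin_sum bd.1).
  by apply: eq_bigr => p _; rewrite !fctE (linZ bd.1).
have [-> _] := h_sum s (fun T => blinM bd (bc T)).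
apply: eq_bigr => p _; rewrite -[h (dag X \o _)]conjCK -h_dag; last exact: blinM.
rewrite dagM// dagK//.
have -> : dag (cut D p.2) \o X = \sum_(q <- s) q.1 *: (dag (cut D p.2) \o cut D q.2).
  apply/funext => v; rewrite /= /X /fcomb !sumE (lin_sum (blinJ (bc _)).1).
  by apply: eq_bigr => q _; rewrite !fctE (linZ (blinJ (bc _)).1).
have [-> _] := h_sum s (fun T => blinM (blinJ (bc p.2)) (bc T)).
rewrite rmorph_sum mulr_sumr; apply: eq_bigr => q _.
by rewrite -mulrA rmorphM /= -[h (_ \o _)]/(gk q.2 p.2) -gkherm.
Qed.
Lemma gkpos (s : seq (R[i] * op G)) :
  0 <= Re (\sum_(p <- s) \sum_(q <- s) p.1 * q.1^* * gk p.2 q.2).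
Proof.
have [_ bX] := h_sum s (fun T => Db (Dc T)).
rewrite gkE; apply: ler_ReC (hp _ _); first by apply: blinM => //; apply: blinJ.
by move=> v /=; rewrite dagPr// ipC ler0c n2_ge0.
Qed.
Definition gker := Kernel gkherm gkpos.
Definition GN : hilbertType R := KH gker.
Definition vec T : GN := kphi gker T.
Lemma vec_total : total vec. Proof. exact: kphi_total. Qed.
Lemma vecE S T : D S -> D T -> inner (vec S) (vec T) = h (dag T \o S).
Proof. by move=> DS DT; rewrite kphiE /= /gk !cutE. Qed.
Lemma vec_cut T : vec T = vec (cut D T).
Proof. by apply: (total_vec vec_total) => S; rewrite !kphiE /= /gk (cutE (Dc T)). Qed.
Lemma vec_ext (L : hilbertType R) (S T : GN -> L) : blin S -> blin T ->
  (forall X, D X -> S (vec X) = T (vec X)) -> S = T.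
Proof. by move=> bS bT e; apply: (total_op vec_total) => // X; rewrite vec_cut; apply/e/Dc. Qed.
Lemma vec_lin k S T : D S -> D T -> vec (k *: S + T) = k *: vec S + vec T.
Proof.
move=> DS DT; have Dk := DZD k DS DT; apply: (total_vec vec_total) => X; rewrite (vec_cut X).
have DX := Dc X; move: (cut D X) DX => {}X DX; rewrite ipDl ipZl !vecE//.
have bd := blinJ (Db DX); have bS := Db DS; have bT := Db DT.
rewrite -hlin; [|exact: blinM|exact: blinM].
by congr h; apply/funext => v; rewrite /= !fctE bd.1.
Qed.
Lemma vec_fcomb s : fcomb vec s = vec (fcomb (cut D) s) /\ D (fcomb (cut D) s).
Proof.
rewrite /fcomb; elim: s => [|p s [ih1 ih2]].
  rewrite !big_nil; split=> //; apply: (addrI (vec 0)); rewrite addr0.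
  by have := vec_lin 1 D0 D0; rewrite scaler0 addr0 scale1r.
by rewrite !big_cons ih1 vec_cut -vec_lin//; try exact: Dc; split=> //; apply: DZD => //; apply: Dc.
Qed.
Definition stab X := blin X /\ forall T, D T -> D (X \o T).
Lemma lam_exists X c : stab X -> nb X c -> exists L : op GN, [/\ blin L, nb L c & forall T, D T -> L (vec T) = vec (X \o T)].
Proof.
move=> [bX sX] nX; have [c0 hc] := nX.
have [|L [bL nL hL]] := total_ext (psi := fun T => vec (X \o cut D T)) vec_total (sqr_ge0 c).
  move=> s; have [-> Ds] := vec_fcomb s.
  have -> : fcomb (fun T => vec (X \o cut D T)) s = vec (X \o fcomb (cut D) s).
    rewrite /fcomb; elim: s {Ds} => [|p s ih].
      rewrite !big_nil; have -> : X \o (0 : op G) = 0 by apply/funext => v; exact: (lin0 bX.1).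
      by have [e _] := vec_fcomb [::]; move: e; rewrite /fcomb !big_nil.
    have [_ Ds] := vec_fcomb s; have Dp := Dc p.2.
    rewrite !big_cons ih -vec_lin; [|exact: sX|exact: sX].
    by congr vec; apply/funext => v; rewrite /= !fctE bX.1.
  move: (fcomb _ s) Ds => T DT; have bT := Db DT; have DXT := sX _ DT.
  rewrite /n2 !vecE// -subr_ge0.
  pose B := (c ^+ 2)%:C%C *: id - (dag X \o X).
  have bXX : blin (dag X \o X) by apply: blinM => //; apply: blinJ.
  have b1 : blin ((c ^+ 2)%:C%C *: @id G) by apply/blinZ/blin_id.
  have bB : blin B by apply: blinB.
  have pB : hpos B.
    by move=> v; rewrite /B !fctE ipBl ipZl /= dagPr// !ipC -rmorphM -rmorphB ler0c subr_ge0; apply: hc.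
  have bdT := blinJ bT.
  have := ler_ReC (hp (blinM (blinM bdT bB) bT) (hpos_sandwich bB bT pB)).
  have -> : dag T \o B \o T = (c ^+ 2)%:C%C *: (dag T \o T) - (dag (X \o T) \o (X \o T)).
    apply/funext => v; rewrite dagM// /= !fctE /B !fctE /= (linB bdT.1) (linZ bdT.1) //.
  have bTT := blinM bdT bT; have bXT := blinM bX bT.
  rewrite hB ?hZ//; [|exact: blinZ|by apply: blinM => //; apply: blinJ].
  by rewrite Re0 ReD ReN ReM ReC ImC mul0r subr0.
by exists L; split=> // T DT; rewrite hL cutE.
Qed.
Definition lam X : op GN := xget 0 [set L : op GN | blin L /\ forall T, D T -> L (vec T) = vec (X \o T)].
Lemma lamP X : stab X -> blin (lam X) /\ forall T, D T -> lam X (vec T) = vec (X \o T).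
Proof.
move=> sX; apply: (@xgetPex _ 0 [set L : op GN | blin L /\ forall T, D T -> L (vec T) = vec (X \o T)]).
by have [c _ nc] := blin_nb sX.1; have [L [bL _ hL]] := lam_exists sX nc; exists L.
Qed.
Lemma lam_blin X : stab X -> blin (lam X). Proof. by move=> /lamP[]. Qed.
Lemma lamE X T : stab X -> D T -> lam X (vec T) = vec (X \o T).
Proof. by move=> /lamP[_ e]; exact: e. Qed.
Lemma lam_nb X c : stab X -> nb X c -> nb (lam X) c.
Proof.
move=> sX nX; have [L [bL nL hL]] := lam_exists sX nX.
suff -> : lam X = L by [].
by apply: vec_ext => //; [exact: lam_blin|move=> T DT; rewrite hL// lamE].
Qed.
Lemma stab_comp X Y : stab X -> stab Y -> stab (X \o Y).
Proof. by move=> [b1 s1] [b2 s2]; split=> [|T DT]; [exact: blinM|apply/s1/s2]. Qed.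
Lemma stab_id : stab id. Proof. by split=> //; apply: blin_id. Qed.
Lemma stab_ZD k X Y : stab X -> stab Y -> stab (k *: X + Y).
Proof. by move=> [b1 s1] [b2 s2]; split=> [|T DT]; [exact: blinZD|apply: DZD; [apply: s1|apply: s2]]. Qed.
Lemma lam_id : lam id = id.
Proof.
by apply: vec_ext => [||T DT]; [exact/lam_blin/stab_id|exact: blin_id|rewrite lamE//; exact: stab_id].
Qed.
Lemma lam_comp X Y : stab X -> stab Y -> lam (X \o Y) = lam X \o lam Y.
Proof.
move=> sX sY; have sXY := stab_comp sX sY; apply: vec_ext => [||T DT]; first exact: lam_blin.
  by apply: blinM; apply: lam_blin.
by rewrite /= !lamE//; apply: sY.2.
Qed.
Lemma lam_ZD k X Y : stab X -> stab Y -> lam (k *: X + Y) = k *: lam X + lam Y.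
Proof.
move=> sX sY; have sXY := stab_ZD k sX sY; apply: vec_ext => [||T DT]; first exact: lam_blin.
  by apply: blinZD; apply: lam_blin.
rewrite lamE// -[RHS]/(k *: lam X (vec T) + lam Y (vec T)) !lamE// -vec_lin//; [exact: sX.2|exact: sY.2].
Qed.
Lemma lam_dag X : stab X -> stab (dag X) -> lam (dag X) = dag (lam X).
Proof.
move=> sX sd; have bl := lam_blin sX; have bX := sX.1; apply: vec_ext => [||T DT]; first exact: lam_blin.
  exact: blinJ.
apply: (total_vec vec_total) => S; rewrite (vec_cut S); have DS := Dc S; move: (cut D S) DS => {}S DS.
rewrite dagPr// !lamE// !vecE//; [|exact: sX.2|exact: sd.2].
by rewrite dagM//; exact: Db.
Qed.
End GNS.

(** * Consequences of the relations between [A], [u] and the projections *)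

Section TSTheory.
Variables (R : realType) (K : hilbertType R) (N A : set (op K)) (E : op K -> op K) (u : op K).
Hypothesis hd : HD N A E u.
Let ce := hd_ce hd.
Let cN := ceN ce.
Let cA := ceA ce.
Local Notation F := (Feps E u).
Local Notation Ee := (Eeps E u).
Local Notation U := (Ueps u).
Variables (G : hilbertType R) (Pi : op K -> op G) (ups p : bool -> op G).
Hypothesis ts : TS A E u Pi ups p.
Implicit Types (v w : G).
Let sA := ts_star ts.
(* w is a reduced word, W its value in G, S the corresponding creation word *)
Inductive CW : bool -> bool -> nat -> op K -> op G -> op G -> Prop :=
| CW1 e : CW e e 1 (U e) (ups e) (p e \o ups e)
| CWc e e' d n (x w : op K) (W S : op G) : A x -> (e != e' -> F e' x = 0) -> CW e' d n w W S ->
    CW e d n.+1 (U e \o x \o w) (ups e \o Pi x \o W) (p e \o ups e \o Pi x \o S).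
Lemma CW_RW e d n (w : op K) W S : CW e d n w W S -> RW A E u e d n w.
Proof.
elim=> [e0|e0 e1 d0 n0 x w0 W0 S0 Ax cx _ ih]; [exact: RW1|exact: RWc cx ih].
Qed.
Lemma RW_CW e d n (w : op K) : RW A E u e d n w -> exists W S, CW e d n w W S.
Proof.
elim=> [e0|e0 e1 d0 n0 x w0 Ax cx _ [W [S h]]]; first by exists (ups e0), (p e0 \o ups e0); apply: CW1.
by exists (ups e0 \o Pi x \o W), (p e0 \o ups e0 \o Pi x \o S); apply: CWc h.
Qed.
Lemma Pi_blin a : A a -> blin (Pi a). Proof. exact: (sh_blin sA). Qed.
Lemma CW_blin e d n (w : op K) W S : CW e d n w W S -> blin W /\ blin S.
Proof.
have bu := ts_blin ts; have bp := ts_pblin ts.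
elim=> [e0|e0 e1 d0 n0 x w0 W0 S0 Ax _ _ [bW bS]]; first by split=> //; apply: blinM.
have bx := Pi_blin Ax; split.
  exact: (blinM (blinM (bu _) bx) bW).
exact: (blinM (blinM (blinM (bp _) (bu _)) bx) bS).
Qed.
Lemma ts_UV e v : ups e (ups (~~ e) v) = v. Proof. by have /(app_eq v) := ts_inv ts e. Qed.
Lemma ts_VU e v : ups (~~ e) (ups e v) = v. Proof. by have := ts_UV (~~ e) v; rewrite negbK. Qed.
Lemma ts_ppx e v : p e (p e v) = p e v. Proof. by have /(app_eq v) := ts_pp ts e. Qed.
Lemma ts_lstar e v : ups (~~ e) (p e v) = ups (~~ e) v - p (~~ e) (ups (~~ e) v).
Proof.
have := ts_r1 ts e (ups (~~ e) v); rewrite ts_UV => h.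
by have := congr1 (ups (~~ e)) h; rewrite ts_VU => <-.
Qed.
(** Annihilation after creation of one letter, with [m] between: [p_e m] acts as [Ee e m] on the
    range of [p_e], and [u^-e] turns this into [F e m]. What was created is [u^e] on the complement
    of [p_-e]. *)
Lemma ts_ld e m v : A m ->
  ups (~~ e) (p e (Pi m (p e (ups e v)))) = Pi (F e m) (v - p (~~ e) v).
Proof.
move=> Am; rewrite (ts_r2 ts)// (ts_cov ts)//= ts_VU -(ts_r1 ts) ts_VU //.
Qed.
Lemma ts_ld0 e m v : A m -> ups e (p (~~ e) (Pi m (p e (ups e v)))) = 0.
Proof. by move=> Am; rewrite (ts_r3 ts)// (lin0 (ts_blin ts _).1). Qed.
Lemma Ee_dag e m : A m -> Ee e (dag m) = dag (Ee e m).
Proof.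
move=> Am; have bU := U_blin hd; have bF := calgW cA (F_in hd e Am).
rewrite /Eeps (F_dag hd)// (dagM (blinM (bU _) bF) (bU _)).
by rewrite (dagM (bU _) bF) !(U_dag hd) negbK.
Qed.
(** [Ee] fixes [Ee e m], so [ts_r2] says that the range of [p_e] is invariant under it; the same
    holds for its adjoint. *)
Lemma ts_com e m v : A m -> p e (Pi (Ee e m) v) = Pi (Ee e m) (p e v).
Proof.
move=> Am; have bp := ts_pblin ts e; have sp := ts_psa ts e.
have inv a w : A a -> p e (Pi (Ee e a) (p e w)) = Pi (Ee e a) (p e w).
  move=> Aa; rewrite (ts_r2 ts); last exact: (hd_E hd).
  by congr (Pi _ _); rewrite {1}/Eeps (F_Ee hd).
have Ad := calgJ cA Am; have AE := hd_E hd e Am; have bE := Pi_blin AE.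
apply: ip_ext => w; rewrite (saP bp sp) (dagP bE) -(sh_dag sA)// -Ee_dag// -inv//.
by rewrite -(saP bp sp) Ee_dag// (sh_dag sA)// -(dagP bE) -(saP bp sp) inv.
Qed.
Lemma F_pos e b : A b -> hpos b -> hpos (F e b).
Proof.
move=> Ab pb; apply: (ce_pos ce); first exact/(NUxU hd)/(AN hd).
by move=> y /=; rewrite -(U_dag hd) (dagPr (U_blin hd e)).
Qed.
Lemma Ee_pos e b : A b -> hpos b -> hpos (Ee e b).
Proof.
move=> Ab pb x; have h := F_pos e Ab pb; rewrite /Eeps /= (dagP (U_blin hd e)) (U_dag hd); exact: h.
Qed.

(** Compressed by [p_e], the element [a^* a] becomes [Ee e (a^* a)], which is positive and commutes
    with [p_e]: its form at [p_e v] is at most its form at [v]. *)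
Lemma ts_domE e v a (z : Kinf K) : A a -> (forall b, A b -> hpos b -> Re (inner (Pi (Ee e b) v) v) <= Re (inner (am b z) z)) ->
  n2 (Pi a (p e v)) <= n2 (am a z).
Proof.
move=> Aa h; have Ad := calgJ cA Aa; have Ab := calgM cA Ad Aa.
have ba := calgW cA Aa; have bp := ts_pblin ts e; have sp := ts_psa ts e.
have pb : hpos (dag a \o a) by move=> x /=; rewrite dagPr// ipC ler0c n2_ge0.
have AE := hd_E hd e Ab; have bE := Pi_blin AE.
have pE : hpos (Pi (Ee e (dag a \o a))).
  by apply: (sh_pos cA sA) => //; apply: Ee_pos.
have -> : n2 (am a z) = Re (inner (am (dag a \o a) z) z) by rewrite (sh_sq cA (am_starA cA)).
apply: le_trans (h _ Ab pb).
rewrite /n2 -(sh_sq cA sA)// -(saP bp sp) (ts_r2 ts)// -ts_com//.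
have := hpos_Re (v - p e v) pE.
rewrite (linB bE.1) !ipBl !ipBr -!ts_com// [inner (p e _) v](saP bp sp) [inner (p e _) (p e v)](saP bp sp) ts_ppx.
by rewrite !reim; lra.
Qed.
Lemma ts_pos_dom v : dom A Pi v -> exists z, forall b, A b -> hpos b ->
  Re (inner (Pi b v) v) <= Re (inner (am b z) z).
Proof. by move=> [z hz]; exists z => b Ab pb; apply: dom_pos cA sA hz Ab pb. Qed.
(** [F e] is [E] after a conjugation by [u], hence normal like [E]; the dominating vector of [E] is
    moved by [u^e]. *)
Lemma ts_domF e z : exists Z : Kinf K, forall b, A b -> hpos b ->
  Re (inner (am (F e b) z) z) <= Re (inner (am b Z) Z).
Proof.
have [Z hZ] := uw_posdom cN z (ce_lin ce) (fun a Na => ce_blin ce Na) (hd_uw hd).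
have bU := U_blin hd; exists (am (U e) Z) => b Ab pb.
have Nb := NUxU hd e (AN hd Ab); have bb := calgW cA Ab.
have pU : hpos (U (~~ e) \o b \o U e) by move=> y /=; rewrite -(U_dag hd) dagPr.
apply: le_trans (hZ _ Nb pU) _.
have amc (x y : op K) : blin x -> blin y -> am (x \o y) = am x \o am y by case: (am_star K) => _ _ h _; apply: h.
rewrite amc; [|exact: blinM|exact: bU]; rewrite amc// -(U_dag hd) am_dag//=.
by rewrite dagPr//; apply/am_blin.
Qed.
(** With [dom_l] below, this is why the GNS space of an extension that need not be normal still
    carries a normal action of [A]. *)
Lemma dom_p e v : dom A Pi v -> dom A Pi (p e v).
Proof.
move=> /ts_pos_dom[z hz]; have [Z hZ] := ts_domF e (am (U (~~ e)) z); exists Z => a Aa.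
apply: ts_domE => // b Ab pb; have AE := hd_E hd e Ab; have AF := F_in hd e Ab.
have bU := U_blin hd; have bF := calgW cA AF.
have pE := Ee_pos e Ab pb.
apply: le_trans (hz _ AE pE) _; apply: le_trans (hZ _ Ab pb).
have amc (x y : op K) : blin x -> blin y -> am (x \o y) = am x \o am y by case: (am_star K) => _ _ h _; apply: h.
rewrite /Eeps amc; [|exact: blinM|exact: bU]; rewrite amc//=.
have := U_dag hd (~~ e); rewrite negbK => <-; rewrite am_dag//.
by rewrite (dagPr (am_blin (bU _))) -(U_dag hd e).
Qed.
Lemma dom_l e v : dom A Pi v -> dom A Pi (p e (ups e v)).
Proof.
move=> /ts_pos_dom[z hz]; have [Z hZ] := ts_domF e z; exists Z => a Aa.
apply: ts_domE => // b Ab pb; have AF := F_in hd e Ab.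
have pF := F_pos e Ab pb.
rewrite (ts_cov ts)//= ts_VU (dagP (ts_blin ts e)) (ts_dag ts) ts_VU.
exact: le_trans (hz _ AF pF) (hZ _ Ab pb).
Qed.
End TSTheory.

(* a representation of A and of words in u, commuting with one of C, whose
   vector state at Om is f *)
Record GM (R : realType) (K : hilbertType R) (N A : set (op K)) (E : op K -> op K) (u : op K)
    (C : choiceType) (cm : C -> C -> C) (cs : C -> C) (f : op K -> C -> R[i]) (Fc : R)
    (G0 : hilbertType R) (Phi0 : op K -> C -> op G0)
    (G : hilbertType R) (Pi : op K -> op G) (ups p : bool -> op G) (Rr : C -> op G) (Om : G) : Prop := {
  gm_ts : TS A E u Pi ups p;
  gm_dom : forall v, dom A Pi v;
  gm_rblin : forall c, blin (Rr c);
  gm_rmul : forall c d, Rr (cm c d) = Rr c \o Rr d;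
  gm_rstar : forall c, Rr (cs c) = dag (Rr c);
  gm_rPi : forall c a, A a -> Rr c \o Pi a = Pi a \o Rr c;
  gm_rups : forall c e, Rr c \o ups e = ups e \o Rr c;
  gm_rp : forall c e, Rr c \o p e = p e \o Rr c;
  gm_om : n2 Om = Fc;
  gm_word : forall c m e d n w W S m', A m -> A m' -> CW A E u Pi ups p e d n w W S ->
    inner (Pi m (W (Pi m' (Rr c Om)))) Om = f (m \o w \o m') c;
  gm_val : forall c a, A a -> inner (Pi a (Rr c Om)) Om = f a c;
  gm_nb : forall s M, inS A s -> nb (ev Phi0 s) M -> nb (ev (fun a c => Pi a \o Rr c) s) M;
  gm_zero : forall d, (forall x c, N x -> f (dag x \o x) (cm (cs (cm d c)) (cm d c)) = 0) -> Rr d = 0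
}.

(** * The functional on [N (x)_A G], its extension and the GNS space *)

Section Machine.
Variables (R : realType) (K : hilbertType R) (N A : set (op K)) (E : op K -> op K) (u : op K).
Hypothesis hd : HD N A E u.
Let ce := hd_ce hd.
Let cN := ceN ce.
Let cA := ceA ce.
Local Notation F := (Feps E u).
Local Notation Ee := (Eeps E u).
Local Notation U := (Ueps u).
Variables (G : hilbertType R) (Pi : op K -> op G).
Hypotheses (sN : star_hom_on N Pi) (Pi1 : Pi id = id) (dN : forall v, dom N Pi v).
Let sA := star_sub hd sN.
Local Notation I0 := (Ind ce sA Pi1).
Local Notation s0 := (@sig _ _ _ _ _ ce _ _ sA Pi1).
Local Notation p0 := (@p0 _ _ _ _ _ _ hd _ _ sN Pi1).
Local Notation ind := (@ind _ _ _ _ _ ce _ _ sA Pi1).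
Variables (C : choiceType) (cm : C -> C -> C) (cs : C -> C) (c1 : C) (rho : C -> op G).
Hypotheses (rb : forall c, blin (rho c)) (rm : forall c d, rho (cm c d) = rho c \o rho d).
Hypotheses (rs : forall c, rho (cs c) = dag (rho c)) (cs1 : cs c1 = c1).
Hypotheses (rl : forall c, rho c1 \o rho c = rho c) (rr : forall c, rho c \o rho c1 = rho c).
Hypothesis rc : forall c x, N x -> rho c \o Pi x = Pi x \o rho c.
Variables (f : op K -> C -> R[i]) (Fc : R).
Definition Phi0 x c : op I0 := s0 x \o ind (rho c).
Implicit Types (s t : seq (op K * C)).
Definition fsum s := \sum_(p <- s) f p.1 p.2.
Hypotheses (flin : forall c k x y, N x -> N y -> f (k *: x + y) c = k * f x c + f y c).
Hypotheses (f1 : f id c1 = Fc%:C%C) (fs : forall x c, N x -> f (dag x) (cs c) = (f x c)^*).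
Hypothesis fbnd : forall s M, inS N s -> nb (ev Phi0 s) M -> Re (fsum s) <= Fc * M.
Hypothesis fnorm : forall c, exists z : Kinf K, forall y, N y -> Re (f (dag y \o y) (cm (cs c) c)) <= n2 (am y z).

Lemma s0_blin x : N x -> blin (s0 x). Proof. exact: sig_blin. Qed.
Let sS : star_hom_on N s0 := sig_star ce sA Pi1.
Lemma CmR c : Cm A Pi (rho c).
Proof.
split; first exact/bounded_opP/rb.
by move=> _ [a Aa <-]; apply/rc/(AN hd).
Qed.
Local Notation rI c := (ind (rho c)).
Lemma rI_blin c : blin (rI c). Proof. exact/ind_blin/CmR. Qed.
Lemma rI_mul c d : rI (cm c d) = rI c \o rI d.
Proof. by rewrite rm ind_comp//; apply: CmR. Qed.
Lemma rI_dag c : rI (cs c) = dag (rI c).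
Proof. by rewrite rs ind_dag//; apply: CmR. Qed.
Lemma rI_l c : rI c1 \o rI c = rI c.
Proof. by rewrite -ind_comp ?rl//; apply: CmR. Qed.
Lemma rI_r c : rI c \o rI c1 = rI c.
Proof. by rewrite -ind_comp ?rr//; apply: CmR. Qed.
Lemma rI_s0 c x : N x -> rI c \o s0 x = s0 x \o rI c.
Proof. by move=> Nx; apply: ind_sig => //; apply: CmR. Qed.
Lemma rI_s0x c x (v : I0) : N x -> rI c (s0 x v) = s0 x (rI c v).
Proof. by move=> Nx; have /(app_eq v) := rI_s0 c Nx. Qed.
Lemma bP : birep cm cs N Phi0.
Proof.
split=> [x c Nx|x y c d Nx Ny|x c Nx].
- by apply: blinM; [exact: s0_blin|exact: rI_blin].
- rewrite /Phi0 rI_mul (sh_comp sS)//; apply/funext => v /=; by rewrite rI_s0x.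
- rewrite /Phi0 dagM -?(sh_dag sS)// ?rI_dag -?rI_dag ?rI_s0//; try exact: (calgJ cN).
    exact: s0_blin.
  exact: rI_blin.
Qed.
Definition seqZ (k : R[i]) s := [seq (k *: p.1, p.2) | p <- s].
Lemma inS_Z k s : inS N s -> inS N (seqZ k s).
Proof. by move=> h _ /mapP[p ps ->]; apply: (calgZ _ cN); apply: h. Qed.
Lemma inS_cat s t : inS N s -> inS N t -> inS N (s ++ t).
Proof. by move=> hs ht p; rewrite mem_cat => /orP[/hs|/ht]. Qed.
Lemma ev_cat s t : ev Phi0 (s ++ t) = ev Phi0 s + ev Phi0 t. Proof. exact: big_cat. Qed.
Lemma fsum_cat s t : fsum (s ++ t) = fsum s + fsum t. Proof. exact: big_cat. Qed.
Lemma ev_Z k s : inS N s -> ev Phi0 (seqZ k s) = k *: ev Phi0 s.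
Proof.
move=> hs; rewrite /ev big_map scaler_sumr; apply: eq_big_seq => p ps /=.
by rewrite /Phi0 (shZ cN sS)//; apply: hs.
Qed.
Lemma f0 c : f 0 c = 0.
Proof.
have N0 := calg0 cN; have := flin c 1 N0 N0; rewrite scaler0 addr0 mul1r => e.
by apply: (addrI (f 0 c)); rewrite addr0 -e.
Qed.
Lemma fZ k x c : N x -> f (k *: x) c = k * f x c.
Proof. by move=> Nx; have := flin c k Nx (calg0 cN); rewrite f0 !addr0. Qed.
Lemma fsum_Z k s : inS N s -> fsum (seqZ k s) = k * fsum s.
Proof.
by move=> hs; rewrite /fsum big_map mulr_sumr; apply: eq_big_seq => p ps /=; rewrite fZ//; apply: hs.
Qed.
Lemma fsum_star s : inS N s -> fsum (starS cs s) = (fsum s)^*.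
Proof.
move=> hs; rewrite /fsum big_map rmorph_sum; apply: eq_big_seq => p ps /=.
by rewrite fs//; apply: hs.
Qed.
(** [fbnd] compares [f] with norms, Hahn-Banach wants the upper end [l] of the numerical range. The
    real part of [s] plus [t] times the unit is positive of norm at most [l + t], and [f] takes on
    it the value [Re f(s) + t Fc]. *)
Lemma fsum_le s l : inS N s -> (forall v, Re (inner (ev Phi0 s v) v) <= l * n2 v) -> Re (fsum s) <= Fc * l.
Proof.
move=> hs hl; have bT := ev_blin bP hs; have [c0 c00 nc] := blin_nb bT.
(* This [t] is large enough for both the shifted element and [l + t] to be nonnegative. The unit is
   [rI c1], a projection that need not be the identity. *)
have hst := inS_star (cs := cs) cN hs; pose t := c0 + `|l|; have N1 := calg1 cN.
pose s2 := seqZ (2^-1)%:C%C (s ++ starS cs s) ++ [:: (t%:C%C *: id, c1)].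
have hs2 : inS N s2.
  apply: inS_cat; first exact/inS_Z/inS_cat.
  by move=> p; rewrite inE => /eqP -> /=; apply: (calgZ _ cN).
have dT := blinJ bT; set T := ev Phi0 s in hl bT nc dT.
have evE2 : ev Phi0 s2 = (2^-1)%:C%C *: (T + dag T) + t%:C%C *: rI c1.
  rewrite ev_cat ev_Z ?ev_cat ?(ev_star bP hs)//; last exact: inS_cat.
  by rewrite /ev big_seq1 /Phi0 /= (shZ cN sS)// sig1.
have fE : Re (fsum s2) = Re (fsum s) + t * Fc.
  rewrite fsum_cat fsum_Z ?fsum_cat ?fsum_star//; last exact: inS_cat.
  by rewrite [X in _ + X]/fsum big_seq1 /= fZ// f1 !reim; field.
have Tq v : T (rI c1 v) = T v.
  rewrite /T /ev !sumE; apply: eq_bigr => p _; rewrite /Phi0 /=.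
  by have /(app_eq v) /= -> := rI_r p.2.
have bq := rI_blin c1; have sq : dag (rI c1) = rI c1 by rewrite -rI_dag cs1.
have qq v : rI c1 (rI c1 v) = rI c1 v by have /(app_eq v) := rI_l c1.
have qT v : rI c1 (T v) = T v.
  rewrite /T /ev !sumE (lin_sum bq.1); apply: eq_big_seq => p ps; rewrite /Phi0 /= rI_s0x; last exact: hs.
  by have /(app_eq v) /= -> := rI_l p.2.
have form v : Re (inner (ev Phi0 s2 v) v) = Re (inner (T (rI c1 v)) (rI c1 v)) + t * n2 (rI c1 v).
  have -> : inner (T (rI c1 v)) (rI c1 v) = inner (T v) v by rewrite -(saP bq sq) qT Tq.
  rewrite evE2 !fctE ipDl !ipZl ipDl (dagPr bT) -[inner v (T v)]ipJ -qq (saP bq sq) -/(n2 _) !reim.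
  by rewrite /n2 !qq; field.
have qn v : n2 (rI c1 v) <= n2 v.
  have := n2_ge0 (v - rI c1 v); rewrite n2B.
  have -> : inner v (rI c1 v) = inner (rI c1 v) (rI c1 v) by rewrite (saP bq sq) qq.
  by rewrite -/(n2 _); lra.
have lt0 : 0 <= l + t by rewrite /t; have := ler_norm (- l); rewrite normrN; lra.
have b2 := ev_blin bP hs2.
have s2a : dag (ev Phi0 s2) = ev Phi0 s2.
  have b3 := blinD bT dT.
  rewrite evE2 (dagD (blinZ _ b3) (blinZ _ bq)) (dagZ _ b3) (dagZ _ bq) sq !JC (dagD bT dT) (dagK bT).
  by rewrite [dag T + T]addrC.
have pos : hpos (ev Phi0 s2).
  apply: hposI => // v; rewrite form; set w := rI c1 v.
  have := bnd_form w (ltW c00) (nbN nc).2; rewrite fctE ipNl ReN => h.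
  have := mulr_ge0 (normr_ge0 l) (n2_ge0 w); rewrite /t mulrDl; lra.
have := fbnd hs2 (conj lt0 (hpos_bnd b2 pos _)); rewrite fE mulrDr => h.
have {}h : Re (fsum s) + t * Fc <= Fc * l + Fc * t.
  apply: h => v; rewrite form; have := ler_wpM2l lt0 (qn v); have := hl (rI c1 v).
  rewrite (mulrDl l t (n2 (rI c1 v))); move: (Re _) (l * _) (t * _) (_ * n2 v) => *; lra.
by move: h; rewrite [t * Fc]mulrC; lra.
Qed.
Lemma fsum_uniq s t : inS N s -> inS N t -> ev Phi0 s = ev Phi0 t -> fsum s = fsum t.
Proof.
move=> hs ht e; apply/subr0_eq; apply: m2_eq0; apply/eqP; rewrite eq_le m2_ge0 andbT.
have hZ : inS N (seqZ (-1) t) by apply: inS_Z.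
(* This factor turns the difference into its squared modulus, to which [fsum_le] applies with
   [l = 0]. *)
pose k := (fsum s - fsum t)^*.
have hD := inS_cat hs hZ; have hK : inS N (seqZ k (s ++ seqZ (-1) t)) by apply: inS_Z.
have := fsum_le (l := 0) hK.
rewrite fsum_Z// fsum_cat fsum_Z// ev_Z// ev_cat ev_Z// e mulN1r scaleN1r subrr scaler0 mulr0 /k mulrC mulJ ReC.
by apply=> v; rewrite mul0r ip0l.
Qed.
Definition Ys : set (op I0) := [set T | exists2 s, inS N s & T = ev Phi0 s].
Definition fhat (T : op I0) : R[i] := fsum (xget [::] [set s | inS N s /\ T = ev Phi0 s]).
Lemma fhatE s : inS N s -> fhat (ev Phi0 s) = fsum s.
Proof.
move=> hs; rewrite /fhat.
have [h1 h2] := @xgetPex _ [::] [set t | inS N t /\ ev Phi0 s = ev Phi0 t] (ex_intro _ s (conj hs erefl)).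
exact: fsum_uniq.
Qed.
Lemma Ys_ZD k S T : Ys S -> Ys T -> Ys (k *: S + T).
Proof.
move=> [s hs ->] [t ht ->]; exists (seqZ k s ++ t); first by apply: inS_cat => //; apply: inS_Z.
by rewrite ev_cat ev_Z.
Qed.
Lemma hext : exists h : op I0 -> R[i], [/\ forall k S T, blin S -> blin T -> h (k *: S + T) = k * h S + h T,
  forall T, blin T -> hpos T -> 0 <= h T & forall x c, N x -> h (s0 x \o rI c) = f x c].
Proof.
have [||||h [h1 h2 h3]] := @pos_ext R _ Ys fhat Fc _ Ys_ZD.
- by exists [::] => //; rewrite /ev big_nil.
- by move=> T [s hs ->]; exact: (ev_blin bP hs).
- move=> k S T [s hs ->] [t ht ->]; have hZ : inS N (seqZ k s) by apply: inS_Z.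
  by rewrite -ev_Z// -ev_cat !fhatE ?fsum_cat ?fsum_Z//; apply: inS_cat.
- by move=> T l [s hs ->] hl; rewrite fhatE//; apply: fsum_le.
exists h; split=> // x c Nx; have hs : inS N [:: (x, c)] by move=> p; rewrite inE => /eqP ->.
have e : ev Phi0 [:: (x, c)] = s0 x \o rI c by rewrite /ev big_seq1.
rewrite -e h3; last by exists [:: (x, c)].
by rewrite fhatE// /fsum big_seq1.
Qed.

Section Extension.
Variable h : op I0 -> R[i].
Hypotheses (hlin : forall k S T, blin S -> blin T -> h (k *: S + T) = k * h S + h T).
Hypotheses (hp : forall T, blin T -> hpos T -> 0 <= h T) (hf : forall x c, N x -> h (s0 x \o rI c) = f x c).
Let ts0 := ind_TS hd sN Pi1 dN.
Let NU := N_U hd.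
Let NA := AN hd.
Let NC := NC hd.
(* creation and annihilation of the letter u^e *)
Definition lp e : op I0 := p0 e \o s0 (U e).
Definition ld e : op I0 := s0 (U (~~ e)) \o p0 e.
(** The left module that spans the GNS space. It starts from [N (.) C], where the extension is [f]
    and hence normal, and grows only by operations that preserve domination. [Dg1] is there to start
    the induction that shows stability under annihilation. *)
Inductive Dg : op I0 -> Prop :=
| Dg0 x c : N x -> Dg (s0 x \o rI c)
| Dg1 e x c : N x -> Dg (ld e \o (s0 x \o rI c))
| DgA a T : A a -> Dg T -> Dg (s0 a \o T)
| DgL e T : Dg T -> Dg (lp e \o T)
| DgZ k S T : Dg S -> Dg T -> Dg (k *: S + T).
Lemma p_blin e : blin (p0 e). Proof. exact: (ts_pblin ts0). Qed.
Lemma sU_blin e : blin (s0 (U e)). Proof. exact/s0_blin/NU. Qed.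
Lemma lp_blin e : blin (lp e). Proof. exact: (blinM (p_blin e) (sU_blin e)). Qed.
Lemma ld_blin e : blin (ld e). Proof. exact: (blinM (sU_blin _) (p_blin e)). Qed.
Lemma Dg_blin T : Dg T -> blin T.
Proof.
have b0 x c : N x -> blin (s0 x \o rI c) by move=> Nx; apply: blinM; [exact: s0_blin|exact: rI_blin].
elim=> [x c /b0//|e x c Nx|a S Aa _ b|e S _ b|k S S' _ bS _ bS'].
- exact: (blinM (ld_blin e) (b0 x c Nx)).
- exact: (blinM (s0_blin (NA Aa)) b).
- exact: (blinM (lp_blin e) b).
- exact: blinZD.
Qed.
Lemma Dg_0 : Dg 0.
Proof.
have -> : (0 : op I0) = s0 0 \o rI c1; last exact/Dg0/(calg0 cN).
by apply/funext => v; rewrite /= (sh0 cN sS).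
Qed.
Lemma Dg_B S T : Dg S -> Dg T -> Dg (S - T).
Proof. by move=> hS hT; have := DgZ (-1) hT hS; rewrite scaleN1r addrC. Qed.
Lemma ts_UV0 e (v : I0) : s0 (U e) (s0 (U (~~ e)) v) = v.
Proof. exact: (ts_UV ts0). Qed.
Lemma lpld e (v : I0) : lp e (ld e v) = p0 e v.
Proof. by rewrite /lp /ld /= ts_UV0 (ts_ppx ts0). Qed.
Lemma ldE e (v : I0) : ld e v = s0 (U (~~ e)) v - lp (~~ e) v.
Proof. exact: (ts_lstar ts0). Qed.
Lemma sU_E e (v : I0) : s0 (U e) v = lp e v + ld (~~ e) v.
Proof. by have := ldE (~~ e) v; rewrite negbK => ->; rewrite addrC subrK. Qed.
Lemma Dg_ldlp e m e' T : A m -> Dg T -> Dg (ld (~~ e') \o T) -> Dg (ld e \o s0 m \o lp e' \o T).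
Proof.
move=> Am hT hd'; have [ee|ne] := eqVneq e e'.
  subst e'; have -> : ld e \o s0 m \o lp e \o T = s0 (F e m) \o (T - (lp (~~ e) \o (ld (~~ e) \o T))).
    by apply/funext => v; rewrite /= [LHS](ts_ld ts0)// !fctE /= lpld.
  by apply: DgA; [exact: (F_in hd)|apply: Dg_B => //; apply: DgL].
have -> : ld e \o s0 m \o lp e' \o T = 0; last exact: Dg_0.
have {}ne : e = ~~ e' by move: ne; clear; case: e e' => -[].
subst e; apply/funext => v; rewrite /= /ld /lp /= (ts_r3 ts0)// (lin0 (sU_blin _).1) //.
Qed.
(** Annihilation is pushed to the right: against a creation it leaves an [F e m] or 0 ([Dg_ldlp]),
    and before another annihilation the latter is rewritten by [ldE] as [u^-e] minus a creation. *)
Lemma Dg_ldm T : Dg T -> forall e m, A m -> Dg (ld e \o s0 m \o T).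
Proof.
have e0 m x c : A m -> N x -> s0 m \o (s0 x \o rI c) = s0 (m \o x) \o rI c.
  by move=> /NA Nm Nx; rewrite (sh_comp sS).
have base e m x c : A m -> N x -> Dg (ld e \o s0 m \o (s0 x \o rI c)).
  move=> Am Nx; have := Dg1 e c (NC (NA Am) Nx); by rewrite -e0.
elim=> [x c Nx e m Am|e' x c Nx e m Am|a S Aa hS ih e m Am|e' S hS ih e m Am|k S S' hS ih hS' ih' e m Am].
- exact: base.
- have NUx := NC (NU (~~ e')) Nx.
  have -> : ld e \o s0 m \o (ld e' \o (s0 x \o rI c)) =
      (ld e \o s0 m \o (s0 (U (~~ e') \o x) \o rI c)) - (ld e \o s0 m \o lp (~~ e') \o (s0 x \o rI c)).
    apply/funext => v; rewrite /= (ldE e') (linB (s0_blin (NA Am)).1) (linB (ld_blin e).1) !fctE /=.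
    by have /(app_eq (rI c v)) /= -> := sh_comp sS (NU (~~ e')) Nx.
  apply: Dg_B; first exact: base.
  apply: Dg_ldlp => //; [exact: Dg0|rewrite negbK; exact: Dg1].
- by have := ih e _ (calgM cA Am Aa); rewrite (sh_comp sS)//; exact: NA.
- by apply: Dg_ldlp => //; have := ih (~~ e') id (calg1 cA); rewrite sig1.
- have -> : ld e \o s0 m \o (k *: S + S') = k *: (ld e \o s0 m \o S) + (ld e \o s0 m \o S').
    by apply/funext => v; rewrite /= !fctE (s0_blin (NA Am)).1 (ld_blin e).1.
  by apply: DgZ; [apply: ih|apply: ih'].
Qed.
Local Notation stab := (stab Dg).
Lemma st_a a : A a -> stab (s0 a).
Proof. by move=> Aa; split=> [|T]; [exact/s0_blin/NA|exact: DgA]. Qed.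
Lemma st_lp e : stab (lp e).
Proof. by split=> [|T]; [exact: lp_blin|exact: DgL]. Qed.
Lemma st_ld e : stab (ld e).
Proof.
split=> [|T hT]; first exact: ld_blin.
by have := Dg_ldm hT e (calg1 cA); rewrite sig1.
Qed.
Lemma st_p e : stab (p0 e).
Proof.
have -> : p0 e = lp e \o ld e by apply/funext => v; rewrite -lpld.
by apply: (stab_comp (st_lp e) (st_ld e)).
Qed.
Lemma st_U e : stab (s0 (U e)).
Proof.
have -> : s0 (U e) = 1 *: lp e + ld (~~ e).
  by rewrite scale1r; apply/funext => v; rewrite sU_E.
exact: (stab_ZD DgZ 1 (st_lp e) (st_ld (~~ e))).
Qed.
Lemma rp_com c e : rI c \o p0 e = p0 e \o rI c.
Proof. by apply/funext => v /=; rewrite p0_ind//; apply: CmR. Qed.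
Lemma rlp_com c e : rI c \o lp e = lp e \o rI c.
Proof. by apply/funext => v /=; have /(app_eq (s0 (U e) v)) /= -> := rp_com c e; rewrite rI_s0x. Qed.
Lemma rld_com c e : rI c \o ld e = ld e \o rI c.
Proof. by apply/funext => v /=; rewrite rI_s0x// /ld /=; have /(app_eq v) /= -> := rp_com c e. Qed.
Lemma st_r c : stab (rI c).
Proof.
split=> [|T]; first exact: rI_blin.
have e0 d x : N x -> rI c \o (s0 x \o rI d) = s0 x \o rI (cm c d).
  by move=> Nx; rewrite rI_mul; apply/funext => v /=; rewrite rI_s0x.
elim=> [x d Nx|e x d Nx|a S Aa hS ih|e S hS ih|k S S' hS ih hS' ih'].
- by rewrite e0//; apply: Dg0.
- rewrite -[_ \o _]/((rI c \o ld e) \o (s0 x \o rI d)) rld_com -[_ \o _]/(ld e \o (rI c \o (s0 x \o rI d))) e0//.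
  exact: Dg1.
- have -> : rI c \o (s0 a \o S) = s0 a \o (rI c \o S) by apply/funext => v /=; rewrite rI_s0x//; apply: NA.
  exact: DgA.
- have -> : rI c \o (lp e \o S) = lp e \o (rI c \o S).
    by apply/funext => v /=; have /(app_eq (S v)) /= -> := rlp_com c e.
  exact: DgL.
- have -> : rI c \o (k *: S + S') = k *: (rI c \o S) + (rI c \o S').
    by apply/funext => v; rewrite /= !fctE (rI_blin c).1.
  exact: DgZ.
Qed.

Local Notation KK := (@GN _ _ h Dg hlin hp Dg_0 Dg_blin).
Local Notation vc := (@vec _ _ h Dg hlin hp Dg_0 Dg_blin).
Local Notation lm := (@lam _ _ h Dg hlin hp Dg_0 Dg_blin).
Definition gPi x : op KK := lm (s0 x).
Definition gups e : op KK := lm (s0 (U e)).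
Definition gp e : op KK := lm (p0 e).
Definition gR c : op KK := lm (rI c).
Definition gOm : KK := vc (rI c1).
Lemma lmC X Y : stab X -> stab Y -> lm (X \o Y) = lm X \o lm Y.
Proof. exact: (lam_comp hlin hp Dg_0 DgZ Dg_blin). Qed.
Lemma lmZD k X Y : stab X -> stab Y -> lm (k *: X + Y) = k *: lm X + lm Y.
Proof. exact: (lam_ZD hlin hp Dg_0 DgZ Dg_blin). Qed.
Lemma lm_blin X : stab X -> blin (lm X). Proof. exact: (lam_blin hlin hp Dg_0 DgZ Dg_blin). Qed.
Lemma lm_vc X T : stab X -> Dg T -> lm X (vc T) = vc (X \o T). Proof. exact: (lamE hlin hp Dg_0 DgZ Dg_blin). Qed.
Lemma lm_dag X : stab X -> stab (dag X) -> lm (dag X) = dag (lm X). Proof. exact: (lam_dag hlin hp Dg_0 DgZ Dg_blin). Qed.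
Lemma st_1B e : stab (id - p0 e).
Proof.
have -> : id - p0 e = (-1) *: p0 e + id by rewrite scaleN1r addrC.
exact: (stab_ZD DgZ (-1) (st_p e) (stab_id Dg)).
Qed.
Lemma lm_1B e v : lm (id - p0 e) v = v - gp e v.
Proof.
have -> : id - p0 e = (-1) *: p0 e + id by rewrite scaleN1r addrC.
rewrite lmZD; [|exact: st_p|exact: stab_id].
rewrite (lam_id hlin hp Dg_0 DgZ Dg_blin) -[LHS]/((-1) *: gp e v + v) scaleN1r addrC //.
Qed.
Lemma g_star : star_hom_on A gPi.
Proof.
split=> [a Aa|k a b Aa Ab|a b Aa Ab|a Aa].
- exact/bounded_opP/lm_blin/st_a.
- rewrite /gPi (sh_lin sS); try exact: NA.
  by rewrite lmZD//; apply: st_a.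
- rewrite /gPi (sh_comp sS); try exact: NA.
  by rewrite lmC//; apply: st_a.
- rewrite !adjE /gPi (sh_dag sS); last exact: NA.
  rewrite lm_dag//; first exact: st_a.
  by rewrite -(sh_dag sS); [apply/st_a/(calgJ cA)|exact: NA].
Qed.
Lemma g_TS : TS A E u gPi gups gp.
Proof.
have D := st_U; have P := st_p; have AE e a : A a -> A (Ee e a) by exact: (hd_E hd).
split.
- exact: g_star.
- by rewrite /gPi sig1 (lam_id hlin hp Dg_0 DgZ Dg_blin).
- by move=> e; apply: lm_blin.
- by move=> e; rewrite /gups -lm_dag// (ts_dag ts0).
- by move=> e; rewrite /gups -lmC// (ts_inv ts0) (lam_id hlin hp Dg_0 DgZ Dg_blin).
- move=> e a Aa; rewrite /gPi (ts_cov ts0)// lmC//; last exact/(stab_comp (D e))/st_a/(F_in hd).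
  by rewrite lmC//; apply/st_a/(F_in hd).
- by move=> e; apply: lm_blin.
- by move=> e; rewrite /gp -lm_dag ?(ts_psa ts0).
- by move=> e; rewrite /gp -lmC// (ts_pp ts0).
- move=> e v; have H : s0 (U e) \o (id - p0 (~~ e)) = p0 e \o s0 (U e).
    by apply/funext => w; exact: (ts_r1 ts0).
  have /(congr1 (fun T => lm T v)) := H; rewrite (lmC (D e) (st_1B (~~ e))) (lmC (P e) (D e)).
  by rewrite /= lm_1B.
- move=> e m v Am; have H : p0 e \o (s0 m \o p0 e) = s0 (Ee e m) \o p0 e.
    by apply/funext => w; exact: (ts_r2 ts0).
  have Sm := st_a Am; have SE := st_a (AE e m Am).
  have /(congr1 (fun T => lm T v)) := H; rewrite (lmC (P e) (stab_comp Sm (P e))) (lmC Sm (P e)) (lmC SE (P e)); exact.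
- move=> e m v Am; have H : p0 (~~ e) \o (s0 m \o p0 e) = 0 *: id + 0.
    by rewrite scale0r addr0; apply/funext => w; exact: (ts_r3 ts0).
  have Sm := st_a Am.
  have S0 : stab 0.
    split=> [|T _]; first exact: blin0.
    by have -> : 0 \o T = 0 :> op I0 by []; apply: Dg_0.
  have l0 : lm 0 = 0.
    have := lmZD 1 S0 S0; rewrite scale1r addr0 scale1r => e0.
    by apply: (addrI (lm 0)); rewrite addr0 -e0.
  have /(congr1 (fun T => lm T v)) := H; rewrite lmZD//; last exact: stab_id.
  rewrite l0 scale0r addr0 (lmC (P _) (stab_comp Sm (P e))) (lmC Sm (P e)); exact.
Qed.
Lemma vc_totalP (S : set KK) : subsp S -> hclosed S -> (forall T, Dg T -> S (vc T)) -> forall v, S v.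
Proof.
move=> sS' cS hS; apply: (proj1 (totalP _) (@vec_total _ _ h Dg hlin hp Dg_0 Dg_blin) S sS' cS) => T.
by rewrite (vec_cut hlin hp Dg_0 Dg_blin); apply: hS; apply: Dc; exact: Dg_0.
Qed.
Lemma g_dom v : dom A gPi v.
Proof.
have tsg := g_TS; have sg := g_star; have sD := dom_subsp cA sg.
(* For these vectors [n2] after applying [a] is the extension at an element of [N (.) C], namely [f]
   at the square of [a x] and of [c], which [fnorm] dominates. *)
have base x c : N x -> dom A gPi (vc (s0 x \o rI c)).
  move=> Nx; have [z hz] := fnorm c; exists (am x z) => a Aa.
  have Na := NA Aa; have Nax := NC Na Nx.
  have -> : gPi a (vc (s0 x \o rI c)) = vc (s0 (a \o x) \o rI c).
    rewrite /gPi lm_vc; [|exact: st_a|exact: Dg0].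
    by rewrite (sh_comp sS).
  have -> : am a (am x z) = am (a \o x) z by rewrite (am_comp cN).
  have Dx := Dg0 c Nax; rewrite /n2 vecE//.
  have bx := s0_blin Nax; have br := rI_blin c; rewrite dagM// -rI_dag -(sh_dag sS)//.
  have Nd := calgJ cN Nax.
  have -> : (rI (cs c) \o s0 (dag (a \o x))) \o (s0 (a \o x) \o rI c) = s0 (dag (a \o x) \o (a \o x)) \o rI (cm (cs c) c).
    rewrite rI_mul (sh_comp sS Nd Nax) (rI_s0 _ Nd); apply/funext => w /=; by rewrite rI_s0x.
  rewrite hf; last exact: NC.
  exact: hz.
apply: vc_totalP => [||T]; [exact: sD|exact: (dom_closed cA sg)|].
elim=> [x c Nx|e x c Nx|a S Aa hS ih|e S hS ih|k S S' hS ih hS' ih'].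
- exact: base.
- have D0 := Dg0 c Nx; have NUx := NC (NU (~~ e)) Nx.
  have -> : vc (ld e \o (s0 x \o rI c)) = gups (~~ e) (gp e (vc (s0 x \o rI c))).
    rewrite -lm_vc//; last exact: st_ld.
    rewrite /gups /gp /ld lmC//; [exact: st_U|exact: st_p].
  rewrite (ts_lstar tsg).
  have -> : gups (~~ e) (vc (s0 x \o rI c)) = vc (s0 (U (~~ e) \o x) \o rI c).
    rewrite /gups lm_vc//; last exact: st_U.
    by rewrite (sh_comp sS).
  by apply: (subspB sD); [exact: base|apply: (dom_p hd tsg); exact: base].
- have -> : vc (s0 a \o S) = gPi a (vc S) by rewrite /gPi lm_vc//; apply: st_a.
  exact: dom_phi.
- have -> : vc (lp e \o S) = gp e (gups e (vc S)).
    rewrite -lm_vc//; last exact: st_lp.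
    by rewrite /lp lmC//; [exact: st_p|exact: st_U].
  exact: (dom_l hd tsg).
- by rewrite (vec_lin hlin hp Dg_0 DgZ Dg_blin)//; apply: sD.2.
Qed.
Lemma g_comR c X : stab X -> rI c \o X = X \o rI c -> gR c \o lm X = lm X \o gR c.
Proof. by move=> sX e; rewrite /gR -!lmC// ?e//; apply: st_r. Qed.
Lemma Dg_r c : Dg (rI c).
Proof. by have := Dg0 c (calg1 cN); rewrite sig1. Qed.
Lemma gROm c : gR c gOm = vc (rI c).
Proof. by rewrite /gR /gOm lm_vc ?rI_r//; [exact: st_r|exact: Dg_r]. Qed.
Lemma g_val x c : N x -> inner (vc (s0 x \o rI c)) gOm = f x c.
Proof.
move=> Nx; have D1 := Dg_r c1; have Dx := Dg0 c Nx; rewrite vecE// -rI_dag cs1 -hf//.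
congr h; rewrite -[LHS]/((rI c1 \o s0 x) \o rI c) rI_s0//.
by rewrite -[LHS]/(s0 x \o (rI c1 \o rI c)) rI_l.
Qed.
Lemma CW_lam e d n w W S : CW A E u gPi gups gp e d n w W S -> stab (s0 w) /\ W = lm (s0 w).
Proof.
elim=> [e0|e0 e1 d0 n0 x w0 W0 S0 Ax cx hw [s1 ->]]; first by split=> //; apply: st_U.
have Nx := NA Ax; have NUx := NC (NU e0) Nx; have Nw := RW_N hd (CW_RW hw).
have sx := st_a Ax; have sU := st_U e0; have sUx := stab_comp sU sx.
rewrite (sh_comp sS)// (sh_comp sS)//; split; first exact: (stab_comp sUx s1).
by rewrite lmC// lmC.
Qed.
Lemma g_GM : GM N A E u cm cs f Fc Phi0 gPi gups gp gR gOm.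
Proof.
split.
- exact: g_TS.
- exact: g_dom.
- by move=> c; apply/lm_blin/st_r.
- by move=> c d; rewrite /gR rI_mul lmC//; apply: st_r.
- by move=> c; rewrite /gR rI_dag lm_dag -?rI_dag//; apply: st_r.
- by move=> c a Aa; apply: g_comR; [exact: st_a|exact/rI_s0/NA].
- by move=> c e; apply: g_comR; [exact: st_U|exact/rI_s0/NU].
- by move=> c e; apply: g_comR; [exact: st_p|exact: rp_com].
- have := g_val c1 (calg1 cN); rewrite f1 sig1 -/gOm ipC => /(congr1 (fun z => Re z)); by rewrite !ReC.
- move=> c m e d n w W S m' Am Am' hW; have [sw ->] := CW_lam hW.
  have Nw := RW_N hd (CW_RW hW); have Nm := NA Am; have Nm' := NA Am'.
  have Nmw := NC Nm Nw; have Dr := Dg_r c.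
  rewrite gROm -g_val; last exact: NC.
  rewrite /gPi (lm_vc (st_a Am')) //.
  rewrite lm_vc//; last exact: DgA.
  rewrite lm_vc//; [|exact: st_a|by apply: sw.2; exact: DgA].
  by rewrite (sh_comp sS)// (sh_comp sS).
- move=> c a Aa; rewrite gROm /gPi lm_vc; [|exact: st_a|exact: Dg_r].
  by rewrite g_val//; exact: NA.
- move=> s M hs hM.
  have [st e] : stab (ev Phi0 s) /\ ev (fun a c => gPi a \o gR c) s = lm (ev Phi0 s).
    elim: s hs {hM} => [|[a c] s ih] hs.
      rewrite /ev !big_nil.
      have S0 : stab 0.
        split=> [|T _]; first exact: blin0.
        by have -> : 0 \o T = 0 :> op I0 by []; apply: Dg_0.
      split=> //; have := lmZD 1 S0 S0; rewrite scale1r addr0 scale1r => e0.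
      by apply: (addrI (lm 0)); rewrite addr0 -e0.
    have [Aa hs'] := inS_cons hs; have [s1 e1] := ih hs'; rewrite /= in Aa.
    have sa := st_a Aa; have sr := st_r c; have sar := stab_comp sa sr.
    have eE (L : hilbertType R) (Ph : op K -> C -> op L) : ev Ph ((a, c) :: s) = 1 *: Ph a c + ev Ph s.
      by rewrite /ev big_cons scale1r.
    rewrite !eE e1; split; first exact: (stab_ZD DgZ 1 sar s1).
    by rewrite lmZD// -lmC.
  by rewrite e; apply: (lam_nb hlin hp Dg_0 DgZ Dg_blin).
(* The vectors killed by [gR d] form a closed subspace stable under the operations generating [Dg].
   On [x] and [c] the squared norm after [gR d] is a value of [f] that [h0] makes 0. *)
- move=> d h0; have sr := st_r d; have br : blin (gR d) by exact: lm_blin.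
  have c0 : hclosed [set v | gR d v = 0].
    move=> w hw; apply: n2_eq0; apply/eqP; rewrite eq_le n2_ge0 andbT; apply: le_eps => e e0.
    have [b1 [c cc hc]] := br; have e1 : 0 < e / (1 + c) by rewrite divr_gt0//; lra.
    have [v /= v0 hv] := hw _ e1; rewrite add0r -[gR d w]subr0 -v0 -(linB b1).
    apply: le_trans (hc _) _; rewrite ltr_pdivlMr in hv; last lra.
    apply: le_trans (ltW hv); rewrite mulrC ler_wpM2l ?n2_ge0//; lra.
  have s0' : subsp [set v | gR d v = 0].
    by split=> [|k v w /= ev0 ew]; [exact: (lin0 br.1)|rewrite /= br.1 ev0 ew scaler0 addr0].
  apply/funext => v; apply: (vc_totalP s0' c0) => T hT /=.
  have cm' X S : stab X -> Dg S -> rI d \o X = X \o rI d -> gR d (vc S) = 0 -> gR d (vc (X \o S)) = 0.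
    move=> sX hS e e0; rewrite -lm_vc//; have /(app_eq (vc S)) /= -> := g_comR sX e.
    by rewrite e0 (lin0 (lm_blin sX).1).
  have base x c : N x -> gR d (vc (s0 x \o rI c)) = 0.
    move=> Nx; have D0 := Dg0 c Nx; rewrite /gR lm_vc//.
    have Dx := Dg0 (cm d c) Nx.
    have -> : rI d \o (s0 x \o rI c) = s0 x \o rI (cm d c).
      by rewrite rI_mul; apply/funext => w /=; rewrite rI_s0x.
    apply: n2_eq0; rewrite /n2 vecE//; have bx := s0_blin Nx; have bdc := rI_blin (cm d c).
    rewrite dagM// -rI_dag -(sh_dag sS)//; have Nd := calgJ cN Nx.
    have -> : (rI (cs (cm d c)) \o s0 (dag x)) \o (s0 x \o rI (cm d c)) =
        s0 (dag x \o x) \o rI (cm (cs (cm d c)) (cm d c)).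
      rewrite (rI_mul (cs _)) (sh_comp sS Nd Nx) (rI_s0 _ Nd); apply/funext => w /=; by rewrite rI_s0x.
    by rewrite hf ?h0//; apply: NC.
  elim: hT => [x c Nx|e x c Nx|a S Aa hS ih|e S hS ih|k S S' hS ih hS' ih'].
  + exact: base.
  + by apply: cm'; [exact: st_ld|exact: Dg0|exact: rld_com|exact: base].
  + by apply: cm' => //; [exact: st_a|exact/rI_s0/NA].
  + by apply: cm' => //; [exact: st_lp|exact: rlp_com].
  + by rewrite (vec_lin hlin hp Dg_0 DgZ Dg_blin)// br.1 ih ih' scaler0 addr0.
Qed.
End Extension.
Lemma machine : exists (KK : hilbertType R) (Pi' : op K -> op KK) ups p (Rr : C -> op KK) Om,
  GM N A E u cm cs f Fc Phi0 Pi' ups p Rr Om.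
Proof.
have [h [h1 h2 h3]] := hext.
do 6 eexists; exact: (g_GM h1 h2 h3).
Qed.
End Machine.

(** * The dilation by creation operators *)

(** The hypotheses say that [phih] is the projection of [phi] onto the closed span of the [phih],
    contained in that of the [phi], and that [psi] has the Gram matrix of [phih]. [T] is this
    projection followed by an isometry. *)
Lemma contr_ext (R : realType) (X : Type) (I G : hilbertType R) (phi phih : X -> I) (psi : X -> G) :
  (forall i j, inner (psi i) (psi j) = inner (phi i) (phih j)) ->
  (forall i j, inner (phi i) (phih j) = inner (phih i) (phih j)) ->
  (forall z, (forall i, inner z (phi i) = 0) -> forall i, inner z (phih i) = 0) ->
  exists T : I -> G, [/\ blin T, nb T 1, forall i, T (phi i) = psi i,
    forall z, (forall i, inner z (phi i) = 0) -> T z = 0 & forall i, dag T (psi i) = phih i].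
Proof.
move=> h1 h2 h3.
have ipc (V W : hilbertType R) (f : X -> V) (g : X -> V) (f' g' : X -> W) s :
    (forall i j, inner (f i) (g j) = inner (f' i) (g' j)) -> inner (fcomb f s) (fcomb g s) = inner (fcomb f' s) (fcomb g' s).
  move=> h; rewrite !ip_suml; apply: eq_bigr => p _; rewrite !ip_sumr; apply: eq_bigr => q _.
  by rewrite !ipZl !ipZr h.
have le s : n2 (fcomb psi s) <= 1 * n2 (fcomb phi s).
  have e1 := ipc _ _ psi psi phi phih s h1; have e2 := ipc _ _ phi phih phih phih s h2.
  have := n2_ge0 (fcomb phi s - fcomb phih s); rewrite n2B /n2 e1 e2 mul1r.
  by move: (Re (inner (fcomb phi s) (fcomb phi s))) (Re _) => *; lra.
have [T [bT nT T1 T2]] := ext_sub ler01 le.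
exists T; split=> //; first by split; rewrite ?expr1n.
move=> j; apply/subr0_eq.
have [P [bP sP PP P1 P2]] := sub_proj phi.
set w := dag T (psi j) - phih j.
have h0 i : inner w (phi i) = 0.
  by rewrite ipBl (dagPr bT) T1 -ipJ -[inner (phih j) _]ipJ h1 subrr.
apply: n2_eq0; rewrite /n2 {2}/w ipBr (h3 _ h0) -(dagP bT) (T2 _ h0) ip0l subrr //.
Qed.

Section TreeWords.
Variables (R : realType) (K : hilbertType R) (N A : set (op K)) (E : op K -> op K) (u : op K).
Hypothesis hd : HD N A E u.
Let ce := hd_ce hd.
Let cN := ceN ce.
Let cA := ceA ce.
Local Notation F := (Feps E u).
Local Notation Ee := (Eeps E u).
Local Notation U := (Ueps u).
Variables (G : hilbertType R) (Pi : op K -> op G) (ups p : bool -> op G).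
Hypothesis ts : TS A E u Pi ups p.
Let sA := ts_star ts.
Local Notation CW := (CW A E u Pi ups p).
Let NA := AN hd.
Let NC := NC hd.
Let AC := calgM cA.
Let bU := U_blin hd.
Let bu := ts_blin ts.
Let bp := ts_pblin ts.
Let bPi a := @Pi_blin _ _ _ _ _ _ _ _ _ ts a.
Lemma Pi_comp a b v : A a -> A b -> Pi (a \o b) v = Pi a (Pi b v).
Proof. by move=> Aa Ab; have /(app_eq v) := sh_comp sA Aa Ab. Qed.
Lemma ts_p0 e e' x v : A x -> (e != e' -> F e' x = 0) -> p (~~ e) (Pi x (p e' v)) = 0.
Proof.
move=> Ax cx; have [<-|ne] := eqVneq e e'; first exact: (ts_r3 ts).
have e'E := Uneg ne; subst e'; rewrite (ts_r2 ts)// (_ : Ee (~~ e) x = 0) ?(sh0 cA sA)//.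
by rewrite /Eeps (cx ne); apply/funext => z; rewrite /= (lin0 (bU _).1).
Qed.
Lemma CW_p e d n w W S v : CW e d n w W S -> p e (S v) = S v.
Proof. by case=> *; rewrite /= (ts_ppx ts). Qed.
Lemma CW_p0 e e' x d n w W S v : A x -> (e != e' -> F e' x = 0) -> CW e' d n w W S ->
  p (~~ e) (Pi x (S v)) = 0.
Proof. by move=> Ax cx h; rewrite -(CW_p v h); apply: ts_p0. Qed.
Lemma ts_lp0 e v : p e (ups e (p (~~ e) v)) = 0.
Proof. by rewrite -(ts_r1 ts) (ts_ppx ts) subrr (lin0 (bu e).1). Qed.
(** The innermost letter [u^d] would cancel the leading [u^-d] of such a vector instead of adding a
    letter. *)
Lemma CW_end e d n w W S v : CW e d n w W S -> S (p (~~ d) v) = 0.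
Proof.
elim=> [e0|e0 e1 d0 n0 x w0 W0 S0 Ax _ _ ih] /=; first exact: ts_lp0.
by rewrite ih (lin0 (bPi Ax).1) (lin0 (bu _).1) (lin0 (bp _).1).
Qed.
Lemma CW_snoc e d e' n y w W S : A y -> (d != e' -> F e' y = 0) -> CW e d n w W S ->
  CW e e' n.+1 (w \o y \o U e') (W \o Pi y \o ups e') (S \o Pi y \o p e' \o ups e').
Proof.
move=> Ay cy h; elim: h Ay cy => [e0|e0 e1 d0 n0 x w0 W0 S0 Ax cx _ ih] Ay cy.
  exact: (CWc Ay cy (CW1 _ _ _ _ _ _ _)).
exact: (CWc Ax cx (ih Ay cy)).
Qed.
Lemma CW_unsnoc e d n w W S : CW e d n w W S -> n = 1%N /\ [/\ e = d, w = U d, W = ups d & S = p d \o ups d] \/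
  exists d' y w' W' S' m,
  [/\ n = m.+1, CW e d' m w' W' S', A y, d' != d -> F d y = 0 &
      [/\ w = w' \o y \o U d, W = W' \o Pi y \o ups d & S = S' \o Pi y \o p d \o ups d]].
Proof.
elim=> [e0|e0 e1 d0 n0 x w0 W0 S0 Ax cx h ih]; [by left|right].
case: ih => [[-> [e1d -> -> ->]]|[d' [y [w' [W' [S' [m [nm hw Ay cy [-> -> ->]]]]]]]]].
  subst e1; exists e0, x, (U e0), (ups e0), (p e0 \o ups e0), 1%N; split=> //.
  exact: CW1.
exists d', y, (U e0 \o x \o w'), (ups e0 \o Pi x \o W'), (p e0 \o ups e0 \o Pi x \o S'), m.+1; split=> //.
  by rewrite nm.
exact: (CWc Ax cx hw).
Qed.
Lemma ts_creat e e' x v : A x -> (e != e' -> F e' x = 0) ->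
  p e (ups e (Pi x (p e' v))) = ups e (Pi x (p e' v)).
Proof. by move=> Ax cx; rewrite -(ts_r1 ts) ts_p0// subr0. Qed.
(** Nothing cancels when the vector begins with a letter that continues the word reducedly, so the
    projections inside [S] act trivially. *)
Lemma CW_creat e d n w W S e' y v : CW e d n w W S -> A y -> (d != e' -> F e' y = 0) ->
  S (Pi y (p e' v)) = W (Pi y (p e' v)).
Proof.
move=> h Ay; elim: h => [e0|e0 e1 d0 n0 x w0 W0 S0 Ax cx h ih] cy /=; first exact: ts_creat.
by rewrite -(ih cy) -(CW_p _ h) ts_creat.
Qed.

(* words of length n with their creation words; q is the projection S^* S *)
Inductive WS : nat -> op K -> op G -> op G -> Prop :=
| WS0 : WS 0 id id id
| WSc e d n w W S : CW e d n w W S -> WS n w S (id - p (~~ d)).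
Lemma CW_n0 e d n w W S : CW e d n w W S -> (0 < n)%N.
Proof. by case. Qed.
Lemma WS_N n w S q : WS n w S q -> N w.
Proof. by case=> [|e d n0 w0 W S0 /CW_RW/(RW_N hd)//]; apply: calg1 cN. Qed.
Lemma WS_blin n w S q : WS n w S q -> blin S /\ blin q.
Proof.
case=> [|e d n0 w0 W S0 h]; first by split; apply: blin_id.
by split; [case: (CW_blin ts h)|apply: blinB => //; apply: blin_id].
Qed.
Lemma WS_Sq n w S q v : WS n w S q -> S (q v) = S v.
Proof.
case=> [//|e d n0 w0 W S0 h]; have [_ bS] := CW_blin ts h.
by rewrite fctE (linB bS.1) (CW_end _ h) subr0.
Qed.
Lemma E_dag_word m e d n w : A m -> RW A E u e d n w -> E (m \o w) = 0.
Proof. by move=> Am h; have := E_word hd Am h (calg1 cA) => e0; apply: etrans e0. Qed.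
Lemma E_word_dag m e d n w : A m -> RW A E u e d n w -> E (dag w \o m) = 0.
Proof.
move=> Am h; have := E_word hd (calg1 cA) (RW_star hd h) Am => e0; exact: etrans e0.
Qed.
Lemma E_ww0 e d n w e' d' n' w' y : RW A E u e d n w -> RW A E u e' d' n' w' -> A y ->
  (e' = e -> F e y = 0) -> E (dag w' \o y \o w) = 0.
Proof.
move=> h h' Ay cy; have := RW_cat (RW_star hd h') Ay _ h => /(_ _)/(hd_red hd); apply.
by move=> ne; apply: cy; move: ne; clear; case: e e' => -[].
Qed.
(** The part [y - Ee e y] keeps the product reduced and has expectation 0; through the other part
    the letters [u^-e] and [u^e] cancel and leave [F e y]. *)
Lemma E_ww e d n z d' n' z' y : RW A E u e d n (U e \o z) -> RW A E u e d' n' (U e \o z') ->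
  N z -> N z' -> A y -> E (dag (U e \o z') \o y \o (U e \o z)) = E (dag z' \o F e y \o z).
Proof.
move=> h h' Nz Nz' Ay; have AE := hd_E hd e Ay; have A0 := calgB cA Ay AE.
have Nw := RW_N hd h; have Nw' := calgJ cN (RW_N hd h').
have e0 : E (dag (U e \o z') \o (y - Ee e y) \o (U e \o z)) = 0.
  by apply: (E_ww0 h h') => // _; apply: (F_sub hd).
have N1 := NC (NC Nw' (NA A0)) Nw; have N2 := NC (NC Nw' (NA AE)) Nw.
have bz' := calgW cN Nz'.
have -> : dag (U e \o z') \o y \o (U e \o z) =
    (dag (U e \o z') \o (y - Ee e y) \o (U e \o z)) + (dag (U e \o z') \o Ee e y \o (U e \o z)).
  apply/funext => v; rewrite /= !fctE /= (linB (calgW cN Nw').1) subrK //.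
rewrite (ceD ce)// e0 add0r; congr E.
rewrite dagM// (U_dag hd); apply/funext => v; by rewrite /= /Eeps /= !(VUx hd).
Qed.
Lemma CW_decomp e d n w W S : CW e d n w W S -> exists z Z, [/\ w = U e \o z, S = p e \o ups e \o Z, N z &
  [/\ n = 1%N, z = id, Z = id & d = e] \/ exists e1 m x w1 W1 S1, [/\ n = m.+1, CW e1 d m w1 W1 S1, A x,
    e != e1 -> F e1 x = 0 & z = x \o w1 /\ Z = Pi x \o S1]].
Proof.
case=> [e0|e0 e1 d0 n0 x w0 W0 S0 Ax cx h].
  by exists id, id; split=> //; [exact: calg1 cN|left].
exists (x \o w0), (Pi x \o S0); split=> //.
  exact: NC (NA Ax) (RW_N hd (CW_RW h)).
by right; exists e1, n0, x, w0, W0, S0.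
Qed.
(** Creation words pair like words under [E]. On both sides the first letter is peeled off, [y]
    becoming [F e y], and the last letter leaves the factor [1 - p_-d]. Unequal lengths end in a
    single reduced word. *)
Lemma CW_pair e d n w W S : CW e d n w W S -> forall e' d' n' w' W' S' y, CW e' d' n' w' W' S' -> A y ->
  (n' != n -> E (dag w' \o y \o w) = 0) /\
  (n' = n -> forall v, dag S' (Pi y (S v)) = Pi (E (dag w' \o y \o w)) (v - p (~~ d) v)).
Proof.
elim: n e d w W S => [|n ih] e d w W S h; first by have := CW_n0 h.
move=> e' d' n' w' W' S' y h' Ay.
have rw := CW_RW h; have rw' := CW_RW h'.
have [z [Z [wE SE Nz hz]]] := CW_decomp h; have [z' [Z' [wE' SE' Nz' hz']]] := CW_decomp h'.
have [bZ bZ'] : blin Z /\ blin Z'.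
  split.
    case: hz => [[_ _ -> _]|[e1 [m [x [w1 [W1 [S1 [_ h1 Ax _ [_ ->]]]]]]]]]; first exact: blin_id.
    exact: (blinM (bPi Ax) (CW_blin ts h1).2).
  case: hz' => [[_ _ -> _]|[e1 [m [x [w1 [W1 [S1 [_ h1 Ax _ [_ ->]]]]]]]]]; first exact: blin_id.
  exact: (blinM (bPi Ax) (CW_blin ts h1).2).
have dS' v : dag S' v = dag Z' (ups (~~ e') (p e' v)).
  have b := blinM (bp e') (bu e').
  by rewrite SE' (dagM b bZ') (dagM (bp _) (bu _)) (ts_psa ts) (ts_dag ts).
have [ee|ne] := eqVneq e' e; last first.
  have E0 : E (dag w' \o y \o w) = 0 by apply: (E_ww0 rw rw') => // ee; move: ne; rewrite ee eqxx.
  split=> // _ v; rewrite E0 (sh0 cA sA) dS' SE /=.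
  have e'E := Uneg ne; have := ts_ld0 ts (~~ e') (Z v) Ay; rewrite negbK -e'E => ->.
  exact: (lin0 (blinJ bZ').1).
subst e'; have AF := F_in hd e Ay.
have EE : E (dag w' \o y \o w) = E (dag z' \o F e y \o z).
  by move: rw rw'; rewrite wE wE' => rw rw'; rewrite (E_ww rw rw').
have pZ v : p (~~ e) (Z v) = if n == 0%N then p (~~ e) v else 0.
  case: hz => [[[->] _ -> _]//|[e1 [m [x [w1 [W1 [S1 [[nm] h1 Ax cx [_ ->]]]]]]]]].
  have := CW_n0 h1; rewrite -nm lt0n => /negbTE ->; exact: (CW_p0 _ Ax cx h1).
have SS v : dag S' (Pi y (S v)) = dag Z' (Pi (F e y) (Z v - p (~~ e) (Z v))).
  by rewrite dS' SE /= (ts_ld ts).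
rewrite EE; case: hz pZ => [[[n0] zE ZE de]|[e1 [m [x [w1 [W1 [S1 [[nm] h1 Ax cx [zE ZE]]]]]]]]] pZ.
- subst n d; case: hz' => [[n1 zE' ZE' de']|[e2 [m2 [x2 [w2 [W2 [S2 [n2E h2 Ax2 cx2 [zE' ZE']]]]]]]]].
    split=> [|_ v]; first by rewrite n1.
    rewrite SS ZE' ZE dag_id zE zE' dag_id -[_ \o _]/(F e y) (ce_fix ce AF) //.
  have m2n := CW_n0 h2; split=> [_|]; last by rewrite n2E => -[m20]; rewrite m20 in m2n.
  rewrite zE zE' (dagM (calgW cA Ax2) (calgW cN (RW_N hd (CW_RW h2)))).
  have := E_word_dag (AC (calgJ cA Ax2) AF) (CW_RW h2) => e0; exact: etrans e0.
- subst m; have n0 := CW_n0 h1; rewrite (negbTE (lt0n_neq0 n0)) in pZ.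
  case: hz' => [[n1 zE' ZE' de']|[e2 [m2 [x2 [w2 [W2 [S2 [n2E h2 Ax2 cx2 [zE' ZE']]]]]]]]].
    split=> [_|]; last by rewrite n1 => -[n00]; rewrite -n00 in n0.
    by rewrite zE zE' dag_id; have := E_dag_word (AC AF Ax) (CW_RW h1) => e0; exact: etrans e0.
  have Ad := calgJ cA Ax2; have Am := AC (AC Ad AF) Ax.
  have bx2 := calgW cA Ax2; have bw2 := calgW cN (RW_N hd (CW_RW h2)).
  have [i1 i2] := ih _ _ _ _ _ h1 _ _ _ _ _ _ _ h2 Am.
  have -> : dag z' \o F e y \o z = dag w2 \o (dag x2 \o F e y \o x) \o w1.
    by rewrite zE zE' (dagM bx2 bw2).
  split=> [ne|en v]; first by apply: i1; move: ne; rewrite n2E.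
  move: en; rewrite n2E => -[en]; rewrite -(i2 en) SS pZ subr0 ZE' ZE.
  rewrite (dagM (bPi Ax2) (CW_blin ts h2).2) /= (Pi_comp _ (AC Ad AF) Ax) (Pi_comp _ Ad AF).
  by rewrite (sh_dag sA).
Qed.

Lemma WS_ortho n w S q n' w' S' q' y : WS n w S q -> WS n' w' S' q' -> A y -> n' <> n ->
  E (dag w' \o y \o w) = 0.
Proof.
move=> h h' Ay ne; case: h ne => [|e d n0 w0 W S0 h] ne; case: h' ne => [|e' d' n0' w0' W' S0' h'] ne //.
- exact: (E_word_dag Ay (CW_RW h')).
- by rewrite dag_id; exact: (E_dag_word Ay (CW_RW h)).
- by have [i1 _] := CW_pair h h' Ay; apply: i1; apply/eqP.
Qed.
Lemma WS_inv n w S q : WS n w S q -> [/\ n = 0%N, w = id, S = id & q = id] \/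
  exists e d W, [/\ (0 < n)%N, CW e d n w W S & q = id - p (~~ d)].
Proof. by case=> [|e d n0 w0 W S0 h]; [left|right; exists e, d, W; split=> //; apply: CW_n0 h]. Qed.
Lemma WS_pair n w S q w' S' q' y v : WS n w S q -> WS n w' S' q' -> A y ->
  dag S' (Pi y (S v)) = Pi (E (dag w' \o y \o w)) (q v).
Proof.
move=> /WS_inv[[n0 -> -> ->]|[e [d [W [n0 h ->]]]]] /WS_inv[[n0' -> -> _]|[e' [d' [W' [n0' h' _]]]]] Ay.
- by rewrite !dag_id -[_ \o _ \o _]/y (ce_fix ce Ay).
- by rewrite n0 in n0'.
- by rewrite n0' in n0.
- by have [_ i2] := CW_pair h h' Ay; rewrite i2.
Qed.
Hypothesis dA : forall v, dom A Pi v.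
Let Pi1 := ts_1 ts.
Local Notation I0 := (Ind ce sA Pi1).
Local Notation t0 := (tau ce sA Pi1).
Local Notation s0 := (@sig _ _ _ _ _ ce _ _ sA Pi1).
Local Notation ind := (@ind _ _ _ _ _ ce _ _ sA Pi1).
Lemma WS_total (Q : set I0) : subsp Q -> hclosed Q ->
  (forall n x w S q v, A x -> WS n w S q -> Q (t0 (x \o w) v)) -> forall z, Q z.
Proof.
move=> sQ cQ h; apply: (Wg_totalP dA sQ cQ) => x v [Ax|[m [e [d [n [w [m' [Am Am' hw xE]]]]]]]].
  exact: (h 0%N _ _ _ _ _ Ax WS0).
rewrite xE (tau_bal ce sA Pi1)//; last exact: NC (NA Am) (RW_N hd hw).
by have [W [S hC]] := RW_CW Pi ups p hw; apply: h Am (WSc hC).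
Qed.
Lemma WS_op (L : hilbertType R) (X Y : I0 -> L) : blin X -> blin Y ->
  (forall n x w S q v, A x -> WS n w S q -> X (t0 (x \o w) v) = Y (t0 (x \o w) v)) -> X = Y.
Proof.
move=> bX bY h; apply/funext => z; apply/subr0_eq.
have bD := blinB bX bY.
apply: (WS_total (preim_subsp bD.1 (@zero_subsp _ _)) (preim_closed bD (@zero_hclosed _ _))) => n x w S q v Ax hW.
by rewrite /= fctE (h _ _ _ _ _ _ Ax hW) subrr.
Qed.
Record WI n := MkWI {wi_x : op K; wi_w : op K; wi_S : op G; wi_q : op G; wi_v : G; wi_A : A wi_x; wi_h : WS n wi_w wi_S wi_q}.
Lemma xw_N n x w S q : A x -> WS n w S q -> N (x \o w).
Proof. by move=> /NA Nx /WS_N; apply: NC. Qed.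
Lemma t0_ip n m x w S q v x' w' S' q' v' : A x -> A x' -> WS n w S q -> WS m w' S' q' ->
  inner (t0 (x \o w) v) (t0 (x' \o w') v') = inner (Pi (E (dag w' \o (dag x' \o x) \o w)) v) v'.
Proof.
move=> Ax Ax' h h'; have N1 := xw_N Ax h; have N2 := xw_N Ax' h'; rewrite tauE// /om.
by rewrite dagM; [|exact: (calgW cA Ax')|exact: (calgW cN (WS_N h'))].
Qed.
(** The row operator [x w (x) v |-> x S_w v] over words of length [n], which vanishes on all other
    lengths. Its adjoint reads off the components of length [n] of a vector of [G]. *)
Definition GnP n (T : I0 -> G) := [/\ blin T, nb T 1,
  forall x w S q v, A x -> WS n w S q -> T (t0 (x \o w) v) = Pi x (S v),
  forall m x w S q v, m <> n -> A x -> WS m w S q -> T (t0 (x \o w) v) = 0 &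
  forall x w S q v, A x -> WS n w S q -> dag T (Pi x (S v)) = t0 (x \o w) (q v)].
Lemma Gn_exists n : exists T, GnP n T.
Proof.
pose ph (i : WI n) := t0 (wi_x i \o wi_w i) (wi_v i).
pose phh (i : WI n) := t0 (wi_x i \o wi_w i) (wi_q i (wi_v i)).
pose ps (i : WI n) := Pi (wi_x i) (wi_S i (wi_v i)).
have key (i j : WI n) : inner (ps i) (ps j) = inner (Pi (E (dag (wi_w j) \o (dag (wi_x j) \o wi_x i) \o wi_w i)) (wi_q i (wi_v i))) (wi_v j).
  rewrite /ps; case: i j => x w S q v Ax h [x' w' S' q' v' Ax' h'] /=.
  have [bS' _] := WS_blin h'; have Ad := calgJ cA Ax'.
  by rewrite -(WS_pair _ h h' (AC Ad Ax)) Pi_comp// (sh_dag sA Ax') (dagPr bS') (dagPr (bPi Ax')).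
have qS (i j : WI n) : inner (phh i) (ph j) = inner (ps i) (ps j).
  by rewrite key /phh /ph; case: i j => x w S q v Ax h [x' w' S' q' v' Ax' h'] /=; rewrite (t0_ip _ _ Ax Ax' h h').
have Sq (i : WI n) : wi_S i (wi_q i (wi_v i)) = wi_S i (wi_v i) by case: i => x w S q v Ax h /=; rewrite (WS_Sq _ h).
pose iq (i : WI n) := MkWI (wi_q i (wi_v i)) (wi_A i) (wi_h i).
have psq i : ps (iq i) = ps i by rewrite /ps /= Sq.
have phq i : ph (iq i) = phh i by [].
have [|||T [bT nT T1 T2 T3]] := @contr_ext R (WI n) I0 G ph phh ps.
- by move=> i j; rewrite -ipJ -qS ipJ.
- by move=> i j; rewrite -[RHS]/(inner (phh i) (ph (iq j))) qS psq -[LHS]ipJ qS ipJ.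
- by move=> z hz i; rewrite -phq.
exists T; split=> //.
- by move=> x w S q v Ax h; exact: (T1 (MkWI v Ax h)).
- move=> m x w S q v ne Ax h; apply: T2 => -[x' w' S' q' v' Ax' h']; rewrite /ph /= (t0_ip _ _ Ax Ax' h h').
  rewrite (WS_ortho h h') ?(sh0 cA sA) ?ip0l//; first exact: (AC (calgJ cA Ax') Ax).
  by move=> e; apply: ne.
- by move=> x w S q v Ax h; exact: (T3 (MkWI v Ax h)).
Qed.
Definition Gn n : I0 -> G := xget 0 [set T | GnP n T].
Lemma Gn_P n : GnP n (Gn n).
Proof. by have := Gn_exists n => h; exact: (@xgetPex _ 0 [set T | GnP n T] h). Qed.
Lemma Gn_blin n : blin (Gn n). Proof. by case: (Gn_P n). Qed.
Lemma Gd_blin n : blin (dag (Gn n)). Proof. exact/blinJ/Gn_blin. Qed.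
Lemma GnE n x w S q v : A x -> WS n w S q -> Gn n (t0 (x \o w) v) = Pi x (S v).
Proof. by case: (Gn_P n) => _ _ h _ _; apply: h. Qed.
Lemma Gn_0 n m x w S q v : m <> n -> A x -> WS m w S q -> Gn n (t0 (x \o w) v) = 0.
Proof. by case: (Gn_P n) => _ _ _ h _; apply: h. Qed.
Lemma GnD n x w S q v : A x -> WS n w S q -> dag (Gn n) (Pi x (S v)) = t0 (x \o w) (q v).
Proof. by case: (Gn_P n) => _ _ _ _ h; apply: h. Qed.
Lemma GGS n x w S q v : A x -> WS n w S q -> Gn n (dag (Gn n) (Pi x (S v))) = Pi x (S v).
Proof. by move=> Ax h; rewrite (GnD _ Ax h) (GnE _ Ax h) (WS_Sq _ h). Qed.
Lemma Gd_nb n : nb (dag (Gn n)) 1.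
Proof.
by case: (Gn_P n) => bT [_ nT] _ _ _; split=> //; apply: dag_bnd nT => //; rewrite expr1n.
Qed.
Lemma Gn_sig n a z : A a -> Gn n (s0 a z) = Pi a (Gn n z).
Proof.
move=> Aa; have Na := NA Aa; have bs := sig_blin ce sA Pi1 Na; have bG := Gn_blin n.
suff /(app_eq z) : Gn n \o s0 a = Pi a \o Gn n by [].
apply: WS_op => [||m x w S q v Ax h]; [exact: blinM|by apply: blinM => //; exact: bPi|].
have Nxw := xw_N Ax h; rewrite /= sig_tau// compA; have Aax := AC Aa Ax.
have [mn|/eqP ne] := eqVneq m n.
  by subst m; rewrite (GnE _ Aax h) (GnE _ Ax h) Pi_comp.
by rewrite (Gn_0 _ ne Aax h) (Gn_0 _ ne Ax h) (lin0 (bPi Aa).1).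
Qed.
Lemma Gn_ind n (T : op G) z : Cm A Pi T -> (forall n w S q v, WS n w S q -> T (S v) = S (T v)) ->
  Gn n (ind T z) = T (Gn n z).
Proof.
move=> CT cS; have bi := ind_blin ce sA Pi1 CT; have bG := Gn_blin n; have bT := calgW (Cm_calg ce sA) CT.
suff /(app_eq z) : Gn n \o ind T = T \o Gn n by [].
apply: WS_op => [||m x w S q v Ax h]; [exact: blinM|exact: blinM|].
rewrite /= ind_tau//.
have [mn|/eqP ne] := eqVneq m n.
  by subst m; rewrite !(GnE _ Ax h) -(cS _ _ _ _ _ h) (CmE _ CT Ax).
by rewrite !(Gn_0 _ ne Ax h) (lin0 bT.1).
Qed.
Lemma Gcross n m (T : op G) v : n <> m -> Cm A Pi T -> Gn n (ind T (dag (Gn m) v)) = 0.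
Proof.
move=> ne CT; have bi := ind_blin ce sA Pi1 CT; have bG := Gn_blin n; have bd := Gd_blin m.
suff /(app_eq v) : Gn n \o ind T \o dag (Gn m) = 0 by [].
pose ps (i : WI m) := Pi (wi_x i) (wi_S i (wi_v i)).
apply: (sub_zero (f := ps)) => [|[x w S q w' Ax h]|y hy].
- exact: (blinM (blinM bG bi) bd).
- rewrite /ps /= (GnD _ Ax h) ind_tau// (Gn_0 _ _ Ax h) //.
  by move=> e; apply: ne.
- rewrite /= (_ : dag (Gn m) y = 0); first by rewrite (lin0 bi.1) (lin0 bG.1).
  apply: ip_ext => z; rewrite ip0l (dagPr (Gn_blin m)).
  have [P [bP sP _ P1 P2]] := sub_proj ps; have bGm := Gn_blin m.
  have PG : P \o Gn m = Gn m.
    apply: WS_op => [||k x w S q v' Ax h]; [exact: blinM|by []|].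
    have [km|/eqP kn] := eqVneq k m; last by rewrite /= (Gn_0 _ kn Ax h) (lin0 bP.1).
    by subst k; rewrite /= (GnE _ Ax h); exact: (P1 (MkWI v' Ax h)).
  by rewrite -PG /= -(saP bP sP) P2// ip0l.
Qed.
(** The projection onto the closed span of the vectors [a p_e v], those that begin with a letter. *)
Definition A1 : op G := Gn 1 \o dag (Gn 1).
Lemma A1_blin : blin A1. Proof. exact: (blinM (Gn_blin 1) (Gd_blin 1)). Qed.
Lemma A1_sa : dag A1 = A1.
Proof. by rewrite /A1 (dagM (Gn_blin 1) (Gd_blin 1)) (dagK (Gn_blin 1)). Qed.
Lemma Gd_sig n a v : A a -> dag (Gn n) (Pi a v) = s0 a (dag (Gn n) v).
Proof.
move=> Aa; have Ad := calgJ cA Aa; have bG := Gn_blin n; have bs := sig_blin ce sA Pi1 (NA Aa).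
apply: ip_ext => z; rewrite (dagPr bG) (dagP (bPi Aa)) -(sh_dag sA)// -(Gn_sig n z Ad) -(dagPr bG).
by rewrite (dagP bs) -(sh_dag (sig_star ce sA Pi1) (NA Aa)).
Qed.
Lemma A1_Cm : Cm A Pi A1.
Proof.
split; first exact/bounded_opP/A1_blin.
by move=> _ [a Aa <-]; apply/funext => v; rewrite /A1 /= Gd_sig// Gn_sig.
Qed.
Lemma A1_letter y e v : A y -> A1 (Pi y (p e (ups e v))) = Pi y (p e (ups e v)).
Proof. by move=> Ay; exact: (GGS v Ay (WSc (CW1 _ _ _ _ _ _ e))). Qed.
Lemma A1_p e v : A1 (p e v) = p e v.
Proof.
have := A1_letter e (ups (~~ e) (p e v)) (calg1 cA).
by rewrite Pi1 (ts_UV ts) (ts_ppx ts).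
Qed.
Lemma WS1 w S q : WS 1 w S q -> exists e, w = U e /\ S = p e \o ups e.
Proof.
move=> /WS_inv[[//]|[e [d [W [_ h _]]]]].
have [[_ [_ -> _ ->]]|[d' [y [w' [W' [S' [m [[m0] h' _ _ _]]]]]]]] := CW_unsnoc h; first by exists d.
by have := CW_n0 h'; rewrite -m0.
Qed.
Lemma A1G z : A1 (Gn 1 z) = Gn 1 z.
Proof.
suff /(app_eq z) : A1 \o Gn 1 = Gn 1 by [].
have bG := Gn_blin 1; apply: WS_op => [||m x w S q v Ax h]; [exact: (blinM A1_blin bG)|by []|].
have [m1|/eqP ne] := eqVneq m 1%N; last by rewrite /= !(Gn_0 _ ne Ax h) (lin0 A1_blin.1).
by subst m; rewrite /= (GnE _ Ax h); exact: GGS h.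
Qed.
Lemma G0d v : dag (Gn 0) v = t0 id v.
Proof. by have := GnD v (calg1 cA) WS0; rewrite Pi1. Qed.
Lemma G0E v : Gn 0 (t0 id v) = v.
Proof. by have := GnE v (calg1 cA) WS0; rewrite Pi1. Qed.
Let T2 n := Gn n \o dag (Gn n).
Let T1 n := Gn n \o ind A1 \o dag (Gn n).
Lemma T1G n z : T1 n.+1 (Gn n.+2 z) = Gn n.+2 z.
Proof.
have bG := Gn_blin n.+1; have bG2 := Gn_blin n.+2; have bi := ind_blin ce sA Pi1 A1_Cm.
have bT1 : blin (T1 n.+1) := blinM (blinM bG bi) (Gd_blin n.+1).
suff /(app_eq z) : T1 n.+1 \o Gn n.+2 = Gn n.+2 by [].
apply: WS_op => [||m x w S q v Ax h]; [exact: blinM|by []|].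
have [mn|/eqP ne] := eqVneq m n.+2; last by rewrite /= !(Gn_0 _ ne Ax h) (lin0 bT1.1).
subst m; rewrite /= (GnE _ Ax h).
have [[//]|[e [d [W [_ hC _]]]]] := WS_inv h.
have [[//]|[d' [y [w' [W' [S' [m [[mn] h' Ay cy [_ _ ->]]]]]]]]] := CW_unsnoc hC; subst m.
have h1 := WSc h'; pose z1 := Pi y (p d (ups d v)).
have e0 : (id - p (~~ d')) z1 = z1 by rewrite !fctE /z1 (ts_p0 _ Ay cy) subr0.
rewrite -[X in Pi x X]/(S' z1) /T1 /= (GnD _ Ax h1) e0 ind_tau//; last exact: A1_Cm.
by rewrite (GnE _ Ax h1) A1_letter.
Qed.
Lemma T2G n z : T2 n.+2 (Gn n.+1 (ind A1 z)) = Gn n.+1 (ind A1 z).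
Proof.
have bG := Gn_blin n.+1; have bG2 := Gn_blin n.+2; have bi := ind_blin ce sA Pi1 A1_Cm.
have bT2 : blin (T2 n.+2) := blinM bG2 (Gd_blin n.+2).
suff /(app_eq z) : T2 n.+2 \o (Gn n.+1 \o ind A1) = Gn n.+1 \o ind A1 by [].
apply: WS_op => [||m x w S q v Ax h]; [by apply: blinM => //; apply: blinM|exact: blinM|].
have CA1 := A1_Cm; rewrite /= ind_tau//.
have [mn|/eqP ne] := eqVneq m n.+1; last by rewrite /= !(Gn_0 _ ne Ax h) (lin0 bT2.1).
subst m; rewrite (GnE _ Ax h); have [bS _] := WS_blin h; rewrite /A1 /=; move: (dag (Gn 1) v) => {}z.
have bL : blin (Pi x \o S \o Gn 1) := blinM (blinM (bPi Ax) bS) (Gn_blin 1).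
suff /(app_eq z) : T2 n.+2 \o (Pi x \o S \o Gn 1) = Pi x \o S \o Gn 1 by [].
apply: WS_op => [||m y w1 S1 q1 v1 Ay h1]; [exact: blinM|by []|].
have [m1|/eqP ne] := eqVneq m 1%N; last first.
  by rewrite /= !(Gn_0 _ ne Ay h1) (lin0 bS.1) (lin0 (bPi Ax).1) (lin0 bT2.1).
subst m; rewrite /= (GnE _ Ay h1); have [e [_ ->]] := WS1 h1 => /=.
have [[//]|[e0 [d [W [_ hC _]]]]] := WS_inv h.
(* For letters of opposite sign [S] kills the part [Ee e y], which commutes with [p_e] ([CW_end]);
   hence [y] may be taken reduced. *)
pose y' := if d == e then y else y - Ee e y.
have Ay' : A y' by rewrite /y'; case: ifP => // _; apply: (calgB cA) => //; apply: (hd_E hd).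
have cy' : d != e -> F e y' = 0 by rewrite /y' => /negbTE ->; apply: (F_sub hd).
have -> : S (Pi y (p e (ups e v1))) = S (Pi y' (p e (ups e v1))).
  rewrite /y'; case: eqVneq => // ne; have AE := hd_E hd e Ay.
  rewrite (shB sA Ay AE) fctE (linB bS.1) -(ts_com hd ts)// (Uneg ne) (CW_end _ hC) subr0 //.
exact: (GGS v1 Ax (WSc (CW_snoc Ay' cy' hC))).
Qed.
(** A word of length [n.+1] is a word of length [n] followed by a letter. For positive [n] the two
    self-adjoint operators [T1 n] and [T2 n.+1] each fix the range of the other, so they coincide;
    [n = 0] is direct. *)
Lemma telescope n v : Gn n (ind A1 (dag (Gn n) v)) = Gn n.+1 (dag (Gn n.+1) v).
Proof.
have CA1 := A1_Cm; case: n => [|n].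
  by rewrite G0d ind_tau ?G0E//; apply: calg1 cN.
have bG := Gn_blin n.+1; have bG2 := Gn_blin n.+2; have bi := ind_blin ce sA Pi1 A1_Cm.
have b1 : blin (T1 n.+1) := blinM (blinM bG bi) (Gd_blin n.+1).
have b2 : blin (T2 n.+2) := blinM bG2 (Gd_blin n.+2).
have s2 : dag (T2 n.+2) = T2 n.+2 by rewrite (dagM bG2 (Gd_blin _)) (dagK bG2).
have s1 : dag (T1 n.+1) = T1 n.+1.
  by rewrite (dagM (blinM bG bi) (Gd_blin _)) (dagM bG bi) (dagK bG) -ind_dag// A1_sa.
apply: ip_ext => w; rewrite -[LHS]/(inner (T1 n.+1 v) w) -[RHS]/(inner (T2 n.+2 v) w).
have e1 : T2 n.+2 (T1 n.+1 v) = T1 n.+1 v by exact: T2G.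
have e2 : T1 n.+1 (T2 n.+2 w) = T2 n.+2 w by exact: T1G.
by rewrite -e1 (saP b2 s2) (saP b1 s1) e2 -(saP b2 s2).
Qed.

Definition Com (T : op G) := [/\ Cm A Pi T, forall e, T \o ups e = ups e \o T & forall e, T \o p e = p e \o T].
Lemma Com_dag T : Com T -> Com (dag T).
Proof.
move=> [CT hu hp]; have cC := Cm_calg ce sA; have bT := calgW cC CT; split=> [|e|e].
- exact: (calgJ cC).
- by have := congr1 (@dag _ _ _) (hu (~~ e)); rewrite (dagM bT (bu _)) (dagM (bu _) bT) (ts_dag ts) negbK => ->.
- by have := congr1 (@dag _ _ _) (hp e); rewrite (dagM bT (bp _)) (dagM (bp _) bT) (ts_psa ts) => ->.
Qed.
Lemma Com_S n w S q T v : Com T -> WS n w S q -> T (S v) = S (T v).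
Proof.
move=> [CT hu hp]; case=> [//|e d n0 w0 W S0 h]; move: v.
have hux e0 v : T (ups e0 v) = ups e0 (T v) by have /(app_eq v) := hu e0.
have hpx e0 v : T (p e0 v) = p e0 (T v) by have /(app_eq v) := hp e0.
elim: h => [e0|e0 e1 d0 n1 x w1 W1 S1 Ax cx h ih] v /=; first by rewrite hpx hux.
by rewrite hpx hux (CmE _ CT Ax) ih.
Qed.

(** * The isometry [V] and the length multiplier *)

Section Dilation.
Variable r : R.
Hypotheses (r0 : 0 < r) (r1 : r < 1).
Let kap : R := Num.sqrt (1 - r ^+ 2).
Lemma kap2 : kap ^+ 2 = 1 - r ^+ 2.
Proof. by rewrite sqr_sqrtr// subr_ge0 expr_le1 ?ltW. Qed.
(** The root of [1 - r^2 A1]: as [A1] is a projection, [Dd] is the scalar [kap] on its range and the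
    identity on the complement. *)
Definition Dd : op G := id - (1 - kap)%:C%C *: A1.
Lemma Dd_Cm : Cm A Pi Dd.
Proof.
have cC := Cm_calg ce sA; apply: (calgB cC); first exact: (calg1 cC).
exact: (calgZ _ cC A1_Cm).
Qed.
Lemma Dd_blin : blin Dd. Proof. exact: (calgW (Cm_calg ce sA) Dd_Cm). Qed.
Lemma Dd_sa : dag Dd = Dd.
Proof.
rewrite /Dd (dagB (@blin_id _ _) (blinZ _ A1_blin)) dag_id (dagZ _ A1_blin) A1_sa JC //.
Qed.
Lemma Dd_fix v : A1 v = v -> Dd v = kap%:C%C *: v.
Proof. by move=> h; rewrite /Dd !fctE h -{1}[v]scale1r -scalerBl rmorphB /= subKr. Qed.
Lemma Dd_sq v : Dd (Dd v) = v - (r ^+ 2)%:C%C *: A1 v.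
Proof.
have bA := A1_blin; have AA w : A1 (A1 w) = A1 w by rewrite {2 3}/A1 /= A1G.
rewrite /Dd !fctE (linB bA.1) (linZ bA.1) AA.
have -> : A1 v - (1 - kap)%:C%C *: A1 v = kap%:C%C *: A1 v.
  by rewrite -{1}[A1 v]scale1r -scalerBl rmorphB /= subKr.
rewrite scalerA -addrA -opprD -scalerDl -rmorphM -rmorphD; congr (_ - _%:C%C *: _).
have := kap2; rewrite !expr2 => e; have -> : r * r = 1 - kap * kap by rewrite e; ring.
ring.
Qed.
Definition Vt n : G -> I0 := ind Dd \o dag (Gn n).
Definition VN n : G -> I0 := \sum_(i < n) (r ^+ i)%:C%C *: Vt i.
Let bDi : blin (ind Dd) := ind_blin ce sA Pi1 Dd_Cm.
Lemma Vt_blin n : blin (Vt n). Proof. exact: (blinM bDi (Gd_blin n)). Qed.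
Lemma VN_blin n : blin (VN n).
Proof. by apply: blin_sum => i; apply/blinZ/Vt_blin. Qed.
Lemma VNS n : VN n.+1 = VN n + (r ^+ n)%:C%C *: Vt n.
Proof. by rewrite /VN big_ord_recr. Qed.
Lemma Vt_ip n m v w : n <> m -> inner (Vt n v) (Vt m w) = 0.
Proof.
move=> ne; have C2 := calgM (Cm_calg ce sA) Dd_Cm Dd_Cm.
rewrite /Vt /= (saP bDi) -?ind_dag ?Dd_sa//; try exact: Dd_Cm.
have /(app_eq (dag (Gn m) w)) /= <- := ind_comp ce sA Pi1 Dd_Cm Dd_Cm.
by rewrite (dagPr (Gn_blin n)) Gcross// ip0r.
Qed.
Lemma Vt_ip2 n v w : inner (Vt n v) (Vt n w) = inner (dag (Gn n) v) (dag (Gn n) w) -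
  (r ^+ 2)%:C%C * inner (dag (Gn n.+1) v) (dag (Gn n.+1) w).
Proof.
have CA := A1_Cm; have cC := Cm_calg ce sA.
rewrite /Vt /= (saP bDi) -?ind_dag ?Dd_sa//; try exact: Dd_Cm.
have /(app_eq (dag (Gn n) w)) /= <- := ind_comp ce sA Pi1 Dd_Cm Dd_Cm.
have -> : Dd \o Dd = (- r ^+ 2)%:C%C *: A1 + id.
  by apply/funext => z; rewrite /= Dd_sq !fctE rmorphN scaleNr addrC.
rewrite (ind_ZD ce sA Pi1 _ CA (calg1 cC)) ind_id !fctE ipDr ipZr JC rmorphN mulNr addrC.
congr (_ - _ * _); rewrite (dagPr (Gn_blin n)) (dagPr (Gn_blin n.+1)) telescope //.
Qed.
(** Terms of different lengths are orthogonal ([Gcross]). By [Dd_sq] and [telescope] the term of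
    length [n] contributes a difference of consecutive quantities, and the sum collapses. *)
Lemma VN_ip n v w : inner (VN n v) (VN n w) =
  inner v w - (r ^+ (2 * n))%:C%C * inner (dag (Gn n) v) (dag (Gn n) w).
Proof.
have VNe k z : VN k z = \sum_(i < k) (r ^+ i)%:C%C *: Vt i z by rewrite /VN sumE.
elim: n => [|n ih].
  rewrite !VNe !big_ord0 ip0l muln0 expr0 mul1r !G0d.
  by rewrite -[t0 id v]/(delta ce sA Pi1 v) -[t0 id w]/(delta ce sA Pi1 w) delta_iso subrr.
rewrite VNS !fctE ipDl !ipDr ih !ipZl !ipZr JC.
have c1 a b : inner (VN n a) (Vt n b) = 0.
  rewrite VNe ip_suml big1// => i _; rewrite ipZl Vt_ip ?mulr0// => e.
  by have := ltn_ord i; rewrite e ltnn.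
rewrite c1 -[inner (Vt n v) _]ipJ c1 rmorph0 !mulr0 addr0 add0r Vt_ip2 !mulrBr.
rewrite mulnS !mul2n -addnn !exprD !rmorphM /=; move: (inner _ _) (inner _ _) (inner _ _) (_%:C%C) (_%:C%C) => *; ring.
Qed.

Lemma V_exists : exists V : G -> I0, blin V /\ ncvg VN V.
Proof.
have [c c0 nc] := blin_nb bDi; have c0' := ltW c0; have r0' := ltW r0.
have [n|n|V [bV hV]] := op_lim c0' r0' r1 (T := VN); first exact: VN_blin.
  rewrite VNS addrAC subrr add0r mulrC; apply: nbZ => //.
  - by split=> //; have := bnd_comp (sqr_ge0 c) nc.2 (Gd_nb n).2; rewrite expr1n mulr1.
  - by rewrite exprn_ge0.
  - by rewrite m2C.
by exists V.
Qed.
Definition V : G -> I0 := xget 0 [set V | blin V /\ ncvg VN V].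
Lemma V_P : blin V /\ ncvg VN V.
Proof. by have := V_exists => h; exact: (@xgetPex _ 0 [set V | blin V /\ ncvg VN V] h). Qed.
Lemma V_blin : blin V. Proof. by case: V_P. Qed.
Lemma V_ip v w : inner (V v) (V w) = inner v w.
Proof.
have [bV cV] := V_P.
have h := clim_ip (ncvg_hlim v cV) (ncvg_hlim w cV); apply: (clim_uniq h).
apply: (clim_ext (w := fun n => inner v w + (- ((r ^+ (2 * n))%:C%C * inner (dag (Gn n) v) (dag (Gn n) w))))) => [n|].
  by rewrite VN_ip.
rewrite -[X in clim _ X]addr0; apply: climD; first exact: clim_cst.
move=> e e0; have B : 0 < 1 + n2 v * n2 w by have := mulr_ge0 (n2_ge0 v) (n2_ge0 w); lra.
(* The squared modulus of the remainder carries [r^(2 n)] squared, hence the ratio [r^4]. *)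
have r2 : 0 <= r ^+ 4 by rewrite exprn_ge0// ltW.
have r21 : r ^+ 4 < 1 by rewrite exprn_ilt1// ltW.
have [M hM] := pow_small r2 r21 (divr_gt0 e0 B); exists M => n /hM h1.
have m2N (z : R[i]) : m2 (- z) = m2 z by rewrite /m2 !reim !sqrrN.
rewrite subr0 m2N m2M m2C -exprM.
have := CS (dag (Gn n) v) (dag (Gn n) w); have := (Gd_nb n).2 v; have := (Gd_nb n).2 w.
rewrite expr1n !mul1r => hw hv hc.
have hb : m2 (inner (dag (Gn n) v) (dag (Gn n) w)) <= n2 v * n2 w.
  by apply: le_trans hc _; apply: ler_pM => //; apply: n2_ge0.
rewrite ltr_pdivlMr// in h1; apply: le_lt_trans h1.
rewrite [r ^+ (2 * n * 2)](_ : _ = (r ^+ 4) ^+ n); last by rewrite -exprM mulnAC mulnC mulnA mulnC.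
by apply: ler_wpM2l; [rewrite exprn_ge0|lra].
Qed.
Lemma V_pair n x w S q v z : A x -> WS n w S q ->
  inner (t0 (x \o w) v) (V z) = (r ^+ n)%:C%C * inner (Pi x (S (Dd v))) z.
Proof.
move=> Ax h; have [bV cV] := V_P.
have hl := clim_ip (hlim_cst (t0 (x \o w) v)) (ncvg_hlim z cV).
apply: (clim_uniq hl); move=> e e0; exists n.+1 => k hk.
suff -> : inner (t0 (x \o w) v) (VN k z) = (r ^+ n)%:C%C * inner (Pi x (S (Dd v))) z.
  by rewrite subrr /m2 !reim expr0n addr0.
have -> : VN k z = \sum_(i < k) (r ^+ i)%:C%C *: Vt i z by rewrite /VN sumE.
rewrite ip_sumr.
have term i : inner (t0 (x \o w) v) ((r ^+ i)%:C%C *: Vt i z) =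
    (r ^+ i)%:C%C * inner (Gn i (t0 (x \o w) (Dd v))) z.
  rewrite ipZr JC /Vt /= -(dagPr bDi) -ind_dag ?Dd_sa//; last exact: Dd_Cm.
  by rewrite ind_tau//; [rewrite (dagP (Gn_blin i)) // dagK|exact: Dd_Cm].
rewrite (bigD1 (Ordinal hk)) //= big1 ?addr0 => [|i ne]; last first.
  rewrite term (Gn_0 _ _ Ax h) ?ip0l ?mulr0// => ni.
  by move: ne; rewrite -val_eqE /= -ni eqxx.
by rewrite term (GnE _ Ax h).
Qed.

Lemma V_a a v : A a -> V (Pi a v) = s0 a (V v).
Proof.
move=> Aa; have bs := sig_blin ce sA Pi1 (NA Aa); have Ad := calgJ cA Aa.
suff /(app_eq v) : V \o Pi a = s0 a \o V by [].
have bV := V_blin; apply/funext => z; apply: ip_extr => y.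
pose X := dag V \o s0 (dag a); pose Y := Pi (dag a) \o dag V; have bdV := blinJ bV.
have bsd := sig_blin ce sA Pi1 (NA Ad).
suff XY : X = Y.
  rewrite /= -(dagPr bV) -(dagPr (bPi Aa)) -(sh_dag sA Aa) -[Pi (dag a) _]/(Y y) -XY /X /= (dagPr bV).
  by rewrite (sh_dag (sig_star ce sA Pi1) (NA Aa)) (dagPr bs).
apply: WS_op => [||n x w S q w' Ax h]; [exact: blinM|exact: (blinM (bPi Ad) bdV)|].
apply: ip_ext => z'; have Nxw := xw_N Ax h; have Adx := AC Ad Ax.
rewrite /X /Y /= (dagPr bV) sig_tau//; last exact: NA.
rewrite compA (V_pair _ _ Adx h) (sh_dag sA Aa) (dagPr (bPi Aa)) (dagPr bV) (V_pair _ _ Ax h).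
by rewrite Pi_comp// (sh_dag sA Aa) (dagPr (bPi Aa)).
Qed.
Lemma V_ind (T : op G) v : Com T -> V (T v) = ind T (V v).
Proof.
move=> hT; have [CT _ _] := hT; have hd' := Com_dag hT; have [Cd _ _] := hd'.
have bi := ind_blin ce sA Pi1 CT; have bV := V_blin; have cC := Cm_calg ce sA.
have bT := calgW cC CT; have bdT := blinJ bT; have bdV := blinJ bV.
have bid := ind_blin ce sA Pi1 Cd.
suff XY : dag V \o ind (dag T) = dag T \o dag V.
  apply: ip_extr => y; rewrite -(dagPr bV) -(dagPr bT) -[dag T _]/((dag T \o dag V) y) -XY /= (dagPr bV).
  by rewrite ind_dag// (dagPr bi).
apply: WS_op => [||n x w S q w' Ax h]; [exact: blinM|exact: blinM|].
apply: ip_ext => z; rewrite /= (dagPr bV) ind_tau// (V_pair _ _ Ax h).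
rewrite (dagPr bT) (dagPr bV) (V_pair _ _ Ax h) -(dagPr bT) (CmE _ Cd Ax) (Com_S _ hd' h).
congr (_ * inner (Pi x (S _)) z); rewrite /Dd !fctE (linB bdT.1) (linZ bdT.1).
congr (_ - _ *: _); have bG := Gn_blin 1; have S1 := fun n w S q v => @Com_S n w S q (dag T) v hd'.
rewrite /A1 /= -Gn_ind//; congr (Gn 1 _).
apply: ip_ext => y; rewrite (dagPr bG) (dagPr bT) ind_dag// (dagPr bi) (dagPr bG).
by rewrite Gn_ind// => k w0 S0 q0 v0; apply: Com_S.
Qed.
Lemma V_out e y z : p e z = z -> inner (p (~~ e) (ups (~~ e) y)) (ups (~~ e) z) = 0.
Proof.
move=> pz; have -> a : inner a (ups (~~ e) z) = inner (ups e a) z by rewrite (dagP (bu e)) (ts_dag ts).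
have := ts_lstar ts (~~ e) (ups (~~ e) y); rewrite negbK (ts_UV ts) => ->.
by rewrite ipBl (saP (bp e) (ts_psa ts e)) pz subrr.
Qed.
Lemma WS_vec (a b : I0) : (forall n x w S q v, A x -> WS n w S q ->
  inner (t0 (x \o w) v) a = inner (t0 (x \o w) v) b) -> a = b.
Proof.
move=> h; apply: ip_extr => y; apply/subr0_eq; rewrite -ipBr; move: y.
apply: WS_total => [|y hy|n x w S q v Ax hW]; last by rewrite ipBr (h _ _ _ _ _ _ Ax hW) subrr.
  by split=> [|k y y' e e']; [exact: ip0l|rewrite ipDl ipZl e e' mulr0 addr0].
apply: m2_eq0; apply/eqP; rewrite eq_le m2_ge0 andbT; apply: le_eps => e e0.
have c0 := n2_ge0 (a - b); have e1 : 0 < e / (1 + n2 (a - b)) by rewrite divr_gt0//; lra.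
have [y' hy' ny] := hy _ e1; have := CS (y - y') (a - b); rewrite ipBl hy' subr0 add0r => /le_trans; apply.
by rewrite ltr_pdivlMr in ny; [move: ny; have := n2_ge0 (y - y') => *; nra|lra].
Qed.
Lemma t0_id n x w S q v z : A x -> WS n w S q -> inner (t0 (x \o w) v) (t0 id z) = inner (Pi (E (x \o w)) v) z.
Proof.
by move=> Ax h; have Nxw := xw_N Ax h; rewrite tauE//; [rewrite dag_id|exact: calg1 cN].
Qed.
Lemma s0_ip y (a b : I0) : N y -> inner a (s0 y b) = inner (s0 (dag y) a) b.
Proof.
move=> Ny; have bs := sig_blin ce sA Pi1 Ny.
by rewrite (sh_dag (sig_star ce sA Pi1) Ny) (dagPr bs).
Qed.
(** Expansion along the first letter. For [z] beginning with [u^e] the component of length 0 is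
    [Dd z = kap z]; the longer ones are those of [u^-e z] with [u^e] put in front, each longer by
    one letter and so carrying one more factor [r]. *)
Lemma V_R e z : p e z = z -> V z = kap%:C%C *: t0 id z + r%:C%C *: s0 (U e) (V (ups (~~ e) z)).
Proof.
move=> pz; have A1' := calg1 cA; have NU := N_U hd.
have Ddz : Dd z = kap%:C%C *: z by apply: Dd_fix; rewrite -pz A1_p.
apply: WS_vec => n x w S q v Ax h; have Nxw := xw_N Ax h.
rewrite ipDr !ipZr !JC (t0_id _ _ Ax h) s0_ip// (U_dag hd) sig_tau// (V_pair _ _ Ax h).
case: (WS_inv h) => [[n0 wE SE qE]|[e0 [d [W [n0 hC qE]]]]].
  subst n w S q; have -> : U (~~ e) \o (x \o id) = (id \o U (~~ e)) \o x by [].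
  rewrite (@tau_bal _ _ _ _ _ ce _ _ sA Pi1 (id \o U (~~ e)) x v)//; last exact: (NU (~~ e)).
  rewrite (V_pair _ _ A1' (WSc (CW1 _ _ _ _ _ _ _))) Pi1 /= V_out// !mulr0 addr0.
  rewrite -[_ \o _]/x (ce_fix ce Ax) expr0 mul1r -(CmE _ Dd_Cm Ax).
  by rewrite (saP Dd_blin Dd_sa) Ddz ipZr JC.
rewrite (E_dag_word Ax (CW_RW hC)) (sh0 cA sA) [inner (0 v) z]ip0l mulr0 add0r.
(* The claim for fixed [w], as a property of the left coefficient: it is additive, so [x] may be
   split into [x - Ee e x] and [Ee e x]. *)
pose Q x := (r ^+ n)%:C%C * inner (Pi x (S (Dd v))) z = r%:C%C * inner (t0 (U (~~ e) \o (x \o w)) v) (V (ups (~~ e) z)).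
have red y : A y -> (~~ e != e0 -> F e0 y = 0) -> Q y.
  move=> Ay cy; rewrite /Q; have := CWc Ay cy hC => h2.
  have -> : U (~~ e) \o (y \o w) = id \o (U (~~ e) \o y \o w) by [].
  rewrite (V_pair _ _ A1' (WSc h2)) Pi1 /= V_out// !mulr0 -pz -(saP (bp e) (ts_psa ts e)).
  by have := CW_p0 (Dd v) Ay cy hC; rewrite negbK => ->; rewrite ip0l mulr0.
rewrite -/(Q x); have [ee|ne] := eqVneq e0 e; last first.
  by apply: red => //; rewrite (Uneg ne) negbK eqxx.
subst e0; have AE := hd_E hd e Ax; have A0 := calgB cA Ax AE; have AF := F_in hd e Ax.
have {red} := red _ A0 (fun _ => F_sub hd e Ax); rewrite /Q => Q1.
have NE := NC (NU (~~ e)) (xw_N AE h); have N0 := NC (NU (~~ e)) (xw_N A0 h).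
have -> : U (~~ e) \o (x \o w) = 1 *: (U (~~ e) \o ((x - Ee e x) \o w)) + (U (~~ e) \o (Ee e x \o w)).
  by rewrite scale1r; apply/funext => k; rewrite /= !fctE /= (linB (bU _).1) subrK.
rewrite tauDl// scale1r ipDl mulrDr -Q1 (shB sA Ax AE) !fctE ipBl mulrBr -[LHS](subrK ((r ^+ n)%:C%C * inner (Pi (Ee e x) (S (Dd v))) z)).
congr (_ + _); have [zz [Z [wE SE Nz hz]]] := CW_decomp hC.
have -> : (fun k => U (~~ e) (Ee e x (w k))) = F e x \o zz by rewrite wE; apply/funext => k; rewrite /= /Eeps /= !(VUx hd).
have -> : inner (Pi (Ee e x) (S (Dd v))) z = inner (Pi (F e x) (Z (Dd v))) (ups (~~ e) z).
  rewrite SE /= -(ts_com hd ts)// (saP (bp e) (ts_psa ts e)) pz (ts_cov ts)//= (ts_VU ts) (dagP (bu e)) (ts_dag ts) //.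
case: hz => [[n1 zE ZE _]|[e1 [m [x1 [w1 [W1 [S1 [nm h1 Ax1 _ [zE ZE]]]]]]]]].
  by subst n zz Z; rewrite (V_pair _ _ AF WS0) expr0 mul1r expr1.
subst n zz Z; rewrite compA (V_pair _ _ (AC AF Ax1) (WSc h1)) mulrA -rmorphM -exprS Pi_comp //.
Qed.
(** One further letter [u^d] on the right of [B]. The vector [v] is split into a part that [u^d]
    lengthens and a part whose first letter it cancels, and [V_R] rewrites both; the last two
    hypotheses handle the terms of length 0. The factor [r] comes out through [1 - kap^2 = r^2]. *)
Lemma V_step (B : op I0) (Wb : op G) d (rho : R) v z : blin B -> lin Wb ->
  (forall y, inner (B (V y)) (V z) = rho%:C%C * inner (Wb y) z) ->
  (forall y, p d y = y -> inner (B (t0 id y)) (V z) = (rho * kap)%:C%C * inner (Wb y) z) ->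
  (forall y, p (~~ d) y = y -> inner (B (s0 (U d) (t0 id y))) (V z) = 0) ->
  inner (B (s0 (U d) (V v))) (V z) = (rho * r)%:C%C * inner (Wb (ups d v)) z.
Proof.
move=> bB lW b1 b2 b3; have bV := V_blin; have bs := sig_blin ce sA Pi1 (N_U hd d).
pose v2 := p (~~ d) v; pose v1 := v - v2; pose y := p d (ups d v).
have py : p d y = y by exact: (ts_ppx ts).
have p2 : p (~~ d) v2 = v2 by exact: (ts_ppx ts).
have y1 : ups d v1 = y by exact: (ts_r1 ts).
have v1E : ups (~~ d) y = v1 by rewrite -y1 (ts_VU ts).
have h1 := V_R py; have h2 := V_R p2; rewrite v1E in h1; rewrite negbK in h2.
have {}h2 : s0 (U d) (V v2) = kap%:C%C *: s0 (U d) (t0 id v2) + r%:C%C *: V (ups d v2).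
  rewrite h2 bs.1 (linZ bs.1); congr (_ + _ *: _).
  have /(app_eq (V (ups d v2))) /= <- := sh_comp (sig_star ce sA Pi1) (N_U hd d) (N_U hd (~~ d)).
  by rewrite (UV hd) sig1.
have vE : v = v1 + v2 by rewrite /v1 subrK.
have r0' : r%:C%C != 0 :> R[i] by rewrite -(rmorph0 (real_complex R)) (inj_eq (@complexI R)) gt_eqF.
(* After multiplication by [r] the expansion of [V y] can be solved for [r u^d V v1]. *)
apply: (mulfI r0'); rewrite {1}vE (linD bV.1) (linD bs.1) (linD bB.1) ipDl mulrDr.
have -> : r%:C%C * inner (B (s0 (U d) (V v1))) (V z) = (rho * r ^+ 2)%:C%C * inner (Wb y) z.
  rewrite -ipZl -(linZ bB.1); have -> : r%:C%C *: s0 (U d) (V v1) = V y - kap%:C%C *: t0 id y.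
    by rewrite h1 addrAC subrr add0r.
  rewrite (linB bB.1) (linZ bB.1) ipBl ipZl b1 b2// mulrA -mulrBl -rmorphM -rmorphB; congr (_%:C%C * _).
  by rewrite [r ^+ 2](_ : _ = 1 - kap ^+ 2); [ring|rewrite kap2; ring].
have -> : inner (B (s0 (U d) (V v2))) (V z) = (r * rho)%:C%C * inner (Wb (ups d v2)) z.
  by rewrite h2 (linD bB.1) !(linZ bB.1) ipDl !ipZl b3// mulr0 add0r b1 mulrA -rmorphM.
have -> : inner (Wb (ups d v)) z = inner (Wb y) z + inner (Wb (ups d v2)) z.
  by rewrite {1}vE (linD (bu d).1) y1 (linD lW) ipDl.
by rewrite expr2 !rmorphM /=; ring.
Qed.
Lemma V_word n e d w W S : CW e d n w W S -> forall v z, inner (s0 w (V v)) (V z) = (r ^+ n)%:C%C * inner (W v) z.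
Proof.
have N1 := calg1 cN; have A1' := calg1 cA; have sS := sig_star ce sA Pi1.
have Ddz d0 y : p d0 y = y -> Dd y = kap%:C%C *: y by move=> py; apply: Dd_fix; rewrite -py A1_p.
elim: n e d w W S => [|n ih] e d w W S h v z; first by have := CW_n0 h.
have NUd := N_U hd d.
have [bW bS] := CW_blin ts h.
case: (CW_unsnoc h) => [[[n0] [ed wE WE SE]]|[d' [y [w' [W' [S' [m [[nm] h' Ay cy [wE WE SE]]]]]]]]].
  subst n w W; rewrite exprS expr0 mulr1 -[r]mul1r.
  apply: (@V_step id id d 1 v z); [exact: blin_id|by []| | |].
  - by move=> y; rewrite V_ip mul1r.
  - move=> y py; have -> : inner (t0 id y) (V z) = inner (t0 (id \o id) y) (V z) by [].
    by rewrite (V_pair _ _ A1' WS0) Pi1 (Ddz _ _ py) expr0 mul1r ipZl mul1r.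
  - move=> y py; rewrite sig_tau// -[U d \o id]/(id \o U d) (V_pair _ _ A1' (WSc (CW1 _ _ _ _ _ _ _))).
    by rewrite Pi1 (Ddz _ _ py) /= (linZ (bu d).1) (linZ (bp d).1) -py (ts_lp0 d y) scaler0 ip0l mulr0.
subst m; have Nw' := RW_N hd (CW_RW h'); have Ny := NA Ay; have Nwy := NC Nw' Ny.
have [bW' bS'] := CW_blin ts h'.
have -> : s0 w (V v) = (s0 w' \o s0 y) (s0 (U d) (V v)) by rewrite wE (sh_comp sS Nwy NUd) (sh_comp sS Nw' Ny).
rewrite exprSr -[W v]/(W v) WE; apply: (@V_step (s0 w' \o s0 y) (W' \o Pi y) d).
- by apply: blinM; apply: sig_blin.
- exact: (blinM bW' (bPi Ay)).1.
- by move=> k; rewrite /= -V_a// (ih _ _ _ _ _ h').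
- move=> k pk; have Ny1 : N (y \o id) := NC Ny N1; rewrite /= sig_tau// sig_tau//.
  have -> : w' \o (y \o id) = (id \o w') \o y by [].
  rewrite (tau_bal ce sA Pi1)// (V_pair _ _ A1' (WSc h')) Pi1 (CmE _ Dd_Cm Ay) (Ddz _ _ pk).
  rewrite (linZ (bPi Ay).1) (linZ bS'.1) ipZl mulrA -rmorphM; congr (_ * inner _ z).
  by rewrite -pk (CW_creat _ h' Ay cy).
- move=> k pk; have NU1 : N (U d \o id) := NC NUd N1; have Ny1 := NC Ny NU1.
  rewrite sig_tau// -[(s0 w' \o s0 y) _]/(s0 w' (s0 y _)) sig_tau// sig_tau//.
  have -> : w' \o (y \o (U d \o id)) = id \o w by rewrite wE.
  by rewrite (V_pair _ _ A1' (WSc h)) Pi1 (Ddz _ _ pk) (linZ bS.1) -pk (CW_end _ h) scaler0 ip0l mulr0.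
Qed.
End Dilation.
End TreeWords.

(** * Slices *)

Section NumericalRange.
Variables (R : realType) (K : hilbertType R).
Implicit Types (x y : op K) (k : K).
Lemma herm_bound y m : blin y -> (forall k, Re (inner (y k) k) <= m * n2 k) ->
  hpos (m%:C%C *: id - (2^-1)%:C%C *: (y + dag y)).
Proof.
move=> by_ h; have bd := blinJ by_; have b1 := blinZ m%:C%C (@blin_id R K).
have b2 := blinZ (2^-1)%:C%C (blinD by_ bd).
apply: hposI => [||k]; first exact: blinB.
  by rewrite (dagB b1 b2) (dagZ _ (@blin_id _ _)) (dagZ _ (blinD by_ bd)) !JC dag_id (dagD by_ bd) (dagK by_) [dag y + y]addrC.
rewrite !fctE ipBl !ipZl ipDl (dagPr by_) -[inner k (y k)]ipJ ipC !reim.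
have := h k; move: (Re _) (Im _) (n2 k) => a b c; lra.
Qed.
Lemma sh_Re_le (G : hilbertType R) (A : set (op K)) (l : op K -> op G) y m v : calg A -> star_hom_on A l ->
  A y -> 0 <= m -> (forall k, Re (inner (y k) k) <= m * n2 k) -> Re (inner (l y v) v) <= m * n2 v.
Proof.
move=> cA sl Ay m0 h; have by_ := calgW cA Ay; have pb := herm_bound by_ h.
have Ad := calgJ cA Ay; have AD := calgD cA Ay Ad; have A1 := calg1 cA.
have := hpos_Re v (sh_pos cA sl (calgB cA (calgZ _ cA A1) (calgZ _ cA AD)) pb).
rewrite (shB sl (calgZ _ cA A1) (calgZ _ cA AD)) !(shZ cA sl)// (shD sl)// (sh_dag sl)//.
rewrite !fctE ipBl !ipZl ipDl (dagPr (sh_blin sl Ay)) -[inner v (l y v)]ipJ (sh_id_n2 cA sl) !reim.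
have := sh_id_le cA sl v; move/(ler_wpM2l m0); move: (Re _) (Im _) (m * _) (n2 v) => *; lra.
Qed.
Section CE.
Variables (N A : set (op K)) (E : op K -> op K).
Hypothesis ce : CE N A E.
Let cN := ceN ce.
Lemma ce_Re_form x y m : N x -> N y -> let b := m%:C%C *: id - (2^-1)%:C%C *: (y + dag y) in
  forall k, Re (inner (E (dag x \o b \o x) k) k) =
    m * Re (inner (E (dag x \o x) k) k) - Re (inner (E (dag x \o y \o x) k) k).
Proof.
move=> Nx Ny b k; have Nd := calgJ cN Nx.
have bd := calgW cN Nd.
have N1 := calgM cN Nd Nx; have N2 := calgM cN (calgM cN Nd Ny) Nx.
have N3 := calgJ cN N2.
have e3 : dag (dag x \o y \o x) = dag x \o dag y \o x.
  have bx := calgW cN Nx; have by_ := calgW cN Ny.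
  by rewrite (dagM (blinM bd by_) bx) (dagM bd by_) (dagK bx).
have -> : dag x \o b \o x = m%:C%C *: (dag x \o x) - (2^-1)%:C%C *: ((dag x \o y \o x) + dag (dag x \o y \o x)).
  by rewrite e3; apply/funext => v; rewrite /b /= !fctE /= (linB bd.1) !(linZ bd.1) (linD bd.1).
have N4 := calgD cN N2 N3.
rewrite (ceB ce (calgZ _ cN N1) (calgZ _ cN N4)) !(ceZ ce)// (ceD ce)// (ce_dag ce)//.
have bE := ce_blin ce N2.
rewrite !fctE ipBl !ipZl ipDl (dagPr bE) -[inner k (E _ k)]ipJ !reim.
by move: (Re _) (Re _) (Im _) (Im _) => *; lra.
Qed.
Lemma ce_sq_ge0 x k : N x -> 0 <= Re (inner (E (dag x \o x) k) k).
Proof.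
move=> Nx; apply/hpos_Re/(ce_pos ce) => [|v /=]; first exact: (calgM cN (calgJ cN Nx) Nx).
by rewrite (dagPr (calgW cN Nx)) ipC ler0c n2_ge0.
Qed.
Lemma ce_Re_le x y m k : N x -> N y -> (forall k, Re (inner (y k) k) <= m * n2 k) ->
  Re (inner (E (dag x \o y \o x) k) k) <= m * Re (inner (E (dag x \o x) k) k).
Proof.
move=> Nx Ny h; have bx := calgW cN Nx; have by_ := calgW cN Ny.
have Nyd := calgJ cN Ny; have N1 := calg1 cN.
have Nb := calgB cN (calgZ m%:C%C cN N1) (calgZ (2^-1)%:C%C cN (calgD cN Ny Nyd)).
have Nxb := calgM cN (calgM cN (calgJ cN Nx) Nb) Nx.
have := hpos_Re k (ce_pos ce Nxb (hpos_sandwich (calgW cN Nb) bx (herm_bound by_ h))).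
by rewrite ce_Re_form//; lra.
Qed.
(** Localized by all [x], a faithful [E] still sees the whole upper end of the numerical range of
    [y], by [ce_order]. *)
Lemma ce_Re_rev y m : N y ->
  (forall x k, N x -> Re (inner (E (dag x \o y \o x) k) k) <= m * Re (inner (E (dag x \o x) k) k)) ->
  forall k, Re (inner (y k) k) <= m * n2 k.
Proof.
move=> Ny h k; have by_ := calgW cN Ny; have Nyd := calgJ cN Ny; have N1 := calg1 cN.
have bD := blinD by_ (blinJ by_); have Nb := calgB cN (calgZ m%:C%C cN N1) (calgZ (2^-1)%:C%C cN (calgD cN Ny Nyd)).
have sb : dag (m%:C%C *: id - (2^-1)%:C%C *: (y + dag y)) = m%:C%C *: id - (2^-1)%:C%C *: (y + dag y).
  rewrite (dagB (blinZ _ (@blin_id _ _)) (blinZ _ bD)) (dagZ _ (@blin_id _ _)) (dagZ _ bD) !JC dag_id.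
  by rewrite (dagD by_ (blinJ by_)) (dagK by_) [dag y + y]addrC.
have := hpos_Re k (ce_order ce Nb sb _); rewrite !fctE ipBl !ipZl ipDl (dagPr by_) -[inner k (y k)]ipJ ipC !reim => hh.
suff : 0 <= m * n2 k - 0 * 0 - (2^-1 * (Re (inner (y k) k) + Re (inner (y k) k)) - 0 * (Im (inner (y k) k) - Im (inner (y k) k))) by lra.
apply: hh => x Nx; have Nxb := calgM cN (calgM cN (calgJ cN Nx) Nb) Nx.
have bx := calgW cN Nx; apply: hposI => [||v]; first exact: (ce_blin ce).
  rewrite -(ce_dag ce)//; congr E; have bb := calgW cN Nb; have bdx := blinJ bx.
  by rewrite (dagM (blinM bdx bb) bx) (dagM bdx bb) (dagK bx) sb.
by rewrite ce_Re_form// subr_ge0; apply: h.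
Qed.
End CE.
End NumericalRange.

Lemma tau_tot (R : realType) (K : hilbertType R) (N A : set (op K)) (E : op K -> op K) (ce : CE N A E)
    (G : hilbertType R) (Pi : op K -> op G) (sP : star_hom_on A Pi) (P1 : Pi id = id) (J : Type) (v : J -> G) :
  total v -> total (fun p : op K * J => tau ce sP P1 (cut N p.1) (v p.2)).
Proof.
move=> tv; apply/totalP => S sS cS h; apply: (proj1 (totalP _) (@tau_total _ _ _ _ _ ce _ _ sP P1) S sS cS) => -[x w].
rewrite /tau2 /= tau_cut; have bt := tau_blin ce sP P1 (cut_in x (ceN ce)).
by apply: (proj1 (totalP _) tv _ (preim_subsp bt.1 sS) (preim_closed bt cS)) => j; exact: (h (x, j)).
Qed.

(* G is K tensored with a space carrying a representation rho of C, and I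
   indexes vectors there: ga c i is the diagonal coefficient of c at i, so
   that slc s i in N is a slice of the element s of N (.) C *)
Record tensor_rep (R : realType) (I : Type) (K G : hilbertType R) (t : I -> K -> G) (kap : I -> I -> R[i])
    (C : choiceType) (cm : C -> C -> C) (cs : C -> C) (rho : C -> op G) (ga : C -> I -> R[i]) : Prop := TensorRep {
  tr_ip : forall i k j l, inner (t i k) (t j l) = kap i j * inner k l;
  tr_total : total (fun p : I * K => t p.1 p.2);
  tr_blin : forall c, blin (rho c);
  tr_mul : forall c d, rho (cm c d) = rho c \o rho d;
  tr_star : forall c, rho (cs c) = dag (rho c);
  tr_comm : forall c x, blin x -> rho c \o amp t x = amp t x \o rho c;
  tr_diag : forall c i k l, inner (rho c (t i k)) (t i l) = ga c i * inner k l
}.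
Section Slices.
Variables (R : realType) (I : Type) (K G1 : hilbertType R) (t : I -> K -> G1) (kap : I -> I -> R[i]).
Variables (C : choiceType) (cm : C -> C -> C) (cs : C -> C) (rho : C -> op G1) (ga : C -> I -> R[i]).
Hypothesis tr : tensor_rep t kap cm cs rho ga.
Let tE := tr_ip tr.
Let tt := tr_total tr.
Let rb := tr_blin tr.
Let rm := tr_mul tr.
Let rs := tr_star tr.
Let rcom := tr_comm tr.
Let rga := tr_diag tr.
Implicit Types (s : seq (op K * C)) (x : op K).
Definition Phit x c : op G1 := amp t x \o rho c.
Definition slc s i : op K := \sum_(p <- s) ga p.2 i *: p.1.
Lemma rga_amp c x i (k l : K) : blin x -> inner (amp t x (rho c (t i k))) (t i l) = ga c i * inner (x k) l.
Proof.
move=> bx; have /(app_eq (t i k)) /= <- := rcom c bx.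
by rewrite (ampE tE tt)// rga.
Qed.
Lemma slc_ip N s i (k l : K) : calg N -> inS N s -> inner (ev Phit s (t i k)) (t i l) = inner (slc s i k) l.
Proof.
move=> cN hs; rewrite /ev /slc !sumE !ip_suml; apply: eq_big_seq => p ps.
by rewrite /Phit /= rga_amp ?fctE ?ipZl//; apply: (calgW cN); apply: hs.
Qed.
Lemma slc_in N s i : calg N -> inS N s -> N (slc s i).
Proof.
move=> cN hs; rewrite /slc big_seq; elim/big_rec: _ => [|p y ps Ny]; first exact: calg0.
by apply: (calg_ZD cN) => //; apply: hs.
Qed.
Lemma n2_t i k : n2 (t i k) = Re (kap i i) * n2 k.
Proof. by rewrite /n2 tE ipC ReM ReC ImC mulr0 subr0. Qed.
Lemma slc_bnd N s i M k : calg N -> inS N s -> nb (ev Phit s) M ->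
  Re (inner (slc s i k) k) <= M * `|Re (kap i i)| * n2 k.
Proof.
move=> cN hs [M0 hM]; rewrite -(slc_ip _ _ _ cN hs); apply: le_trans (bnd_form _ M0 hM) _.
rewrite n2_t mulrA ler_wpM2r ?n2_ge0// ler_wpM2l// ler_norm //.
Qed.
Lemma Phit_birep N : calg N -> birep cm cs N Phit.
Proof.
move=> cN; have ba x : N x -> blin (amp t x) by move=> Nx; apply: (amp_blin tE tt); apply: (calgW cN).
split=> [x c Nx|x y c d Nx Ny|x c Nx]; first by apply: blinM => //; apply: ba.
  have bx := calgW cN Nx; have by_ := calgW cN Ny.
  rewrite /Phit (amp_comp tE tt)// rm; apply/funext => v /=.
  by have /(app_eq (rho d v)) /= -> := rcom c by_.
have bx := calgW cN Nx; rewrite /Phit (dagM (ba _ Nx) (rb c)) (amp_dag tE tt)// -rs.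
by rewrite -(amp_dag tE tt)// rcom//; apply: blinJ.
Qed.

Section Ind.
Variables (N A : set (op K)) (E : op K -> op K) (u : op K).
Hypothesis hd : HD N A E u.
Let ce := hd_ce hd.
Let cN := ceN ce.
Let cA := ceA ce.
Hypotheses (sN : star_hom_on N (amp t)) (Pi1 : amp t id = id).
Let sA := star_sub hd sN.
Local Notation Ph0 := (@Phi0 _ _ _ _ _ _ hd _ _ sN Pi1 _ rho).
Local Notation t0 := (tau ce sA Pi1).
Let rcN c x : N x -> rho c \o amp t x = amp t x \o rho c.
Proof. by move=> Nx; apply/rcom/(calgW cN). Qed.
Lemma form0 s x i k : inS N s -> N x ->
  inner (ev Ph0 s (t0 x (t i k))) (t0 x (t i k)) = inner (E (dag x \o slc s i \o x) k) k.
Proof.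
move=> hs Nx; have Nd := calgJ cN Nx; have bd := calgW cN Nd.
pose g (p : op K * C) := cut N p.1.
have gN p : N (g p) by apply: cut_in.
have -> : dag x \o slc s i \o x = \sum_(p <- s) ga p.2 i *: (dag x \o g p \o x).
  apply/funext => v; rewrite /= /slc !sumE (lin_sum bd.1); apply: eq_big_seq => p ps.
  by rewrite !fctE /= (linZ bd.1) /g cutE//; apply: hs.
have N3 p : N (dag x \o g p \o x) by apply: (calgM cN) => //; apply: (calgM cN).
rewrite (ce_sum ce) => [|p]; last by apply: (calgZ _ cN).
rewrite /ev !sumE !ip_suml; apply: eq_big_seq => p ps; have Np := hs p ps.
have Nax := calgM cN Np Nx.
rewrite (ceZ ce)// fctE ipZl /Phi0 /= ind_tau; last exact: (CmR hd rb rcN).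
rewrite sig_tau// tauE// /om rga_amp; first by rewrite /g cutE.
by apply: (ce_blin ce); apply: (calgM cN).
Qed.
Lemma n2_t0 x i k : N x -> n2 (t0 x (t i k)) = Re (kap i i) * Re (inner (E (dag x \o x) k) k).
Proof.
move=> Nx; have Nxx := calgM cN (calgJ cN Nx) Nx; have bx := calgW cN Nx.
have pE : hpos (E (dag x \o x)).
  by apply: (ce_pos ce) => // v /=; rewrite (dagPr bx) ipC ler0c n2_ge0.
rewrite /n2 tauE// /om (ampE tE tt) ?tE; last exact: (ce_blin ce).
by rewrite ReM (ger0_Im (pE k)) mulr0 subr0.
Qed.
Let bp0 : birep cm cs N Ph0 := bP hd sN Pi1 rb rm rs rcN.
(** At [x (x) t i k] the form of [s] is [E] of its slice at [i] between [x^*] and [x], which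
    [ce_Re_le] bounds; [transfer] removes the constants. *)
Lemma ind_le s M : inS N s -> nb (ev Phit s) M -> nb (ev Ph0 s) M.
Proof.
have tt2 := tau_tot (ce := ce) (sP := sA) (P1 := Pi1) tt.
move=> hs hM; apply: (transfer cN bp0 (Phit_birep cN) tt2 _ hs hM) => -[x [i k]] /=.
have Nx := cut_in x cN; move: (cut N x) Nx => {}x Nx.
have pE := ce_sq_ge0 ce k Nx.
exists (`|Re (kap i i)| * Re (inner (E (dag x \o x) k) k)); first by rewrite mulr_ge0.
move=> s1 M1 hs1 hM1; rewrite form0// mulrAC [_ * M1]mulrC.
apply: (ce_Re_le ce) => // [|k']; [exact: slc_in|exact: slc_bnd cN hs1 hM1].
Qed.
(** The converse comparison, where faithfulness of [E] enters through [ce_Re_rev]. It makes a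
    functional bounded for the spatial norm bounded on the induced space. *)
Lemma ind_ge s M : inS N s -> nb (ev Ph0 s) M -> nb (ev Phit s) M.
Proof.
apply: (transfer cN (Phit_birep cN) bp0 tt) => -[i k] /=.
exists (`|Re (kap i i)| * n2 k); first by rewrite mulr_ge0 ?n2_ge0.
move=> s1 M1 hs1 [M0 hM1]; rewrite (slc_ip _ _ _ cN hs1) mulrAC [_ * M1]mulrC.
apply: (ce_Re_rev ce) => [|x k' Nx]; first exact: slc_in.
rewrite -form0//; apply: le_trans (bnd_form _ M0 hM1) _.
have pE := ce_sq_ge0 ce k' Nx.
by rewrite n2_t0// mulrA ler_wpM2r// ler_wpM2l// ler_norm.
Qed.
End Ind.

Section Hom.
Variables (K' G1' : hilbertType R) (t' : I -> K' -> G1') (rho' : C -> op G1').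
Hypothesis tr' : tensor_rep t' kap cm cs rho' ga.
Let tE' := tr_ip tr'.
Let tt' := tr_total tr'.
Let rcom' := tr_comm tr'.
Variables (A : set (op K)) (l : op K -> op K').
Hypotheses (cA : calg A) (sl : star_hom_on A l).
(** Contractivity of [l (x) id] without complete positivity: on a slice only [l] acts, and
    [sh_Re_le] suffices there because [transfer] absorbs the constants. *)
Lemma hom_le s M : inS A s -> nb (ev Phit s) M -> nb (ev (fun a c => amp t' (l a) \o rho' c) s) M.
Proof.
have bl a : A a -> blin (l a) by exact: (sh_blin sl).
have b2 : birep cm cs A (fun a c => amp t' (l a) \o rho' c).
  split=> [a c Aa|a b c d Aa Ab|a c Aa].
  - by apply: blinM (tr_blin tr' c); apply: (amp_blin tE' tt'); apply: bl.
  - rewrite (sh_comp sl Aa Ab) (amp_comp tE' tt' (bl _ Aa) (bl _ Ab)) (tr_mul tr'); apply/funext => v /=.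
    by have /(app_eq (rho' d v)) /= -> := rcom' c (bl _ Ab).
  - have ba := amp_blin tE' tt' (bl _ Aa); rewrite (dagM ba (tr_blin tr' c)) -(tr_star tr') (sh_dag sl Aa).
    by rewrite -(amp_dag tE' tt' (bl _ Aa)) rcom'//; apply/blinJ/bl.
apply: (transfer cA b2 (Phit_birep cA) tt') => -[i k] /=.
exists (`|Re (kap i i)| * n2 k); first by rewrite mulr_ge0 ?n2_ge0.
move=> s1 M1 hs1 hM1; have [M0 _] := hM1.
have -> : inner (ev (fun a c => amp t' (l a) \o rho' c) s1 (t' i k)) (t' i k) = inner (l (slc s1 i) k) k.
  rewrite /ev sumE ip_suml.
  have lE : l (slc s1 i) = \sum_(p <- s1) ga p.2 i *: l p.1.
    rewrite /slc; elim: s1 hs1 {hM1} => [|p s2 ih] hs2; first by rewrite !big_nil (sh0 cA sl).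
    have [Ap hs3] := inS_cons hs2; rewrite !big_cons (sh_lin sl) ?ih//.
    exact: (slc_in i cA hs3).
  rewrite lE sumE ip_suml; apply: eq_big_seq => p ps; have Ap := hs1 p ps.
  have /(app_eq (t' i k)) /= <- := rcom' p.2 (bl _ Ap).
  by rewrite (ampE tE' tt' _ _ (bl _ Ap)) (tr_diag tr') fctE ipZl.
have As := slc_in i cA hs1; have m0 : 0 <= M1 * `|Re (kap i i)| by rewrite mulr_ge0.
have := sh_Re_le k cA sl As m0 (fun k' => slc_bnd i k' cA hs1 hM1).
by rewrite [_ * n2 k * M1]mulrC mulrA.
Qed.
End Hom.
End Slices.

Lemma sig_dom (R : realType) (K : hilbertType R) (N A : set (op K)) (E : op K -> op K) (u : op K)
    (hd : HD N A E u) (G : hilbertType R) (Pi : op K -> op G) (sA : star_hom_on A Pi) (Pi1 : Pi id = id) :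
  (forall v, dom A Pi v) -> forall v, dom N (@sig _ _ _ _ _ (hd_ce hd) _ _ sA Pi1) v.
Proof.
move=> dA v; have cN := ceN (hd_ce hd); have sS := sig_star (hd_ce hd) sA Pi1.
apply: (proj1 (totalP _) (@tau_total _ _ _ _ _ (hd_ce hd) _ _ sA Pi1) _ (dom_subsp cN sS) (dom_closed cN sS)) => -[x w].
rewrite /tau2 /= tau_cut; have Nx := cut_in x cN; move: (cut N x) Nx => {}x Nx.
have [Z hZ] := om_dom hd sA dA w; exists (am x Z) => y Ny.
have Nyx := calgM cN Ny Nx; rewrite sig_tau// /n2 tauE//.
by have := hZ _ Nyx; rewrite (am_comp cN).
Qed.

(** * Normal functionals and their length multipliers *)

Section Normal.
Variables (R : realType) (K : hilbertType R) (N : set (op K)).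
Hypothesis cN : calg N.
Implicit Types (h phi psi : op K -> R[i]) (z : Kinf K).
(** The functionals that define the ultraweak topology, each written with two vectors of the
    amplification ([uwE], [l2_co]). *)
Definition wf z z' : op K -> R[i] := fun x => inner (am x z) z'.
Definition normal h := exists z z', forall y, N y -> h y = wf z z' y.
Lemma wfZDx z z' k x y : N x -> N y -> wf z z' (k *: x + y) = k * wf z z' x + wf z z' y.
Proof. by move=> Nx Ny; rewrite /wf amZD ?ipDl ?ipZl//; apply: (calgW cN). Qed.
Lemma normalZD k h h' : normal h -> normal h' -> normal (fun x => k * h x + h' x).
Proof.
move=> [z [z' hz]] [w [w' hw]]; exists (Wk 0 (k *: z) + Wk 1 w), (Wk 0 z' + Wk 1 w') => y Ny.
have by_ := calgW cN Ny; have bam := am_blin by_.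
rewrite hz// hw// /wf (linD bam.1) !am_W// ipDl !ipDr !Wk_ip /= !mul1r !mul0r addr0 add0r.
by rewrite (linZ bam.1) ipZl.
Qed.
Lemma normal_dom h (G : hilbertType R) (Phi : op K -> op G) v v' : star_hom_on N Phi -> dom N Phi v ->
  (forall y, N y -> h y = inner (Phi y v) v') -> normal h.
Proof.
move=> sP [z hz] hE; have v0 := n2_ge0 v'.
have [|a Na|z' hz'] := @am_riesz _ _ _ cN h ((Num.sqrt (n2 v'))%:C%C *: z).
- move=> k a b Na Nb; rewrite !hE//; last exact: (calg_ZD cN).
  by rewrite (sh_lin sP k Na Nb) !fctE ipDl ipZl.
- rewrite hE// (linZ (am_blin (calgW cN Na)).1) n2Z m2C sqr_sqrtr//.
  by apply: le_trans (CS _ _) _; rewrite mulrC ler_wpM2l// hz.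
by exists ((Num.sqrt (n2 v'))%:C%C *: z), z'.
Qed.
End Normal.

Section Graded.
Variables (R : realType) (K : hilbertType R) (N A : set (op K)) (E : op K -> op K) (u : op K).
Hypothesis hd : HD N A E u.
Hypothesis vN : von_neumann N.
Let ce := hd_ce hd.
Let cN := ceN ce.
Let cA := ceA ce.
Local Notation RW := (RW A E u).
Local Notation Wg := (Wg A E u).
Local Notation normal := (normal N).
Let NA := AN hd.
Let NC := NC hd.
Implicit Types (h phi psi : op K -> R[i]) (z : Kinf K) (r : R).
(** [Wg_dens] at the single vector [z] representing [h] approximates [x] by combinations of words
    well enough. *)
Lemma normal_uniq h : normal h -> (forall x, Wg x -> h x = 0) -> forall x, N x -> h x = 0.
Proof.
move=> [z [z' hz]] h0 x Nx; apply: m2_eq0; apply/eqP; rewrite eq_le m2_ge0 andbT; apply: le_eps => e e0.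
have e1 : 0 < e / (1 + n2 z') by rewrite divr_gt0//; have := n2_ge0 z'; lra.
have [y [Ny [[s [Ws ys]] hy]]] := Wg_dens hd z Nx e1.
have wy : h y = 0.
  subst y; elim: s Ws {hy} Ny => [|p s ih] Ws Ny.
    by rewrite big_nil hz ?/wf; [rewrite (sh0 (@calg_blins _ _) (am_star K)) ip0l|exact: (calg0 cN)].
  have Ws' q : q \in s -> Wg q.2 by move=> qs; apply: Ws; rewrite in_cons qs orbT.
  have Ns : N (\sum_(p <- s) p.1 *: p.2).
    rewrite big_seq; elim/big_rec: _ => [|q w qs Nw]; first exact: (calg0 cN).
    by apply: (calg_ZD cN) => //; apply/(Wg_N hd)/Ws'.
  have Wp : Wg p.2 by apply: Ws; rewrite mem_head.
  have Np := Wg_N hd Wp; rewrite big_cons hz; last exact: (calg_ZD cN).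
  by rewrite (wfZDx cN)// -!hz// ih// h0// mulr0 addr0.
have -> : h x = wf z z' (x - y).
  have -> : x - y = (-1) *: y + x by rewrite scaleN1r addrC.
  by rewrite (wfZDx cN)// -!hz// wy mulr0 add0r.
apply: le_trans (CS _ _) _; have := n2_ge0 z'; move: hy; rewrite ltr_pdivlMr; last by have := n2_ge0 z'; lra.
have := n2_ge0 (am (x - y) z); move: (n2 _) (n2 _) => a b *; nra.
Qed.
(* h is the image of phi under the length multiplier r^n *)
Definition GR r phi h := [/\ normal h, forall a, A a -> h a = phi a &
  forall m e d n w m', A m -> A m' -> RW e d n w -> h (m \o w \o m') = (r ^+ n)%:C%C * phi (m \o w \o m')].
Lemma GR_uniq r phi h h' : GR r phi h -> GR r phi h' -> forall x, N x -> h x = h' x.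
Proof.
move=> [n1 a1 w1] [n2' a2 w2] x Nx; apply/subr0_eq.
have nD := normalZD cN (-1) n2' n1.
have := normal_uniq nD _ Nx; rewrite mulN1r addrC; apply=> y [Ay|[m [e [d [n [w [m' [Am Am' hw ->]]]]]]]].
  by rewrite a1// a2// mulN1r addNr.
by rewrite (w1 _ _ _ _ _ _ Am Am' hw) (w2 _ _ _ _ _ _ Am Am' hw) mulN1r addNr.
Qed.
Lemma GR_ZD r k phi h psi h' : GR r phi h -> GR r psi h' -> GR r (fun x => k * phi x + psi x) (fun x => k * h x + h' x).
Proof.
move=> [n1 a1 w1] [n2' a2 w2]; split=> [|a Aa|m e d n w m' Am Am' hw]; first exact: normalZD.
  by rewrite a1// a2.
by rewrite (w1 _ _ _ _ _ _ Am Am' hw) (w2 _ _ _ _ _ _ Am Am' hw) mulrDr mulrCA.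
Qed.
Lemma GR_ext r phi psi h : (forall x, N x -> phi x = psi x) -> GR r phi h -> GR r psi h.
Proof.
move=> e [n1 a1 w1]; split=> // [a Aa|m e0 d n w m' Am Am' hw]; first by rewrite a1// e//; apply: NA.
rewrite (w1 _ _ _ _ _ _ Am Am' hw) e//; apply: (NC (NC (NA Am) (RW_N hd hw)) (NA Am')).
Qed.

(* compressing to the range of V turns the vector functional of a GM into its
   image under the length multiplier *)
Section Compression.
Variables (C : choiceType) (cm : C -> C -> C) (cs : C -> C) (f : op K -> C -> R[i]) (Fc : R).
Variables (G0 : hilbertType R) (Ph : op K -> C -> op G0).
Variables (G : hilbertType R) (Pi : op K -> op G) (ups p : bool -> op G) (Rr : C -> op G) (Om : G).
Hypothesis gm : GM N A E u cm cs f Fc Ph Pi ups p Rr Om.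
Let ts := gm_ts gm.
Let dA := gm_dom gm.
Let sA := ts_star ts.
Let Pi2 := ts_1 ts.
Local Notation s0 := (@sig _ _ _ _ _ ce _ _ sA Pi2).
Variable r : R.
Hypotheses (r0 : 0 < r) (r1 : r < 1).
Local Notation Vr := (V hd ts r).
Lemma GM_GR c : GR r (fun x => f x c) (fun x => inner (s0 x (Vr (Rr c Om))) (Vr Om)).
Proof.
have sS := sig_star ce sA Pi2.
split=> [|a Aa|m e d n w m' Am Am' hw].
- have hD := sig_dom (hd := hd) (sA := sA) (Pi1 := Pi2) dA (Vr (Rr c Om)).
  by apply: (normal_dom (v' := Vr Om) cN sS hD) => y _.
- by rewrite -(V_a hd ts dA r0 r1)// (V_ip hd ts dA r0 r1) (gm_val gm).
- have [W [S hC]] := RW_CW Pi ups p hw; have Nw := RW_N hd hw.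
  have Nm := NA Am; have Nm' := NA Am'; have Nmw := NC Nm Nw.
  rewrite (sh_comp sS Nmw Nm') (sh_comp sS Nm Nw) /= -(V_a hd ts dA r0 r1 _ Am').
  have bs := sig_blin ce sA Pi2 Nm; rewrite (dagP bs) -(sh_dag sS Nm).
  have Ad := calgJ cA Am; rewrite -(V_a hd ts dA r0 r1 Om Ad) (V_word hd ts dA r0 r1 hC).
  by rewrite (sh_dag sA Am) -(dagP (sh_blin sA Am)) (gm_word gm _ Am Am' hC).
Qed.
End Compression.

(* the construction with C reduced to a point *)
Lemma GR_pos r z : 0 < r -> r < 1 -> exists h, GR r (wf z z) h /\
  forall x M, N x -> nb x M -> m2 (h x) <= (M * n2 z) ^+ 2.
Proof.
move=> r0 r1; have sN : star_hom_on N (@am R K) := am_starA cN; have Pi1 := @am_id R K.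
have dN v : dom N (@am R K) v by exists v.
pose rho (c : unit) : op (Kinf K) := id; pose cm (c d : unit) := tt; pose cs (c : unit) := tt.
have rb c : blin (rho c) := @blin_id _ _.
have rs c : rho (cs c) = dag (rho c) by rewrite /rho dag_id.
have rga c i k l : inner (rho c (@ei R K i k)) (ei i l) = (i == i)%:R * inner k l by rewrite /rho eiE.
pose f x (c : unit) := wf z z x.
have rm c d : rho (cm c d) = rho c \o rho d by [].
have cs1 : cs tt = tt by [].
have rl c : rho tt \o rho c = rho c by [].
have rr c : rho c \o rho tt = rho c by [].
have rc c x : N x -> rho c \o am x = am x \o rho c by [].
have rcb c x : blin x -> rho c \o amp (@ei R K) x = amp (@ei R K) x \o rho c by [].
have flin c k x y : N x -> N y -> f (k *: x + y) c = k * f x c + f y c by move=> Nx Ny; rewrite /f (wfZDx cN).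
have f1 : f id tt = (n2 z)%:C%C by rewrite /f /wf am_id ipC.
have fs x c : N x -> f (dag x) (cs c) = (f x c)^*.
  by move=> Nx; have bx := calgW cN Nx; rewrite /f /wf (am_dag bx) (dagPr (am_blin bx)) ipJ.
have fbnd s M : inS N s -> nb (ev (@Phi0 _ _ _ _ _ _ hd _ _ sN Pi1 _ rho) s) M -> Re (fsum f s) <= n2 z * M.
  move=> hs hM; have [M0 hM1] := ind_ge (TensorRep (@eiE R K) (@ei_total R K) rb rm rs rcb rga) hs hM.
  have := bnd_form z M0 hM1; rewrite mulrC; congr (_ <= _); congr (Re _).
  by rewrite /ev /fsum sumE ip_suml; apply: eq_bigr.
have fnorm c : exists z : Kinf K, forall y, N y -> Re (f (dag y \o y) (cm (cs c) c)) <= n2 (am y z).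
  by exists z => y Ny; rewrite /f /wf (sh_sq cN sN z Ny).
have [KK [Pi [ups [p [Rr [Om gm]]]]]] := machine dN rb rm rs cs1 rl rr rc flin f1 fs fbnd fnorm.
pose ts := gm_ts gm; pose dA := gm_dom gm; pose sA := ts_star ts; pose Pi2 := ts_1 ts.
have sS := sig_star ce sA Pi2.
have bR := gm_rblin gm tt; pose w1 := Rr tt Om.
(* [Rr tt] is idempotent and self-adjoint, since product and star on a point are trivial; it is a
   projection. *)
have w1n : n2 w1 <= n2 z.
  have q1 : inner w1 w1 = inner w1 Om.
    have sR : dag (Rr tt) = Rr tt by rewrite -(gm_rstar gm).
    by rewrite {1}/w1 -(saP bR sR) -[Rr tt (Rr tt Om)]/((Rr tt \o Rr tt) Om) -(gm_rmul gm).
  have := n2_ge0 (Om - w1); rewrite n2B (gm_om gm) -[inner Om w1]ipJ -q1 !reim -/(n2 w1); lra.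
exists (fun x => inner (@sig _ _ _ _ _ ce _ _ sA Pi2 x (V hd ts r w1)) (V hd ts r Om)); split.
  exact: (GM_GR gm r0 r1 tt).
move=> x M Nx [M0 hM]; have := CS (@sig _ _ _ _ _ ce _ _ sA Pi2 x (V hd ts r w1)) (V hd ts r Om).
have := (sh_contr cN sS Nx (conj M0 hM)).2 (V hd ts r w1).
have n2V v : n2 (V hd ts r v) = n2 v by rewrite /n2 (V_ip hd ts dA r0 r1).
rewrite !n2V (gm_om gm) => h1 /le_trans; apply.
rewrite exprMn expr2 [n2 z ^+ 2]expr2 mulrA; apply: ler_wpM2r; first exact: n2_ge0.
by apply: le_trans h1 _; apply: ler_wpM2l; rewrite ?mulr_ge0.
Qed.

Let j : R[i] := Complex 0 1.
Lemma polar z z' x : N x -> wf z z' x = (4^-1)%:C%C * (wf (z + z') (z + z') x +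
  (- wf (z - z') (z - z') x + (j * wf (z + j *: z') (z + j *: z') x + - j * wf (z - j *: z') (z - j *: z') x))).
Proof.
move=> Nx; have l := (am_blin (calgW cN Nx)).1; rewrite /wf !(linD l) !(linN l) !(linZ l).
rewrite !ipDl !ipDr !ipNl !ipNr !ipZl !ipZr; move: (inner _ _) (inner _ _) (inner _ _) (inner _ _) => a b c d.
have jj : j * j = -1 by exact: sqr_i.
have jJ : j * j^* = 1 by apply: eqC_ReIm; rewrite !reim /j /= ?mul0r ?mulr0 ?mulrN ?mulr1 ?mul1r ?sub0r ?opprK ?addr0 ?oppr0.
have q4 : (4^-1)%:C%C * 4 = 1 :> R[i].
  by rewrite -[4 in X in _ * X](rmorph_nat (real_complex R)) -rmorphM /= mulVf ?pnatr_eq0.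
rewrite -[LHS]mul1r -q4; transitivity ((4^-1)%:C%C * (2 * d + 2 * b + 2 * (j * j^* ) * d + 2 * (j * j) * b)).
  by rewrite jj jJ; ring.
by ring.
Qed.
Lemma GR_comb r z z' h1 h2 h3 h4 : GR r (wf (z + z') (z + z')) h1 -> GR r (wf (z - z') (z - z')) h2 ->
  GR r (wf (z + j *: z') (z + j *: z')) h3 -> GR r (wf (z - j *: z') (z - j *: z')) h4 ->
  GR r (wf z z') (fun x => (4^-1)%:C%C * (1 * h1 x + (-1 * h2 x + (j * h3 x + (- j * h4 x + 0)))) + 0).
Proof.
move=> g1 g2 g3 g4; have z0 : GR r (fun=> 0) (fun=> 0).
  split=> [|//|m e d n w m' _ _ _]; last by rewrite mulr0.
  by exists 0, 0 => y _; rewrite /wf ip0r.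
have gg := GR_ZD (4^-1)%:C%C (GR_ZD 1 g1 (GR_ZD (-1) g2 (GR_ZD j g3 (GR_ZD (-j) g4 z0)))) z0.
by apply: GR_ext gg => y Ny; rewrite (polar z z' Ny) mul1r mulN1r !addr0.
Qed.
(** The bound does not depend on [r]. Polarization writes [wf z z'] by four positive functionals,
    each covered by [GR_pos], and by uniqueness [h] is the corresponding combination of their
    images. *)
Lemma GR_bnd r z z' h x M : 0 < r -> r < 1 -> GR r (wf z z') h -> N x -> nb x M ->
  m2 (h x) <= (2 * M * (n2 z + n2 z')) ^+ 2.
Proof.
move=> r0 r1 hh Nx hM; have M0 := hM.1; set B := (2 * M * _) ^+ 2.
have [h1 [g1 b1]] := GR_pos (z + z') r0 r1; have [h2 [g2 b2]] := GR_pos (z - z') r0 r1.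
have [h3 [g3 b3]] := GR_pos (z + j *: z') r0 r1; have [h4 [g4 b4]] := GR_pos (z - j *: z') r0 r1.
rewrite (GR_uniq hh (GR_comb g1 g2 g3 g4) Nx).
have bn (w : Kinf K) (k : op K -> R[i]) : (forall x M, N x -> nb x M -> m2 (k x) <= (M * n2 w) ^+ 2) -> n2 w <= 2 * n2 z + 2 * n2 z' -> m2 (k x) <= B.
  move=> /(_ x M Nx hM) hk hw; apply: le_trans hk _.
  rewrite ler_pXn2r ?nnegrE ?mulr_ge0 ?addr_ge0 ?n2_ge0//.
  by rewrite [2 * M]mulrC -mulrA ler_wpM2l// mulrDr.
have l3 := n2D_le z (j *: z'); have l4 := n2B_le z (j *: z').
have jn (w : Kinf K) : n2 (j *: w) = n2 w by rewrite n2Z /m2 /j /= expr0n expr1n add0r mul1r.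
rewrite !jn in l3 l4.
have c1 := bn _ _ b1 (n2D_le z z'); have c2 := bn _ _ b2 (n2B_le z z').
have c3 := bn _ _ b3 l3; have c4 := bn _ _ b4 l4.
rewrite mul1r mulN1r !addr0; move: B c1 c2 c3 c4 {bn} => B c1 c2 c3 c4.
have mj (a : R[i]) : m2 (j * a) = m2 a by rewrite m2M /m2 /j /= expr0n expr1n add0r mul1r.
rewrite m2M m2C mulNr.
have := m2D (h1 x - h2 x) (j * h3 x - j * h4 x); have := m2D (h1 x) (- h2 x); have := m2D (j * h3 x) (- (j * h4 x)).
have -> : (4^-1) ^+ 2 = 16^-1 :> R by field.
rewrite !m2N !mj [h1 x + (_ + _)]addrA => *; lra.
Qed.
Lemma GR_ex r z z' : 0 < r -> r < 1 -> exists h, GR r (wf z z') h.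
Proof.
move=> r0 r1; have [h1 [g1 _]] := GR_pos (z + z') r0 r1; have [h2 [g2 _]] := GR_pos (z - z') r0 r1.
have [h3 [g3 _]] := GR_pos (z + j *: z') r0 r1; have [h4 [g4 _]] := GR_pos (z - j *: z') r0 r1.
by eexists; apply: GR_comb g1 g2 g3 g4.
Qed.
(** Quantifying over every image [h] avoids a choice; on [N] there is at most one by [GR_uniq]. *)
Definition conv phi := forall x, N x -> forall e : R, 0 < e -> exists2 q : R, 0 < q < 1 &
  forall r, q < r -> r < 1 -> forall h, GR r phi h -> m2 (h x - phi x) < e.
Lemma conv_ext phi psi : (forall x, N x -> phi x = psi x) -> conv phi -> conv psi.
Proof.
move=> e c x Nx d d0; have [q q1 hq] := c x Nx d d0; exists q => // r r0 r1 h hh.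
have hh' : GR r phi h by apply: GR_ext hh => y Ny; rewrite e.
rewrite -e//; exact: (hq r r0 r1 h hh').
Qed.
(** An argument with three small terms: [phi - psi] has to be small at [x], and so has its image
    under the multipliers, uniformly in [r]. *)
Lemma conv_approx phi : normal phi -> (forall x M (e : R), N x -> nb x M -> 0 < e -> exists psi, conv psi /\ normal psi /\
   m2 (phi x - psi x) < e /\ forall r h, 0 < r -> r < 1 -> GR r (fun x => -1 * psi x + phi x) h -> m2 (h x) < e) -> conv phi.
Proof.
move=> np H x Nx e e0; have [M _ hM] := blin_nb (calgW cN Nx).
have e16 : 0 < e / 16 by lra.
have [psi [cp [[z [z' hz]] [h1 h2]]]] := H x M _ Nx hM e16.
have [q /andP[q0 q1] hq] := cp x Nx _ e16; exists q => [|r r0 r1 h hh]; first by rewrite q0.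
have r00 := lt_trans q0 r0; have [g hg] := GR_ex z z' r00 r1.
have {}hg : GR r psi g by apply: GR_ext hg => y Ny; rewrite hz.
have a1 := hq r r0 r1 g hg; have a2 := h2 r _ r00 r1 (GR_ZD (-1) hg hh).
have -> : h x - phi x = (-1 * g x + h x) + ((g x - psi x) - (phi x - psi x)) by ring.
have mN (a : R[i]) : m2 (- a) = m2 a by rewrite /m2 !reim !sqrrN.
have := m2D (-1 * g x + h x) ((g x - psi x) - (phi x - psi x)); have := m2D (g x - psi x) (- (phi x - psi x)).
by rewrite mN; move: (m2 _) (m2 _) (m2 _) (m2 _) (m2 _) a1 a2 h1 => *; lra.
Qed.

(** [GR_bnd] involves the sum of two squared norms, which does not become small with one of the
    vectors. Since [wf d w] is unchanged when [d] is multiplied and [w] divided by [s], a suitable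
    [s] makes the sum small once [n2 d = a] is. *)
Lemma small_num (e M b : R) : 0 < e -> 0 <= M -> 0 <= b -> exists2 d : R, 0 < d & forall a, 0 <= a -> a < d ->
  M ^+ 2 * a * b < e /\ exists2 s : R, 0 < s & (2 * M * (s ^+ 2 * a + s ^- 2 * b)) ^+ 2 < e.
Proof.
move=> e0 M0 b0; have M2 := sqr_ge0 M; pose eta := Num.min 1 (e / (1 + 16 * M ^+ 2)).
have p0 : 0 < 1 + 16 * M ^+ 2 by lra.
have h0 : 0 < eta by rewrite lt_min ltr01 divr_gt0.
have h1 : eta <= 1 by rewrite ge_min lexx.
have h2 : eta * (1 + 16 * M ^+ 2) <= e by rewrite -ler_pdivlMr// ge_min lexx orbT.
pose s := 1 + b / eta; have be : 0 <= b / eta by rewrite divr_ge0// ltW.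
have s0 : 0 < s by rewrite /s; lra.
have s1 : 1 <= s by rewrite /s; lra.
have sb : s ^- 2 * b <= eta.
  rewrite mulrC ler_pdivrMr ?exprn_gt0// expr2 mulrA.
  have : b <= eta * s by rewrite /s mulrDr mulr1 mulrC divfK ?gt_eqF//; lra.
  by move=> hb; apply: le_trans hb _; rewrite ler_peMr// mulr_ge0// ltW.
have Mb : 0 < 1 + M ^+ 2 * b by have := mulr_ge0 M2 b0; lra.
exists (Num.min (eta / s ^+ 2) (e / (1 + M ^+ 2 * b))).
  by rewrite lt_min !divr_gt0 ?exprn_gt0.
move=> a a0; rewrite lt_min ltr_pdivlMr ?exprn_gt0// ltr_pdivlMr// => /andP[ha hb]; split.
  by move: hb; rewrite mulrDr mulr1 mulrCA mulrA; lra.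
exists s => //; have x0 : 0 <= s ^+ 2 * a + s ^- 2 * b by rewrite addr_ge0// mulr_ge0// ?invr_ge0 exprn_ge0// ltW.
apply: (@le_lt_trans _ _ ((4 * M * eta) ^+ 2)).
  rewrite ler_pXn2r ?nnegrE ?mulr_ge0 ?(ltW h0)//.
  have : s ^+ 2 * a + s ^- 2 * b <= 2 * eta by rewrite [s ^+ 2 * a]mulrC; lra.
  by move/(ler_wpM2l (mulr_ge0 (ler0n R 2) M0)); lra.
have : eta ^+ 2 * M ^+ 2 <= eta * M ^+ 2 by rewrite ler_wpM2r// expr2 ler_piMl// ltW.
rewrite !exprMn; move: (eta ^+ 2) (M ^+ 2) M2 h2 => x y *; nra.
Qed.
Lemma wfB z w z' x : N x -> wf z z' x - wf w z' x = wf (z - w) z' x.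
Proof. by move=> Nx; rewrite /wf (linB (am_blin (calgW cN Nx)).1) ipBl. Qed.
Lemma wf_small r d w x M (s e : R) h : 0 < r -> r < 1 -> GR r (wf d w) h -> N x -> nb x M -> 0 < s ->
  (2 * M * (s ^+ 2 * n2 d + s ^- 2 * n2 w)) ^+ 2 < e -> m2 (h x) < e.
Proof.
move=> r0 r1 hh Nx hM s0; apply: le_lt_trans.
have hh' : GR r (wf (s%:C%C *: d) ((s^-1)%:C%C *: w)) h.
  apply: GR_ext hh => y Ny; rewrite /wf (linZ (am_blin (calgW cN Ny)).1) ipZl ipZr JC mulrA -rmorphM.
  by rewrite mulfV ?gt_eqF// mul1r.
have := GR_bnd r0 r1 hh' Nx hM; rewrite !n2Z !m2C exprVn //.
Qed.
Lemma wf_bnd d w x M : nb x M -> N x -> m2 (wf d w x) <= M ^+ 2 * n2 d * n2 w.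
Proof.
move=> hM Nx; apply: le_trans (CS _ _) _; apply: ler_wpM2r; first exact: n2_ge0.
exact: (sh_contr cN (am_starA cN) Nx hM).2.
Qed.
Lemma wf_normal z z' : normal (wf z z'). Proof. by exists z, z'. Qed.
Lemma cv_closedl z' : hclosed [set z | conv (wf z z')].
Proof.
move=> z hz; apply: conv_approx => [|x M e Nx hM e0]; first exact: wf_normal.
have [d d0 hd'] := small_num e0 hM.1 (n2_ge0 z'); have [w cw hw] := hz d d0.
have [b1 [s s0 b2]] := hd' _ (n2_ge0 _) hw; exists (wf w z'); split=> //; split; first exact: wf_normal.
rewrite wfB//; split; first exact: le_lt_trans (wf_bnd _ _ hM Nx) b1.
move=> r h r0 r1 hh; have {}hh : GR r (wf (z - w) z') h by apply: GR_ext hh => y Ny; rewrite -wfB// mulN1r addrC.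
exact: (wf_small r0 r1 hh Nx hM s0 b2).
Qed.
Lemma cv_closedr z : hclosed [set z' | conv (wf z z')].
Proof.
move=> z' hz'; apply: conv_approx => [|x M e Nx hM e0]; first exact: wf_normal.
have [d d0 hd'] := small_num e0 hM.1 (n2_ge0 z); have [w cw hw] := hz' d d0.
have [b1 [s s0 b2]] := hd' _ (n2_ge0 _) hw; exists (wf z w); split=> //; split; first exact: wf_normal.
have wE y : wf z z' y - wf z w y = wf z (z' - w) y by rewrite /wf ipBr.
rewrite wE; split; first by apply: le_lt_trans (wf_bnd _ _ hM Nx) _; rewrite mulrAC.
move=> r h r0 r1 hh; have {}hh : GR r (wf z (z' - w)) h by apply: GR_ext hh => y Ny; rewrite -wE mulN1r addrC.
apply: (wf_small r0 r1 hh Nx hM (s := s^-1)); first by rewrite invr_gt0.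
by rewrite exprVn invrK addrC.
Qed.
Lemma conv_ZD k phi psi : normal phi -> normal psi -> conv phi -> conv psi -> conv (fun x => k * phi x + psi x).
Proof.
move=> [z [z' hz]] [w [w' hw]] c1 c2 x Nx e e0.
have k0 := m2_ge0 k; have p0 : 0 < 4 * (1 + m2 k) by lra.
have e1 : 0 < e / (4 * (1 + m2 k)) by rewrite divr_gt0.
have [q1 /andP[q10 q11] h1] := c1 x Nx _ e1; have [q2 /andP[q20 q21] h2] := c2 x Nx _ e1.
exists (Num.max q1 q2); first by rewrite lt_max q10 gt_max q11 q21.
move=> r; rewrite gt_max => /andP[r1 r2] r3 h hh; have r0 := lt_trans q10 r1.
have [g1 hg1] := GR_ex z z' r0 r3; have [g2 hg2] := GR_ex w w' r0 r3.
have {}hg1 : GR r phi g1 by apply: GR_ext hg1 => y Ny; rewrite hz.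
have {}hg2 : GR r psi g2 by apply: GR_ext hg2 => y Ny; rewrite hw.
have a1 := h1 r r1 r3 g1 hg1; have a2 := h2 r r2 r3 g2 hg2.
rewrite (GR_uniq hh (GR_ZD k hg1 hg2) Nx).
have -> : k * g1 x + g2 x - (k * phi x + psi x) = k * (g1 x - phi x) + (g2 x - psi x) by ring.
have := m2D (k * (g1 x - phi x)) (g2 x - psi x); rewrite m2M => /le_lt_trans; apply.
rewrite ltr_pdivlMr// in a1; rewrite ltr_pdivlMr// in a2.
move: (m2 _) (m2 _) (m2 _) (m2_ge0 (g1 x - phi x)) (m2_ge0 (g2 x - psi x)) k0 a1 a2 => x1 x2 x3 *; nra.
Qed.
Lemma conv0 : conv (fun=> 0).
Proof.
move=> x Nx e e0; exists 2^-1; first by rewrite invr_gt0 ltr0n invf_lt1// ltr1n.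
move=> r _ _ h [nh h1 h2]; rewrite (normal_uniq nh)// ?subrr ?m20// => y [Ay|[m [e' [d [n [w [m' [Am Am' hw ->]]]]]]]].
  exact: h1.
by rewrite (h2 _ _ _ _ _ _ Am Am' hw) mulr0.
Qed.
Lemma cv_subl z' : subsp [set z | conv (wf z z')].
Proof.
split=> [|k z w c1 c2 /=].
  apply: conv_ext conv0 => x Nx; by rewrite /wf (lin0 (am_blin (calgW cN Nx)).1) ip0l.
apply: conv_ext (conv_ZD k (wf_normal z z') (wf_normal w z') c1 c2) => x Nx.
by rewrite /wf (am_blin (calgW cN Nx)).1 ipDl ipZl.
Qed.
Lemma cv_subr z : subsp [set z' | conv (wf z z')].
Proof.
split=> [|k z' w c1 c2 /=]; first by apply: conv_ext conv0 => x Nx; rewrite /wf ip0r.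
apply: conv_ext (conv_ZD k^* (wf_normal z z') (wf_normal z w) c1 c2) => x Nx.
by rewrite /wf ipDr ipZr.
Qed.
(** [phi] lives on words of length [n0]: its image under the multiplier is [r^n0 phi]. The rest is
    [1 - r^n <= n (1 - r)]. *)
Lemma conv_hom n0 phi : normal phi -> (forall r a, A a -> phi a = (r ^+ n0)%:C%C * phi a) ->
  (forall r m e d n w m', A m -> A m' -> RW e d n w ->
     (r ^+ n)%:C%C * phi (m \o w \o m') = (r ^+ n0)%:C%C * phi (m \o w \o m')) -> conv phi.
Proof.
move=> np h0 hn x Nx e e0; have B0 : 0 < 1 + n0%:R ^+ 2 * m2 (phi x).
  by have := mulr_ge0 (sqr_ge0 (n0%:R : R)) (m2_ge0 (phi x)); lra.
pose q := Num.max 2^-1 (1 - Num.min 2^-1 (e / (1 + n0%:R ^+ 2 * m2 (phi x)))).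
have t0 : 0 < Num.min 2^-1 (e / (1 + n0%:R ^+ 2 * m2 (phi x))) by rewrite lt_min invr_gt0 ltr0n divr_gt0.
exists q; first by rewrite lt_max invr_gt0 ltr0n /= gt_max invf_lt1// ltr1n /=; lra.
move=> r; rewrite gt_max => /andP[rh rq] r1 h hh.
have hg : GR r phi (fun y => (r ^+ n0)%:C%C * phi y + 0).
  split=> [|a Aa|m e1 d n w m' Am Am' hw].
  - by apply: (normalZD cN _ np); exists 0, 0 => y _; rewrite /wf ip0r.
  - by rewrite addr0 -h0.
  - by rewrite addr0 (hn r _ _ _ _ _ _ Am Am' hw).
rewrite (GR_uniq hh hg Nx) addr0 -[X in _ - X]mul1r -mulrBl m2M -(rmorph1 (real_complex R)) -rmorphB m2C.
have pw n : 0 <= 1 - r ^+ n <= n%:R * (1 - r).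
  elim: n => [|n /andP[i1 i2]]; first by rewrite expr0 subrr mul0r lexx.
  rewrite exprS -natr1 mulrDl mul1r; apply/andP; split; first by nra.
  by have : r ^+ n * (1 - r) <= 1 * (1 - r); [rewrite ler_wpM2r//; lra|nra].
have /andP[p1 p2] := pw n0.
have sq : (r ^+ n0 - 1) ^+ 2 <= n0%:R ^+ 2 * (1 - r) ^+ 2.
  by rewrite -exprMn -sqrrN opprB ler_pXn2r// nnegrE; apply: le_trans p1 p2.
have r2 : (1 - r) ^+ 2 <= 1 - r by rewrite expr2 ler_piMl//; lra.
have r3 : 1 - r < Num.min 2^-1 (e / (1 + n0%:R ^+ 2 * m2 (phi x))) by lra.
have {r3} : 1 - r < e / (1 + n0%:R ^+ 2 * m2 (phi x)) by apply: lt_le_trans r3 _; rewrite ge_min lexx orbT.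
rewrite ltr_pdivlMr// => r3; apply: (@le_lt_trans _ _ ((1 - r) * (1 + n0%:R ^+ 2 * m2 (phi x)))) => //.
have s1 : (r ^+ n0 - 1) ^+ 2 <= n0%:R ^+ 2 * (1 - r).
  by apply: le_trans sq _; rewrite ler_wpM2l// sqr_ge0.
have := ler_wpM2r (m2_ge0 (phi x)) s1; move: (m2 _) (_ ^+ 2) (n0%:R ^+ 2) => a b c; lra.
Qed.

(** The bicommutant of [am N] is [am N]: matrix units commute with it and make [P] diagonal with a
    constant entry, and the operators [am S] with [S] in the commutant of [N] put that entry into
    [N]. *)
Lemma am_bicomm (P : op (Kinf K)) : blin P ->
  (forall S, blin S -> (forall x, N x -> S \o am x = am x \o S) -> P \o S = S \o P) ->
  exists2 p, N p & P = am p.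
Proof.
move=> bP hP; have be n : blin (@ei R K n) by exact: ei_blin.
have bd n : blin (dag (@ei R K n)) by exact: blinJ.
have de (n : nat) (k : K) : dag (@ei R K n) (ei n k) = k.
  by apply: ip_ext => l; rewrite (dagPr (be n)) eiE eqxx mul1r.
have dam n x z : N x -> dag (@ei R K n) (am x z) = x (dag (ei n) z).
  move=> Nx; have bx := calgW cN Nx; apply: ip_ext => l.
  by rewrite (dagPr (be n)) (dagP (am_blin bx)) -am_dag// amE; [rewrite (dagP bx) (dagPr (be n))|exact: blinJ].
pose p := dag (@ei R K 0) \o P \o @ei R K 0.
have bp : blin p := blinM (blinM (bd 0%N) bP) (be 0%N).
have Pe n k : P (ei n k) = ei n (p k).
  pose S := @ei R K n \o dag (@ei R K 0); have bS : blin S := blinM (be n) (bd 0%N).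
  have cS x : N x -> S \o am x = am x \o S.
    by move=> Nx; apply/funext => z; rewrite /S /= dam// amE//; apply: (calgW cN).
  by have /(app_eq (ei 0 k)) := hP S bS cS; rewrite /S /= de.
exists p; last by apply: ei_op => [||n k] //; [exact: am_blin|rewrite Pe amE].
have [_ _ <-] := vN; split; first exact/bounded_opP.
move=> S [/bounded_opP bS hS]; have baS := am_blin bS.
have cS x : N x -> am S \o am x = am x \o am S.
  move=> Nx; have bx := calgW cN Nx; case: (am_star K) => _ _ h _.
  by rewrite -!h// hS.
apply/funext => k; have /(app_eq (ei 0 k)) := hP (am S) baS cS.
rewrite /p /= amE// => ->; rewrite -[P (ei 0 k)]/(P (ei 0 k)) Pe amE// !de //.
Qed.
Lemma E_homog m0 e0 d0 n0 w0 m0' m e d n w m' : A m0 -> A m0' -> RW e0 d0 n0 w0 ->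
  A m -> A m' -> RW e d n w -> n0 <> n -> E (dag (m0 \o w0 \o m0') \o (m \o w \o m')) = 0.
Proof.
move=> A0 A0' h0 Am Am' h ne.
(* The statement mentions no model, but [WS_ortho] needs one; any will do. *)
have [G [Pi [ups [p ts]]]] : exists (G : hilbertType R) (Pi : op K -> op G) ups p, TS A E u Pi ups p.
  by do 4 eexists; apply: (ind_TS hd (am_starA cN) (@am_id R K)) => v; exists v.
have [W [S hC]] := RW_CW Pi ups p h; have [W0 [S0 hC0]] := RW_CW Pi ups p h0.
have N0 := RW_N hd h0; have Nw := RW_N hd h; have Nd := calgJ cN N0.
have b0 := calgW cA A0; have b0' := calgW cA A0'; have bw := calgW cN N0.
have Am2 := calgM cA (calgJ cA A0) Am.
have z := WS_ortho hd ts (WSc hC) (WSc hC0) Am2 ne.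
rewrite (dagM (blinM b0 bw) b0') (dagM b0 bw).
have Nm := NC (NC Nd (NA Am2)) Nw; have := ce_bim ce (calgJ cA A0') Nm Am'.
rewrite z => /= h1; apply: (etrans h1).
by apply/funext => v; rewrite /= (lin0 (blinJ b0').1).
Qed.
(** The [z] good for every [z'] form a closed subspace invariant under the commutant of [am N], so
    the projection onto it is [am p] with [p] in [N]. To get [p = 1], functionals on [N (x)_A K]
    tested against words are homogeneous and hence convergent; they supply good vectors, from which
    [E (q^* q) = 0] follows for [q = 1 - p]. Faithfulness of [E] concludes. *)
Lemma conv_all z z' : conv (wf z z').
Proof.
have sI : star_hom_on A (fun a : op K => a).
  by split=> // a Aa; apply/bounded_opP/(calgW cA).
have dI (v : K) : dom A (fun a : op K => a) v.
  exists (ei 0 v) => a Aa; rewrite amE ?/n2 ?eiE ?eqxx ?mul1r//; exact: (calgW cA).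
pose I0 := Ind ce sI erefl.
pose t0 : op K -> K -> I0 := tau ce sI erefl.
pose s0 : op K -> op I0 := @sig _ _ _ _ _ ce _ _ sI erefl.
have sS : star_hom_on N s0 := sig_star ce sI erefl.
have N1 := calg1 cN.
pose good (z : Kinf K) := forall z', conv (wf z z').
have sg : subsp good.
  split=> [z1|k v w hv hw z1]; first by case: (cv_subl z1).
  by have [_ h] := cv_subl z1; apply: h; [exact: hv|exact: hw].
have cg : hclosed good.
  move=> v hv z1; apply: (cv_closedl (z' := z1)) => e e0; have [y gy hy] := hv e e0.
  by exists y => //; apply: gy.
have comg S v : blin S -> (forall x, N x -> S \o am x = am x \o S) -> good v -> good (S v).
  move=> bS cS gv z1; apply: conv_ext (gv (dag S z1)) => x Nx.
  have /(app_eq v) /= e := cS x Nx.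
  by rewrite /wf -e (dagP bS).
have [P [bP sP PP P1 P2]] := sub_proj (fun v : Kinf K => if `[< good v >] then v else 0).
have Pg v : good v -> P v = v by move=> gv; have := P1 v; case: asboolP.
have gP v : good (P v).
  have [y gy hy] := proj_exists v sg cg.
  suff -> : P v = y by [].
  have e : P (v - y) = 0.
    by apply: P2 => w; apply: hy; case: asboolP => // _; case: sg.
  by rewrite -[v](subrK y) (linD bP.1) e add0r Pg.
(* Good vectors are invariant under [S] and under its adjoint, so the projection onto them commutes
   with [S]. *)
have comP S : blin S -> (forall x, N x -> S \o am x = am x \o S) -> P \o S = S \o P.
  move=> bS cS; have bd := blinJ bS.
  have cSd x : N x -> dag S \o am x = am x \o dag S.
    move=> Nx; have bx := calgW cN Nx; have bam := am_blin bx; have Nd := calgJ cN Nx.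
    have bad := am_blin (blinJ bx).
    have := congr1 (@dag _ _ _) (cS _ Nd); rewrite (dagM bS bad) (dagM bad bS) am_dag// dagK//.
  have inv T w : blin T -> (forall x, N x -> T \o am x = am x \o T) -> P (T (P w)) = T (P w).
    by move=> bT cT; apply/Pg/comg.
  apply/funext => v; apply: ip_ext => w /=.
  by rewrite (saP bP sP) (dagP bS) -(inv (dag S))// -(saP bP sP) -(dagP bS) -(saP bP sP) inv.
have [p Np Pp] := am_bicomm bP comP.
suff p1 : p = id by have := gP z; rewrite Pp p1 am_id; apply.
pose q := id - p; have Nq : N q by apply: (calgB cN).
suff q0 : q = 0 by apply/esym/subr0_eq.
have Nqq := calgM cN (calgJ cN Nq) Nq; have bq := calgW cN Nq.
suff Eq0 : E (dag q \o q) = 0.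
  have hq : hpos (dag q \o q) by move=> v /=; rewrite (dagPr bq) ipC ler0c n2_ge0.
  have := ce_faith ce Nqq hq Eq0 => e; apply/funext => v; apply: n2_eq0.
  by rewrite /n2 -(dagPr bq) -[dag q (q v)]/((dag q \o q) v) e ip0l.
(* The squared norm of this vector is the form of [E (q^* q)] at [k]. *)
suff qk k : s0 q (t0 id k) = 0.
  apply/funext => k; have hE : hpos (E (dag q \o q)).
    by apply: (ce_pos ce) => // v /=; rewrite (dagPr bq) ipC ler0c n2_ge0.
  apply: (hpos_eq0 (ce_blin ce Nqq) hE).
  have := ip0l (s0 q (t0 id k)); rewrite -{1}(qk k) /s0 /t0 sig_tau// tauE//.
have [Z hZ] : dom N s0 (t0 id k) := sig_dom (hd := hd) (sA := sI) (Pi1 := erefl) dI _.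
have [S0 [bS0 Sz SI]] := dom_inter cN sS hZ; have bd := blinJ bS0.
have SZ : S0 Z = t0 id k by have := Sz _ N1; rewrite am_id /s0 sig1.
(* By closedness only [y = w (x) k'] with [w] a word matters. Words of different lengths being
   orthogonal under [E], the functional is then concentrated on the length of [w]. *)
have cvZ y : conv (wf Z (dag S0 y)).
  have cS := preim_closed bd (@cv_closedr Z); have sS' := preim_subsp bd.1 (cv_subr Z).
  apply: (Wg_totalP dI sS' cS) => w k' Ww /=; have Nw := Wg_N hd Ww.
  have fE y0 : N y0 -> wf Z (dag S0 (t0 w k')) y0 = inner (E (dag w \o y0) k) k'.
    move=> Ny; rewrite /wf -(dagP bS0) Sz// /s0 /t0 sig_tau// tauE//; exact: (NC Ny N1).
  case: Ww fE => [Aw|[m0 [e0 [d0 [n0 [w0 [m0' [A0 A0' h0 wE]]]]]]]] fE.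
    apply: (@conv_hom 0); [exact: wf_normal|by move=> r a _; rewrite expr0 mul1r|].
    move=> r m e d n w1 m' Am Am' hw; have Nw1 := NC (NC (NA Am) (RW_N hd hw)) (NA Am').
    rewrite fE// -[dag w \o _]/((dag w \o m) \o w1 \o m') (E_word hd _ hw Am') ?ip0l ?mulr0//.
    exact: (calgM cA (calgJ cA Aw) Am).
  apply: (@conv_hom n0); first exact: wf_normal.
    move=> r a Aa; rewrite fE; last exact: NA.
    have bw := calgW cN (RW_N hd h0); have b0 := calgW cA A0; have b0' := calgW cA A0'.
    rewrite wE (dagM (blinM b0 bw) b0') (dagM b0 bw).
    rewrite -[_ \o a]/(dag m0' \o dag w0 \o (dag m0 \o a)) (E_word hd _ (RW_star hd h0)) ?ip0l ?mulr0//.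
      exact: (calgJ cA).
    exact: (calgM cA (calgJ cA A0) Aa).
  move=> r m e d n w1 m' Am Am' hw; have Nw1 := NC (NC (NA Am) (RW_N hd hw)) (NA Am').
  have [->//|/eqP ne] := eqVneq n n0.
  by rewrite fE// wE (E_homog A0 A0' h0 Am Am' hw) ?ip0l ?mulr0// => e1; apply: ne.
pose T := dag S0 \o S0; have bT : blin T := blinM bd bS0.
have Tam x : N x -> T \o am x = am x \o T.
  move=> Nx; apply/funext => v; rewrite /T /= SI//; apply: ip_ext => y.
  have Nd := calgJ cN Nx; have bx := calgW cN Nx.
  rewrite (dagPr bS0) (dagP (sh_blin sS Nx)) -(sh_dag sS Nx) -SI// -(dagPr bS0).
  by rewrite am_dag// -(dagP (am_blin bx)).
(* [S0^* S0] commutes with [am N], which moves it to the other vector and reduces to [cvZ]. Since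
   [am p] fixes good vectors, [q] kills [T Z]. *)
have gT : good (T Z).
  move=> z1; apply: conv_ext (cvZ (S0 z1)) => x Nx; have /(app_eq Z) /= e := Tam x Nx.
  by rewrite /wf -e /T /= (dagPr bS0) (dagP bS0).
have qT : T (am q Z) = 0.
  have /(app_eq Z) /= -> := Tam q Nq.
  have -> : q = (-1) *: p + id by rewrite scaleN1r addrC.
  rewrite amZD ?am_id; [|exact: (calgW cN)|exact: blin_id].
  by rewrite -Pp Pg// scaleN1r addNr.
rewrite -SZ -SI//; apply: n2_eq0; rewrite /n2 -(dagPr bS0) -[dag S0 _]/(T (am q Z)) qT ip0l //.
Qed.
End Graded.

(** * The bound of the functional by the quotient norm *)

Section Core.
Variables (R : realType) (K : hilbertType R) (N A : set (op K)) (E : op K -> op K) (u : op K).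
Hypotheses (hd : HD N A E u) (vN : von_neumann N).
Let ce := hd_ce hd.
Let cN := ceN ce.
Variables (C : choiceType) (cm : C -> C -> C) (cs : C -> C).
Implicit Types (s : seq (op K * C)).
Variables (f : op K -> C -> R[i]) (Fc : R) (G0 : hilbertType R) (Ph : op K -> C -> op G0).
Variables (G : hilbertType R) (Pi : op K -> op G) (ups p : bool -> op G) (Rr : C -> op G) (Om : G).
Hypothesis gm : GM N A E u cm cs f Fc Ph Pi ups p Rr Om.
Hypothesis fn : forall c, normal N (fun x => f x c).
Let ts := gm_ts gm.
Let dA := gm_dom gm.
Let sA := ts_star ts.
Let Pi1 := ts_1 ts.
Local Notation s0 := (@sig _ _ _ _ _ ce _ _ sA Pi1).
Local Notation t0 := (tau ce sA Pi1).
Local Notation ind := (@ind _ _ _ _ _ ce _ _ sA Pi1).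
Lemma Com_R c : Com A Pi ups p (Rr c).
Proof.
split=> [|e|e]; [|exact: (gm_rups gm)|exact: (gm_rp gm)].
split; first exact/bounded_opP/(gm_rblin gm).
by move=> _ [a Aa <-]; apply: (gm_rPi gm).
Qed.
Let CmRr c : Cm A Pi (Rr c). Proof. by case: (Com_R c). Qed.
Definition PhV x c := s0 x \o ind (Rr c).
Lemma PhV_birep : birep cm cs N PhV.
Proof.
have sS := sig_star ce sA Pi1.
split=> [x c Nx|x y c d Nx Ny|x c Nx].
- by apply: blinM; [exact: (sig_blin ce sA Pi1 Nx)|exact: (ind_blin ce sA Pi1 (CmRr c))].
- rewrite /PhV (gm_rmul gm) ind_comp// (sh_comp sS)//; apply/funext => v /=.
  by have /(app_eq (ind (Rr d) v)) /= -> := ind_sig ce sA Pi1 (CmRr c) Ny.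
- have Nd := calgJ cN Nx; have bx := sig_blin ce sA Pi1 Nx; have br := ind_blin ce sA Pi1 (CmRr c).
  by rewrite /PhV (dagM bx br) -(sh_dag sS)// (gm_rstar gm) ind_dag// -ind_dag// ind_sig//; apply: (calgJ (Cm_calg ce sA)).
Qed.

Variables (I : Type) (G2 : hilbertType R) (t : I -> K -> G2) (kap : I -> I -> R[i]) (rho : C -> op G2) (ga : C -> I -> R[i]).
Hypothesis tr : tensor_rep t kap cm cs rho ga.
Let tE := tr_ip tr.
Let tt := tr_total tr.
Local Notation Ph2 := (Phit t rho).
Variable k0 : R.
Hypothesis k00 : 0 <= k0.
Hypothesis we : forall s M, inS A s -> nb (ev Ph2 s) M -> nb (ev (fun a c => Pi a \o Rr c) s) (k0 * M).
(** Carries the form of an element of [N (.) C] at [x (x) v] over to [A (.) C], where weak exactness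
    gives a bound. *)
Definition cmpS x s : seq (op K * C) := [seq (E (dag x \o p.1 \o x), p.2) | p <- s].
Lemma cmpS_in x s : N x -> inS N s -> inS A (cmpS x s).
Proof.
move=> Nx hs _ /mapP[q qs ->] /=; apply: (ce_in ce).
by apply: (calgM cN) => //; apply: (calgM cN); [exact: (calgJ cN)|exact: hs].
Qed.
Lemma PhV_form s x v : inS N s -> N x ->
  inner (ev PhV s (t0 x v)) (t0 x v) = inner (ev (fun a c => Pi a \o Rr c) (cmpS x s) v) v.
Proof.
move=> hs Nx; rewrite /ev !sumE big_map !ip_suml; apply: eq_big_seq => q qs; have Nq := hs q qs.
have Nqx := calgM cN Nq Nx; rewrite /PhV /= ind_tau// sig_tau// tauE// /om compA //.
Qed.
(** Seen in the induced space of the spatial representation, compression is multiplication by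
    [v |-> x (x) v] and its adjoint, and [ind_le] bounds what lies between. *)
Lemma ev_cmp x : N x -> exists2 c : R, 0 <= c & forall s M, inS N s -> nb (ev Ph2 s) M -> nb (ev Ph2 (cmpS x s)) (c * M).
Proof.
move=> Nx; have sN : star_hom_on N (amp t).
  have [h1 h2 h3 h4] := amp_star tE tt; have bN := calgW cN.
  by split=> [T /bN/h1//|k S T /bN hS /bN|S T /bN hS /bN|T /bN]; [exact: h2|exact: h3|exact: h4].
have P1 : amp t id = id := amp_id tE tt; pose sA2 := star_sub hd sN.
have bt := tau_blin ce sA2 P1 Nx; have [c c0 nc] := blin_nb bt.
have rcN d y : N y -> rho d \o amp t y = amp t y \o rho d by move=> Ny; apply/(tr_comm tr)/(calgW cN).
have CR d : Cm A (amp t) (rho d) := CmR hd (tr_blin tr) rcN d.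
exists (c * c) => [|s M hs hM]; first by rewrite mulr_ge0// ltW.
have [M0 hY] := ind_le tr hd sN P1 hs hM.
set Y := ev _ s in hY.
have -> : ev Ph2 (cmpS x s) = dag (tau ce sA2 P1 x) \o (Y \o tau ce sA2 P1 x).
  apply/funext => v; apply: ip_ext => w; rewrite /= (dagPr bt) /Y /ev !sumE big_map !ip_suml.
  apply: eq_big_seq => q qs; have Nq := hs q qs; have Nqx := calgM cN Nq Nx.
  by rewrite /Phi0 /= ind_tau// sig_tau// tauE.
have c0' := ltW c0; split; first by rewrite !mulr_ge0.
have := bnd_comp (sqr_ge0 c) (dag_bnd bt (sqr_ge0 c) nc.2) (bnd_comp (sqr_ge0 M) hY nc.2).
by congr (bnd _ _); ring.
Qed.
(** The constant [k0] of weak exactness and those of [ev_cmp] disappear in [transfer]: the final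
    bound is contractive. *)
Lemma PhV_nb s M : inS N s -> nb (ev Ph2 s) M -> nb (ev PhV s) M.
Proof.
move=> hs hM; have bp2 := Phit_birep tr cN.
have tv : total (fun v : G => v) by move=> v e e0; exists v; [exists [:: (1, v)] => //; rewrite /fcomb big_seq1 scale1r|rewrite subrr n20].
have tt2 := tau_tot (ce := ce) (sP := sA) (P1 := Pi1) tv.
apply: (transfer cN PhV_birep bp2 tt2 _ hs hM) => -[x v] /=.
have Nx := cut_in x cN; move: (cut N x) Nx => {}x Nx; have [c c0 hc] := ev_cmp Nx.
exists (k0 * c * n2 v) => [|s1 M1 hs1 hM1]; first by rewrite !mulr_ge0 ?n2_ge0.
rewrite PhV_form//; have [M0 hk] := we (cmpS_in Nx hs1) (hc _ _ hs1 hM1).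
by have := bnd_form v M0 hk; rewrite [k0 * c * n2 v * M1](_ : _ = k0 * (c * M1) * n2 v)//; ring.
Qed.
Lemma core s M : inS N s -> nb (ev Ph2 s) M -> Re (fsum f s) <= Fc * M.
Proof.
move=> hs hM.
pose g r x c := inner (s0 x (V hd ts r (Rr c Om))) (V hd ts r Om).
have gle r : 0 < r -> r < 1 -> Re (\sum_(q <- s) g r q.1 q.2) <= Fc * M.
  move=> r0 r1; have [M0 hV] := PhV_nb hs hM; have := bnd_form (V hd ts r Om) M0 hV.
  have -> : n2 (V hd ts r Om) = Fc by rewrite /n2 (V_ip hd ts dA r0 r1) -(gm_om gm).
  rewrite [M * Fc]mulrC; congr (_ <= _); congr (Re _); rewrite /ev sumE ip_suml.
  by apply: eq_bigr => q _; rewrite /PhV /g /= (V_ind hd ts dA r0 r1 Om (Com_R q.2)).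
apply: le_eps => e e0.
(* The compressed functionals satisfy the bound for every [r]; it remains to let [r] tend to 1, for
   the finitely many terms of [s] at once. *)
suff [q /andP[q0 q1] hq] : exists2 q : R, 0 < q < 1 & forall r, q < r -> r < 1 ->
    Re (fsum f s) <= Re (\sum_(q <- s) g r q.1 q.2) + e.
  have [r [qr r1]] : exists r, q < r /\ r < 1 by exists ((q + 1) / 2); split; lra.
  by apply: le_trans (hq r qr r1) _; rewrite lerD2r; apply: gle => //; apply: lt_trans qr.
elim: s hs e e0 {hM gle} => [|b s ih] hs e e0.
  exists 2^-1; first by rewrite invr_gt0 ltr0n invf_lt1// ltr1n.
  by move=> r _ _; rewrite /fsum !big_nil Re0 add0r ltW.
have [Nb hs'] := inS_cons hs; have e2 : 0 < e / 2 by lra.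
have [q1 /andP[q10 q11] h1] := ih hs' _ e2.
have cf : conv N A E u (fun x => f x b.2).
  have [z [z' hz]] := fn b.2; apply: (conv_ext hd _ (conv_all hd vN z z')) => y Ny.
  by rewrite hz.
have [q2 /andP[q20 q21] h2] := cf b.1 Nb _ (exprn_gt0 2 e2).
exists (Num.max q1 q2); first by rewrite lt_max q10 gt_max q11 q21.
move=> r; rewrite gt_max => /andP[r1 r2] r3; have r0 := lt_trans q10 r1.
have h3 : m2 (g r b.1 b.2 - f b.1 b.2) < (e / 2) ^+ 2.
  by apply: (h2 r r2 r3 (fun x => g r x b.2)); apply: GM_GR.
have := h1 r r1 r3; rewrite /fsum !big_cons !ReD.
have h4 : Re (f b.1 b.2 - g r b.1 b.2) <= e / 2.
  apply: Re_le_m2; first exact: ltW.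
  have mN (a : R[i]) : m2 (- a) = m2 a by rewrite /m2 !reim !sqrrN.
  by rewrite -mN opprB ltW.
by move: h4; rewrite ReD ReN; move: (Re _) (Re _) (Re _) (Re _) => *; lra.
Qed.
End Core.

(** * Representations of minimal tensor products *)

Lemma opnorm_nb (R : realType) (G : hilbertType R) (T : op G) : blin T -> nb T (opnorm T).
Proof. by move=> bT; split; [exact: opnorm_ge0|exact: opnorm_bnd]. Qed.
Lemma nb_opnorm (R : realType) (G : hilbertType R) (T : op G) M : nb T M -> opnorm T <= M.
Proof. by case=> M0 h; apply: opnorm_le. Qed.
Lemma nb_eq0 (R : realType) (G : hilbertType R) (T : op G) : (forall e : R, 0 < e -> nb T e) -> T = 0.
Proof.
move=> h; have [_ h0] : nb T 0 by apply: nb_lim => // e e0; rewrite add0r; apply: h.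
apply/funext => v; apply: n2_eq0; apply/eqP; rewrite eq_le n2_ge0 andbT.
by have := h0 v; rewrite expr0n mul0r.
Qed.

Section ClosureExt.
Variables (R : realType) (K : hilbertType R) (C : choiceType) (cm : C -> C -> C) (cs : C -> C) (N : set (op K)).
Hypothesis cN : calg N.
Variables (G1 G2 : hilbertType R) (Phi1 : op K -> C -> op G1) (Phi2 : op K -> C -> op G2).
Hypotheses (b1 : birep cm cs N Phi1) (b2 : birep cm cs N Phi2).
Hypothesis z1 : forall k x c, N x -> Phi1 (k *: x) c = k *: Phi1 x c.
Hypothesis z2 : forall k x c, N x -> Phi2 (k *: x) c = k *: Phi2 x c.
Hypothesis le : forall s M, inS N s -> nb (ev Phi1 s) M -> nb (ev Phi2 s) M.
Implicit Types (s : seq (op K * C)) (S T : op G1) (X Y : op G2).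
Definition clP T := blin T /\ forall e : R, 0 < e -> exists2 s, inS N s & nb (T - ev Phi1 s) e.
(** The closure of the graph of [ev Phi1 s |-> ev Phi2 s]. The algebraic properties are proved for
    the relation, and a map is chosen at the end. *)
Definition rel T X := [/\ blin T, blin X & forall e : R, 0 < e -> exists s, [/\ inS N s, nb (T - ev Phi1 s) e & nb (X - ev Phi2 s) e]].
Lemma evZ_gen (G : hilbertType R) (Phi : op K -> C -> op G) k s : (forall k x c, N x -> Phi (k *: x) c = k *: Phi x c) ->
  inS N s -> ev Phi (seqZ k s) = k *: ev Phi s.
Proof.
move=> z hs; rewrite /ev big_map scaler_sumr; apply: eq_big_seq => p ps /=; apply: z; exact: hs.
Qed.
Lemma ev_catg (G : hilbertType R) (Phi : op K -> C -> op G) s s' : ev Phi (s ++ s') = ev Phi s + ev Phi s'.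
Proof. exact: big_cat. Qed.
Lemma seqZ_in k s : inS N s -> inS N (seqZ k s).
Proof. by move=> hs _ /mapP[q qs ->]; apply: (calgZ _ cN); apply: hs. Qed.
Lemma rel_ev s : inS N s -> rel (ev Phi1 s) (ev Phi2 s).
Proof.
move=> hs; split=> [||e e0]; [exact: (ev_blin b1 hs)|exact: (ev_blin b2 hs)|exists s; split=> //].
  by rewrite subrr; apply: nb_le (nb0 _ _) (ltW e0).
by rewrite subrr; apply: nb_le (nb0 _ _) (ltW e0).
Qed.
Lemma rel_cl T X : rel T X -> clP T.
Proof. by move=> [bT _ h]; split=> // e /h[s [hs ns _]]; exists s. Qed.
Lemma rel_contr T X M : rel T X -> nb T M -> nb X M.
Proof.
move=> [bT bX h] nT; apply: (nb_lim nT.1) => e e0; have e2 : 0 < e / 2 by lra.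
have [s [hs n1 n2']] := h _ e2; have n3 : nb (ev Phi1 s) (M + e / 2).
  by have := nbB nT n1; rewrite opprB addrC subrK.
by have := nbD n2' (le hs n3); rewrite subrK => hh; apply: nb_le hh _; lra.
Qed.
Lemma nb_scale (G : hilbertType R) (T : op G) k a : nb T a -> nb (k *: T) ((1 + m2 k) * a).
Proof.
move=> h; have k0 := m2_ge0 k; apply: nbZ h _ _; first by lra.
by rewrite sqrrD expr1n mul1r -mulr_natl; have := sqr_ge0 (m2 k); lra.
Qed.
Lemma rel_ZD k S T X Y : rel S X -> rel T Y -> rel (k *: S + T) (k *: X + Y).
Proof.
move=> [bS bX h1] [bT bY h2]; split=> [||e e0]; [exact: blinZD|exact: blinZD|].
have k0 := m2_ge0 k; have p0 : 0 < 2 + m2 k by lra.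
have e1 : 0 < e / (2 + m2 k) by rewrite divr_gt0.
have [s [hs n1 n1']] := h1 _ e1; have [s' [hs' n2' n2'']] := h2 _ e1.
have eE : (1 + m2 k) * (e / (2 + m2 k)) + e / (2 + m2 k) = e by field; rewrite gt_eqF.
have hZ : inS N (seqZ k s) by exact: seqZ_in.
exists (seqZ k s ++ s'); split; first exact: inS_cat.
  rewrite ev_catg evZ_gen// opprD addrACA -scalerBr -eE; exact: (nbD (nb_scale k n1) n2').
rewrite ev_catg evZ_gen// opprD addrACA -scalerBr -eE; exact: (nbD (nb_scale k n1') n2'').
Qed.
Lemma rel_uniq T X X' : rel T X -> rel T X' -> X = X'.
Proof.
move=> h h'; have := rel_ZD (-1) h' h; rewrite !scaleN1r addNr [- X' + X]addrC => h0.
apply/subr0_eq; apply: nb_eq0 => e e0; apply: nb_le (ltW e0); apply: rel_contr h0 (nb0 _ _).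
Qed.
Lemma rel_comp S T X Y : rel S X -> rel T Y -> rel (S \o T) (X \o Y).
Proof.
move=> [bS bX h1] [bT bY h2]; split=> [||e e0]; [exact: blinM|exact: blinM|].
have [a a0 na] := blin_nb bS; have [b b0 nb_] := blin_nb bT; have [a' a0' na'] := blin_nb bX; have [b' b0' nb_'] := blin_nb bY.
pose m := 1 + a + b + a' + b'; pose d := Num.min 1 (e / m).
have m0 : 0 < m by rewrite /m; lra.
have d0 : 0 < d by rewrite lt_min ltr01 divr_gt0.
have d1 : d <= 1 by rewrite ge_min lexx.
have dm : d * m <= e by rewrite -ler_pdivlMr// ge_min lexx orbT.
have [s [hs n1 n1']] := h1 _ d0; have [s' [hs' n2' n2'']] := h2 _ d0.
have est (G : hilbertType R) (P Q P' Q' : op G) al be : blin P -> nb P al -> nb Q be -> nb (P - P') d -> nb (Q - Q') d ->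
    0 < al -> 0 < be -> 1 + al + be <= m -> nb ((P \o Q) - (P' \o Q')) e.
  move=> bP hP hQ hP' hQ' a1 c1 am.
  have nQ' : nb Q' (be + d) by have := nbB hQ hQ'; rewrite opprB addrC subrK.
  have -> : (P \o Q) - (P' \o Q') = (P \o (Q - Q')) + ((P - P') \o Q').
    by apply/funext => v; rewrite /= !fctE /= (linB bP.1) addrA subrK.
  apply: nb_le (nbD (nb_comp hP hQ') (nb_comp hP' nQ')) _.
  have : d * (1 + al + be) <= d * m by rewrite ler_wpM2l// ltW.
  have : d * d <= d * 1 by rewrite ler_wpM2l// ltW.
  by move: (d * m) dm => x; lra.
exists (mulS cm s s'); split; first exact: inS_mul.
  rewrite (ev_mul b1 hs hs'); apply: (est _ _ _ _ _ a b) => //; by rewrite /m; lra.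
rewrite (ev_mul b2 hs hs'); apply: (est _ _ _ _ _ a' b') => //; by rewrite /m; lra.
Qed.
Lemma rel_dag T X : rel T X -> rel (dag T) (dag X).
Proof.
move=> [bT bX h]; split=> [||e e0]; [exact: blinJ|exact: blinJ|].
have [s [hs n1 n2']] := h _ e0; exists (starS cs s); split; first exact: inS_star.
  rewrite (ev_star b1 hs) -dagB//; last exact: (ev_blin b1 hs).
  by split; [exact: n1.1|apply: dag_bnd n1.2; [exact: (blinB bT (ev_blin b1 hs))|exact: sqr_ge0]].
rewrite (ev_star b2 hs) -dagB//; last exact: (ev_blin b2 hs).
by split; [exact: n2'.1|apply: dag_bnd n2'.2; [exact: (blinB bX (ev_blin b2 hs))|exact: sqr_ge0]].
Qed.
Lemma rel_exists T : clP T -> exists X, rel T X.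
Proof.
move=> [bT h]; have h0 : (0 : R) <= 2^-1 by rewrite invr_ge0. 
have h1 : (2^-1 : R) < 1 by rewrite invf_lt1// ltr1n.
have p n : 0 < (2^-1 : R) ^+ n by rewrite exprn_gt0// invr_gt0.
have /choice[s hs] : forall n : nat, exists s, inS N s /\ nb (T - ev Phi1 s) ((2^-1) ^+ n).
  by move=> n; have [s hs ns] := h _ (p n); exists s.
have sN n : inS N (s n) by case: (hs n).
have h2 : (0 : R) <= 2 by [].
have [n|n|X [bX hX]] := op_lim h2 h0 h1 (T := fun n => ev Phi2 (s n)).
- exact: (ev_blin b2 (sN n)).
- have hZ : inS N (seqZ (-1) (s n)) by exact: seqZ_in.
  have -> : ev Phi2 (s n.+1) - ev Phi2 (s n) = ev Phi2 (s n.+1 ++ seqZ (-1) (s n)).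
    by rewrite ev_catg evZ_gen// scaleN1r.
  apply: le; first exact: inS_cat.
  rewrite ev_catg evZ_gen// scaleN1r; have := nbB (hs n).2 (hs n.+1).2.
  rewrite opprB addrC addrA subrK => hn; apply: nb_le hn _; rewrite exprS; have := p n; lra.
exists X; split=> // e e0; have [n1 hn1] := hX e e0; have [n2' hn2] := pow_small h0 h1 e0.
pose n := maxn n1 n2'; exists (s n); split=> //; last by apply: hn1; rewrite leq_maxl.
by apply: nb_le (hs n).2 _; apply/ltW/hn2; rewrite leq_maxr.
Qed.
Lemma closure_ext : exists pi : op G1 -> op G2,
  [/\ star_hom_on clP pi, forall s, inS N s -> pi (ev Phi1 s) = ev Phi2 s &
      forall T M, clP T -> nb T M -> nb (pi T) M].
Proof.
pose pi T := xget 0 [set X | rel T X].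
have piP T : clP T -> rel T (pi T) by move=> /rel_exists h; exact: (@xgetPex _ 0 [set X | rel T X] h).
have piE T X : rel T X -> pi T = X by move=> h; have hp := piP _ (rel_cl h); exact: rel_uniq hp h.
exists pi; split=> [|s hs|T M cT]; last exact/rel_contr/piP; last exact/piE/rel_ev.
split=> [T /piP[_ bX _]|k S T /piP hS /piP hT|S T /piP hS /piP hT|T /piP hT].
- exact/bounded_opP.
- exact/piE/rel_ZD.
- exact/piE/rel_comp.
- by rewrite !adjE; apply/piE/rel_dag.
Qed.
End ClosureExt.

(** * HNN extensions *)

Section HnnData.
Variables (R : realType) (H K : hilbertType R) (M B : set (op H)) (theta E_B E_theta : op H -> op H).
Variables (N : set (op K)) (iota : op H -> op K) (E : op K -> op K) (u : op K).
Hypotheses (vM : von_neumann M) (vB : von_neumann B) (BM : B `<=` M).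
Hypotheses (eth : vn_embedding B theta) (thM : forall b, B b -> M (theta b)).
Hypotheses (eB : fn_cond_exp M B E_B) (eT : fn_cond_exp M (theta @` B) E_theta).
Hypothesis hnn : is_HNN M B theta E_B E_theta N iota E u.
Let A := iota @` M.
Let cM := calg_vn vM.
Let cB := calg_vn vB.
Let cN := calg_vn (hnn_vn hnn).
Lemma iota_hom : star_hom_on M iota. Proof. by case: (hnn_iota hnn). Qed.
Lemma theta_hom : star_hom_on B theta. Proof. by case: eth. Qed.
Lemma iota_id : iota id = id. Proof. by case: (hnn_iota hnn). Qed.
Lemma iota_eq0 m : M m -> iota m = 0 -> m = 0.
Proof.
move=> Mm h; case: (hnn_iota hnn) => _ _ inj _; apply: inj; rewrite ?inE//; first exact: calg0.
by rewrite h (sh0 cM iota_hom).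
Qed.
Lemma iota_in m : M m -> N (iota m). Proof. by move=> Mm; apply: (hnn_incl hnn); exists m. Qed.
Let Elin : linear_on N E. Proof. by case: (hnn_E hnn) => -[]. Qed.
Let Efix a : A a -> E a = a. Proof. by case: (hnn_E hnn) => -[_ h _ _ _] _ _; apply: h. Qed.
Let Ein x : N x -> A (E x). Proof. by case: (hnn_E hnn) => -[h _ _ _ _] _ _; apply: h. Qed.
Let EB x y : N x -> N y -> E (x - y) = E x - E y.
Proof. by move=> Nx Ny; have := Elin (-1) Ny Nx; rewrite !scaleN1r addrC => ->; rewrite addrC. Qed.
(** The delicate clause is norm closedness: [A] is the fixed set of [E] in [N], and [E] is norm
    continuous because it is normal. *)
Lemma calg_image : calg A.
Proof.
have AN a : A a -> N a by exact: (hnn_incl hnn).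
split.
- by move=> T /AN /(calgW cN).
- by exists id; [exact: calg1|exact: iota_id].
- move=> k _ _ [x Mx <-] [y My <-]; exists (k *: x + y); first exact: calg_ZD.
  by rewrite (sh_lin iota_hom).
- move=> _ _ [x Mx <-] [y My <-]; exists (x \o y); first exact: calgM.
  by rewrite (sh_comp iota_hom).
- move=> _ [x Mx <-]; exists (dag x); first exact: calgJ.
  by rewrite (sh_dag iota_hom).
move=> T bT h; have NT : N T.
  by apply: (calg_closed cN bT) => e /h[S AS nS]; exists S => //; apply: AN.
suff <- : E T = T by exact: Ein.
have Eb x : N x -> blin (E x) by move=> /Ein/AN/(calgW cN).
apply/funext => v; apply: ip_ext => w; apply/subr0_eq; rewrite -ipBl.
have uE : uw_continuous_on N E by case: (hnn_E hnn).
(* Ultraweak continuity bounds the matrix coefficient of [E] at [v], [w] by the norm at one vector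
   [z] of the amplification, which suffices for norm limits. *)
have [z hz] := uw_norm_bnd cN (ei 0 v) (ei 0 w) Elin Eb uE.
apply: m2_eq0; apply/eqP; rewrite eq_le m2_ge0 andbT.
pose c := 2 * (n2 z + n2 v * n2 w).
have c0 : 0 <= c by rewrite mulr_ge0// addr_ge0 ?n2_ge0// mulr_ge0 ?n2_ge0.
apply: le_eps => e e0; rewrite add0r.
have e1 : 0 < Num.sqrt (e / (1 + c)) by rewrite sqrtr_gt0 divr_gt0//; lra.
have [S AS nS] := h _ e1; have NS := AN _ AS; have bS := calgW cN NS.
have b1 : blin (T - S) by exact: blinB.
have -> : inner (E T v - T v) w = inner (E (T - S) v) w - inner ((T - S) v) w.
  by rewrite -ipBl EB// (Efix AS) !fctE opprB addrA subrK.
have h1 : m2 (inner (E (T - S) v) w) <= e / (1 + c) * n2 z.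
  have := hz _ (calgB cN NT NS); rewrite amE; last exact: (Eb _ (calgB cN NT NS)).
  rewrite eiE eqxx mul1r => h2; apply: le_trans h2 _.
  have [_ nA] := sh_contr (calg_blins K) (am_star K) b1 nS.
  by have := nA z; rewrite sqr_sqrtr// divr_ge0 ?(ltW e0)//; lra.
have h2 : m2 (inner ((T - S) v) w) <= e / (1 + c) * (n2 v * n2 w).
  apply: le_trans (CS _ _) _; rewrite mulrA ler_wpM2r ?n2_ge0//.
  by have := nS.2 v; rewrite sqr_sqrtr// divr_ge0 ?(ltW e0)//; lra.
apply: le_trans (m2D _ _) _; rewrite m2N.
have h3 : 2 * (e / (1 + c) * n2 z) + 2 * (e / (1 + c) * (n2 v * n2 w)) = e / (1 + c) * c.
  by rewrite /c; ring.
have h4 : e / (1 + c) * c <= e by rewrite mulrAC ler_pdivrMr ?mulrDr; [lra|lra].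
lra.
Qed.
Lemma hnn_ce : CE N A E.
Proof.
case: (hnn_E hnn) => -[h1 h2 h3 h4 h5] h6 h7; split=> //.
- exact: calg_image.
- exact: hnn_incl hnn.
- move=> x Nx px; have : positive_op x by apply/positive_opP; split=> //; apply: (calgW cN).
  by move=> /(h4 _ Nx)/positive_opP[].
- move=> x Nx px; apply: h6 => //; apply/positive_opP; split=> //; exact: (calgW cN).
Qed.
Lemma conj_up b : B b -> iota (theta b) = adj u \o iota b \o u.
Proof.
move=> Bb; rewrite -(hnn_conj hnn Bb); case: (hnn_unitary hnn) => _ h1 h2.
apply/funext => v /=; have e1 x : adj u (u x) = x by have /(app_eq x) := h1.
by rewrite !e1.
Qed.
Lemma word2 e m : M m -> (if e then E_theta else E_B) m = 0 -> E (upow u e \o iota m \o upow u (~~ e)) = 0.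
Proof.
move=> Mm h; pose x i := if i is 1%N then m else id; pose ee i := if i is 1%N then e else ~~ e.
have -> : upow u e \o iota m \o upow u (~~ e) = word iota u x ee 2 by rewrite /= iota_id.
apply: (hnn_reduced hnn) => // [[|[|i]] _ //=|]; try exact: calg1.
by move=> [|[|i]] //=.
Qed.
Let NU e : N (upow u e).
Proof. by case: e; [exact: (hnn_u hnn)|rewrite /= adjE; apply: (calgJ cN); exact: (hnn_u hnn)]. Qed.
Let split_E e m m' : M m -> M m' -> (if e then E_theta else E_B) (m - m') = 0 ->
  Feps E u (~~ e) (iota m) = E (upow u e \o iota m' \o upow u (~~ e)).
Proof.
move=> Mm Mm' h; apply/subr0_eq; rewrite /Feps negbK -EB; last first.
- exact: (calgM cN (calgM cN (NU _) (iota_in _)) (NU _)).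
- exact: (calgM cN (calgM cN (NU _) (iota_in _)) (NU _)).
rewrite -(word2 (calgB cM Mm Mm') h) (shB iota_hom)//; congr E.
by apply/funext => v; rewrite /= !fctE (linB (calgW cN (NU e)).1).
Qed.
Let cEB : cond_exp M B E_B. Proof. by case: eB. Qed.
Let cET : cond_exp M (theta @` B) E_theta. Proof. by case: eT. Qed.
Let cexp0 (B' : set (op H)) P m : cond_exp M B' P -> B' `<=` M -> M m -> P (m - P m) = 0.
Proof.
case=> h1 h2 h3 _ _ sB Mm; have MP := sB _ (h1 _ Mm).
by have := h3 (-1) _ _ MP Mm; rewrite !scaleN1r addrC => ->; rewrite h2 ?addNr//; apply: h1.
Qed.
Let thS : theta @` B `<=` M. Proof. by move=> _ [b Bb <-]; apply: thM. Qed.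
Lemma F_true m : M m -> Feps E u true (iota m) = iota (theta (E_B m)).
Proof.
move=> Mm; have Bb := cond_exp_in cEB Mm.
rewrite (@split_E false _ (E_B m))//; [|exact: BM|exact: (cexp0 cEB)].
by rewrite /= -conj_up// Efix//; exists (theta (E_B m)) => //; apply: thM.
Qed.
Lemma F_false m b : M m -> B b -> E_theta m = theta b -> Feps E u false (iota m) = iota b.
Proof.
move=> Mm Bb h; rewrite (@split_E true _ (theta b))//; [|exact: thM|rewrite -h; exact: (cexp0 cET)].
by rewrite /= (hnn_conj hnn)// Efix//; exists b => //; apply: BM.
Qed.
Lemma word_shift x e n : word iota u x e n.+1 =
  iota (x 0%N) \o upow u (e 1%N) \o word iota u (fun i => x i.+1) (fun i => e i.+1) n.
Proof. by elim: n => // n ih; rewrite -[LHS]/(word iota u x e n.+1 \o _ \o _) ih. Qed.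
(** [word] grows on the right whereas [RW] grows on the left. The clauses [x 0 = id] and [ee 1 = e]
    carry the induction together with [word_shift]. *)
Lemma RW_word e d n w : RW A E u e d n w -> exists x ee,
  [/\ (0 < n)%N, forall i, M (x i), x 0%N = id /\ ee 1%N = e,
      reduced E_B E_theta x ee n & w = word iota u x ee n].
Proof.
elim=> {e d n w} [e|e e' d n _ w [m Mm <-] h _ [x [ee [n0 Mx [x0 ee1] hr ->]]]].
  exists (fun=> id), (fun=> e); split=> //; [by move=> i; apply: calg1|by move=> i _; rewrite eqxx|].
  by rewrite /= iota_id.
exists (fun i => if i is j.+1 then if j is 0 then m else x j else id),
  (fun i => if i is j.+1 then if j is 0 then e else ee j else e); split=> //.
- by move=> [|[|i]]; [exact: calg1|exact: Mm|exact: Mx].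
- move=> [|[|i]]//= hi; last by apply: hr; rewrite -ltnS.
  (* Injectivity of [iota] and [theta] turns [F e' x = 0] back into the vanishing of [E_theta] or
     [E_B]. *)
  rewrite ee1 => ne; have := h ne.
  case: e e' ne h {ee1} => [] [] //= _ _.
    have [b Bb hb] := cond_exp_in cET Mm.
    rewrite (F_false Mm Bb (esym hb)) => /(iota_eq0 (BM Bb)) b0.
    by rewrite -hb b0 (sh0 cB theta_hom).
  have Bb := cond_exp_in cEB Mm; rewrite F_true// => /(iota_eq0 (thM Bb)) b0.
  case: eth => _ _ inj _; apply: inj; rewrite ?inE//; first exact: calg0.
  by rewrite b0 (sh0 cB theta_hom).
case: n n0 hr => // n _ _; rewrite !word_shift /= iota_id x0 iota_id ee1.
by case: n => // n; rewrite ?word_shift.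
Qed.
Lemma hnn_HD : HD N A E u.
Proof.
case: (hnn_unitary hnn) => _ h1 h2; split.
- exact: hnn_ce.
- by case: (hnn_E hnn).
- exact: hnn_u hnn.
- by rewrite -adjE.
- by rewrite -adjE.
- move=> e _ [m Mm <-]; case: e; rewrite /Eeps.
    by have Bb := cond_exp_in cEB Mm; rewrite F_true// /Ueps /= (hnn_conj hnn)//; exists (E_B m) => //; apply: BM.
  have [b Bb hb] := cond_exp_in cET Mm; rewrite (F_false Mm Bb (esym hb)) /Ueps /= -conj_up//.
  by exists (theta b) => //; apply: thM.
- move=> e d n w /RW_word[x [ee [n0 Mx _ hr ->]]]; apply: (hnn_reduced hnn) => // i _; exact: Mx.
- exact: hnn_generated hnn.
Qed.
End HnnData.

(** * Representations of algebras whose unit is a projection *)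

Section Corner.
Variables (R : realType) (G : hilbertType R) (P : set (op G)) (e : op G).
Hypotheses (Pe : P e) (se : dag e = e) (Pu : forall T, P T -> [/\ blin T, T \o e = T & e \o T = T]).
Hypotheses (PZ : forall k S T, P S -> P T -> P (k *: S + T)) (PC : forall S T, P S -> P T -> P (S \o T)).
Hypothesis PD : forall T, P T -> P (dag T).
Hypothesis Pl : forall T, blin T -> (forall d : R, 0 < d -> exists2 S, P S & nb (T - S) d) -> P T.
(** A faithful representation of [C] is not assumed unital, so the minimal tensor product has a
    projection [e] as unit, while [calg] asks for [id]. The operators commuting with [e] whose
    product with [e] lies in [P] form such an algebra. *)
Lemma calg_corner : calg [set T | [/\ blin T, T \o e = e \o T & P (T \o e)]].
Proof.
have [be ee _] := Pu Pe; split.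
- by move=> T [].
- by split=> //; exact: blin_id.
- move=> k T S [bT cT PT] [bS cS PS]; split; first exact: blinZD.
    apply/funext => v; have /(app_eq v) /= h1 := cT; have /(app_eq v) /= h2 := cS.
    by rewrite /= !fctE h1 h2 (linD be.1) (linZ be.1).
  exact: (PZ k PT PS).
- move=> T S [bT cT PT] [bS cS PS]; split; first exact: blinM.
    apply/funext => v; have /(app_eq v) /= h2 := cS; have /(app_eq (S v)) /= h1 := cT.
    by rewrite /= h2 h1.
  suff -> : (T \o S) \o e = (T \o e) \o (S \o e) by exact: PC.
  apply/funext => v; have /(app_eq (e v)) /= h2 := cS; have /(app_eq v) /= h1 := ee.
  by rewrite /= -h2 h1.
- move=> T [bT cT PT]; have h : dag T \o e = e \o dag T.
    by have := congr1 (@dag _ _ _) cT; rewrite (dagM bT be) (dagM be bT) se.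
  split=> //; first exact: blinJ.
  by rewrite -se -(dagM be bT) -cT; exact: PD.
move=> T bT h; have [c c0 nc] := blin_nb be.
have cT : T \o e = e \o T.
  apply/subr0_eq/nb_eq0 => d d0; have d1 : 0 < d / (2 * c) by rewrite divr_gt0 ?mulr_gt0.
  have [S [bS cS _] nS] := h _ d1; have -> : (T \o e) - (e \o T) = ((T - S) \o e) - (e \o (T - S)).
    apply/funext => v; have /(app_eq v) /= h1 := cS.
    by rewrite /= !fctE /= (linB be.1) h1 opprB addrA subrK.
  apply: nb_le (nbB (nb_comp nS nc) (nb_comp nc nS)) _; rewrite [c * _]mulrC -mulrDl -mulr2n.
  by rewrite -[(_ *+ 2)]mulr_natl le_eqVlt; apply/orP; left; apply/eqP; field; rewrite gt_eqF.
split=> //; apply: Pl => [|d d0]; first exact: blinM.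
have d1 : 0 < d / c by rewrite divr_gt0.
have [S [bS cS PS] nS] := h _ d1; exists (S \o e) => //.
have -> : (T \o e) - (S \o e) = (T - S) \o e by [].
by apply: nb_le (nb_comp nS nc) _; rewrite divfK// gt_eqF.
Qed.
Lemma corner_contr (L : hilbertType R) (l : op G -> op L) T M :
  star_hom_on P l -> P T -> nb T M -> nb (l T) M.
Proof.
move=> sl PT; have cB := calg_corner.
have [bT Te eT] := Pu PT; have [be ee _] := Pu Pe.
have sB : star_hom_on [set T | [/\ blin T, T \o e = e \o T & P (T \o e)]] (fun T => l (T \o e)).
  split.
  - by move=> S [_ _ PS]; exact/bounded_opP/(sh_blin sl).
  - by move=> k S S' [_ _ PS] [_ _ PS']; rewrite -(sh_lin sl).
  - move=> S S' [bS cS PS] [bS' cS' PS']; rewrite -(sh_comp sl)//; congr l.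
    apply/funext => v; have /(app_eq (e v)) /= h2 := cS'; have /(app_eq v) /= h1 := ee.
    by rewrite /= -h2 h1.
  - move=> S [bS cS PS]; rewrite !adjE -(sh_dag sl)//; congr l.
    by rewrite cS (dagM be bS) se.
move=> nT; have := sh_contr cB sB (T := T) _ nT; rewrite Te; apply; split=> //; by rewrite ?Te ?eT.
Qed.

End Corner.

Section Spatial.
Variables (R : realType) (H : hilbertType R) (C Q : cstarType R) (q : C -> Q) (W : spatial H Q).
Local Notation srm := (@sp_map _ _ _ W).
Local Notation srp := (@sp_rep _ _ _ W).
Hypothesis hq : cstar_morphism q.
(** The legs are exchanged to fit [amp], which acts on the second one. Through [q] the section
    serves both the quotient and, with the identity, [C] itself. *)
Definition sp_t (l : sp_space W) k := srm k l.
Definition sp_rho c := aL (srm) (srp (q c)).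
Definition sp_ga c l := inner (srp (q c) l) l.
Let hW := sp_mapP W.
Lemma sp_rep_blin d : blin (srp d).
Proof. by case: (sp_repP W) => h _ _ _ _; apply/bounded_opP. Qed.
Lemma sp_tE i k j l : inner (sp_t i k) (sp_t j l) = inner i j * inner k l.
Proof. exact: (htEC hW). Qed.
Lemma sp_tt : total (fun p : sp_space W * H => sp_t p.1 p.2).
Proof. exact: (ht_totalC hW). Qed.
Lemma sp_rb c : blin (sp_rho c). Proof. by apply: (aL_blin hW); apply: sp_rep_blin. Qed.
Lemma sp_rm c d : sp_rho (c ** d) = sp_rho c \o sp_rho d.
Proof.
case: (sp_repP W) => _ _ hm _ _; case: hq => _ qm _ _; rewrite /sp_rho qm hm.
exact: (sh_comp (aL_star hW) (sp_rep_blin _) (sp_rep_blin _)).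
Qed.
Lemma sp_rs c : sp_rho (star c) = dag (sp_rho c).
Proof.
case: (sp_repP W) => _ _ _ hs _; case: hq => _ _ _ qs; rewrite /sp_rho qs hs adjE.
exact: (sh_dag (aL_star hW) (sp_rep_blin _)).
Qed.
Lemma sp_rcom c (x : op H) : blin x -> sp_rho c \o amp sp_t x = amp sp_t x \o sp_rho c.
Proof. by move=> bx; rewrite -(aHL hW bx (sp_rep_blin _)). Qed.
Lemma sp_rga c i (k l : H) : inner (sp_rho c (sp_t i k)) (sp_t i l) = sp_ga c i * inner k l.
Proof. by rewrite /sp_rho (aLE hW _ _ (sp_rep_blin _)) sp_tE. Qed.
Lemma sp_tr : tensor_rep sp_t (@inner R _) (@cmul R C) (@star R C) sp_rho sp_ga.
Proof. by split; [exact: sp_tE|exact: sp_tt|exact: sp_rb|exact: sp_rm|exact: sp_rs|exact: sp_rcom|exact: sp_rga]. Qed.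
Lemma sp_elt a c : blin a -> @elt _ _ _ W a (q c) = Phit sp_t sp_rho a c.
Proof. by move=> ba; apply: (op_tensorE hW ba (sp_rep_blin _)). Qed.
Lemma sp_ev M s : calg M -> inS M s -> \sum_(p <- s) @elt _ _ _ W p.1 (q p.2) = ev (Phit sp_t sp_rho) s.
Proof. by move=> cM hs; apply: eq_big_seq => p ps; apply/sp_elt/(calgW cM)/hs. Qed.
Lemma Phit_Z k a c : blin a -> Phit sp_t sp_rho (k *: a) c = k *: Phit sp_t sp_rho a c.
Proof.
move=> ba; have := sh_lin (aH_star hW) k ba (@blin0 _ _ _).
rewrite (sh0 (calg_blins H) (aH_star hW)) !addr0 => h.
by apply/funext => v; have /(app_eq (sp_rho c v)) := h.
Qed.
End Spatial.

Lemma cstar_id (R : realType) (C : cstarType R) : cstar_morphism (@idfun C).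
Proof. by split. Qed.
Lemma star_cone (R : realType) (C : cstarType R) : star (@cone R C) = cone.
Proof. by rewrite -[LHS]cmul1x -{1}[cone]starK -starM cmul1x starK. Qed.
Section MinTensor.
Variables (R : realType) (K : hilbertType R) (C : cstarType R) (W : spatial K C) (N : set (op K)).
Hypothesis cN : calg N.
Local Notation tW := (@sp_t _ _ _ W).
Local Notation rW := (@sp_rho _ _ _ _ idfun W).
Local Notation PW := (Phit tW rW).
Local Notation MT := (@min_tensor _ _ _ W N setT).
Let hC := @cstar_id R C.
Lemma PW_birep : birep (@cmul R C) (@star R C) N PW.
Proof. exact: (Phit_birep (sp_tr W hC) cN). Qed.
Lemma PW_Z k x c : N x -> PW (k *: x) c = k *: PW x c.
Proof. by move=> Nx; apply/Phit_Z/(calgW cN). Qed.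
Lemma min_tensorP T : MT T <-> clP N PW T.
Proof.
split=> [[/bounded_opP bT h]|[bT h]]; split=> //.
- move=> e /h[_ [s hs <-] hT]; have hN : inS N s by move=> p /hs[].
  rewrite (sp_ev idfun W cN hN) in hT; exists s => //; apply: nb_le (ltW hT).
  exact/opnorm_nb/(blinB bT)/(ev_blin PW_birep).
- exact/bounded_opP.
move=> e e0; have e2 : 0 < e / 2 by rewrite divr_gt0.
have [s hs nT] := h _ e2; exists (ev PW s); first by exists s => [p /hs//|]; rewrite (sp_ev idfun W cN).
by apply: le_lt_trans (nb_opnorm nT) _; lra.
Qed.
Lemma MT_ev s : inS N s -> MT (ev PW s).
Proof. by move=> hs; apply/min_tensorP/rel_cl/(rel_ev PW_birep PW_birep hs). Qed.
Lemma MT_rel T : MT T -> rel N PW PW T T.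
Proof. by move=> /min_tensorP[bT h]; split=> // e /h[s hs ns]; exists s. Qed.
Lemma rel_MT T X : rel N PW PW T X -> MT T. Proof. by move=> /rel_cl/min_tensorP. Qed.
Let c1 := @cone R C.
Lemma rW_1c c : rW c1 \o rW c = rW c. Proof. by rewrite -(sp_rm W hC) cmul1x. Qed.
Lemma rW_c1 c : rW c \o rW c1 = rW c. Proof. by rewrite -(sp_rm W hC) cmulx1. Qed.
Lemma MT_unit T : MT T -> [/\ blin T, T \o rW c1 = T & rW c1 \o T = T].
Proof.
have be := @sp_rb _ _ _ _ idfun W c1; move=> /min_tensorP[bT h].
have est s : inS N s -> ev PW s \o rW c1 = ev PW s /\ rW c1 \o ev PW s = ev PW s.
  move=> hs; split; apply/funext => v; rewrite /ev /= !sumE ?(lin_sum be.1); apply: eq_big_seq => p ps.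
    by have /(app_eq v) /= h1 := rW_c1 p.2; rewrite /Phit /= h1.
  have bp := calgW cN (hs p ps); have /(app_eq (rW p.2 v)) /= h1 := sp_rcom idfun W c1 bp.
  by have /(app_eq v) /= h2 := rW_1c p.2; rewrite /Phit /= h1 h2.
have [cc cc0 ncc] := blin_nb be.
have app d : 0 < d -> exists2 s, inS N s & nb (T - ev PW s) (d / (cc + 1)).
  by move=> d0; apply: h; rewrite divr_gt0//; lra.
have ccE (d : R) : d / (cc + 1) * cc + d / (cc + 1) = d.
  by rewrite -{2}[d / _]mulr1 -mulrDr divfK// gt_eqF//; lra.
split=> //; apply/subr0_eq/nb_eq0 => d /app[s hs ns]; have [e1 e2] := est s hs.
  have -> : (T \o rW c1) - T = ((T - ev PW s) \o rW c1) - (T - ev PW s).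
    apply/funext => v; have /(app_eq v) /= h1 := e1.
    by rewrite /= !fctE /= h1 opprB addrA subrK.
  by have := nbB (nb_comp ns ncc) ns; rewrite ccE.
have -> : (rW c1 \o T) - T = (rW c1 \o (T - ev PW s)) - (T - ev PW s).
  apply/funext => v; have /(app_eq v) /= h1 := e2.
  by rewrite /= !fctE /= (linB be.1) h1 opprB addrA subrK.
by have := nbB (nb_comp ncc ns) ns; rewrite [cc * _]mulrC ccE.
Qed.
Lemma MT_one : MT (rW c1).
Proof.
have h1 : inS N [:: (id, c1)] by move=> p; rewrite inE => /eqP ->; apply: (calg1 cN).
have h2 : amp tW id = id := aH_id (sp_mapP W).
by have := MT_ev h1; rewrite /ev big_seq1 /Phit /= h2.
Qed.
Lemma MT_ZD k S T : MT S -> MT T -> MT (k *: S + T).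
Proof. by move=> /MT_rel hS /MT_rel hT; exact: (rel_MT (rel_ZD cN PW_Z PW_Z k hS hT)). Qed.
Lemma MT_comp S T : MT S -> MT T -> MT (S \o T).
Proof. by move=> /MT_rel hS /MT_rel hT; apply: rel_MT (rel_comp cN PW_birep PW_birep hS hT). Qed.
Lemma MT_dag T : MT T -> MT (dag T).
Proof. by move=> /MT_rel hT; apply: rel_MT (rel_dag cN PW_birep PW_birep hT). Qed.
Lemma MT_closed T : blin T -> (forall d : R, 0 < d -> exists2 S, MT S & nb (T - S) d) -> MT T.
Proof.
move=> bT h; apply/min_tensorP; split=> // e e0; have e2 : 0 < e / 2 by rewrite divr_gt0.
have [S /min_tensorP[_ hS] nS] := h _ e2; have [s hs ns] := hS _ e2; exists s => //.
by have := nbD nS ns; rewrite addrA subrK -splitr.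
Qed.
Lemma MT_contr (L : hilbertType R) (pi : op (sp_tensor W) -> op L) T M :
  star_hom_on MT pi -> MT T -> nb T M -> nb (pi T) M.
Proof.
have se : dag (rW c1) = rW c1 by rewrite -(sp_rs W hC) star_cone.
exact: (corner_contr MT_one se MT_unit MT_ZD MT_comp MT_dag MT_closed).
Qed.
End MinTensor.

(** * Weak exactness transported from [M] on [H] to its image on [K] *)

Section Transport.
Variables (R : realType) (H K : hilbertType R) (M : set (op H)) (iota : op H -> op K).
Hypotheses (cM : calg M) (si : star_hom_on M iota) (inj : set_inj M iota) (ui : uw_continuous_on M iota).
Let A := iota @` M.
Hypothesis cA : calg A.
Variables (C Q : cstarType R) (J : set C) (q : C -> Q) (W : spatial K C) (V : spatial K Q).
Hypotheses (hJ : closed_ideal J) (hQ : cstar_quotient J q).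
Variables (G : hilbertType R) (Pi : op K -> op G) (Rr : C -> op G).
Hypotheses (sP : star_hom_on A Pi) (dP : forall v, dom A Pi v).
Hypotheses (rb : forall c, blin (Rr c)) (rm : forall c d, Rr (c ** d) = Rr c \o Rr d).
Hypotheses (rs : forall c, Rr (star c) = dag (Rr c)) (rP : forall c a, A a -> Rr c \o Pi a = Pi a \o Rr c).
Hypothesis rJ : forall c, J c -> Rr c = 0.
Hypothesis gb : forall s m, inS A s -> nb (ev (Phit (@sp_t _ _ _ W) (@sp_rho _ _ _ _ idfun W)) s) m ->
  nb (ev (fun a c => Pi a \o Rr c) s) m.
Let hC := @cstar_id R C.
Let qm : cstar_morphism q. Proof. by case: hQ. Qed.
Let Ai a : M a -> A (iota a). Proof. by move=> Ma; exists a. Qed.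
Let WH : spatial H C := Spatial (sp_repP W) (tens_hilbert H (sp_space W)).
Let VH : spatial H Q := Spatial (sp_repP V) (tens_hilbert H (sp_space V)).
Let PWH := Phit (@sp_t _ _ _ WH) (@sp_rho _ _ _ _ idfun WH).
Let Ph2 a c := Pi (iota a) \o Rr c.
Let si_comp : star_hom_on M (fun a => Pi (iota a)).
Proof.
split=> [a /Ai h|k a b Ma Mb|a b Ma Mb|a Ma]; first exact/bounded_opP/(sh_blin sP).
- by rewrite (sh_lin si)// (sh_lin sP)//; exact: Ai.
- by rewrite (sh_comp si)// (sh_comp sP)//; exact: Ai.
- by rewrite !adjE (sh_dag si)// (sh_dag sP)//; exact: Ai.
Qed.
Let b2 : birep (@cmul R C) (@star R C) M Ph2.
Proof.
split=> [a c Ma|a b c d Ma Mb|a c Ma]; first exact: (blinM (sh_blin si_comp Ma) (rb c)).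
  rewrite /Ph2 (sh_comp si_comp)// rm; apply/funext => v /=.
  by have /(app_eq (Rr d v)) /= -> := rP c (Ai Mb).
have ba := sh_blin si_comp Ma; rewrite /Ph2 (dagM ba (rb c)) (sh_dag si_comp)// -rs -(sh_dag si_comp)//.
by rewrite rP//; apply/Ai/(calgJ cM).
Qed.
Let im s : seq (op K * C) := [seq (iota p.1, p.2) | p <- s].
Let im_in s : inS M s -> inS A (im s).
Proof. by move=> hs _ /mapP[p ps ->]; apply/Ai/hs. Qed.
Let ev2 s : ev Ph2 s = ev (fun a c => Pi a \o Rr c) (im s). Proof. by rewrite /ev big_map. Qed.
Let le s m : inS M s -> nb (ev PWH s) m -> nb (ev Ph2 s) m.
Proof.
move=> hs hm; rewrite ev2; apply: gb (im_in hs) _.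
have := hom_le (sp_tr WH hC) (sp_tr W hC) cM si hs hm.
by rewrite /ev big_map.
Qed.
Let back a := xget 0 [set x | M x /\ iota x = a].
Let backK x : M x -> back (iota x) = x.
Proof.
move=> Mx; have [My e] : [set y | M y /\ iota y = iota x] (back (iota x)).
  by apply: xgetPex; exists x.
by apply: inj; rewrite ?inE.
Qed.
Let back_hom : star_hom_on A back.
Proof.
have bM := calgW cM.
split=> [_ [x Mx <-]|k _ _ [x Mx <-] [y My <-]|_ _ [x Mx <-] [y My <-]|_ [x Mx <-]].
- by rewrite backK//; apply/bounded_opP/bM.
- by rewrite -(sh_lin si)// !backK//; apply: (calg_ZD cM).
- by rewrite -(sh_comp si)// !backK//; apply: (calgM cM).
- by rewrite !adjE -(sh_dag si)// !backK//; apply: (calgJ cM).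
Qed.
Let uw_dom v : dom M (fun a => Pi (iota a)) v.
Proof.
have [z hz] := dP v; have bi a : M a -> blin (iota a) by move=> Ma; exact: (sh_blin si Ma).
have [|z' hz'] := uw_posdom cM z _ bi ui; first by case: si.
exists z' => a Ma; apply: le_trans (hz _ (Ai Ma)) _.
have ba := calgW cM Ma.
have pa : hpos (dag a \o a) by move=> w /=; rewrite (dagPr ba) ipC ler0c n2_ge0.
have := hz' _ (calgM cM (calgJ cM Ma) Ma) pa.
have key (X : hilbertType R) (b : op X) y : blin b -> Re (inner (am (dag b \o b) y) y) = n2 (am b y).
  by move=> bb; rewrite (sh_sq (calg_blins X) (am_star X))// ipC.
by rewrite (sh_comp si)// ?(sh_dag si)// ?key//; [exact: bi|exact: (calgJ cM)].
Qed.
Hypothesis wM : weakly_exact M.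
(** The hypothesis concerns [M] on [H], with spatial data over [H], and the conclusion concerns [A]
    on [K]. By [hom_le], for [iota] and for its inverse on [A], the spatial norms agree;
    [closure_ext] provides the representation of [M (x) C] to which weak exactness is applied. *)
Lemma weak_exact_transport : exists2 k : R, 0 <= k & forall s m, inS A s ->
  nb (ev (Phit (@sp_t _ _ _ V) (@sp_rho _ _ _ _ q V)) s) m -> nb (ev (fun a c => Pi a \o Rr c) s) (k * m).
Proof.
have bM := calgW cM; have bW := PW_birep WH cM.
have z2 k x c : M x -> Ph2 (k *: x) c = k *: Ph2 x c.
  by move=> Mx; rewrite /Ph2 (shZ cM si_comp).
have [pi [spi piE pib]] := closure_ext cM bW b2 (PW_Z WH cM) z2 le.
have piE1 a c : M a -> pi (@elt _ _ _ WH a c) = Ph2 a c.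
  move=> Ma; have h1 : inS M [:: (a, c)] by move=> p; rewrite inE => /eqP ->.
  by have := piE _ h1; rewrite /ev !big_seq1 -(sp_elt idfun WH _ (bM _ Ma)).
have mE : @min_tensor _ _ _ WH M setT = clP M PWH.
  by apply/seteqP; split=> T /(min_tensorP cM).
have spi' : star_hom_on (@min_tensor _ _ _ WH M setT) pi by rewrite mE.
(* Elements with coefficients in [J] go to 0 because [Rr] kills [J]; contractivity extends this to
   the closure. *)
have kill T : @min_tensor _ _ _ WH M J T -> pi T = 0.
  move=> [/bounded_opP bT h]; apply: nb_eq0 => e /h[_ [s hs <-] hT].
  have hN : inS M s by move=> p /hs[].
  rewrite (sp_ev idfun WH cM hN) in hT.
  have nT : nb (T - ev PWH s) e by apply: nb_le (ltW hT); exact/opnorm_nb/(blinB bT)/(ev_blin bW).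
  have mT : clP M PWH T.
    split=> // d /h[_ [s' hs' <-] hT']; have hN' : inS M s' by move=> p /hs'[].
    rewrite (sp_ev idfun WH cM hN') in hT'; exists s' => //.
    by apply: nb_le (ltW hT'); exact/opnorm_nb/(blinB bT)/(ev_blin bW).
  have ms := rel_cl (rel_ev bW bW hN).
  have := MT_contr cM spi' (T := T - ev PWH s) _ nT; rewrite mE.
  have e1 : ev Ph2 s = 0.
    rewrite /ev big_seq; apply: big1 => p /hs[Mp Jp]; rewrite /Ph2 rJ//.
    by apply/funext => v /=; rewrite (lin0 (sh_blin si_comp Mp).1).
  have e2 : pi (T - ev PWH s) = pi T.
    have := sh_lin spi (-1) ms mT; rewrite !scaleN1r addrC => ->.
    by rewrite (piE _ hN) e1 oppr0 add0r.
  rewrite e2; apply; rewrite -mE -(scaleN1r (ev _ _)) addrC; apply: (MT_ZD cM); by rewrite mE.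
have uw : uw_continuous_on M (fun a => pi (@elt _ _ _ WH a cone)).
  apply: dom_uw => // [|v].
    split=> [a Ma|k a b Ma Mb|a b Ma Mb|a Ma].
    - by rewrite piE1//; apply/bounded_opP/(bi_blin b2).
    - by rewrite !piE1// /Ph2 ?(sh_lin si_comp)//; apply: (calg_ZD cM).
    - rewrite !piE1//; last exact: (calgM cM).
      by rewrite -(bi_mul b2)// cmul1x.
    - rewrite !piE1 ?adjE//; last exact: (calgJ cM).
      by rewrite -(bi_star b2)// star_cone.
  by have [z hz] := uw_dom (Rr cone v); exists z => a Ma; rewrite piE1//; exact: hz.
(* The constant of weak exactness carries no sign; its maximum with 0 is used. *)
have [k hk] := wM hJ spi' kill uw hQ VH; exists (Num.max 0 k) => [|s m hs hm]; first by rewrite le_max lexx.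
pose s' : seq (op H * C) := [seq (back p.1, p.2) | p <- s].
have hb a : A a -> M (back a) /\ iota (back a) = a by move=> [x Mx <-]; rewrite backK.
have hs' : inS M s' by move=> _ /mapP[p ps ->]; case: (hb _ (hs _ ps)).
have nV := hom_le (sp_tr V qm) (sp_tr VH qm) cA back_hom hs hm.
have {}hk := hk s' hs'; rewrite (sp_ev q VH cM hs') in hk.
have e1 : \sum_(p <- s') pi (@elt _ _ _ WH p.1 p.2) = ev (fun a c => Pi a \o Rr c) s.
  rewrite /s' big_map; apply: eq_big_seq => p ps; have [Mb e] := hb _ (hs _ ps).
  by rewrite piE1// /Ph2 e.
rewrite e1 in hk.
have nV' : opnorm (ev (Phit (@sp_t _ _ _ VH) (@sp_rho _ _ _ _ q VH)) s') <= m.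
  by apply: nb_opnorm; rewrite /ev big_map.
have bV := ev_blin (Phit_birep (sp_tr VH qm) cM) hs'.
have bE : blin (ev (fun a c => Pi a \o Rr c) s).
  rewrite /ev big_seq; elim/big_rec: _ => [|p y ps by_]; first exact: blin0.
  exact: (blinD (blinM (sh_blin sP (hs p ps)) (rb _)) by_).
apply: nb_le (opnorm_nb bE) _; apply: le_trans hk _.
have o0 := opnorm_ge0 bV; apply: le_trans (ler_wpM2l _ nV'); last by rewrite le_max lexx.
by rewrite ler_wpM2r// le_max lexx orbT.
Qed.
End Transport.

(** * The comparison of [pi] with the quotient norm *)

Section WeakExactness.
Variables (R : realType) (H K : hilbertType R) (M : set (op H)) (iota : op H -> op K).
Hypotheses (cM : calg M) (si : star_hom_on M iota) (inj : set_inj M iota) (ui : uw_continuous_on M iota).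
Hypothesis wM : weakly_exact M.
Let A := iota @` M.
Variables (N : set (op K)) (E : op K -> op K) (u : op K).
Hypotheses (hd : HD N A E u) (vN : von_neumann N).
Let cN := ceN (hd_ce hd).
Let cA := ceA (hd_ce hd).
Let AN a : A a -> N a := ce_sub (hd_ce hd) (t := a).
Variables (C Q : cstarType R) (J : set C) (q : C -> Q) (W : spatial K C) (V : spatial K Q).
Hypotheses (hJ : closed_ideal J) (hQ : cstar_quotient J q).
Variables (L : hilbertType R) (pi : op (sp_tensor W) -> op L).
Hypothesis spi : star_hom_on (@min_tensor _ _ _ W N setT) pi.
Hypothesis kill : forall T, @min_tensor _ _ _ W N J T -> pi T = 0.
Hypothesis upi : uw_continuous_on N (fun a => pi (@elt _ _ _ W a cone)).
Let hC := @cstar_id R C.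
Let qm : cstar_morphism q. Proof. by case: hQ. Qed.
Local Notation tW := (@sp_t _ _ _ W).
Local Notation rW := (@sp_rho _ _ _ _ idfun W).
Local Notation PW := (Phit tW rW).
Local Notation PV := (Phit (@sp_t _ _ _ V) (@sp_rho _ _ _ _ q V)).
Let bW := PW_birep W cN.
Let phi x c := pi (PW x c).
Let MT1 x c : N x -> @min_tensor _ _ _ W N setT (PW x c).
Proof.
move=> Nx; have h1 : inS N [:: (x, c)] by move=> p; rewrite inE => /eqP ->.
by have := MT_ev W cN h1; rewrite /ev big_seq1.
Qed.
Let bphi : birep (@cmul R C) (@star R C) N phi.
Proof.
split=> [x c Nx|x y c d Nx Ny|x c Nx]; first exact/(sh_blin spi)/MT1.
  by rewrite /phi (bi_mul bW)// (sh_comp spi)//; exact: MT1.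
by rewrite /phi (bi_star bW)// (sh_dag spi)//; exact: MT1.
Qed.
Let sW : star_hom_on N (amp tW).
Proof.
have bN := calgW cN; have [h1 h2 h3 h4] := aH_star (sp_mapP W).
by split=> [x /bN/h1|k x y /bN hx /bN|x y /bN hx /bN|x /bN]; [|exact: h2|exact: h3|exact: h4].
Qed.
Let W1 : amp tW id = id. Proof. exact: (aH_id (sp_mapP W)). Qed.
Let dW v : dom N (amp tW) v.
Proof.
apply: (proj1 (totalP _) (@sp_tt _ _ _ W) _ (dom_subsp cN sW) (dom_closed cN sW)) => -[l k].
exists (ei 0 ((Num.sqrt (n2 l))%:C%C *: k)) => a Na; have ba := calgW cN Na.
rewrite (ampE (@sp_tE _ _ _ W) (@sp_tt _ _ _ W) _ _ ba) amE// n2_ei (linZ ba.1) n2Z m2C.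
by rewrite sqr_sqrtr ?n2_ge0// /n2 sp_tE [inner l l]ipC ReM ReC ImC mul0r subr0.
Qed.
Let phiZD k x y c : N x -> N y -> phi (k *: x + y) c = k *: phi x c + phi y c.
Proof.
move=> Nx Ny; rewrite /phi -(sh_lin spi)//; [|exact: MT1|exact: MT1]; congr pi.
by apply/funext => v; rewrite /Phit /= (sh_lin sW).
Qed.
Let phi1 x c : N x -> phi x c = phi x cone \o phi id c.
Proof. by move=> Nx; rewrite -(bi_mul bphi)// ?cmul1x//; exact: (calg1 cN). Qed.
Let phi_ev s : inS N s -> pi (ev PW s) = ev phi s.
Proof.
have m0 : @min_tensor _ _ _ W N setT 0 by have := MT_ev W cN (s := [::]); rewrite /ev big_nil; apply.
elim: s => [|p s ih] hs.
  have := sh_lin spi (-1) m0 m0; rewrite scaler0 addr0 scaleN1r addNr => e0.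
  by rewrite /ev !big_nil.
have [Np hs'] := inS_cons hs; rewrite /ev !big_cons -[PW _ _]scale1r (sh_lin spi _ (MT1 _ Np) (MT_ev W cN hs')).
by rewrite scale1r [pi (ev _ _)]ih.
Qed.
(** [pi] need not be unital; [f] at the unit is [n2 (e1 xi)], which is where [Fc] comes from. *)
Let e1 := phi id cone.
Let e1d : dag e1 = e1.
Proof. by rewrite -(bi_star bphi) ?dag_id ?star_cone//; exact: (calg1 cN). Qed.
Let e1e : e1 \o e1 = e1.
Proof. by rewrite -(bi_mul bphi) ?cmul1x//; exact: (calg1 cN). Qed.
Let be1 : blin e1. Proof. exact/(bi_blin bphi)/(calg1 cN). Qed.
Let e1_n2 v : inner (e1 v) v = (n2 (e1 v))%:C%C.
Proof. by rewrite -ipC -{2}e1d dagPr// dagP// e1d; have /(app_eq v) /= -> := e1e. Qed.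
Let e1_le v : n2 (e1 v) <= n2 v.
Proof.
have := n2_ge0 (v - e1 v); rewrite n2B -[inner v (e1 v)]ipJ ReJ e1_n2 ReC; lra.
Qed.
Section State.
Variable xi : L.
Let f x c := inner (phi x c xi) xi.
Let Fc := n2 (e1 xi).
Let f_n2 y c : N y -> f (dag y \o y) (star c ** c) = (n2 (phi y c xi))%:C%C.
Proof.
move=> Ny; have Nd := calgJ cN Ny; have by_ := bi_blin bphi c Ny.
by rewrite /f (bi_mul bphi)// (bi_star bphi)//= (dagPr by_) ipC.
Qed.
Let am0 x (v w : L) : N x -> inner (am (pi (@elt _ _ _ W x cone)) (ei 0 v)) (ei 0 w) = inner (phi x cone v) w.
Proof.
move=> Nx; rewrite (sp_elt idfun W _ (calgW cN Nx)) amE ?eiE ?eqxx ?mul1r//.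
exact: (bi_blin bphi).
Qed.
Let fsumE s : inS N s -> \sum_(p <- s) f p.1 p.2 = inner (ev phi s xi) xi.
Proof. by move=> hs; rewrite /ev sumE ip_suml. Qed.
(** Supplies what the construction and [core] ask of the vector functional of [xi]: normality from
    [upi], boundedness on the induced space, and vanishing on [J]. *)
Lemma state_bound s m : inS N s -> nb (ev PV s) m -> Re (\sum_(p <- s) f p.1 p.2) <= Fc * m.
Proof.
have bel a : N a -> blin (pi (@elt _ _ _ W a cone)).
  by move=> Na; rewrite (sp_elt idfun W _ (calgW cN Na)); exact: (bi_blin bphi).
have lel : linear_on N (fun a => pi (@elt _ _ _ W a cone)).
  move=> k x y Nx Ny; have b1 := calgW cN Nx; have b2 := calgW cN Ny.
  by rewrite !(sp_elt idfun W)//; [exact: phiZD|exact: blinZD].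
have fnorm c : exists z : Kinf K, forall y, N y -> Re (f (dag y \o y) (star c ** c)) <= n2 (am y z).
  have [z hz] := uw_posdom cN (ei 0 (phi id c xi)) lel bel upi.
  exists z => y Ny; have by_ := calgW cN Ny; have Nd := calgJ cN Ny.
  have := hz _ (calgM cN Nd Ny) (fun w => _); rewrite am0; last exact: (calgM cN).
  rewrite (sh_sq (calg_blins K) (am_star K))// ipC f_n2// ReC.
  rewrite -{1}[cone](@cmul1x R C) -{1}(@star_cone R C) (bi_mul bphi)// (bi_star bphi)//=.
  rewrite dagPr ?ipC; last exact: (bi_blin bphi).
  rewrite (phi1 c Ny) /=; apply.
  by move=> w; rewrite /= (dagPr by_) ipC ler0c n2_ge0.
have fn c : normal N (fun x => f x c).
  have [z hz] := uw_norm_bnd cN (ei 0 (phi id c xi)) (ei 0 xi) lel bel upi.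
  have fE x : N x -> f x c = inner (am (pi (@elt _ _ _ W x cone)) (ei 0 (phi id c xi))) (ei 0 xi).
    by move=> Nx; rewrite am0// /f phi1.
  have [||z' hz'] := am_riesz cN (h := fun x => f x c) (z := z); last by exists z, z'.
    by move=> k x y Nx Ny; rewrite /f phiZD// ipDl ipZl.
  by move=> x Nx; rewrite fE//; exact: hz.
have flin c k x y : N x -> N y -> f (k *: x + y) c = k * f x c + f y c.
  by move=> Nx Ny; rewrite /f phiZD// ipDl ipZl.
have fs x c : N x -> f (dag x) (star c) = (f x c)^*.
  by move=> Nx; rewrite /f (bi_star bphi)// dagPr ?ipJ//; exact: (bi_blin bphi).
have rcN c x : N x -> rW c \o amp tW x = amp tW x \o rW c by move=> /(calgW cN); exact: sp_rcom.
(* [ind_ge] returns from the induced space to the spatial norm, for which [pi] is contractive. *)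
have fbnd s' m' : inS N s' -> nb (ev (@Phi0 _ _ _ _ _ _ hd _ _ sW W1 _ rW) s') m' -> Re (fsum f s') <= Fc * m'.
  move=> hs' /(ind_ge (sp_tr W hC) hs') n1.
  have mt := MT_ev W cN hs'; have [_ u1 u2] := MT_unit cN mt; have m1 := MT_one W cN.
  have n3 := MT_contr cN spi mt n1; rewrite /fsum fsumE//.
  have e1E : e1 = pi (rW cone) by rewrite /e1 /phi /Phit W1.
  have -> : inner (ev phi s' xi) xi = inner (pi (ev PW s') (e1 xi)) (e1 xi).
    rewrite -phi_ev// -(dagPr be1) e1d e1E.
    have := sh_comp spi (MT_comp cN m1 mt) m1; rewrite (sh_comp spi m1 mt) u2 u1.
    by move=> /(app_eq xi) /= <-.
  by rewrite mulrC; apply: bnd_form n3.1 n3.2.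
have [KK [Pi [ups [p [Rr [Om gm]]]]]] := machine (hd := hd) (sN := sW) (Pi1 := W1) dW (@sp_rb _ _ _ _ idfun W)
  (sp_rm W hC) (sp_rs W hC) (@star_cone R C) (rW_1c W) (rW_c1 W) rcN flin (e1_n2 xi) fs fbnd fnorm.
(* [J] is an ideal, so the second components needed in [gm_zero] stay in [J], where [pi]
   vanishes. *)
have rJ c : J c -> Rr c = 0.
  move=> Jc; apply: (gm_zero gm) => x d Nx; case: hJ => _ _ _ hI.
  have Nxx := calgM cN (calgJ cN Nx) Nx.
  rewrite /f /phi kill ?ip0l//; split=> [|e e0]; first exact/bounded_opP/(bi_blin bW).
  exists (PW (dag x \o x) (star (c ** d) ** (c ** d))).
    exists [:: (dag x \o x, star (c ** d) ** (c ** d))]; last first.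
      by rewrite big_seq1 (sp_elt idfun W _ (calgW cN Nxx)).
    by move=> p'; rewrite inE => /eqP -> /=; split=> //; apply: (hI _ _ (hI _ _ Jc).2).1.
  by rewrite subrr; apply: le_lt_trans e0; apply: nb_opnorm (nb0 _ _).
have gb s' m' : inS A s' -> nb (ev PW s') m' -> nb (ev (fun a c => Pi a \o Rr c) s') m'.
  move=> hs' hm; apply: (gm_nb gm) => //.
  have hN : inS N s' by move=> p' /hs'; exact: AN.
  exact: (ind_le (sp_tr W hC) hd sW W1 hN hm).
have [k k0 we] := weak_exact_transport cM si inj ui cA V hJ hQ (ts_star (gm_ts gm)) (gm_dom gm)
  (gm_rblin gm) (gm_rmul gm) (gm_rstar gm) (gm_rPi gm) rJ gb wM.
exact: (core hd vN gm fn (sp_tr V qm) k0 we).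
Qed.
End State.
(** [state_bound] at the element [s^* s] bounds [n2] of [pi (s) xi] for each [xi] by
    [m^2 n2 (e1 xi)], and [e1] is a projection. *)
Lemma quotient_contr s : inS N s -> opnorm (\sum_(p <- s) pi (@elt _ _ _ W p.1 p.2)) <= opnorm (\sum_(p <- s) @elt _ _ _ V p.1 (q p.2)).
Proof.
move=> hs; have bV := Phit_birep (sp_tr V qm) cN.
have -> : \sum_(p <- s) pi (@elt _ _ _ W p.1 p.2) = ev phi s.
  by apply: eq_big_seq => p ps; rewrite (sp_elt idfun W _ (calgW cN (hs p ps))).
rewrite (sp_ev q V cN hs); set m := opnorm (ev PV s); have nm := opnorm_nb (ev_blin bV hs); rewrite -/m in nm.
apply: nb_opnorm; split=> [|xi]; first exact: nm.1.
have hs1 := inS_star (cs := @star R C) cN hs; have hs2 := inS_mul (cm := @cmul R C) cN hs1 hs.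
have nd : nb (dag (ev PV s)) m.
  have [m0 hm] := nm; split=> //.
  by apply: dag_bnd hm; [exact: (ev_blin bV hs)|exact: sqr_ge0].
have n2m : nb (ev PV (mulS (@cmul R C) (starS (@star R C) s) s)) (m * m).
  by rewrite (ev_mul bV hs1 hs) (ev_star bV hs); exact: nb_comp.
have := state_bound xi hs2 n2m; have -> : forall t, \sum_(p <- t) inner (phi p.1 p.2 xi) xi = inner (ev phi t xi) xi.
  by move=> t; rewrite /ev sumE ip_suml.
rewrite (ev_mul bphi hs1 hs) (ev_star bphi hs) /= (dagPr (ev_blin bphi hs)) => h.
apply: le_trans h _; rewrite -expr2 mulrC ler_wpM2l ?sqr_ge0//.
Qed.
End WeakExactness.

Theorem corollary1p2 (R : realType) (H : hilbertType R) (M B : set (op H))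
    (theta E_B E_theta : op H -> op H) :
  von_neumann M -> von_neumann B -> subset B M ->
  sigma_finite_vn M -> sigma_finite_vn B ->
  vn_embedding B theta -> (forall b, B b -> M (theta b)) ->
  fn_cond_exp M B E_B -> fn_cond_exp M (image B theta) E_theta ->
  weakly_exact M ->
  forall (K : hilbertType R) (N : set (op K)) (iota : op H -> op K)
    (E : op K -> op K) (u : op K),
  is_HNN M B theta E_B E_theta N iota E u ->
  weakly_exact N.
Proof.
move=> vM vB BM _ _ eth thM eB eT wM K N iota E u hnn C J hJ W L pi spi kill upi Q q hQ V.
have hd := hnn_HD vM vB BM eth thM eB eT hnn.
have [si _ inj ui] := hnn_iota hnn; exists 1 => s hs; rewrite mul1r.
have h := quotient_contr (calg_vn vM) si inj ui wM hd (hnn_vn hnn) V hJ hQ spi kill upi hs.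
exact: h.
Qed.
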